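(* For every $L > 0$ there exists a constant $C(L)$, depending only on $L$, such that the following holds. Let $\mu = e^{-V}dx$ be a probability measure on $\mathbb{R}^n$ satisfying $\operatorname{Hess} V \geq \mathrm{I}_n$. If $F : \mathbb{R}^n \to \mathbb{R}$ satisfies $\|F\|_{\mathrm{Lip}} \leq L$ and $$\int e^{F}\, d\mu \geq \exp\left( \int F\, d\mu + \frac{L^2}{2} (1 - \epsilon/2) \right)$$ for some $\epsilon \geq 0$, then there is a direction $\sigma \in \mathbb{S}^{n-1}$ for which $$W_1(\mu, \gamma_{b,\sigma} \otimes \bar{\mu}) \leq C(L) \sqrt{\epsilon},$$ where $\gamma_{b,\sigma}$ denotes the standard Gaussian measure on $\operatorname{Span}(\sigma)$ with barycenter $b = \sigma \int x \cdot \sigma\, d\mu$, and $\bar{\mu}$ is the marginal distribution of $\mu$ on $\operatorname{Span}(\sigma)^{\perp}$.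
   Context: $\|F\|_{\mathrm{Lip}}$ is the Lipschitz constant of $F$ for the Euclidean norm. $W_1$ is the $L^1$ Kantorovich-Wasserstein distance (Euclidean cost). The standard Gaussian measure on the line $\operatorname{Span}(\sigma)$ with barycenter $b$ has mean $b$ and unit variance. The product $\gamma_{b,\sigma} \otimes \bar{\mu}$ is viewed as a measure on $\mathbb{R}^n = \operatorname{Span}(\sigma) \oplus \operatorname{Span}(\sigma)^{\perp}$. *)

(* Defs.v *)
(* R^n is 'rV[R]_n with R : realType. The norm that the library puts on
   'rV[R]_n is the sup norm; it is used below only through the topology and
   differentiability, which are the Euclidean ones. Metric quantities use
   [norm2]. *)
From HB Require Import structures.
From mathcomp Require Import all_boot all_order all_algebra.
From mathcomp Require Import all_classical all_reals all_analysis.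
From mathcomp Require Import measurable_realfun.

Set Implicit Arguments.
Unset Strict Implicit.
Unset Printing Implicit Defensive.

Import Order.TTheory GRing.Theory Num.Theory.
Import numFieldNormedType.Exports.

Local Open Scope classical_set_scope.
Local Open Scope ring_scope.

(* The Borel sigma-algebra of R^n, presented, as the library does for
   n.-tuple, as the one generated by the coordinate functions. *)
Section measurable_rV.
Context (R : realType) (n : nat).

Definition coord_rV (i : 'I_n) (x : 'rV[R]_n) : R := x ord0 i.

Let rV_set0 : g_sigma_preimage coord_rV set0.
Proof. exact: sigma_algebra0. Qed.

Let rV_setC A : g_sigma_preimage coord_rV A -> g_sigma_preimage coord_rV (~` A).
Proof. exact: sigma_algebraC. Qed.

Let rV_bigcup (F : _^nat) : (forall i, g_sigma_preimage coord_rV (F i)) ->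
  g_sigma_preimage coord_rV (\bigcup_i (F i)).
Proof. exact: sigma_algebra_bigcup. Qed.

HB.instance Definition _ := @isMeasurable.Build default_measure_display
  'rV[R]_n (g_sigma_preimage coord_rV) rV_set0 rV_setC rV_bigcup.

Lemma measurable_coord_rV (i : 'I_n) : measurable_fun [set: 'rV[R]_n] (coord_rV i).
Proof.
move=> _ Y mY; rewrite setTI; apply: sub_sigma_algebra => /=.
rewrite -bigcup_seq/=; exists i => /=; first by rewrite mem_index_enum.
by exists Y => //; rewrite setTI.
Qed.

Lemma measurable_fun_rV d (T : measurableType d) (f : T -> 'rV[R]_n) :
  (forall i, measurable_fun [set: T] (fun x => f x ord0 i)) ->
  measurable_fun [set: T] f.
Proof.
move=> mf _ A mA; rewrite setTI.
suff : <<s \big[setU/set0]_(i < n)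
    preimage_set_system setT (coord_rV i) measurable >> `<=`
    [set B | measurable (f @^-1` B)] by exact.
apply: smallest_sub.
  split => /=.
  - by rewrite preimage_set0.
  - by move=> B mB; rewrite setTD preimage_setC; exact: measurableC.
  - by move=> F mF; rewrite preimage_bigcup; exact: bigcupT_measurable.
move=> B; rewrite -bigcup_seq/= => -[i _ [Y mY <-]].
by rewrite setTI/= -[X in measurable X]setTI; exact: (mf i measurableT Y mY).
Qed.

End measurable_rV.

Section euclidean.
Context (R : realType) (n : nat).
Implicit Types (x y s v : 'rV[R]_n).

Definition dot x y : R := \sum_(i < n) x ord0 i * y ord0 i.

Definition norm2 x : R := Num.sqrt (dot x x).

Definition proj_perp s x : 'rV[R]_n := x - dot x s *: s.

(* \|F\|_Lip for the Euclidean norm *)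
Definition lip_const (F : 'rV[R]_n -> R) : \bar R :=
  ereal_sup [set (`|F p.1 - F p.2| / norm2 (p.1 - p.2))%:E
    | p in [set p : 'rV[R]_n * 'rV[R]_n | p.1 != p.2]].

Definition partial (i : 'I_n) (V : 'rV[R]_n -> R) (x : 'rV[R]_n) : R :=
  'D_(delta_mx ord0 i) V x.

Definition gradient (V : 'rV[R]_n -> R) (x : 'rV[R]_n) : 'rV[R]_n :=
  \row_i partial i V x.

Definition Hess (V : 'rV[R]_n -> R) (x : 'rV[R]_n) : 'M[R]_n :=
  \matrix_(i, j) partial i (partial j V) x.

(* In the Frechet sense, with no continuity of the second derivatives; this
   makes Hess V x symmetric for every x. *)
Definition twice_differentiable (V : 'rV[R]_n -> R) : Prop :=
  (forall x, differentiable V x) /\ (forall x, differentiable (gradient V) x).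

(* A <= B in the Loewner order, for symmetric A and B *)
Definition loewner_le (A B : 'M[R]_n) : Prop :=
  forall v, 0 <= (v *m (B - A) *m v^T) ord0 ord0.

Lemma measurable_proj_perp s : measurable_fun [set: 'rV[R]_n] (proj_perp s).
Proof.
apply: measurable_fun_rV => i.
rewrite (_ : (fun _ => _) = (fun x => coord_rV i x -
    (\sum_(j < n) coord_rV j x * s ord0 j) * s ord0 i)); last first.
  by apply/funext => x; rewrite !mxE.
apply: measurable_funB; first exact: measurable_coord_rV.
apply: measurable_funM => //; apply: measurable_sum => j.
by apply: measurable_funM => //; exact: measurable_coord_rV.
Qed.

HB.instance Definition _ s := isMeasurableFun.Build _ _ _ _ (proj_perp s)
  (measurable_proj_perp s).

Definition line_map b s (t : measurableTypeR R) : 'rV[R]_n := b + t *: s.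

Lemma measurable_line_map b s : measurable_fun setT (line_map b s).
Proof.
apply: measurable_fun_rV => i.
rewrite (_ : (fun _ => _) = (fun t => b ord0 i + t * s ord0 i)); last first.
  by apply/funext => t; rewrite !mxE.
by apply: measurable_funD => //; exact: measurable_funM.
Qed.

HB.instance Definition _ b s := isMeasurableFun.Build _ _ _ _ (line_map b s)
  (measurable_line_map b s).

Definition add_rV (p : 'rV[R]_n * 'rV[R]_n) : 'rV[R]_n := p.1 + p.2.

Lemma measurable_add_rV : measurable_fun setT add_rV.
Proof.
apply: measurable_fun_rV => i.
rewrite (_ : (fun _ => _) = (fun p => (coord_rV i \o fst) p + (coord_rV i \o snd) p));
  last by apply/funext => t; rewrite !mxE.
by apply: measurable_funD; apply: measurableT_comp => //; exact: measurable_coord_rV.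
Qed.

HB.instance Definition _ := isMeasurableFun.Build _ _ _ _ add_rV measurable_add_rV.

End euclidean.

(* [distribution] for measures that need not be probabilities *)
Section image_measure.
Context d d' (T : measurableType d) (T' : measurableType d') (R : realType).
Variables (m : {measure set T -> \bar R}) (X : {mfun T >-> T'}).

Definition image_measure : set T' -> \bar R := pushforward m X.

Let image_measure0 : image_measure set0 = 0%E.
Proof. exact: measure0. Qed.

Let image_measure_ge0 A : (0 <= image_measure A)%E.
Proof. exact: measure_ge0. Qed.

Let image_measure_sigma_additive : semi_sigma_additive image_measure.
Proof. exact: measure_semi_sigma_additive. Qed.

HB.instance Definition _ := isMeasure.Build _ _ _ image_measure
  image_measure0 image_measure_ge0 image_measure_sigma_additive.

End image_measure.

Section lebesgue_rV.
Context (R : realType).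

Definition cons_rV n (p : 'rV[R]_n * measurableTypeR R) : 'rV[R]_n.+1 :=
  \row_(i < n.+1) oapp (fun j => p.1 ord0 j) p.2 (unlift ord0 i).

Lemma measurable_cons_rV n : measurable_fun setT (@cons_rV n).
Proof.
apply: measurable_fun_rV => i; case: (unliftP ord0 i) => [j ->|->].
  rewrite (_ : (fun _ => _) = coord_rV j \o fst); last first.
    by apply/funext => p; rewrite !mxE liftK.
  by apply: measurableT_comp => //; exact: measurable_coord_rV.
rewrite (_ : (fun _ => _) = snd) //; apply/funext => p.
by rewrite !mxE unlift_none.
Qed.

HB.instance Definition _ n := isMeasurableFun.Build _ _ _ _ (@cons_rV n)
  (@measurable_cons_rV n).

(* R^0 is a point, of mass 1. *)
Fixpoint lebesgue_rV n : {measure set 'rV[R]_n -> \bar R} :=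
  match n with
  | 0%N => \d_(0 : 'rV[R]_0)
  | m.+1 => image_measure (lebesgue_rV m \x (@lebesgue_measure R))%E (@cons_rV m)
  end.

End lebesgue_rV.

Section gaussian_factor.
Context (R : realType) (n : nat).
Implicit Types (b s : 'rV[R]_n) (mu : probability 'rV[R]_n R).

(* For s a unit vector: the standard Gaussian on Span(s) with barycenter b,
   as a measure on R^n carried by that line *)
Definition gaussian_line b s : probability 'rV[R]_n R :=
  distribution (normal_prob (0 : R) (1 : R)) (line_map b s).

(* The marginal on the orthogonal complement of Span(s), as a measure on R^n
   carried by that hyperplane *)
Definition marginal_perp mu s : probability 'rV[R]_n R :=
  distribution mu (proj_perp s).

Definition barycenter_along mu s : 'rV[R]_n := (\int[mu]_x dot x s) *: s.

(* The product of measures carried by two complementary subspaces, as a measure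
   on R^n: the image of P \x Q under (u, w) |-> u + w *)
Definition direct_sum_product (P Q : probability 'rV[R]_n R) :
    {measure set 'rV[R]_n -> \bar R} :=
  image_measure (P \x Q)%E (@add_rV R n).

End gaussian_factor.

Section wasserstein.
Context (R : realType) (n : nat).
Implicit Types P Q : {measure set 'rV[R]_n -> \bar R}.

Definition coupling P Q : set (probability ('rV[R]_n * 'rV[R]_n)%type R) :=
  [set pi | forall A, measurable A ->
    pi (A `*` setT) = P A /\ pi (setT `*` A) = Q A].

Definition W1 P Q : \bar R :=
  ereal_inf [set (\int[pi]_p (norm2 (p.1 - p.2))%:E)%E | pi in coupling P Q].

End wasserstein.

(* Main.v *)
(* Write mu = w dx. Everything rests on Prekopa-Leindler, which yields a logarithmic Sobolev
   inequality for w with a pointwise slope, hence Herbst's bound E e^F <= e^(E F + L^2/2) and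
   the Poincare inequality. If Herbst's bound is nearly attained, then so is
   KL(e^F w | w) <= L^2/2 up to the same defect d, after replacing F by a multiple. Adding an
   independent Gaussian to mu and to e^F mu, the chain rule for KL shows that the log-density
   of the noisy measures has a gradient of nearly maximal length; comparing two noise levels,
   this gradient has variance O(d), so it is nearly a constant t sigma. Convexity of the Laplace
   transform along sigma then gives a tilt of mu by tau (x . sigma), 0 <= tau <= L, for which
   x . sigma has variance at least 1 - C d. Near-equality in Poincare gives an approximate Stein
   identity for x . sigma under mu, with error O(sqrt d); solving Stein's equation on the lines
   parallel to sigma compares the integrals of every 1-Lipschitz function against mu and against
   gamma (x) mubar, and Kantorovich duality concludes. If d is not small, any direction works. *)

From HB Require Import structures.
Require Import Defs.
From mathcomp Require Import all_boot all_order all_algebra.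
From mathcomp Require Import all_classical all_reals all_analysis.
From mathcomp Require Import measurable_realfun.
From mathcomp Require Import ring lra.

Set Implicit Arguments.
Unset Strict Implicit.
Unset Printing Implicit Defensive.

Import Order.TTheory GRing.Theory Num.Theory.
Import numFieldNormedType.Exports.

Local Open Scope classical_set_scope.
Local Open Scope ring_scope.

(** * Euclidean structure and Lebesgue measure *)

(** [F] is only Lipschitz: it has no gradient to work with, and [e^F w] need not be log-concave.
    Gaussian noise repairs both. The gradient of the noisy log-density is a difference of posterior
    means, and once the noise level exceeds a constant depending on [L] alone, the noisy [e^F w] is
    strongly log-concave, because posterior variances are bounded independently of the dimension.
    Noise costs nothing in the defect: the entropy bound $L^2/(2(1+\eta))$ of the noisy measures and
    the bound $L^2/(2(1+1/\eta))$ of the posteriors add up to $L^2/2$, so near-saturation of the sum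
    forces near-saturation of the first. The variance of $x \cdot \sigma$ is close to 1 only at some
    intermediate tilt, found by a mean value argument, and not at [mu] itself; Poincare is therefore
    tested with functions carrying the factor $e^{-\tau x \cdot \sigma}$, which brings expectations
    back to [mu]. The functional inequalities are stated for increments with a quadratic error
    instead of gradients, so that no weak derivative is ever needed. *)

Section euclid.
Context (R : realType) (n : nat).
Implicit Types (x y z v : 'rV[R]_n) (a b : R).

Lemma dotC x y : dot x y = dot y x.
Proof. by apply: eq_bigr => i _; rewrite mulrC. Qed.

Lemma dotDl x y z : dot (x + y) z = dot x z + dot y z.
Proof. by rewrite -big_split; apply: eq_bigr => i _; rewrite !mxE mulrDl. Qed.

Lemma dotZl a x y : dot (a *: x) y = a * dot x y.
Proof. by rewrite mulr_sumr; apply: eq_bigr => i _; rewrite !mxE mulrA. Qed.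

Lemma dotNl x y : dot (- x) y = - dot x y.
Proof. by rewrite -scaleN1r dotZl mulN1r. Qed.

Lemma dotBl x y z : dot (x - y) z = dot x z - dot y z.
Proof. by rewrite dotDl dotNl. Qed.

Lemma dotDr x y z : dot z (x + y) = dot z x + dot z y.
Proof. by rewrite dotC dotDl !(dotC z). Qed.

Lemma dotZr a x y : dot x (a *: y) = a * dot x y.
Proof. by rewrite dotC dotZl dotC. Qed.

Lemma dotNr x y : dot x (- y) = - dot x y.
Proof. by rewrite dotC dotNl dotC. Qed.

Lemma dotBr x y z : dot z (x - y) = dot z x - dot z y.
Proof. by rewrite dotDr dotNr. Qed.

Lemma dot0l x : dot 0 x = 0.
Proof. by rewrite -(scale0r 0) dotZl mul0r. Qed.

Lemma dot0r x : dot x 0 = 0.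
Proof. by rewrite dotC dot0l. Qed.

Definition dotE := (dotDl, dotDr, dotZl, dotZr, dotNl, dotNr, dot0l, dot0r).

Lemma dot_ge0 x : 0 <= dot x x.
Proof. by apply: sumr_ge0 => i _; rewrite -expr2 sqr_ge0. Qed.

Lemma dot_delta x (i : 'I_n) : dot x (delta_mx ord0 i) = x ord0 i.
Proof.
rewrite /dot (bigD1 i)//= mxE !eqxx mulr1 big1 ?addr0// => j ji.
by rewrite mxE (negbTE ji) andbF mulr0.
Qed.

Lemma norm2_ge0 x : 0 <= norm2 x.
Proof. exact: sqrtr_ge0. Qed.

Lemma sqr_norm2 x : norm2 x ^+ 2 = dot x x.
Proof. by rewrite sqr_sqrtr// dot_ge0. Qed.

Lemma norm20 : norm2 (0 : 'rV[R]_n) = 0.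
Proof. by rewrite /norm2 dot0l sqrtr0. Qed.

Lemma norm2Z a x : norm2 (a *: x) = `|a| * norm2 x.
Proof. by rewrite /norm2 !dotE mulrA -expr2 sqrtrM ?sqr_ge0// sqrtr_sqr. Qed.

Lemma norm2N x : norm2 (- x) = norm2 x.
Proof. by rewrite -scaleN1r norm2Z normrN1 mul1r. Qed.

Lemma norm2_eq0 x : norm2 x = 0 -> x = 0.
Proof.
move=> x0; have : dot x x = 0 by rewrite -sqr_norm2 x0 expr0n.
move=> /eqP; rewrite psumr_eq0; last by move=> i _; rewrite -expr2 sqr_ge0.
move=> /allP h; apply/matrixP => i j; rewrite (ord1 i) mxE.
by have := h j (mem_index_enum _); rewrite -expr2 sqrf_eq0 => /eqP.
Qed.

Lemma norm2_gt0 x : x != 0 -> 0 < norm2 x.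
Proof. by move=> x0; rewrite lt_def norm2_ge0 andbT; apply: contraNneq x0 => /norm2_eq0 ->. Qed.

Lemma cauchy_schwarz x y : dot x y <= norm2 x * norm2 y.
Proof.
have [->|x0] := eqVneq x 0; first by rewrite dot0l norm20 mul0r.
have [->|y0] := eqVneq y 0; first by rewrite dot0r norm20 mulr0.
have nx := norm2_gt0 x0; have ny := norm2_gt0 y0.
have := dot_ge0 (norm2 y *: x - norm2 x *: y).
rewrite !dotE -!sqr_norm2 (dotC y x).
set a := norm2 x in nx *; set b := norm2 y in ny *; set c := dot x y.
have ab : 0 < a * b by exact: mulr_gt0.
move=> h; have {}h : 0 <= (a * b) * (a * b - c).
  by move: h; rewrite -subr_ge0 subr0 => h; nra.
by rewrite -subr_ge0; move: h; rewrite pmulr_rge0.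
Qed.

Lemma cauchy_schwarz_abs x y : `|dot x y| <= norm2 x * norm2 y.
Proof.
rewrite ler_norml cauchy_schwarz andbT lerNl -dotNl.
by rewrite (le_trans (cauchy_schwarz _ _))// norm2N.
Qed.

Lemma norm2D x y : norm2 (x + y) <= norm2 x + norm2 y.
Proof.
rewrite -(@ler_pXn2r _ 2)// ?nnegrE ?addr_ge0 ?norm2_ge0//.
rewrite sqr_norm2 !dotE -!sqr_norm2 (dotC y x).
by have := cauchy_schwarz x y; nra.
Qed.

Lemma norm2B x y : norm2 (x - y) = norm2 (y - x).
Proof. by rewrite -norm2N opprB. Qed.

Lemma norm2_tri x y z : norm2 (x - z) <= norm2 (x - y) + norm2 (y - z).
Proof. by rewrite (le_trans _ (norm2D _ _))// addrA subrK. Qed.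

Lemma coord_le_norm2 x (i : 'I_n) : `|x ord0 i| <= norm2 x.
Proof.
rewrite -sqrtr_sqr ler_wsqrtr// /dot (bigD1 i)//= -expr2 lerDl.
by apply: sumr_ge0 => j _; rewrite -expr2 sqr_ge0.
Qed.

Lemma norm2_le_sum x : norm2 x <= \sum_(i < n) `|x ord0 i|.
Proof.
have s0 : 0 <= \sum_(i < n) `|x ord0 i| by apply: sumr_ge0.
rewrite -(@ler_pXn2r _ 2)// ?nnegrE ?norm2_ge0// sqr_norm2 expr2 mulr_suml.
apply: ler_sum => i _; rewrite -expr2 -[x ord0 i ^+ 2]real_normK ?num_real// expr2.
by rewrite ler_wpM2l// (bigD1 i)//= lerDl sumr_ge0.
Qed.

End euclid.

Section measurability.
Context (R : realType) (n : nat) d (T : measurableType d).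
Implicit Types (f g : T -> 'rV[R]_n).

Lemma measurable_coord f (i : 'I_n) : measurable_fun setT f ->
  measurable_fun setT (fun t => f t ord0 i).
Proof. by move=> mf; exact: (measurableT_comp (@measurable_coord_rV R n i) mf). Qed.

Lemma measurable_rVD f g : measurable_fun setT f -> measurable_fun setT g ->
  measurable_fun setT (fun t => f t + g t).
Proof.
move=> mf mg; apply: measurable_fun_rV => i.
rewrite (_ : (fun _ => _) = (fun t => f t ord0 i + g t ord0 i)); last first.
  by apply/funext => t; rewrite mxE.
by apply: measurable_funD; exact: measurable_coord.
Qed.

Lemma measurable_rVZ (a : T -> R) f : measurable_fun setT a -> measurable_fun setT f ->
  measurable_fun setT (fun t => a t *: f t).
Proof.
move=> ma mf; apply: measurable_fun_rV => i.
rewrite (_ : (fun _ => _) = (fun t => a t * f t ord0 i)); last first.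
  by apply/funext => t; rewrite mxE.
by apply: measurable_funM => //; exact: measurable_coord.
Qed.

Lemma measurable_rVN f : measurable_fun setT f -> measurable_fun setT (fun t => - f t).
Proof.
move=> mf; rewrite (_ : (fun _ => _) = (fun t => -1 *: f t)); last first.
  by apply/funext => t; rewrite scaleN1r.
exact: measurable_rVZ.
Qed.

Lemma measurable_rVB f g : measurable_fun setT f -> measurable_fun setT g ->
  measurable_fun setT (fun t => f t - g t).
Proof. by move=> mf mg; apply: measurable_rVD => //; exact: measurable_rVN. Qed.

Lemma measurable_dot f g : measurable_fun setT f -> measurable_fun setT g ->
  measurable_fun setT (fun t => dot (f t) (g t)).
Proof.
move=> mf mg; apply: measurable_sum => i; apply: measurable_funM; exact: measurable_coord.
Qed.

Lemma measurable_sqrtr (h : T -> R) : measurable_fun setT h ->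
  measurable_fun setT (fun t => Num.sqrt (h t)).
Proof.
move=> mh; apply: measurableT_comp => //; apply: continuous_measurable_fun.
exact: sqrt_continuous.
Qed.

Lemma measurable_norm2 f : measurable_fun setT f -> measurable_fun setT (fun t => norm2 (f t)).
Proof. by move=> mf; apply: measurable_sqrtr; exact: measurable_dot. Qed.

End measurability.

Section lebesgue_affine.
Context (R : realType).
Local Notation leb := (@lebesgue_measure R).
Variables (a : R) (b : R).
Hypothesis a0 : 0 < a.

Let f (x : measurableTypeR R) : measurableTypeR R := (x - b) / a.

Let mf : measurable_fun setT f.
Proof. by apply: measurable_funM => //; exact: measurable_funB. Qed.

HB.instance Definition _ := isMeasurableFun.Build _ _ _ _ f mf.

Let m : {measure set (measurableTypeR R) -> \bar R} := image_measure leb f.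

(** By uniqueness of Lebesgue measure: the rescaled image measure has the right mass on half-open
    intervals. *)
Lemma lebesgue_affine (A : set (measurableTypeR R)) : measurable A ->
  leb ((fun x => (x - b) / a) @^-1` A) = (a%:E * leb A)%E.
Proof.
move=> mA.
have : leb A = mscale (NngNum (ltW (etrans (invr_gt0 a) a0)))%R m A.
  apply: lebesgue_measure_unique => // X [[c d] _ <-].
  rewrite /m /image_measure/= /pushforward.
  rewrite [X in mscale _ X]/= /mscale/= (_ : f @^-1` _ = `]a * c + b, a * d + b]%classic); last first.
    apply/seteqP; split => x /=; rewrite /f !in_itv/= ltr_pdivlMr// ler_pdivrMr//;
      by rewrite ltrBrDr lerBlDr !(mulrC a).
  rewrite !lebesgue_measure_itv/= !lte_fin ltrD2r ltr_pM2l//.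
  case: ifPn => _; last by rewrite mule0.
  by rewrite -!EFinD -EFinM; congr EFin; field; rewrite gt_eqF.
move=> ->; rewrite /mscale/= /image_measure/= muleA -EFinM divff ?gt_eqF// mul1e.
by [].
Qed.

End lebesgue_affine.

Section lebesgue_affine_integral.
Context (R : realType).
Local Notation leb := (@lebesgue_measure R).
Variables (a b : R).

Let g (x : measurableTypeR R) : measurableTypeR R := a * x + b.

Let mg : measurable_fun setT g.
Proof. by apply: measurable_funD => //; exact: measurable_funM. Qed.

HB.instance Definition _ := isMeasurableFun.Build _ _ _ _ g mg.

Lemma ge0_integral_affine (f : measurableTypeR R -> \bar R) : 0 < a ->
  measurable_fun setT f -> (forall x, 0 <= f x)%E ->
  (a%:E * \int[leb]_x f (a * x + b)%R = \int[leb]_x f x)%E.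
Proof.
move=> a0 mf f0.
have a'0 : 0 < a^-1 by rewrite invr_gt0.
pose r := NngNum (ltW a0).
have -> : (\int[leb]_x f x = \int[mscale r (image_measure leb g)]_x f x)%E.
  apply: eq_measure_integral => //= A mA _.
  rewrite /mscale/= /image_measure /pushforward/=.
  have := lebesgue_affine (- b / a) a'0 mA.
  rewrite (_ : (fun x : R => (x - - b / a) / a^-1) = g); last first.
    by apply/funext => x; rewrite /g; field; rewrite gt_eqF.
  by move=> ->; rewrite muleA -EFinM divff ?gt_eqF// mul1e.
rewrite ge0_integral_mscale//=; congr (_ * _)%E.
by rewrite /image_measure (ge0_integral_pushforward mg).
Qed.

End lebesgue_affine_integral.

Section lam.
Context (R : realType).
Local Notation leb := (@lebesgue_measure R).

(** A separate constant, to which the sigma-finiteness required by Tonelli's theorem can be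
    attached. *)
Definition lam n : set 'rV[R]_n -> \bar R := lebesgue_rV R n.

Let lam0 n : lam (@set0 'rV[R]_n) = 0%E.
Proof. exact: measure0. Qed.

Let lam_ge0 n A : (0 <= @lam n A)%E.
Proof. exact: measure_ge0. Qed.

Let lam_sigma_additive n : semi_sigma_additive (@lam n).
Proof. exact: measure_semi_sigma_additive. Qed.

HB.instance Definition _ n := isMeasure.Build _ _ _ (@lam n)
  (@lam0 n) (@lam_ge0 n) (@lam_sigma_additive n).

Lemma cons_rV_bij n (x : 'rV[R]_n.+1) :
  cons_rV (\row_(j < n) x ord0 (lift ord0 j), x ord0 ord0) = x.
Proof.
apply/matrixP => i j; rewrite (ord1 i) mxE.
by case: (unliftP ord0 j) => [k ->|->]; rewrite ?liftK ?unlift_none/= ?mxE.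
Qed.

Lemma lam_sigma_finite n : sigma_finite setT (@lam n).
Proof.
elim: n => [|n [F FT mF]].
  exists (fun=> setT); first by rewrite bigcup_const//; exists 0%N.
  by move=> k; split => //; rewrite /lam/= diracE in_setT ltry.
have [G GT mG] := sigma_finiteT (@lebesgue_measure R).
pose tailr (x : 'rV[R]_n.+1) : 'rV[R]_n := \row_(j < n) x ord0 (lift ord0 j).
pose headr (x : 'rV[R]_n.+1) : measurableTypeR R := x ord0 ord0.
have mt : measurable_fun setT tailr.
  apply: measurable_fun_rV => i.
  rewrite (_ : (fun _ => _) = coord_rV (lift ord0 i)); first exact: measurable_coord_rV.
  by apply/funext => x; rewrite mxE.
have mh : measurable_fun setT headr by exact: measurable_coord_rV.
pose H (p : nat * nat) := tailr @^-1` F p.1 `&` headr @^-1` G p.2.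
have mH p : measurable (H p).
  apply: measurableI.
    by rewrite -[X in measurable X]setTI; apply: mt => //; exact: (mF _).1.
  by rewrite -[X in measurable X]setTI; apply: mh => //; exact: (mG _).1.
exists (fun k => H (odflt (0, 0)%N (unpickle k))).
  apply/seteqP; split => // x _.
  have [i _ Fi] : (\bigcup_i F i) (tailr x) by rewrite -FT.
  have [j _ Gj] : (\bigcup_i G i) (headr x) by rewrite -GT.
  by exists (pickle (i, j)) => //; rewrite pickleK /=; split.
move=> k; set p := odflt _ _; split; first exact: mH.
rewrite /lam/= /image_measure /pushforward.
rewrite (_ : _ @^-1` _ = F p.1 `*` G p.2); last first.
  apply/seteqP; split => -[x t] /=; rewrite /H/=.
    move=> [h1 h2]; split.
      move: h1; rewrite (_ : tailr _ = x)//; apply/matrixP => i j.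
      by rewrite (ord1 i) !mxE liftK.
    by move: h2; rewrite /headr mxE unlift_none.
  move=> [h1 h2]; split.
    rewrite (_ : tailr _ = x)//; apply/matrixP => i j.
    by rewrite (ord1 i) !mxE liftK.
  by rewrite /headr mxE unlift_none.
rewrite product_measure1E; [|exact: (mF _).1|exact: (mG _).1].
have f1 : lebesgue_rV R n (F p.1) \is a fin_num.
  by rewrite ge0_fin_numE//; exact: (mF _).2.
have f2 : leb (G p.2) \is a fin_num by rewrite ge0_fin_numE//; exact: (mG _).2.
by rewrite -ge0_fin_numE ?fin_numM// mule_ge0.
Qed.

HB.instance Definition _ n := Measure_isSigmaFinite.Build _ _ _ (@lam n)
  (@lam_sigma_finite n).

Lemma ge0_integral_lam0 (f : 'rV[R]_0 -> \bar R) : measurable_fun setT f ->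
  (\int[@lam 0]_x f x = f 0%R)%E.
Proof.
move=> mf; rewrite (@eq_measure_integral _ _ _ _ (\d_(0 : 'rV[R]_0)))//.
by rewrite integral_dirac// diracE in_setT mul1e.
Qed.

Lemma ge0_integral_lamS n (f : 'rV[R]_n.+1 -> \bar R) : measurable_fun setT f ->
  (forall x, 0 <= f x)%E ->
  (\int[@lam n.+1]_x f x = \int[@lam n]_x \int[leb]_t f (cons_rV (x, t)))%E.
Proof.
move=> mf f0.
rewrite (@eq_measure_integral _ _ _ _ (pushforward (@lam n \x leb)%E (@cons_rV R n)))//.
rewrite (ge0_integral_pushforward (@measurable_cons_rV R n))//=.
rewrite fubini_tonelli1//.
by apply: measurableT_comp => //; exact: measurable_cons_rV.
Qed.

Lemma cons_rVD n (x y : 'rV[R]_n) (t u : R) :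
  cons_rV (x + y, t + u) = cons_rV (x, t) + cons_rV (y, u).
Proof. by apply/matrixP => i j; rewrite (ord1 i) !mxE; case: unliftP => [k _|_] /=; rewrite ?mxE. Qed.

Lemma cons_rVZ n (x : 'rV[R]_n) (a t : R) :
  cons_rV (a *: x, a * t) = a *: cons_rV (x, t).
Proof. by apply/matrixP => i j; rewrite (ord1 i) !mxE; case: unliftP => [k _|_] /=; rewrite ?mxE. Qed.

Lemma dot_cons_rV n (x y : 'rV[R]_n) (t u : R) :
  dot (cons_rV (x, t)) (cons_rV (y, u)) = t * u + dot x y.
Proof.
rewrite /dot big_ord_recl !mxE unlift_none/=; congr (_ + _).
by apply: eq_bigr => i _; rewrite !mxE liftK.
Qed.

Lemma ge0_integral_lam_shift n (v : 'rV[R]_n) (f : 'rV[R]_n -> \bar R) :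
  measurable_fun setT f -> (forall x, 0 <= f x)%E ->
  (\int[@lam n]_x f (x + v)%R = \int[@lam n]_x f x)%E.
Proof.
elim: n v f => [|n ih] v f mf f0.
  by apply: eq_integral => x _; congr f; rewrite thinmx0 [RHS]thinmx0.
have mshift : measurable_fun setT (fun x : 'rV[R]_n.+1 => x + v) by exact: measurable_rVD.
rewrite (ge0_integral_lamS mf f0) (ge0_integral_lamS (measurableT_comp mf mshift) (fun x => f0 _)).
rewrite -(cons_rV_bij v); set v1 := \row_ _ _; set v2 := v _ _.
pose g (x : 'rV[R]_n) := (\int[leb]_t f (cons_rV (x, t)))%E.
have mg : measurable_fun setT g.
  apply: (@measurable_fun_fubini_tonelli_F _ _ _ _ _ leb (f \o @cons_rV R n)); last by move=> ?; exact: f0.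
  by apply: measurableT_comp => //; exact: measurable_cons_rV.
have g0 x : (0 <= g x)%E by apply: integral_ge0 => t _; exact: f0.
rewrite -[RHS](ih v1 g mg g0).
apply: eq_integral => x _; rewrite /g.
have mfx : measurable_fun setT (fun t : measurableTypeR R => f (cons_rV (x + v1, t))).
  apply: (measurableT_comp (f := f \o @cons_rV R n)).
    by apply: measurableT_comp => //; exact: measurable_cons_rV.
  exact: measurable_pair1.
rewrite -[RHS](ge0_integral_affine v2 ltr01 mfx)// mul1e.
by apply: eq_integral => t _; rewrite /= mul1r -cons_rVD.
Qed.

End lam.

(** * The Prekopa-Leindler inequality *)

Section brunn_minkowski.
Context (R : realType).
Local Notation leb := (@lebesgue_measure R).
Implicit Types (U V W : set (measurableTypeR R)).

(** Translates of $(1-s)U$ and $sV$ fit side by side in [W], on the two sides of $(1-s)x_1 + s y_0$,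
    if $x_1$ is the maximum of [U] and $y_0$ the minimum of [V]. These need not exist, so [x1] and
    [y0] are taken within [e] of the supremum and infimum and the parts beyond them, of measure at
    most [e], are dropped. *)
Lemma brunn_minkowski1 (s : R) U V W : 0 < s < 1 ->
  measurable U -> measurable V -> measurable W -> U !=set0 -> V !=set0 ->
  has_ubound U -> has_lbound V ->
  (forall x y, U x -> V y -> W ((1 - s) * x + s * y)) ->
  ((1 - s)%:E * leb U + s%:E * leb V <= leb W)%E.
Proof.
move=> /andP[s0 s1] mU mV mW U0 V0 ubU lbV UVW.
have s1' : 0 < 1 - s by rewrite subr_gt0.
apply/lee_addgt0Pr => e e0.
have [x1 Ux1 x1e] := sup_adherent e0 (conj U0 ubU).
have [y0 Vy0 y0e] := inf_adherent e0 (conj V0 lbV).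
set U1 := U `&` `]-oo, x1]%classic; set V1 := V `&` `]y0, +oo[%classic.
have mU1 : measurable U1 by exact: measurableI.
have mV1 : measurable V1 by exact: measurableI.
have hU : (leb U <= leb U1 + e%:E)%E.
  apply: (@le_trans _ _ (leb (U1 `|` `]x1, x1 + e]%classic))).
    apply: le_measure; rewrite ?inE//; first exact: measurableU.
    move=> x Ux; have [xx1|xx1] := leP x x1; [left|right].
      by split => //=; rewrite in_itv.
    by rewrite /= in_itv/= xx1/= -lerBlDr; rewrite (le_trans _ (ltW x1e))// lerD2r ub_le_sup.
  have <- : leb `]x1, x1 + e]%classic = e%:E.
    by rewrite lebesgue_measure_itv/= lte_fin ltrDl e0 -EFinD; congr EFin; ring.
  exact: measureU2.
have hV : (leb V <= leb V1 + e%:E)%E.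
  apply: (@le_trans _ _ (leb (V1 `|` `[y0 - e, y0]%classic))).
    apply: le_measure; rewrite ?inE//; first exact: measurableU.
    move=> x Vx; have [xx1|xx1] := ltP y0 x; [left|right].
      by split => //=; rewrite in_itv/= xx1.
    by rewrite /= in_itv/= xx1 andbT lerBlDr (le_trans (ltW y0e))// lerD2r ge_inf.
  have <- : leb `[y0 - e, y0]%classic = e%:E.
    by rewrite lebesgue_measure_itv/= lte_fin gtrBl e0 -EFinD; congr EFin; ring.
  exact: measureU2.
pose U2 := (fun x => (x - s * y0) / (1 - s)) @^-1` U1.
pose V2 := (fun x => (x - (1 - s) * x1) / s) @^-1` V1.
have mU2 : measurable U2.
  rewrite -[X in measurable X]setTI; apply: (measurable_funM (f := fun x : measurableTypeR R => x - s * y0)) => //.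
  exact: measurable_funB.
have mV2 : measurable V2.
  rewrite -[X in measurable X]setTI; apply: (measurable_funM (f := fun x : measurableTypeR R => x - (1 - s) * x1)) => //.
  exact: measurable_funB.
have UV2W : U2 `|` V2 `<=` W.
  move=> z [[Uz zx]|[Vz zy]].
    by have := UVW _ _ Uz Vy0; rewrite mulrC divfK ?gt_eqF// subrK.
  by have := UVW _ _ Ux1 Vz; rewrite [s * _]mulrC divfK ?gt_eqF// addrCA subrr addr0.
have dUV : [disjoint U2 & V2].
  apply/disj_set2P; apply/seteqP; split => // z [[_ /=]]; rewrite in_itv/= ler_pdivrMr// => h1.
  by case=> _ /=; rewrite in_itv/= andbT ltr_pdivlMr// => h2; lra.
have : (leb U2 + leb V2 <= leb W)%E.
  rewrite -measureU//; last exact/disj_set2P.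
  by apply: le_measure; rewrite ?inE//; exact: measurableU.
rewrite /U2 /V2 lebesgue_affine// lebesgue_affine// => h.
apply: (@le_trans _ _ ((1 - s)%:E * (leb U1 + e%:E) + s%:E * (leb V1 + e%:E))%E).
  by apply: leeD; rewrite lee_pmul2l// lte_fin.
rewrite !ge0_muleDr ?lee_fin ?(ltW e0)// addeACA -!EFinM -!EFinD.
rewrite -mulrDl subrK mul1r; exact: leeD2r.
Qed.

Lemma layer_cake1 (f : measurableTypeR R -> R) : measurable_fun setT f ->
  (forall x, 0 <= f x <= 1) ->
  (\int[leb]_x (f x)%:E = \int[leb]_(t in `]0%R, 1%R[) leb [set x | t < f x]%R)%E.
Proof.
move=> mf f01.
pose E := [set p : measurableTypeR R * measurableTypeR R | 0 < p.2 < 1 /\ p.2 < f p.1].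
have mE : measurable E.
  rewrite (_ : E = (snd @^-1` `]0, 1[%classic) `&` [set p | p.2 < f p.1]).
    apply: measurableI; first by rewrite -[X in measurable X]setTI; exact: measurable_snd.
    rewrite -[X in measurable X]setTI; apply: measurable_fun_ltr => //.
    by apply: measurableT_comp.
  by apply/seteqP; split => -[x t]; rewrite /E /= in_itv.
have := @indic_fubini_tonelli _ _ _ _ _ leb leb E mE.
rewrite indic_fubini_tonelli_FE// indic_fubini_tonelli_GE//= => h.
transitivity (\int[leb]_x leb (xsection E x))%E.
  apply: eq_integral => x _; have /andP[f0 f1] := f01 x.
  rewrite (_ : xsection E x = `]0, f x[%classic).
    rewrite lebesgue_measure_itv/= lte_fin sube0; case: ltP => //.
    by move=> f0'; congr EFin; apply/eqP; rewrite eq_le f0 f0'.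
  apply/seteqP; split => t; rewrite /xsection /= inE /E/= in_itv/=.
    by case=> /andP[-> _] ->.
  by move=> /andP[t0 tf]; rewrite t0 tf (lt_le_trans tf f1).
rewrite h [RHS]integral_mkcond; apply: eq_integral => t _; rewrite patchE/=.
case: ifPn => [/set_mem|/negP]; rewrite ?inE/= in_itv/= => t01.
  by congr (leb _); apply/seteqP; split => x; rewrite /ysection /= inE /E /=; [case|].
rewrite (_ : ysection E t = set0) ?measure0//; apply/seteqP; split => // x.
by rewrite /ysection /= inE /E/= => -[t01' _]; apply: t01.
Qed.

(** Brunn-Minkowski is integrated over the levels [t]. It needs nonempty superlevel sets of [u] and
    of [v] for the same levels, whence the normalisation of both suprema to 1; it then yields an
    arithmetic mean. *)
Lemma prekopa_leindler1_norm (s : R) (u v h : measurableTypeR R -> R) : 0 < s < 1 ->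
  measurable_fun setT u -> measurable_fun setT v -> measurable_fun setT h ->
  (forall x, 0 <= u x <= 1) -> (forall x, 0 <= v x <= 1) -> (forall x, 0 <= h x) ->
  (forall t, t < 1 -> exists x, t < u x) -> (forall t, t < 1 -> exists x, t < v x) ->
  (forall t, 0 < t -> has_ubound [set x | t < u x]) ->
  (forall t, 0 < t -> has_lbound [set x | t < v x]) ->
  (forall t x y, 0 < t < 1 -> t < u x -> t < v y -> t < h ((1 - s) * x + s * y)) ->
  ((1 - s)%:E * (\int[leb]_x (u x)%:E) + s%:E * (\int[leb]_x (v x)%:E) <= \int[leb]_x (h x)%:E)%E.
Proof.
move=> s01 mu mv mh u01 v01 h0 u1 v1 ubu lbv uvh.
have /andP[s0 s1] := s01.
(* Only levels below 1 are compared, so [h] may be cut at 1, where [layer_cake1] applies to it. *)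
pose h' x := Num.min (h x) 1.
have mh' : measurable_fun setT h' by exact: measurable_minr.
have h'01 x : 0 <= h' x <= 1 by rewrite /h' le_min h0 ler01 ge_min lexx orbT.
apply: (@le_trans _ _ (\int[leb]_x (h' x)%:E)%E); last first.
  apply: ge0_le_integral => //.
  - by move=> x _; rewrite lee_fin; case/andP: (h'01 x).
  - exact/measurable_EFinP.
  - exact/measurable_EFinP.
  - by move=> x _; rewrite lee_fin /h' ge_min lexx.
have mlev (f : measurableTypeR R -> R) t : measurable_fun setT f -> measurable [set x | t < f x].
  move=> mf; rewrite -[X in measurable X]setTI.
  by apply: (measurable_fun_ltr (f := cst t)).
have mleb (f : measurableTypeR R -> R) : measurable_fun setT f ->
   measurable_fun (`]0%R, 1%R[%classic : set (measurableTypeR R)) (fun t : measurableTypeR R => leb [set x | t < f x]).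
  move=> mf; apply: measurable_funTS.
  pose E := [set p : measurableTypeR R * measurableTypeR R | p.2 < f p.1].
  have mE : measurable E.
    rewrite -[X in measurable X]setTI; apply: measurable_fun_ltr => //.
    by apply: measurableT_comp.
  have := measurable_fun_ysection leb mE.
  by congr (measurable_fun _ _); apply/funext => t /=; congr (leb _);
    apply/seteqP; split => x; rewrite /ysection /= inE.
rewrite !layer_cake1//.
have s1' : 0 <= 1 - s by rewrite subr_ge0 ltW.
rewrite -!ge0_integralZl ?lee_fin ?(ltW s0)//; [|exact: mleb..].
rewrite -ge0_integralD//; last 4 first.
- by move=> t _; rewrite mule_ge0// lee_fin.
- by apply: measurable_funeM; exact: mleb.
- by move=> t _; rewrite mule_ge0// lee_fin ltW.
- by apply: measurable_funeM; exact: mleb.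
apply: ge0_le_integral => //.
- by move=> t _; rewrite adde_ge0// mule_ge0// lee_fin// ltW.
- by apply: emeasurable_funD; apply: measurable_funeM; exact: mleb.
- exact: mleb.
move=> t /=; rewrite in_itv/= => t01; have /andP[t0 t1] := t01.
have [x ux] := u1 t t1; have [y vy] := v1 t t1.
apply: brunn_minkowski1 => //; [exact: mlev..|by exists x|by exists y|exact: ubu|exact: lbv|].
by move=> x' y' /= ux' vy'; rewrite /h' lt_min t1 andbT; exact: uvh.
Qed.

End brunn_minkowski.

Section rint.
Context d (T : measurableType d) (R : realType) (m : {measure set T -> \bar R}).

Lemma EFin_Rint (f : T -> R) : m.-integrable setT (EFin \o f) ->
  ((\int[m]_x f x)%:E = \int[m]_x (f x)%:E)%E.
Proof. by move=> fi; rewrite fineK//; exact: integrable_fin_num. Qed.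

Lemma ler_Rint (f g : T -> R) : m.-integrable setT (EFin \o f) ->
  m.-integrable setT (EFin \o g) -> (forall x, f x <= g x) ->
  \int[m]_x f x <= \int[m]_x g x.
Proof. by move=> fi gi fg; apply: le_Rintegral. Qed.

Lemma eq_Rint (f g : T -> R) : f =1 g -> \int[m]_x f x = \int[m]_x g x.
Proof. by move=> fg; apply: eq_Rintegral => x _; exact: fg. Qed.

Lemma integrable_le (f g : T -> R) : measurable_fun setT f ->
  m.-integrable setT (EFin \o g) -> (forall x, `|f x| <= g x) ->
  m.-integrable setT (EFin \o f).
Proof.
move=> mf gi fg; apply: le_integrable gi => //; first exact/measurable_EFinP.
by move=> x _ /=; rewrite lee_fin (le_trans (fg x))// ler_norm.
Qed.

Lemma integrable_Zl (a : R) (f : T -> R) : m.-integrable setT (EFin \o f) ->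
  m.-integrable setT (EFin \o (fun x => a * f x)).
Proof.
move=> fi; rewrite (_ : EFin \o _ = fun x => a%:E * (EFin \o f) x)%E//.
exact: integrableZl.
Qed.

Lemma Rint_gt0 (f : T -> R) : m.-integrable setT (EFin \o f) -> (forall x, 0 < f x) ->
  m setT != 0%E -> 0 < \int[m]_x f x.
Proof.
move=> fi f0 mT; rewrite lt_def Rintegral_ge0//; last by move=> x _; rewrite ltW.
rewrite andbT; apply: contra mT => /eqP If0; apply/eqP.
have mf : measurable_fun setT (EFin \o f) by exact: measurable_int fi.
have /ae_eq_integral_abs : (\int[m]_x `|(EFin \o f) x| = 0)%E.
  under eq_integral do rewrite /= gtr0_norm//.
  by rewrite -EFin_Rint// If0.
move=> /(_ measurableT mf) [N [mN N0]] fN.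
rewrite (_ : setT = N) ?N0//; apply/seteqP; split => // x _; apply: fN => /= h.
by have := h I; case=> fx0; move: (f0 x); rewrite fx0 ltxx.
Qed.

End rint.

(** * Gaussian domination, sections and marginals *)

Section gaussian_domination.
Context (R : realType).
Local Notation leb := (@lebesgue_measure R).

(** Domination by a Gaussian is the standing integrability condition: unlike integrability, it
    passes to every section and every marginal, so inductions on the dimension can carry it
    along. *)
Record gdom1 (f : measurableTypeR R -> R) : Prop := Gdom1 {
  gdom1_measurable : measurable_fun setT f;
  gdom1_bound : exists A c : R, 0 < c /\ forall x, `|f x| <= A * expR (- c * x ^+ 2) }.

Record gdom n (f : 'rV[R]_n -> R) : Prop := Gdom {
  gdom_measurable : measurable_fun setT f;
  gdom_bound : exists A c : R, 0 < c /\ forall x, `|f x| <= A * expR (- c * dot x x) }.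

Lemma integrable_gauss1 (c : R) : 0 < c ->
  leb.-integrable setT (EFin \o (fun x : measurableTypeR R => expR (- c * x ^+ 2))).
Proof.
move=> c0.
have mg : measurable_fun setT (fun x : measurableTypeR R => expR (- c * x ^+ 2)).
  by apply: measurableT_comp => //; apply: measurable_funM => //; exact: measurable_funX.
apply/integrableP; split; first exact/measurable_EFinP.
have sc : 0 < Num.sqrt c by rewrite sqrtr_gt0.
have := @ge0_integral_affine R (Num.sqrt c) 0 (EFin \o gauss_fun) sc.
have -> : (\int[leb]_x (EFin \o gauss_fun) x = (Num.sqrt pi)%:E :> \bar R)%E by exact: integralT_gauss.
move=> /(_ _ _)/eqP h.
under eq_integral.
  move=> x _; rewrite /= ger0_norm ?expR_ge0//.
  have -> : expR (- c * x ^+ 2) = gauss_fun (Num.sqrt c * x + 0).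
    by rewrite /gauss_fun addr0 exprMn sqr_sqrtr ?ltW// mulNr.
  over.
set J := (\int[_]_x _)%E; have {}h : ((Num.sqrt c)%:E * J = (Num.sqrt pi)%:E)%E.
  apply/eqP; apply: h; last by move=> x; rewrite lee_fin gauss_fun_ge0.
  by apply/measurable_EFinP; exact: measurable_gauss_fun.
rewrite ltNge leye_eq; apply/negP => /eqP Jy; move: h.
by rewrite Jy gt0_muley ?lte_fin.
Qed.

Lemma gdom1_integrable f : gdom1 f -> leb.-integrable setT (EFin \o f).
Proof.
move=> [mf [A [c [c0 fA]]]]; apply: integrable_le fA => //.
rewrite (_ : EFin \o _ = fun x => A%:E * (expR (- c * x ^+ 2))%:E)%E//.
by apply: integrableZl => //; exact: integrable_gauss1.
Qed.

Lemma lebT_neq0 : leb [set: measurableTypeR R] != 0%E.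
Proof.
have : (leb `[0%R, 1%R]%classic <= leb [set: measurableTypeR R])%E.
  by apply: le_measure => //; rewrite inE.
rewrite lebesgue_measure_itv/= lte01 sube0 => h.
by apply/negP => /eqP h0; move: h; rewrite h0 lee_fin ler10.
Qed.

Lemma gauss_cons n (x : 'rV[R]_n) (t c : R) :
  expR (- c * dot (cons_rV (x, t)) (cons_rV (x, t))) =
  expR (- c * t ^+ 2) * expR (- c * dot x x).
Proof. by rewrite dot_cons_rV -expr2 mulrDr expRD. Qed.

Lemma measurable_cons1 n d (T : measurableType d) (f : 'rV[R]_n.+1 -> T) (x : 'rV[R]_n) :
  measurable_fun setT f ->
  measurable_fun setT (fun t : measurableTypeR R => f (cons_rV (x, t))).
Proof.
move=> mf; apply: (measurableT_comp (f := f \o @cons_rV R n)).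
  by apply: measurableT_comp => //; exact: measurable_cons_rV.
exact: measurable_pair1.
Qed.

Lemma gdom_section n (f : 'rV[R]_n.+1 -> R) x : gdom f ->
  gdom1 (fun t => f (cons_rV (x, t))).
Proof.
move=> [mf [A [c [c0 fA]]]]; split; first exact: measurable_cons1.
exists (A * expR (- c * dot x x)), c; split => // t.
by rewrite (le_trans (fA _))// gauss_cons mulrA mulrAC.
Qed.

Definition margin n (f : 'rV[R]_n.+1 -> R) (x : 'rV[R]_n) : R :=
  \int[leb]_t f (cons_rV (x, t)).

Lemma gdom_margin n (f : 'rV[R]_n.+1 -> R) : gdom f -> (forall x, 0 <= f x) ->
  gdom (margin f).
Proof.
move=> gf f0; have [mf [A [c [c0 fA]]]] := gf; split.
  rewrite (_ : margin f = fine \o (fun x => \int[leb]_t (f (cons_rV (x, t)))%:E)%E)//.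
  apply: measurableT_comp => //.
  apply: (@measurable_fun_fubini_tonelli_F _ _ _ _ _ leb (EFin \o f \o @cons_rV R n)).
    apply: measurableT_comp; last exact: measurable_cons_rV.
    exact/measurable_EFinP.
  by move=> p; rewrite lee_fin.
have gi := integrable_gauss1 c0.
exists (A * \int[leb]_t expR (- c * t ^+ 2)), c; split => // x.
rewrite ger0_norm; last by apply: Rintegral_ge0 => t _.
rewrite mulrAC -RintegralZl//.
apply: ler_Rint.
- exact/gdom1_integrable/gdom_section.
- rewrite (_ : EFin \o _ = fun t => (A * expR (- c * dot x x))%:E * (expR (- c * t ^+ 2))%:E)%E//.
  exact: integrableZl.
- move=> t; rewrite (le_trans (ler_norm _))// (le_trans (fA _))//.
  by rewrite gauss_cons mulrA mulrAC.
Qed.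

Lemma gdom_Tonelli n (f : 'rV[R]_n.+1 -> R) : gdom f -> (forall x, 0 <= f x) ->
  (\int[@lam R n.+1]_x (f x)%:E = \int[@lam R n]_x (margin f x)%:E)%E.
Proof.
move=> gf f0; rewrite ge0_integral_lamS//; last by apply/measurable_EFinP; case: gf.
apply: eq_integral => x _; rewrite EFin_Rint//.
exact/gdom1_integrable/gdom_section.
Qed.

Lemma gdom_ge0_fin n (f : 'rV[R]_n -> R) : gdom f -> (forall x, 0 <= f x) ->
  (\int[@lam R n]_x (f x)%:E < +oo)%E.
Proof.
elim: n f => [|n ih] f gf f0.
  by rewrite ge0_integral_lam0 ?ltry//; apply/measurable_EFinP; case: gf.
rewrite gdom_Tonelli//; apply: ih; first exact: gdom_margin.
by move=> x; apply: Rintegral_ge0.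
Qed.

Lemma gdom_integrable n (f : 'rV[R]_n -> R) : gdom f ->
  (@lam R n).-integrable setT (EFin \o f).
Proof.
move=> [mf [A [c [c0 fA]]]]; apply/integrableP; split; first exact/measurable_EFinP.
rewrite (_ : (\int[_]_x _) = \int[@lam R n]_x (`|f x|)%:E)%E//.
apply: gdom_ge0_fin => //; split; first exact: measurableT_comp.
by exists A, c; split => // x; rewrite normr_id.
Qed.

Lemma gdom_RTonelli n (f : 'rV[R]_n.+1 -> R) : gdom f -> (forall x, 0 <= f x) ->
  \int[@lam R n.+1]_x f x = \int[@lam R n]_x margin f x.
Proof.
move=> gf f0; apply: EFin_inj; rewrite !EFin_Rint; last 2 first.
- exact/gdom_integrable/gdom_margin.
- exact/gdom_integrable.
exact: gdom_Tonelli.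
Qed.

Lemma margin_gt0 n (f : 'rV[R]_n.+1 -> R) x : gdom f -> (forall x, 0 < f x) ->
  0 < margin f x.
Proof.
by move=> gf f0; apply: Rint_gt0 => //; [exact/gdom1_integrable/gdom_section|exact: lebT_neq0].
Qed.

Lemma Rint_lam0 (f : 'rV[R]_0 -> R) : measurable_fun setT f -> \int[@lam R 0]_x f x = f 0.
Proof. by move=> mf; rewrite /Rintegral ge0_integral_lam0//; exact/measurable_EFinP. Qed.

Lemma gdom_Rint_gt0 n (f : 'rV[R]_n -> R) : gdom f -> (forall x, 0 < f x) ->
  0 < \int[@lam R n]_x f x.
Proof.
elim: n f => [|n ih] f gf f0.
  by rewrite Rint_lam0//; case: gf.
rewrite gdom_RTonelli// => [|x]; last exact: ltW.
apply: ih => [|x]; last exact: margin_gt0.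
by apply: gdom_margin => // x; exact: ltW.
Qed.

End gaussian_domination.

Section prekopa_leindler.
Context (R : realType).
Local Notation leb := (@lebesgue_measure R).

(** Supplies the boundedness conditions of [prekopa_leindler1_norm]. Since $e^y \ge y$, a point of
    the superlevel set has $x^2 < A/(tc)$; the summand 1 covers $|x| < 1$, and $|x| \le x^2$
    otherwise. *)
Lemma gdom1_superlevel (f : measurableTypeR R -> R) t : gdom1 f -> 0 < t ->
  exists M, forall x, t < f x -> `|x| <= M.
Proof.
move=> [_ [A [c [c0 fA]]]] t0; exists (1 + A / (t * c)) => x tf.
have {}tf : t < A * expR (- c * x ^+ 2).
  by rewrite (lt_le_trans tf)// (le_trans (ler_norm _)).
have A0 : 0 < A.
  by move: (lt_trans t0 tf); rewrite pmulr_lgt0// expR_gt0.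
have : t * (c * x ^+ 2) < A.
  have h := expR_ge1Dx (c * x ^+ 2).
  rewrite (le_lt_trans (y := t * expR (c * x ^+ 2)))//.
    by rewrite ler_pM2l// (le_trans _ h)// lerDr.
  by move: tf; rewrite mulNr expRN ltr_pdivlMr ?expR_gt0.
rewrite mulrA -ltr_pdivlMl ?mulr_gt0// mulrC => h.
rewrite leNgt; apply/negP => hx.
have x1 : 1 <= `|x| by rewrite (le_trans _ (ltW hx))// lerDl divr_ge0// ?ltW// mulr_gt0.
move: h; rewrite -[x ^+ 2]real_normK ?num_real// => h.
have : `|x| <= `|x| ^+ 2 by rewrite expr2 ler_peMl.
by have := lt_trans (le_lt_trans _ hx) ; lra.
Qed.

(** Reduction to the normalised case by dividing [u] and [v] by their suprema. Positivity of all
    functions allows the geometric mean to be written with logarithms. *)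
Lemma prekopa_leindler1 (s : R) (u v h : measurableTypeR R -> R) : 0 < s < 1 ->
  gdom1 u -> gdom1 v -> gdom1 h ->
  (forall x, 0 < u x) -> (forall x, 0 < v x) -> (forall x, 0 < h x) ->
  (forall x y, (1 - s) * ln (u x) + s * ln (v y) <= ln (h ((1 - s) * x + s * y))) ->
  (1 - s) * ln (\int[leb]_x u x) + s * ln (\int[leb]_x v x) <= ln (\int[leb]_x h x).
Proof.
move=> s01 gu gv gh u0 v0 h0 uvh; have /andP[s0 s1] := s01.
have s1' : 0 < 1 - s by rewrite subr_gt0.
have hsup (f : measurableTypeR R -> R) : gdom1 f -> (forall x, 0 < f x) ->
    exists A, [/\ 0 < A, forall x, f x <= A & forall t, t < 1 -> exists x, t < f x / A].
  move=> [_ [B [c [c0 fB]]]] f0; exists (sup (range f)).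
  have hs : has_sup (range f).
    split; first by exists (f 0), 0.
    exists B => _ [x _ <-]; apply: (le_trans (ler_norm _)); apply: (le_trans (fB x)).
    have B0 : 0 <= B.
      by have := le_trans (normr_ge0 _) (fB 0); rewrite pmulr_lge0 ?expR_gt0.
    by rewrite ler_piMr// -expR0 ler_expR mulNr oppr_le0 mulr_ge0 ?(ltW c0) ?sqr_ge0.
  have fle x : f x <= sup (range f) by apply: ub_le_sup; [exact: hs.2|exists x].
  have A0 := lt_le_trans (f0 0) (fle 0).
  split => // t t1.
  have e0 : 0 < sup (range f) * (1 - t) by rewrite mulr_gt0// subr_gt0.
  have [_ [x _ <-] hx] := sup_adherent e0 hs; exists x.
  by rewrite ltr_pdivlMr// mulrC; move: hx; rewrite mulrBr mulr1 opprB addrCA subrr addr0.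
have [A [A0 uA uA1]] := hsup u gu u0; have [B [B0 vB vB1]] := hsup v gv v0.
(* $H = A^{1-s} B^s$ is the scaling of [h] that preserves the hypothesis after [u] and [v] are
   divided by [A] and [B]. *)
pose H := expR ((1 - s) * ln A + s * ln B).
have H0 : 0 < H by exact: expR_gt0.
have md (f : measurableTypeR R -> R) (a : R) : gdom1 f -> measurable_fun setT (fun x => f x / a).
  by case=> mf _; exact: measurable_funM.
have bd (f : measurableTypeR R -> R) (a : R) t : 0 < a -> gdom1 f -> 0 < t ->
    exists M, forall x, t < f x / a -> `|x| <= M.
  move=> a0 gf t0; have [M hM] := gdom1_superlevel gf (mulr_gt0 t0 a0).
  by exists M => x; rewrite ltr_pdivlMr//; exact: hM.
have := @prekopa_leindler1_norm R s (fun x => u x / A) (fun x => v x / B) (fun x => h x / H)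
  s01 (md _ _ gu) (md _ _ gv) (md _ _ gh) _ _ _ uA1 vB1.
have q01 (f : measurableTypeR R -> R) (a : R) x : 0 < a -> (forall x, 0 < f x) ->
    (forall x, f x <= a) -> 0 <= f x / a <= 1.
  by move=> a0 f0 fa; rewrite (divr_ge0 (ltW (f0 x)) (ltW a0)) ler_pdivrMr ?mul1r ?fa.
move=> /(_ (fun x => q01 u A x A0 u0 uA) (fun x => q01 v B x B0 v0 vB)).
move=> /(_ (fun x => divr_ge0 (ltW (h0 x)) (ltW H0))).
have ub t : 0 < t -> has_ubound [set x | t < u x / A].
  by move=> t0; have [M hM] := bd u A t A0 gu t0; exists M => x /hM; rewrite ler_norml => /andP[].
have lb t : 0 < t -> has_lbound [set x | t < v x / B].
  by move=> t0; have [M hM] := bd v B t B0 gv t0; exists (- M) => x /hM; rewrite ler_norml => /andP[].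
move=> /(_ ub lb).
have cond t x y : 0 < t < 1 -> t < u x / A -> t < v y / B -> t < h ((1 - s) * x + s * y) / H.
  move=> /andP[t0 t1]; rewrite !ltr_pdivlMr// => tu tv.
  have tH : 0 < t * H by rewrite mulr_gt0.
  rewrite -ltr_ln ?posrE//; apply: lt_le_trans (uvh x y).
  have lu : ln t + ln A < ln (u x) by rewrite -lnM ?posrE// ltr_ln ?posrE// mulr_gt0.
  have lv : ln t + ln B < ln (v y) by rewrite -lnM ?posrE// ltr_ln ?posrE// mulr_gt0.
  by rewrite lnM ?posrE// /H expRK; nra.
move=> /(_ cond).
have int (f : measurableTypeR R -> R) (a : R) : gdom1 f -> (\int[leb]_x (f x / a)%:E = (a^-1 * \int[leb]_x f x)%:E)%E.
  move=> gf; rewrite -RintegralZl//; last exact: gdom1_integrable.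
  rewrite EFin_Rint; first by apply: eq_integral => x _; rewrite mulrC.
  by apply: integrable_Zl; exact: gdom1_integrable.
rewrite !int// -!EFinM -EFinD lee_fin.
have Ip (f : measurableTypeR R -> R) : gdom1 f -> (forall x, 0 < f x) -> 0 < \int[leb]_x f x.
  by move=> gf f0; apply: Rint_gt0 => //; [exact: gdom1_integrable|exact: lebT_neq0].
have := Ip u gu u0; have := Ip v gv v0; have := Ip h gh h0.
move: (\int[leb]_x u x) (\int[leb]_x v x) (\int[leb]_x h x) => a b c c0 b0 a0 key.
rewrite -(ler_expR) lnK ?posrE//.
have a'0 : 0 < A^-1 * a by rewrite mulr_gt0// invr_gt0.
have b'0 : 0 < B^-1 * b by rewrite mulr_gt0// invr_gt0.
(* weighted AM-GM, by the tangent line of [exp] at [m] *)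
have amgm : expR ((1 - s) * ln (A^-1 * a) + s * ln (B^-1 * b)) <= (1 - s) * (A^-1 * a) + s * (B^-1 * b).
  set m := (1 - s) * _ + s * _.
  have tang x : expR m * (1 + (x - m)) <= expR x.
    have -> : expR x = expR m * expR (x - m) by rewrite -expRD addrC subrK.
    by rewrite ler_pM2l ?expR_gt0// expR_ge1Dx.
  have t1 := tang (ln (A^-1 * a)); have t2 := tang (ln (B^-1 * b)).
  rewrite (lnK (x := A^-1 * a)) ?posrE// in t1.
  rewrite (lnK (x := B^-1 * b)) ?posrE// in t2.
  have mE : expR m = (1 - s) * (expR m * (1 + (ln (A^-1 * a) - m))) +
     s * (expR m * (1 + (ln (B^-1 * b) - m))).
    by generalize (expR m) => M; rewrite /m; ring.
  by rewrite [leLHS]mE; apply: lerD; rewrite ler_pM2l.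
have := le_trans amgm key; rewrite -ler_pdivrMl ?invr_gt0// invrK.
apply: le_trans; rewrite /H -expRD ler_expR !lnM ?posrE ?invr_gt0// !lnV ?posrE//.
by lra.
Qed.

(** Induction on the dimension: by the one-dimensional case on the fibres, the marginals of [u], [v]
    and [h] again satisfy the hypothesis. *)
Theorem prekopa_leindler n (s : R) (u v h : 'rV[R]_n -> R) : 0 < s < 1 ->
  gdom u -> gdom v -> gdom h ->
  (forall x, 0 < u x) -> (forall x, 0 < v x) -> (forall x, 0 < h x) ->
  (forall x y, (1 - s) * ln (u x) + s * ln (v y) <= ln (h ((1 - s) *: x + s *: y))) ->
  (1 - s) * ln (\int[@lam R n]_x u x) + s * ln (\int[@lam R n]_x v x) <=
  ln (\int[@lam R n]_x h x).
Proof.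
move=> s01; elim: n u v h => [|n ih] u v h gu gv gh u0 v0 h0 uvh.
  have E (f : 'rV[R]_0 -> R) : gdom f -> \int[@lam R 0]_x f x = f 0.
    by case=> mf _; rewrite Rint_lam0.
  by rewrite !E//; have := uvh 0 0; rewrite !scaler0 addr0.
have gt0W (f : 'rV[R]_n.+1 -> R) : (forall x, 0 < f x) -> forall x, 0 <= f x by move=> f0 x; exact: ltW.
rewrite !gdom_RTonelli//; try by [apply: gt0W].
apply: ih; try (by apply: gdom_margin => //; exact: gt0W); try (by move=> x; exact: margin_gt0).
move=> x y; apply: prekopa_leindler1 => //; try exact: gdom_section.
by move=> t t'; rewrite (le_trans (uvh _ _))// -!cons_rVZ -cons_rVD.
Qed.

End prekopa_leindler.

(** * Exponential tilts of a weight *)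

Section growth.
Context (R : realType) (n : nat).
Implicit Types (f g h w : 'rV[R]_n -> R).

(** Functions of linear growth serve as exponents of tilts, functions of exponential growth ([egro])
    as integrands. A Gaussian-dominated weight absorbs both, so every integral of this kind below
    converges. *)
Record lgro h : Prop := Lgro {
  lgro_measurable : measurable_fun setT h;
  lgro_bound : exists A, forall x, `|h x| <= A * (1 + norm2 x) }.

Record egro f : Prop := Egro {
  egro_measurable : measurable_fun setT f;
  egro_bound : exists A, forall x, `|f x| <= A * expR (A * norm2 x) }.

Lemma lgro_ge0 h : lgro h -> exists A, 0 <= A /\ forall x, `|h x| <= A * (1 + norm2 x).
Proof.
move=> [_ [A hA]]; exists A; split => //.
by have := le_trans (normr_ge0 _) (hA 0); rewrite norm20 addr0 mulr1.
Qed.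

Lemma egro_ge0 f : egro f -> exists A, 0 <= A /\ forall x, `|f x| <= A * expR (A * norm2 x).
Proof.
move=> [_ [A hA]]; exists A; split => //.
by have := le_trans (normr_ge0 _) (hA 0); rewrite norm20 mulr0 expR0 mulr1.
Qed.

Lemma egro_le f A B : measurable_fun setT f -> 0 <= A -> 0 <= B ->
  (forall x, `|f x| <= A * expR (B * norm2 x)) -> egro f.
Proof.
move=> mf A0 B0 fAB; split => //; exists (A + B) => x.
rewrite (le_trans (fAB x))// ler_pM ?expR_ge0 ?lerDl// ler_expR.
by rewrite ler_wpM2r ?norm2_ge0// lerDr.
Qed.

Lemma lgro_cst (a : R) : lgro (fun _ => a).
Proof. by split => //; exists `|a| => x; rewrite ler_peMr// lerDl norm2_ge0. Qed.

Lemma lgroD h g : lgro h -> lgro g -> lgro (fun x => h x + g x).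
Proof.
move=> [mh [A hA]] [mg [B gB]]; split; first exact: measurable_funD.
by exists (A + B) => x; rewrite (le_trans (ler_normD _ _))// mulrDl lerD.
Qed.

Lemma lgroZ (a : R) h : lgro h -> lgro (fun x => a * h x).
Proof.
move=> [mh [A hA]]; split; first exact: measurable_funM.
by exists (`|a| * A) => x; rewrite normrM -mulrA ler_wpM2l.
Qed.

Lemma lgroB h g : lgro h -> lgro g -> lgro (fun x => h x - g x).
Proof.
move=> lh lg; rewrite (_ : (fun _ => _) = (fun x => h x + -1 * g x)).
  by apply: lgroD => //; exact: lgroZ.
by apply/funext => x; rewrite mulN1r.
Qed.

Lemma lgro_dot v : lgro (fun x => dot x v).
Proof.
split; first exact: measurable_dot.
exists (norm2 v) => x; rewrite (le_trans (cauchy_schwarz_abs _ _))// mulrC.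
by rewrite ler_wpM2l ?norm2_ge0// lerDr.
Qed.

Lemma lgro_norm2 : lgro (@norm2 R n).
Proof.
split; first exact: measurable_norm2.
by exists 1 => x; rewrite mul1r ger0_norm ?norm2_ge0// lerDr.
Qed.

Lemma lip_lgro h (L : R) : measurable_fun setT h ->
  (forall x y, h x - h y <= L * norm2 (x - y)) -> lgro h.
Proof.
move=> mh hL; split => //; exists (`|h 0| + `|L|) => x.
have hx : `|h x - h 0| <= `|L| * norm2 x.
  have L1 := hL x 0; have L2 := hL 0 x; rewrite norm2B in L2; rewrite subr0 in L1 L2.
  have L3 : L * norm2 x <= `|L| * norm2 x by rewrite ler_wpM2r ?norm2_ge0// ler_norm.
  by rewrite ler_norml; apply/andP; split; lra.
have := ler_normD (h x - h 0) (h 0); rewrite subrK => hx2.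
have := norm2_ge0 x; have := normr_ge0 (h 0); have := normr_ge0 L; nra.
Qed.

Lemma egroD f g : egro f -> egro g -> egro (fun x => f x + g x).
Proof.
move=> ef eg; have [mf _] := ef; have [mg _] := eg.
have [A [A0 fA]] := egro_ge0 ef; have [B [B0 gB]] := egro_ge0 eg.
apply: (@egro_le _ (A + B) (A + B)); rewrite ?addr_ge0//; first exact: measurable_funD.
move=> x; rewrite (le_trans (ler_normD _ _))// mulrDl; apply: lerD.
  rewrite (le_trans (fA x))// ler_wpM2l// ler_expR ler_wpM2r ?norm2_ge0//; lra.
rewrite (le_trans (gB x))// ler_wpM2l// ler_expR ler_wpM2r ?norm2_ge0//; lra.
Qed.

Lemma egroM f g : egro f -> egro g -> egro (fun x => f x * g x).
Proof.
move=> ef eg; have [mf _] := ef; have [mg _] := eg.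
have [A [A0 fA]] := egro_ge0 ef; have [B [B0 gB]] := egro_ge0 eg.
apply: (@egro_le _ (A * B) (A + B)); rewrite ?addr_ge0 ?mulr_ge0//; first exact: measurable_funM.
by move=> x; rewrite normrM mulrDl expRD mulrACA ler_pM.
Qed.

Lemma lgro_egro h : lgro h -> egro h.
Proof.
move=> lh; have [A [A0 hA]] := lgro_ge0 lh.
apply: (@egro_le _ A 1) => //; first by case: lh.
by move=> x; rewrite (le_trans (hA x))// ler_wpM2l// mul1r expR_ge1Dx.
Qed.

Lemma egro_cst (a : R) : egro (fun _ => a).
Proof. exact/lgro_egro/lgro_cst. Qed.

Lemma egroZ (a : R) f : egro f -> egro (fun x => a * f x).
Proof. by move=> ef; apply: egroM => //; exact: egro_cst. Qed.

Lemma egroB f g : egro f -> egro g -> egro (fun x => f x - g x).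
Proof.
move=> lh lg; rewrite (_ : (fun _ => _) = (fun x => f x + -1 * g x)).
  by apply: egroD => //; exact: egroZ.
by apply/funext => x; rewrite mulN1r.
Qed.

Lemma egroX f k : egro f -> egro (fun x => f x ^+ k).
Proof.
move=> ef; elim: k => [|k ih].
  by rewrite (_ : (fun _ => _) = (fun=> 1)); [exact: egro_cst|apply/funext => x; rewrite expr0].
rewrite (_ : (fun _ => _) = (fun x => f x * f x ^+ k)); first exact: egroM.
by apply/funext => x; rewrite exprS.
Qed.

Lemma egro_norm f : egro f -> egro (fun x => `|f x|).
Proof.
move=> [mf [A fA]]; split; first exact: measurableT_comp.
by exists A => x; rewrite normr_id.
Qed.

Lemma egro_expR h : lgro h -> egro (fun x => expR (h x)).
Proof.
move=> lh; have [A [A0 hA]] := lgro_ge0 lh.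
apply: (@egro_le _ (expR A) A); rewrite ?expR_ge0//.
  by apply: measurableT_comp => //; case: lh.
move=> x; rewrite ger0_norm ?expR_ge0// -expRD ler_expR.
by rewrite (le_trans (ler_norm _))// (le_trans (hA x))// mulrDr mulr1.
Qed.

Lemma egro_sum (I : Type) (r : seq I) (F : I -> 'rV[R]_n -> R) :
  (forall i, egro (F i)) -> egro (fun x => \sum_(i <- r) F i x).
Proof.
move=> eF; elim: r => [|i r ih].
  by rewrite (_ : (fun _ => _) = (fun=> 0)); [exact: egro_cst|apply/funext => x; rewrite big_nil].
rewrite (_ : (fun _ => _) = (fun x => F i x + \sum_(j <- r) F j x)); first exact: egroD.
by apply/funext => x; rewrite big_cons.
Qed.

Lemma egro_bounded f (A : R) : measurable_fun setT f -> (forall x, `|f x| <= A) -> egro f.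
Proof.
move=> mf fA; have A0 : 0 <= A by rewrite (le_trans _ (fA 0)).
by apply: (@egro_le _ A 0) => // x; rewrite mul0r expR0 mulr1.
Qed.

Lemma egro_gdom f w : egro f -> gdom w -> gdom (fun x => f x * w x).
Proof.
move=> ef [mw [B [c [c0 wB]]]]; have [mf _] := ef; have [A [A0 fA]] := egro_ge0 ef.
split; first exact: measurable_funM.
(* Completing the square: $A r - c r^2 \le A^2/(2c) - c r^2/2$. *)
exists (A * B * expR (A ^+ 2 / (2 * c))), (c / 2); split; first by rewrite divr_gt0.
move=> x; rewrite normrM; apply: (@le_trans _ _ ((A * expR (A * norm2 x)) * (B * expR (- c * dot x x)))).
  by rewrite ler_pM.
have B0 : 0 <= B.
  by have := le_trans (normr_ge0 _) (wB 0); rewrite pmulr_lge0 ?expR_gt0.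
rewrite mulrACA -!mulrA !ler_wpM2l// -!expRD ler_expR -sqr_norm2 -subr_ge0.
set t := norm2 x; rewrite (_ : _ - _ = (A - c * t) ^+ 2 / (2 * c)); last by field; rewrite gt_eqF.
by rewrite divr_ge0 ?sqr_ge0// mulr_ge0// ltW.
Qed.

Lemma gdomD f g : gdom f -> gdom g -> gdom (fun x => f x + g x).
Proof.
move=> [mf [A [c [c0 fA]]]] [mg [B [e [e0 gB]]]]; split; first exact: measurable_funD.
have A0 : 0 <= A.
  by have := le_trans (normr_ge0 _) (fA 0); rewrite pmulr_lge0 ?expR_gt0.
have B0 : 0 <= B.
  by have := le_trans (normr_ge0 _) (gB 0); rewrite pmulr_lge0 ?expR_gt0.
exists (A + B), (Num.min c e); split; first by rewrite lt_min c0.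
move=> x; rewrite (le_trans (ler_normD _ _))// mulrDl; apply: lerD.
  rewrite (le_trans (fA x))// ler_wpM2l// ler_expR ler_wpM2r ?dot_ge0// lerN2.
  by rewrite ge_min lexx.
rewrite (le_trans (gB x))// ler_wpM2l// ler_expR ler_wpM2r ?dot_ge0// lerN2.
by rewrite ge_min lexx orbT.
Qed.

Lemma gdomZ (a : R) f : gdom f -> gdom (fun x => a * f x).
Proof. by apply: egro_gdom; exact: egro_cst. Qed.

End growth.

Section weighted.
Context (R : realType) (n : nat).
Implicit Types (f g h w : 'rV[R]_n -> R).

Record wt w : Prop := Wt { wt_gdom : gdom w; wt_gt0 : forall x, 0 < w x }.

Definition J w f : R := \int[@lam R n]_x (f x * w x).

Lemma J_int w f : gdom w -> egro f -> (@lam R n).-integrable setT (EFin \o (fun x => f x * w x)).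
Proof. by move=> gw ef; apply: gdom_integrable; exact: egro_gdom. Qed.

Lemma eq_J w f g : f =1 g -> J w f = J w g.
Proof. by move=> fg; apply: eq_Rint => x; rewrite fg. Qed.

Lemma JD w f g : gdom w -> egro f -> egro g -> J w (fun x => f x + g x) = J w f + J w g.
Proof.
move=> gw ef eg; rewrite /J -RintegralD//; try exact: J_int.
by apply: eq_Rint => x; rewrite mulrDl.
Qed.

Lemma JZ w (a : R) f : gdom w -> egro f -> J w (fun x => a * f x) = a * J w f.
Proof.
move=> gw ef; rewrite /J -RintegralZl//; last exact: J_int.
by apply: eq_Rint => x; rewrite mulrA.
Qed.

Lemma JB w f g : gdom w -> egro f -> egro g -> J w (fun x => f x - g x) = J w f - J w g.
Proof.
move=> gw ef eg; rewrite /J -RintegralB//; try exact: J_int.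
by apply: eq_Rint => x; rewrite mulrBl.
Qed.

Lemma J_le w f g : wt w -> egro f -> egro g -> (forall x, f x <= g x) -> J w f <= J w g.
Proof.
move=> [gw w0] ef eg fg; apply: ler_Rint; try exact: J_int.
by move=> x; rewrite ler_wpM2r// ltW.
Qed.

Lemma J_gt0 w f : wt w -> egro f -> (forall x, 0 < f x) -> 0 < J w f.
Proof.
move=> [gw w0] ef f0; apply: gdom_Rint_gt0; first exact: egro_gdom.
by move=> x; rewrite mulr_gt0.
Qed.

Lemma J_norm w f : wt w -> egro f -> `|J w f| <= J w (fun x => `|f x|).
Proof.
move=> ww ef; rewrite ler_norml; have en := egro_norm ef.
rewrite -mulN1r -JZ//; last by case: ww.
apply/andP; split; apply: J_le => //; first exact: egroZ.
  by move=> x; rewrite mulN1r lerNl -normrN ler_norm.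
by move=> x; exact: ler_norm.
Qed.

Lemma J_tilt w f h : J (fun x => expR (h x) * w x) f = J w (fun x => f x * expR (h x)).
Proof. by apply: eq_Rint => x; rewrite mulrA. Qed.

Lemma wt_tilt w h : wt w -> lgro h -> wt (fun x => expR (h x) * w x).
Proof.
move=> [gw w0] lh; split; first by apply: egro_gdom => //; exact: egro_expR.
by move=> x; rewrite mulr_gt0// expR_gt0.
Qed.

(* Integrals against the normalised weight; [w] itself need not have mass 1. *)
Definition E w f : R := J w f / J w (fun=> 1).

Lemma J1_gt0 w : wt w -> 0 < J w (fun=> 1).
Proof. by move=> ww; apply: J_gt0 => //; exact: egro_cst. Qed.

Lemma eq_E w f g : f =1 g -> E w f = E w g.
Proof. by move=> fg; rewrite /E (eq_J w fg). Qed.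

Lemma ED w f g : wt w -> egro f -> egro g -> E w (fun x => f x + g x) = E w f + E w g.
Proof. by move=> [gw _] ef eg; rewrite /E JD// mulrDl. Qed.

Lemma EB w f g : wt w -> egro f -> egro g -> E w (fun x => f x - g x) = E w f - E w g.
Proof. by move=> [gw _] ef eg; rewrite /E JB// mulrBl. Qed.

Lemma EZ w (a : R) f : wt w -> egro f -> E w (fun x => a * f x) = a * E w f.
Proof. by move=> [gw _] ef; rewrite /E JZ// mulrA. Qed.

Lemma E_cst w (a : R) : wt w -> E w (fun=> a) = a.
Proof.
move=> ww; have -> : E w (fun=> a) = E w (fun=> a * 1) by apply: eq_E => x; rewrite mulr1.
by rewrite EZ//; [rewrite /E divff ?mulr1// gt_eqF// J1_gt0|exact: egro_cst].
Qed.

Lemma E_le w f g : wt w -> egro f -> egro g -> (forall x, f x <= g x) -> E w f <= E w g.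
Proof.
by move=> ww ef eg fg; rewrite ler_pM2r ?invr_gt0 ?J1_gt0//; exact: J_le.
Qed.

Lemma E_ge0 w f : wt w -> egro f -> (forall x, 0 <= f x) -> 0 <= E w f.
Proof. by move=> ww ef f0; rewrite -[leLHS](E_cst 0 ww); apply: E_le => //; exact: egro_cst. Qed.

Lemma E_gt0 w f : wt w -> egro f -> (forall x, 0 < f x) -> 0 < E w f.
Proof. by move=> ww ef f0; rewrite divr_gt0 ?J1_gt0//; exact: J_gt0. Qed.

Lemma E_le_cst w f (a : R) : wt w -> egro f -> (forall x, f x <= a) -> E w f <= a.
Proof. by move=> ww ef fa; rewrite -[leRHS](E_cst a ww); apply: E_le => //; exact: egro_cst. Qed.

Lemma E_norm w f : wt w -> egro f -> `|E w f| <= E w (fun x => `|f x|).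
Proof.
move=> ww ef; rewrite normrM (gtr0_norm (x := _^-1)) ?invr_gt0 ?J1_gt0//.
by rewrite ler_pM2r ?invr_gt0 ?J1_gt0//; exact: J_norm.
Qed.

Lemma E_tilt w f h : wt w -> lgro h ->
  E (fun x => expR (h x) * w x) f = E w (fun x => f x * expR (h x)) / E w (fun x => expR (h x)).
Proof.
move=> ww lh; rewrite /E !J_tilt.
have -> : J w (fun x => 1 * expR (h x)) = J w (fun x => expR (h x)).
  by apply: eq_J => x; rewrite mul1r.
have j0 := J1_gt0 ww.
have je : 0 < J w (fun x => expR (h x)).
  by apply: J_gt0 => //; [exact: egro_expR|move=> x; exact: expR_gt0].
by field; rewrite !gt_eqF.
Qed.

Lemma E_sum w (I : Type) (r : seq I) (F : I -> 'rV[R]_n -> R) : wt w ->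
  (forall i, egro (F i)) -> E w (fun x => \sum_(i <- r) F i x) = \sum_(i <- r) E w (F i).
Proof.
move=> ww eF; elim: r => [|i r ih].
  by rewrite big_nil -[RHS](E_cst 0 ww); apply: eq_E => x; rewrite big_nil.
rewrite big_cons -ih -ED//; last exact: egro_sum.
by apply: eq_E => x; rewrite big_cons.
Qed.

Lemma E_jensen_expR w f : wt w -> lgro f -> expR (E w f) <= E w (fun x => expR (f x)).
Proof.
move=> ww lf; set m := E w f; have ef := lgro_egro lf.
have h x : expR m * (1 + (f x - m)) <= expR (f x).
  have -> : expR (f x) = expR m * expR (f x - m) by rewrite -expRD addrC subrK.
  by rewrite ler_pM2l ?expR_gt0// expR_ge1Dx.
have eh : egro (fun x => 1 + (f x - m)).
  by apply: egroD; [exact: egro_cst|apply: egroB => //; exact: egro_cst].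
apply: le_trans (E_le ww (egroZ _ eh) (egro_expR lf) h).
rewrite EZ// ED//; [|exact: egro_cst|by apply: egroB => //; exact: egro_cst].
by rewrite EB//; [rewrite !E_cst// subrr addr0 mulr1|exact: egro_cst].
Qed.

End weighted.

Section real_calculus.
Context (R : realType).
Implicit Types (F f : R -> R) (t s : R).

Lemma expR_taylor2 t : `|expR t - 1 - t| <= t ^+ 2 * expR `|t|.
Proof.
have h1 := expR_ge1Dx t; have h2 := expR_ge1Dx (- t).
rewrite ger0_norm; last lra.
have h3 : expR t * expR (- t) = 1 by rewrite -expRD subrr expR0.
have e0 := expR_gt0 t.
have h4 : expR t - 1 <= t * expR t by nra.
case: (leP 0 t) => t0; first by rewrite ger0_norm//; nra.
rewrite ltr0_norm//.
have : 1 <= expR (- t) by rewrite (le_trans _ h2)//; lra.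
nra.
Qed.

(** The basis of differentiation under the integral sign here: a quadratic remainder, uniform for
    [|d| <= 1], replaces dominated convergence. *)
Lemma is_derive_quad F s (dF C : R) :
  (forall d, `|d| <= 1 -> `|F (s + d) - F s - d * dF| <= C * d ^+ 2) -> is_derive s 1 F dF.
Proof.
move=> h.
have cv : d^-1 *: (F (d *: 1 + s) - F s) @[d --> 0^'] --> dF.
  apply/cvgrPdist_le => e e0; near=> d.
  have d0 : d != 0 by near: d; exact: nbhs_dnbhs_neq.
  have d1 : `|d| <= 1.
    near: d; apply: nbhs_dnbhs; exists 1 => //= x /=.
    by rewrite sub0r normrN => /ltW.
  have dC : `|d| <= e / (`|C| + 1).
    near: d; apply: nbhs_dnbhs; exists (e / (`|C| + 1)) => //=.
      by rewrite divr_gt0// ltr_wpDl.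
    by move=> x /=; rewrite sub0r normrN => /ltW.
  have /= hd := h d d1.
  have -> : dF - d^-1 *: (F (d *: 1 + s) - F s) = - d^-1 * (F (s + d) - F s - d * dF).
    by rewrite /GRing.scale/= mulr1 (addrC d); field.
  rewrite normrM normrN normfV ler_pdivrMl ?normr_gt0//.
  rewrite (le_trans hd)// -[d ^+ 2]real_normK ?num_real// expr2 mulrA mulrC.
  rewrite ler_wpM2l//.
  move: dC; rewrite ler_pdivlMr ?ltr_wpDl// => dC.
  have := ler_norm C; have := normr_ge0 d; nra.
by apply: DeriveDef; [apply/cvg_ex; exists dF|apply/cvg_lim].
Unshelve. all: by end_near.
Qed.

Lemma MVT_is_derive f (df : R -> R) (a b : R) : a < b ->
  (forall x, a <= x <= b -> is_derive x 1 f (df x)) ->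
  exists c, a < c < b /\ f b - f a = df c * (b - a).
Proof.
move=> ab fd; have [||c cab fE] := @MVT R f df a b ab.
- by move=> x; rewrite in_itv/= => /andP[/ltW ax /ltW xb]; apply: fd; rewrite ax.
- apply: derivable_within_continuous => x; rewrite in_itv/= => xab.
  by have := fd x xab => -[].
- by exists c; split => //; move: cab; rewrite in_itv.
Qed.

Lemma le_eps (a b c s0 : R) : 0 < s0 -> (forall s, 0 < s < s0 -> a <= b + s * c) -> a <= b.
Proof.
move=> s00 h; rewrite leNgt; apply/negP => ba.
pose s := Num.min (s0 / 2) ((a - b) / (2 * (`|c| + 1))).
have c1 : 0 < 2 * (`|c| + 1) by rewrite mulr_gt0// ltr_wpDl.
have s0' : 0 < s by rewrite lt_min !divr_gt0// subr_gt0.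
have /h : 0 < s < s0 by rewrite s0' gt_min; apply/orP; left; lra.
have : s <= (a - b) / (2 * (`|c| + 1)) by rewrite ge_min lexx orbT.
rewrite ler_pdivlMr// => h1 h2; have := ler_norm c; nra.
Qed.

Lemma is_derive_continuous_at0 f df : is_derive (0:R) 1 f df -> forall e, 0 < e ->
  exists d, 0 < d /\ forall x, `|x| <= d -> `|f x - f 0| <= e.
Proof.
move=> [fd _] e e0.
have /cvgrPdist_le /(_ e e0) [d /= d0 h] : {for 0, continuous f}.
  exact/differentiable_continuous/derivable1_diffP.
exists (d / 2); split; first by rewrite divr_gt0.
move=> x xd; rewrite distrC; apply: h => /=; rewrite sub0r normrN; lra.
Qed.

End real_calculus.

Section tilts.
Context (R : realType) (n : nat).
Implicit Types (f g h w : 'rV[R]_n -> R).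

Definition tilt w h : 'rV[R]_n -> R := fun x => expR (h x) * w x.

Lemma J_derive w f h (s : R) : wt w -> egro f -> lgro h ->
  is_derive s 1 (fun s => J w (fun x => f x * expR (s * h x)))
                (J w (fun x => f x * h x * expR (s * h x))).
Proof.
move=> ww ef lh; have [gw w0] := ww.
have eh := lgro_egro lh.
have ee t : egro (fun x => expR (t * h x)) by apply: egro_expR; exact: lgroZ.
have efe t : egro (fun x => f x * expR (t * h x)) by exact: egroM.
have efh : egro (fun x => f x * h x * expR (s * h x)) by do 2 apply: egroM => //.
have lnh : lgro (fun x => `|h x|).
  have [mh [A hA]] := lh; split; first exact: measurableT_comp.
  by exists A => x; rewrite normr_id.
have eg : egro (fun x => `|f x| * expR (s * h x) * (h x ^+ 2 * expR `|h x|)).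
  apply: egroM; first by apply: egroM => //; exact: egro_norm.
  by apply: egroM; [exact: egroX|exact: egro_expR].
apply: (is_derive_quad (C := J w (fun x => `|f x| * expR (s * h x) * (h x ^+ 2 * expR `|h x|)))) => d d1.
rewrite -JB// -JZ// -JB//; [|exact: egroB|exact: egroZ].
rewrite [leRHS]mulrC -JZ//.
rewrite (le_trans (J_norm ww _))//.
  by apply: egroB; [exact: egroB|exact: egroZ].
apply: J_le => //; [|exact: egroZ|].
  by apply: egro_norm; apply: egroB; [exact: egroB|exact: egroZ].
move=> x; have -> : f x * expR ((s + d) * h x) - f x * expR (s * h x) - d * (f x * h x * expR (s * h x))
  = f x * expR (s * h x) * (expR (d * h x) - 1 - d * h x) by rewrite mulrDl expRD; ring.
rewrite normrM normrM (ger0_norm (expR_ge0 _)).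
rewrite [leRHS]mulrCA; apply: ler_wpM2l; first by rewrite mulr_ge0 ?expR_ge0.
rewrite (le_trans (expR_taylor2 _))// exprMn -mulrA !ler_wpM2l ?sqr_ge0//.
by rewrite ler_expR normrM ler_piMl.
Qed.

Lemma tilt0 w h : tilt w (fun x => 0 * h x) = w.
Proof. by apply/funext => x; rewrite /tilt mul0r expR0 mul1r. Qed.

Lemma tiltD w h g : tilt (tilt w h) g = tilt w (fun x => h x + g x).
Proof. by apply/funext => x; rewrite /tilt addrC expRD mulrA. Qed.

Lemma wt_tiltZ w h s : wt w -> lgro h -> wt (tilt w (fun x => s * h x)).
Proof. by move=> ww lh; apply: wt_tilt => //; exact: lgroZ. Qed.

Definition Cov w f g := E w (fun x => f x * g x) - E w f * E w g.

Lemma E_tilt_derive w f h (s : R) : wt w -> egro f -> lgro h ->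
  is_derive s 1 (fun s => E (tilt w (fun x => s * h x)) f)
                (Cov (tilt w (fun x => s * h x)) f h).
Proof.
move=> ww ef lh; have eh := lgro_egro lh.
pose M g t := J w (fun x => g x * expR (t * h x)).
have dM g : egro g -> is_derive s 1 (M g) (M (fun x => g x * h x) s).
  by move=> eg; exact: J_derive.
pose one := (fun=> 1) : 'rV[R]_n -> R.
have e1 : egro one by exact: egro_cst.
have M0 t : 0 < M one t.
  apply: J_gt0 => //; first by apply: egroM => //; apply: egro_expR; exact: lgroZ.
  by move=> x; rewrite mul1r expR_gt0.
have EM g t : E (tilt w (fun x => t * h x)) g = M g t * (M one t)^-1.
  by rewrite /E !J_tilt.
have -> : (fun s => E (tilt w (fun x => s * h x)) f) = (fun t => M f t * (M one t)^-1).
  by apply/funext => t; exact: EM.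
have dV := is_deriveV (lt0r_neq0 (M0 s)) (dM _ e1).
have D := is_deriveM (dM f ef) dV; apply: (is_derive_eq D).
rewrite /Cov !EM /GRing.scale/=.
have -> : M (fun x => one x * h x) s = M h s by congr (J w _); apply/funext => x; rewrite mul1r.
have := lt0r_neq0 (M0 s).
generalize (M one s) (M f s) (M h s) (M (fun x => f x * h x) s) => a b c e a0.
by field.
Qed.

Definition lnE w f := ln (E w (fun x => expR (f x))).

Lemma lnE_derive w h (s : R) : wt w -> lgro h ->
  is_derive s 1 (fun s => lnE w (fun x => s * h x)) (E (tilt w (fun x => s * h x)) h).
Proof.
move=> ww lh; have eh := lgro_egro lh.
pose one := (fun=> 1) : 'rV[R]_n -> R.
have e1 : egro one by exact: egro_cst.
pose M t := J w (fun x => one x * expR (t * h x)).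
have M0 t : 0 < M t.
  apply: J_gt0 => //; first by apply: egroM => //; apply: egro_expR; exact: lgroZ.
  by move=> x; rewrite mul1r expR_gt0.
have j0 := J1_gt0 ww.
have -> : (fun s => lnE w (fun x => s * h x)) = @ln R \o (fun t => M t * (J w one)^-1).
  apply/funext => t; rewrite /lnE /= /E; congr (ln (_ / _)).
  by apply: eq_J => x; rewrite mul1r.
have dM : is_derive s 1 M (J w (fun x => one x * h x * expR (s * h x))) by exact: J_derive.
have dM' : is_derive s 1 (fun t => M t * (J w one)^-1) (J w (fun x => one x * h x * expR (s * h x)) * (J w one)^-1).
  rewrite (_ : (fun _ => _) = (J w one)^-1 *: M); last by apply/funext => t; rewrite mulrC.
  by apply: is_derive_eq; rewrite /GRing.scale/= mulrC.
have Mj : 0 < M s * (J w one)^-1 by rewrite mulr_gt0// invr_gt0.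
apply: is_derive_eq; first by apply: is_derive1_comp; exact: is_derive1_ln.
rewrite /E !J_tilt -/(M s) /=.
have -> : J w (fun x => one x * h x * expR (s * h x)) = J w (fun x => h x * expR (s * h x)).
  by apply: eq_J => x; rewrite mul1r.
have := lt0r_neq0 (M0 s); have : J w one != 0 := lt0r_neq0 j0.
generalize (M s) (J w one) (J w (fun x => h x * expR (s * h x))) => a b c b0 a0.
by rewrite /GRing.scale/=; field; rewrite a0 b0.
Qed.

Lemma lnEK w f : wt w -> lgro f -> expR (lnE w f) = E w (fun x => expR (f x)).
Proof.
move=> ww lf; rewrite lnK// posrE; apply: E_gt0 => //; first exact: egro_expR.
by move=> x; exact: expR_gt0.
Qed.

Lemma lnE_J w f : wt w -> lgro f ->
  lnE w f = ln (J w (fun x => expR (f x))) - ln (J w (fun=> 1)).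
Proof.
move=> ww lf; rewrite /lnE /E ln_div// posrE; last exact: J1_gt0.
by apply: J_gt0 => //; [exact: egro_expR|move=> x; exact: expR_gt0].
Qed.

Lemma lnE_cst w (a : R) : wt w -> lnE w (fun=> a) = a.
Proof. by move=> ww; rewrite /lnE E_cst// expRK. Qed.

Lemma Rint_tilt w h : \int[lam (n:=n)]_x tilt w h x = J w (fun x => expR (h x)).
Proof. by []. Qed.

Lemma Rint_J1 w : \int[lam (n:=n)]_x w x = J w (fun=> 1).
Proof. by apply: eq_Rint => x; rewrite mul1r. Qed.

Lemma EJ w f : E w f = J w f / J w (fun=> 1).
Proof. by []. Qed.

Lemma J_Rint w f : J w f = \int[lam (n:=n)]_x (f x * w x).
Proof. by []. Qed.

End tilts.
Global Opaque J E lnE.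

(** * Functional inequalities for strongly log-concave weights *)

Section functional_inequalities.
Context (R : realType) (n : nat).
Implicit Types (f g h w u F G : 'rV[R]_n -> R) (k : R).

(** Strong log-concavity as a chord inequality. Prekopa-Leindler consumes this form directly, and
    Gaussian smoothing preserves it without any differentiability of [w]. *)
Definition slc k w := forall (s : R) x y, 0 < s < 1 ->
  (1 - s) * ln (w x) + s * ln (w y) + k * (s * (1 - s)) / 2 * dot (x - y) (x - y) <=
  ln (w ((1 - s) *: x + s *: y)).

(** The relative entropy of the normalised [e^F w] with respect to the normalised [w]. *)
Definition KL w F := E (tilt w F) F - lnE w F.

Lemma lnE_ge w f : wt w -> lgro f -> E w f <= lnE w f.
Proof.
by move=> ww lf; rewrite -ler_expR lnEK//; exact: E_jensen_expR.
Qed.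

Lemma lnED w f g : wt w -> lgro f -> lgro g ->
  lnE w (fun x => f x + g x) = lnE w f + lnE (tilt w f) g.
Proof.
move=> ww lf lg; have wf : wt (tilt w f) by exact: wt_tilt.
apply: expR_inj; rewrite (lnEK ww (lgroD lf lg)) (expRD (lnE w f)) (lnEK ww lf) (lnEK wf lg) (E_tilt _ ww lf).
have -> : E w (fun x => expR (f x + g x)) = E w (fun x => expR (g x) * expR (f x)).
  by apply: eq_E => x; rewrite expRD mulrC.
rewrite mulrC divfK// gt_eqF//; apply: E_gt0 => //; first exact: egro_expR.
by move=> x; exact: expR_gt0.
Qed.


(** Jensen's inequality for [f - F] under the tilted weight. *)
Lemma donsker_varadhan w F f : wt w -> lgro F -> lgro f ->
  E (tilt w F) f <= KL w F + lnE w f.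
Proof.
move=> ww lF lf; have lB := lgroB lf lF.
have wF : wt (tilt w F) by exact: wt_tilt.
have := lnE_ge wF lB; rewrite EB//; try exact: lgro_egro.
have -> : lnE w f = lnE w (fun x => F x + (f x - F x)).
  by congr lnE; apply/funext => x; rewrite addrC subrK.
rewrite /KL (lnED ww lF lB); lra.
Qed.

Lemma expR_le1 (t b : R) : 0 <= t <= b -> expR t <= 1 + t + t ^+ 2 * expR b.
Proof.
move=> /andP[t0 tb]; have := expR_taylor2 t; rewrite (ger0_norm t0) => h.
have : expR t <= expR b by rewrite ler_expR.
have := le_trans (ler_norm _) h; have := sqr_ge0 t; nra.
Qed.

(* Logarithmic Sobolev inequality. The slope [G] may be read off pointwise because the
   second-order error [C] is absorbed by strong concavity: apply Prekopa-Leindler to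
   [w e^(u/(1-s))], [w] and [w e^(u + s G^2/2k')], with [k' -> k] as [s -> 0]. *)
Theorem local_lsi w k (C Gm : R) u G : wt w -> slc k w -> 0 < k -> 0 <= C -> lgro u ->
  measurable_fun setT G -> (forall x, 0 <= G x <= Gm) ->
  (forall x z, u x - u z <= G z * norm2 (x - z) + C * dot (x - z) (x - z)) ->
  KL w u <= E (tilt w u) (fun x => G x ^+ 2) / (2 * k).
Proof.
move=> ww kw k0 C0 lu mG G01 uG.
have [gw w0] := ww.
have Gm0 : 0 <= Gm by have /andP[] := G01 0; exact: le_trans.
have wu : wt (tilt w u) by exact: wt_tilt.
have lG2 : lgro (fun x => G x ^+ 2).
  split; first exact: measurable_funX.
  exists (Gm ^+ 2) => x; have /andP[g0 g1] := G01 x.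
  rewrite ger0_norm ?sqr_ge0// (le_trans (y := Gm ^+ 2))//.
    by rewrite ler_pXn2r// nnegrE.
  by rewrite ler_peMr ?sqr_ge0// lerDl norm2_ge0.
set B := E (tilt w u) (fun x => G x ^+ 2).
pose c := Gm ^+ 4 * expR (Gm ^+ 2 / k).
have key (s : R) : 0 < s < Num.min 1 (k / (2 * k + 4 * C)) ->
    2 * k * KL w u <= B + s * (c / k + (2 * k + 4 * C) * `|KL w u|).
  rewrite lt_min => /andP[s0 /andP[s1]].
  have kC : 0 < 2 * k + 4 * C by lra.
  rewrite ltr_pdivlMr// => sk.
  have s1' : 0 < 1 - s by rewrite subr_gt0.
  (* With $r = |x-y|$, the concavity term minus the error [C] leaves $s G r - s k' r^2/2$, whose
     maximum over $r$ is [b * G ^+ 2] for the [b] below. The bound on [s] keeps [k'] above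
     [k / 2]. *)
  pose k' := k * (1 - s) - 2 * s * C.
  have k'0 : k / 2 < k' by rewrite /k'; lra.
  have k'1 : 0 < k' by lra.
  pose b := s / (2 * k').
  have b0 : 0 < b by rewrite divr_gt0// mulr_gt0.
  have bk : b <= s / k.
    rewrite ler_pdivrMr ?mulr_gt0// -mulrA ler_peMr ?(ltW s0)//; apply: ltW.
    by rewrite ltr_pdivlMl// mulr1; lra.
  have lus : lgro (fun x => (1 - s)^-1 * u x) by exact: lgroZ.
  have lbG : lgro (fun x => b * G x ^+ 2) by exact: lgroZ.
  have luG : lgro (fun x => u x + b * G x ^+ 2) by exact: lgroD.
  have w1 : wt (tilt w (fun x => (1 - s)^-1 * u x)) by exact: wt_tilt.
  have w2 : wt (tilt w (fun x => u x + b * G x ^+ 2)) by exact: wt_tilt.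
  have lnt h x : ln (tilt w h x) = h x + ln (w x).
    by rewrite /tilt lnM ?posrE ?expR_gt0// expRK.
  have s01 : 0 < s < 1 by rewrite s0.
  have := @prekopa_leindler R n s _ w _ s01 (wt_gdom w1) gw (wt_gdom w2) (wt_gt0 w1) w0 (wt_gt0 w2).
  have cond x y : (1 - s) * ln (tilt w (fun x => (1 - s)^-1 * u x) x) + s * ln (w y) <=
      ln (tilt w (fun x => u x + b * G x ^+ 2) ((1 - s) *: x + s *: y)).
    rewrite !lnt; set z := (1 - s) *: x + s *: y.
    have xz : x - z = s *: (x - y).
      by apply/matrixP => i j; rewrite !mxE; ring.
    have := kw s x y s01; rewrite -/z.
    have := uG x z; rewrite xz norm2Z dotZl dotZr -!sqr_norm2 gtr0_norm//.
    set r := norm2 _; have /andP[Gz0 _] := G01 z.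
    have -> : (1 - s) * ((1 - s)^-1 * u x + ln (w x)) = u x + (1 - s) * ln (w x).
      by field; rewrite gt_eqF.
    have sq : 0 <= b * G z ^+ 2 - (G z * (s * r) + C * (s * (s * r ^+ 2)) - k * (s * (1 - s)) / 2 * r ^+ 2).
      have -> : b * G z ^+ 2 - (G z * (s * r) + C * (s * (s * r ^+ 2)) - k * (s * (1 - s)) / 2 * r ^+ 2)
        = b * (G z - k' * r) ^+ 2.
        rewrite /b /k'; field; rewrite -/k'; apply/eqP; move: k'1; rewrite /k' => h1 h2; lra.
      by rewrite mulr_ge0 ?sqr_ge0// ltW.
    lra.
  move=> /(_ cond).
  rewrite !Rint_tilt Rint_J1 => pl.
  have {}pl : (1 - s) * lnE w (fun x => (1 - s)^-1 * u x) <= lnE w (fun x => u x + b * G x ^+ 2).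
    rewrite (lnE_J ww lus) (lnE_J ww luG); move: pl; clear.
    generalize (ln (J w (fun=> 1))) (ln (J w (fun x => expR ((1 - s)^-1 * u x)))) => a a'.
    generalize (ln (J w (fun x => expR (u x + b * G x ^+ 2)))) => a''; lra.
  (* Since $(1-s)^{-1} = 1 + s/(1-s)$, one factor [e^u] goes into the weight and Jensen's inequality
     treats the rest. *)
  have l1 : lnE w u + s / (1 - s) * E (tilt w u) u <= lnE w (fun x => (1 - s)^-1 * u x).
    have -> : lnE w (fun x => (1 - s)^-1 * u x) = lnE w (fun x => u x + s / (1 - s) * u x).
      by congr lnE; apply/funext => x; field; rewrite gt_eqF.
    have lsu : lgro (fun x => s / (1 - s) * u x) by exact: lgroZ.
    rewrite lnED// lerD2l; apply: le_trans (lnE_ge wu lsu).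
    by rewrite EZ//; exact: lgro_egro.
  (* To first order in [b]; as [b] is of order [s], the term with [c] disappears after division by
     [s] and passage to the limit. *)
  have l2 : lnE (tilt w u) (fun x => b * G x ^+ 2) <= b * B + b ^+ 2 * c.
    have e1 : 0 < E (tilt w u) (fun x => expR (b * G x ^+ 2)).
      by apply: E_gt0 => //; [exact: egro_expR|move=> x; exact: expR_gt0].
    have := expR_ge1Dx (lnE (tilt w u) (fun x => b * G x ^+ 2)); rewrite lnEK// => h1.
    have h2 : E (tilt w u) (fun x => expR (b * G x ^+ 2)) <=
        E (tilt w u) (fun x => 1 + (b * G x ^+ 2 + b ^+ 2 * c)).
      apply: E_le => //; first exact: egro_expR.
        by do ?apply: egroD; [exact: egro_cst|exact: lgro_egro|exact: egro_cst].
      move=> x; have /andP[g0 g1] := G01 x.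
      have G2 : G x ^+ 2 <= Gm ^+ 2 by rewrite ler_pXn2r// nnegrE.
      have bG0 : 0 <= b * G x ^+ 2 by rewrite mulr_ge0 ?sqr_ge0// ltW.
      have bGk : b * G x ^+ 2 <= Gm ^+ 2 / k.
        rewrite mulrC ler_pM ?sqr_ge0 ?(ltW b0)// (le_trans bk)//.
        by rewrite -[leRHS]mul1r ler_pM2r ?invr_gt0// ltW.
      rewrite (le_trans (expR_le1 (b := Gm ^+ 2 / k) _)) ?bG0//.
      rewrite -addrA !lerD2l exprMn -mulrA ler_wpM2l ?sqr_ge0// /c.
      rewrite ler_wpM2r ?expR_ge0// -exprM (_ : 4 = 2 * 2)%N// exprM.
      by rewrite exprM ler_pXn2r// ?nnegrE ?sqr_ge0.
    rewrite ED// in h2; [|exact: egro_cst|by apply: egroD; [exact: lgro_egro|exact: egro_cst]].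
    rewrite ED// in h2; [|exact: lgro_egro|exact: egro_cst].
    rewrite EZ// in h2; last exact: lgro_egro.
    rewrite !(E_cst _ wu) -/B in h2; move: h1 h2; clear.
    generalize (E (tilt w u) (fun x => expR (b * G x ^+ 2))) (lnE (tilt w u) (fun x => b * G x ^+ 2)) => a a'; lra.
  have l3 : s * KL w u <= b * B + b ^+ 2 * c.
    rewrite lnED// in pl.
    have := ler_wpM2l (ltW s1') l1.
    have -> : (1 - s) * (lnE w u + s / (1 - s) * E (tilt w u) u) = (1 - s) * lnE w u + s * E (tilt w u) u.
      by field; rewrite gt_eqF.
    rewrite /KL; move: pl l2; clear.
    generalize (E (tilt w u) u) (lnE w u) (lnE (tilt w u) (fun x => b * G x ^+ 2)) => a a' a''.
    generalize (lnE w (fun x => (1 - s)^-1 * u x)) (b * B + b ^+ 2 * c) => a1 a2; lra.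
  have l4 : 2 * k' * KL w u <= B + s * (c / k).
    have : (2 * k') / s * (s * KL w u) <= (2 * k') / s * (b * B + b ^+ 2 * c).
      by rewrite ler_wpM2l// divr_ge0 ?ltW// mulr_gt0.
    have -> : (2 * k') / s * (s * KL w u) = 2 * k' * KL w u by field; rewrite gt_eqF.
    have -> : (2 * k') / s * (b * B + b ^+ 2 * c) = B + b * c.
      by rewrite /b; field; rewrite !gt_eqF.
    move=> h; rewrite (le_trans h)// lerD2l (_ : s * (c / k) = s / k * c); last by ring.
    by apply: ler_wpM2r => //; rewrite /c mulr_ge0 ?expR_ge0 ?exprn_ge0.
  have -> : 2 * k * KL w u = 2 * k' * KL w u + s * ((2 * k + 4 * C) * KL w u) by rewrite /k'; ring.
  rewrite [s * (c / k + _)]mulrDr addrA; apply: lerD => //.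
  by rewrite (ler_wpM2l (ltW s0))// (ler_wpM2l (ltW kC))// ler_norm.
have m0 : 0 < Num.min 1 (k / (2 * k + 4 * C)).
  by rewrite lt_min ltr01/= divr_gt0//; lra.
have := le_eps m0 key.
by move=> h; rewrite ler_pdivlMr; [rewrite mulrC|rewrite mulr_gt0].
Qed.

Lemma lip_KL w k L F : wt w -> slc k w -> 0 < k -> 0 <= L -> measurable_fun setT F ->
  (forall x y, F x - F y <= L * norm2 (x - y)) -> KL w F <= L ^+ 2 / (2 * k).
Proof.
move=> ww kw k0 L0 mF FL; have lF := lip_lgro mF FL.
have := @local_lsi w k 0 L F (fun=> L) ww kw k0 (lexx _) lF _ _ _.
rewrite E_cst; last exact: wt_tilt.
apply => //; first by move=> x; rewrite L0 lexx.
by move=> x z; rewrite mul0r addr0.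
Qed.

Lemma lgro_KL_ge0 w F : wt w -> lgro F -> 0 <= KL w F.
Proof.
move=> ww lF; have := donsker_varadhan ww lF (lgro_cst n 0).
by rewrite lnE_cst// E_cst ?addr0//; exact: wt_tilt.
Qed.

Lemma lipZ (L a : R) F : 0 <= a -> (forall x y, F x - F y <= L * norm2 (x - y)) ->
  forall x y, a * F x - a * F y <= (a * L) * norm2 (x - y).
Proof. by move=> a0 FL x y; rewrite -mulrBr -mulrA ler_wpM2l. Qed.

(* Herbst's argument: the derivative of [lnE w (l F) / l] is [KL w (l F) / l ^ 2]. *)
Lemma herbst_derive w F (l : R) : wt w -> lgro F -> 0 < l ->
  is_derive l 1 (fun l => lnE w (fun x => l * F x) * l^-1)
    (KL w (fun x => l * F x) / l ^+ 2).
Proof.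
move=> ww lF l0.
have d1 := lnE_derive l ww lF.
have d2 := is_deriveV (lt0r_neq0 l0) (is_derive_id l (1 : R)).
have D := is_deriveM d1 d2; apply: (is_derive_eq D).
rewrite /GRing.scale/= /KL EZ//; [|exact: wt_tiltZ|exact: lgro_egro].
by field; rewrite gt_eqF.
Qed.

Lemma laplace_lip w k L F : wt w -> slc k w -> 0 < k -> 0 <= L -> measurable_fun setT F ->
  (forall x y, F x - F y <= L * norm2 (x - y)) -> lnE w F <= E w F + L ^+ 2 / (2 * k).
Proof.
move=> ww kw k0 L0 mF FL; have lF := lip_lgro mF FL; have eF := lgro_egro lF.
pose c := E w (fun x => F x ^+ 2 * expR `|F x|).
have lnF : lgro (fun x => `|F x|).
  have [_ [A hA]] := lF; split; first exact: measurableT_comp.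
  by exists A => x; rewrite normr_id.
have ec : egro (fun x => F x ^+ 2 * expR `|F x|).
  by apply: egroM; [exact: egroX|exact: egro_expR].
apply: (@le_eps _ _ _ c 1) => // e /andP[e0 e1].
have small : lnE w (fun x => e * F x) <= e * E w F + e ^+ 2 * c.
  have leF : lgro (fun x => e * F x) by exact: lgroZ.
  have := expR_ge1Dx (lnE w (fun x => e * F x)); rewrite lnEK// => h1.
  have : E w (fun x => expR (e * F x)) <= E w (fun x => 1 + (e * F x + e ^+ 2 * (F x ^+ 2 * expR `|F x|))).
    apply: E_le => //; first exact: egro_expR.
      apply: egroD; first exact: egro_cst.
      by apply: egroD; [exact: egroZ|exact: egroZ].
    move=> x; have := expR_taylor2 (e * F x).
    have : (e * F x) ^+ 2 * expR `|e * F x| <= e ^+ 2 * (F x ^+ 2 * expR `|F x|).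
      rewrite exprMn -mulrA !ler_wpM2l ?sqr_ge0// ler_expR normrM gtr0_norm//.
      by rewrite ler_piMl// ltW.
    move=> h2 h3; have := le_trans (ler_norm _) h3; lra.
  rewrite ED//; [|exact: egro_cst|by apply: egroD; exact: egroZ].
  rewrite ED//; [|exact: egroZ|exact: egroZ].
  by rewrite E_cst// !EZ// -/c; lra.
(* [phi] approaches [E w F] at 0 without taking that value there, so the mean value theorem is used
   on [[e, 1]]; [small] bounds [phi e] and [le_eps] lets [e] go to 0. *)
pose phi (l : R) := lnE w (fun x => l * F x) * l^-1.
have [|c0 [/andP[ec0 c01] hc]] := @MVT_is_derive R phi (fun l => KL w (fun x => l * F x) / l ^+ 2) e 1 e1.
  move=> x /andP[ex x1]; apply: herbst_derive => //; exact: lt_le_trans ex.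
have c00 := lt_trans e0 ec0.
have hKL : KL w (fun x => c0 * F x) / c0 ^+ 2 <= L ^+ 2 / (2 * k).
  have mcF : measurable_fun setT (fun x => c0 * F x) by exact: measurable_funM.
  have := lip_KL ww kw k0 (mulr_ge0 (ltW c00) L0) mcF (lipZ (ltW c00) FL).
  rewrite ler_pdivrMr ?exprn_gt0// => h; rewrite (le_trans h)// exprMn.
  by rewrite -mulrA mulrC.
have p1 : phi 1 = lnE w F.
  by rewrite /phi invr1 mulr1; congr lnE; apply/funext => x; rewrite mul1r.
have p2 : phi e <= E w F + e * c.
  rewrite /phi ler_pdivrMr//; rewrite (le_trans small)//.
  by rewrite mulrDl mulrC; apply: lerD => //; rewrite expr2 mulrAC.
have hL0 : 0 <= L ^+ 2 / (2 * k) by rewrite divr_ge0 ?sqr_ge0// mulr_ge0// ltW.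
have : KL w (fun x => c0 * F x) / c0 ^+ 2 * (1 - e) <= L ^+ 2 / (2 * k).
  have : 0 < 1 - e <= 1 by rewrite subr_gt0 e1 gerBl ltW.
  move=> /andP[e2 e3]; rewrite (le_trans (ler_wpM2r (ltW e2) hKL))//.
  by rewrite ler_piMr.
rewrite -p1 -(subrK (phi e) (phi 1)) hc => h.
by rewrite addrC addrAC; apply: lerD.
Qed.

(** Donsker-Varadhan for [t f]: the entropy of the tilt costs $L^2/(2k)$ and the Laplace transform
    $t^2 l^2/(2k)$. After division by [t] the sum is smallest at $t = L/l$. The bound is sharp, and
    its sharpness is what the comparison of noise levels rests on. *)
Lemma shift_lip w k L l F f : wt w -> slc k w -> 0 < k -> 0 < L -> 0 < l ->
  measurable_fun setT F -> measurable_fun setT f ->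
  (forall x y, F x - F y <= L * norm2 (x - y)) ->
  (forall x y, f x - f y <= l * norm2 (x - y)) ->
  E (tilt w F) f - E w f <= l * L / k.
Proof.
move=> ww kw k0 L0 l0 mF mf FL fl; have lF := lip_lgro mF FL; have lf := lip_lgro mf fl.
have t0 : 0 < L / l by rewrite divr_gt0.
have ltf : lgro (fun x => L / l * f x) by exact: lgroZ.
have h1 := donsker_varadhan ww lF ltf.
have mtf : measurable_fun setT (fun x => L / l * f x) by exact: measurable_funM.
have h2 := laplace_lip ww kw k0 (mulr_ge0 (ltW t0) (ltW l0)) mtf (lipZ (ltW t0) fl).
have h3 := lip_KL ww kw k0 (ltW L0) mF FL.
rewrite divfK ?gt_eqF// in h2.
have wF : wt (tilt w F) by exact: wt_tilt.
rewrite !EZ// in h1 h2; try exact: lgro_egro.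
have h4 : L / l * (E (tilt w F) f - E w f) <= L ^+ 2 / k.
  have -> : L ^+ 2 / k = L ^+ 2 / (2 * k) + L ^+ 2 / (2 * k) by field; rewrite gt_eqF.
  rewrite mulrBr; lra.
move: h4; rewrite -ler_pdivlMl// => h4; rewrite (le_trans h4)//.
by rewrite le_eqVlt; apply/orP; left; apply/eqP; field; rewrite !gt_eqF.
Qed.

Lemma var_tilt_lip w k L l F h : wt w -> slc k w -> 0 < k -> 0 <= L -> 0 <= l ->
  measurable_fun setT F -> measurable_fun setT h ->
  (forall x y, F x - F y <= L * norm2 (x - y)) ->
  (forall x y, h x - h y <= l * norm2 (x - y)) ->
  (forall x y, h y - h x <= l * norm2 (x - y)) ->
  E (tilt w F) (fun x => (h x - E w h) ^+ 2 / 2) <= 2 * expR ((L + l) ^+ 2 / (2 * k)).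
Proof.
move=> ww kw k0 L0 l0 mF mh FL hl hl'; have lF := lip_lgro mF FL; have lh := lip_lgro mh hl.
set c := E w h; have wF : wt (tilt w F) by exact: wt_tilt.
have lhc : lgro (fun x => h x - c) by apply: lgroB => //; exact: lgro_cst.
have lhc' : lgro (fun x => -1 * (h x - c)) by exact: lgroZ.
apply: (@le_trans _ _ (E (tilt w F) (fun x => expR (h x - c) + expR (-1 * (h x - c))))).
  apply: E_le => //.
  - by apply: egroM; [apply: egroX; exact: lgro_egro|exact: egro_cst].
  - by apply: egroD; exact: egro_expR.
  move=> x; set t := h x - c.
  have sq (a : R) : 0 <= a -> a ^+ 2 / 2 <= expR a.
    by move=> a0; rewrite (le_trans _ (expR_ge1Dxn 1%N a0))// lerDr.
  have p1 := expR_ge0 t; have p2 := expR_ge0 (-1 * t).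
  case: (leP 0 t) => t0; first by have := sq t t0; lra.
  have t1 : 0 <= -1 * t by lra.
  have := sq _ t1; rewrite exprMn sqrrN expr1n mul1r; lra.
have bnd (g : 'rV[R]_n -> R) : measurable_fun setT g -> E w g = 0 ->
    (forall x y, g x - g y <= l * norm2 (x - y)) ->
    E (tilt w F) (fun x => expR (g x)) <= expR ((L + l) ^+ 2 / (2 * k)).
  move=> mg g0 gl; have lg := lip_lgro mg gl.
  rewrite -lnEK// ler_expR.
  have FgL x y : (F x + g x) - (F y + g y) <= (L + l) * norm2 (x - y).
    by rewrite mulrDl; have := FL x y; have := gl x y; lra.
  have h1 := laplace_lip ww kw k0 (addr_ge0 L0 l0) (measurable_funD mF mg) FgL.
  have h2 := lnE_ge ww lF.
  rewrite lnED// ED// in h1; try exact: lgro_egro.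
  rewrite g0 in h1; lra.
rewrite ED//; try exact: egro_expR.
have ec : E w (fun x => h x - c) = 0.
  by rewrite EB//; [rewrite E_cst// subrr|exact: lgro_egro|exact: egro_cst].
have b1 := bnd _ (lgro_measurable lhc) ec _; have b2 := bnd _ (lgro_measurable lhc') _ _.
rewrite [leRHS](_ : _ = expR ((L + l) ^+ 2 / (2 * k)) + expR ((L + l) ^+ 2 / (2 * k))); last by ring.
apply: lerD.
  by apply: b1 => x y; have := hl x y; lra.
apply: b2; last by move=> x y; have := hl' x y; lra.
by rewrite EZ//; [rewrite ec mulr0|apply: lgro_egro].
Qed.

Definition Var w f := Cov w f f.

(** The logarithmic Sobolev inequality for [d f], linearised as [d] goes to 0. If the claim failed
    by [P > 0], then for small [d] the variance and the mean square slope under the tilt would each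
    be within the tolerance [P / 4], up to the factor [k], and the two bounds on the entropy would
    be incompatible. *)
Lemma poincare w k (C Gm : R) f G : wt w -> slc k w -> 0 < k -> 0 <= C -> lgro f ->
  measurable_fun setT G -> (forall x, 0 <= G x <= Gm) ->
  (forall x z, f x - f z <= G z * norm2 (x - z) + C * dot (x - z) (x - z)) ->
  Var w f <= E w (fun x => G x ^+ 2) / k.
Proof.
move=> ww kw k0 C0 lf mG G01 fG; have ef := lgro_egro lf.
have eG2 : egro (fun x => G x ^+ 2).
  apply/egroX/(@egro_bounded _ _ _ Gm) => // x.
  by have /andP[g0 g1] := G01 x; rewrite ger0_norm.
pose V s := Var (tilt w (fun x => s * f x)) f.
pose e2 s := E (tilt w (fun x => s * f x)) f.
pose g s := E (tilt w (fun x => s * f x)) (fun x => G x ^+ 2).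
have V0 : V 0 = Var w f by rewrite /V tilt0.
have g0 : g 0 = E w (fun x => G x ^+ 2) by rewrite /g tilt0.
have [dV HdV] : exists dV, is_derive (0 : R) (1 : R) V dV.
  have D1 := E_tilt_derive 0 ww (egroM ef ef) lf.
  have D2 := E_tilt_derive 0 ww ef lf.
  by have D := is_deriveB D1 (is_deriveM D2 D2); eexists; exact: D.
have Hdg := E_tilt_derive 0 ww eG2 lf.
rewrite leNgt; apply/negP => hlt; set P := Var w f - E w (fun x => G x ^+ 2) / k.
have P0 : 0 < P by rewrite subr_gt0.
have P4 : 0 < P / 4 by rewrite divr_gt0.
have [d1 [d10 hV]] := is_derive_continuous_at0 HdV P4.
have [d2 [d20 hg]] := is_derive_continuous_at0 Hdg (mulr_gt0 k0 P4).
pose d := Num.min d1 d2.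
have d0 : 0 < d by rewrite lt_min d10.
have dd1 : d <= d1 by rewrite ge_min lexx.
have dd2 : d <= d2 by rewrite ge_min lexx orbT.
(* This is [KL w (s f)]; its derivative in [s] is [s * V s], so subtracting $a s^2/2$ leaves a
   function with nonnegative derivative as long as [a <= V s]. *)
pose A s := s * e2 s - lnE w (fun x => s * f x).
pose a := Var w f - P / 4.
pose B s := A s - a / 2 * (s * s).
have dB s : is_derive s (1 : R) B (s * V s - a * s).
  have D1 := is_deriveM (is_derive_id s (1 : R)) (E_tilt_derive s ww ef lf).
  have D2 := lnE_derive s ww lf.
  have D3 := is_deriveZ (a / 2) (is_deriveM (is_derive_id s (1 : R)) (is_derive_id s (1 : R))).
  have D := is_deriveB (is_deriveB D1 D2) D3.
  by apply: (is_derive_eq D); rewrite /GRing.scale/= -/(e2 s) /V /Var; field.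
have [c [/andP[c0 cd] hc]] := MVT_is_derive d0 (fun x _ => dB x).
have B0 : B 0 = 0.
  rewrite /B /A !mul0r sub0r mulr0 subr0.
  rewrite (_ : (fun x => 0 * f x) = fun=> 0); first by rewrite lnE_cst// oppr0.
  by apply/funext => x; rewrite mul0r.
have Vc : a <= V c.
  have : `|V c - V 0| <= P / 4 by apply: hV; rewrite gtr0_norm// (le_trans (ltW cd)).
  by rewrite V0 ler_norml /a => /andP[h _]; move: h; clear; lra.
have hA : a / 2 * d ^+ 2 <= A d.
  rewrite B0 !subr0 in hc.
  have : 0 <= B d.
    rewrite hc; apply: mulr_ge0; last exact: ltW.
    by rewrite (mulrC c) -mulrBl mulr_ge0 ?(ltW c0)// subr_ge0.
  by rewrite /B subr_ge0 expr2.
have hL : A d <= d ^+ 2 * g d / (2 * k).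
  have ldf : lgro (fun x => d * f x) by exact: lgroZ.
  have wd : wt (tilt w (fun x => d * f x)) by exact: wt_tilt.
  have := @local_lsi w k (d * C) (d * Gm) _ (fun x => d * G x) ww kw k0 (mulr_ge0 (ltW d0) C0) ldf.
  have -> : E (tilt w (fun x => d * f x)) (fun x => (d * G x) ^+ 2) = d ^+ 2 * g d.
    by rewrite /g -EZ//; apply: eq_E => x; rewrite exprMn.
  rewrite /KL EZ//; apply.
  - exact: measurable_funM.
  - by move=> x; have /andP[h1 h2] := G01 x; rewrite mulr_ge0 ?(ltW d0)// ler_wpM2l ?(ltW d0).
  - by move=> x z; have := fG x z; rewrite -mulrBr -!mulrA -mulrDr ler_wpM2l ?(ltW d0).
have hgd : g d <= g 0 + k * (P / 4).
  have : `|g d - g 0| <= k * (P / 4) by rewrite /g; apply: hg; rewrite gtr0_norm.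
  by move=> /(le_trans (ler_norm _)); rewrite lerBlDl.
have : a / 2 * d ^+ 2 <= d ^+ 2 * ((g 0 + k * (P / 4)) / (2 * k)).
  rewrite (le_trans hA)// (le_trans hL)// -mulrA ler_wpM2l ?sqr_ge0//.
  by rewrite ler_wpM2r// invr_ge0 mulr_ge0// ltW.
rewrite mulrC ler_pM2l ?exprn_gt0// g0.
have -> : (E w (fun x => G x ^+ 2) + k * (P / 4)) / (2 * k) =
    (E w (fun x => G x ^+ 2) / k) / 2 + P / 8 by field; rewrite gt_eqF.
move: P0; rewrite /a /P; clear.
generalize (Var w f) (E w (fun x => G x ^+ 2) / k) => b b'; lra.
Qed.

End functional_inequalities.

Section variance.
Context (R : realType) (n : nat).
Implicit Types (f g h w u F G : 'rV[R]_n -> R) (k : R).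

Lemma Cov_affine w f g (a b : R) : wt w -> egro f -> egro g ->
  Cov w (fun x => f x - a) (fun x => g x - b) = Cov w f g.
Proof.
move=> ww ef eg; have ec (c : R) : egro (fun _ : 'rV[R]_n => c) by exact: egro_cst.
have efg : egro (fun x => f x * g x) by exact: egroM.
rewrite /Cov (EB ww ef (ec a)) (EB ww eg (ec b)) !(E_cst _ ww).
have -> : E w (fun x => (f x - a) * (g x - b)) =
    E w (fun x => f x * g x - (b * f x + (a * g x - a * b))).
  by apply: eq_E => x; ring.
rewrite (EB ww) ?(ED ww) ?(EB ww) ?(EZ _ ww) ?(E_cst _ ww)//; try exact: egroZ; try exact: ec.
- by ring.
- by apply: egroB; [exact: egroZ|exact: ec].
- by apply: egroD; [exact: egroZ|apply: egroB; [exact: egroZ|exact: ec]].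
Qed.

Lemma Cov_E w f g : wt w -> egro f -> egro g ->
  Cov w f g = E w (fun x => (f x - E w f) * (g x - E w g)).
Proof.
move=> ww ef eg; rewrite -(Cov_affine (E w f) (E w g) ww ef eg) /Cov.
by rewrite (EB ww ef (egro_cst n _)) (E_cst _ ww) subrr mul0r subr0.
Qed.

Lemma Var_ge0 w f : wt w -> egro f -> 0 <= Var w f.
Proof.
move=> ww ef; rewrite /Var Cov_E//; apply: E_ge0 => //.
  by apply: egroM; apply: egroB => //; exact: egro_cst.
by move=> x; rewrite -expr2 sqr_ge0.
Qed.

Lemma Var_le w f (a : R) : wt w -> egro f -> Var w f <= E w (fun x => (f x - a) ^+ 2).
Proof.
move=> ww ef; have efa : egro (fun x => f x - a) by apply: egroB => //; exact: egro_cst.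
rewrite /Var -(Cov_affine a a ww ef ef) /Cov -expr2.
by rewrite lerBlDr lerDl sqr_ge0.
Qed.

Lemma VarZ w f (a : R) : wt w -> egro f -> Var w (fun x => a * f x) = a ^+ 2 * Var w f.
Proof.
move=> ww ef; rewrite /Var /Cov (EZ _ ww ef).
have -> : E w (fun x => a * f x * (a * f x)) = a ^+ 2 * E w (fun x => f x * f x).
  by rewrite -(EZ _ ww (egroM ef ef)); apply: eq_E => x; ring.
by ring.
Qed.

Lemma CovZl w f g (a : R) : wt w -> egro f -> egro g ->
  Cov w (fun x => a * f x) g = a * Cov w f g.
Proof.
move=> ww ef eg; rewrite /Cov (EZ _ ww ef).
have -> : E w (fun x => a * f x * g x) = a * E w (fun x => f x * g x).
  by rewrite -(EZ _ ww (egroM ef eg)); apply: eq_E => x; ring.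
by ring.
Qed.

Lemma CovC w f g : Cov w f g = Cov w g f.
Proof. by rewrite /Cov mulrC; congr (_ - _); apply: eq_E => x; rewrite mulrC. Qed.


Lemma Var_lin w f g (t : R) : wt w -> egro f -> egro g ->
  Var w (fun x => f x + t * g x) = Var w f + 2 * t * Cov w f g + t ^+ 2 * Var w g.
Proof.
move=> ww ef eg; have etg := egroZ t eg.
rewrite /Var /Cov (ED ww ef etg) (EZ _ ww eg).
have -> : E w (fun x => (f x + t * g x) * (f x + t * g x)) =
    E w (fun x => f x * f x + ((2 * t) * (f x * g x) + t ^+ 2 * (g x * g x))).
  by apply: eq_E => x; ring.
rewrite (ED ww) ?(ED ww) ?(EZ _ ww)//; try by [exact: egroM|apply: egroZ; exact: egroM].
  by ring.
by apply: egroD; apply: egroZ; exact: egroM.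
Qed.

Lemma quad_disc (a b c : R) : 0 <= a -> 0 <= c ->
  (forall t, 0 <= a + 2 * t * b + t ^+ 2 * c) -> b ^+ 2 <= a * c.
Proof.
move=> a0 c0 h; have [cn|cp] := leP c 0; last first.
  have := h (- b / c); have -> : a + 2 * (- b / c) * b + (- b / c) ^+ 2 * c = (a * c - b ^+ 2) / c.
    by field; rewrite gt_eqF.
  by rewrite pmulr_lge0 ?invr_gt0// subr_ge0.
have c0' : c = 0 by apply/eqP; rewrite eq_le c0 cn.
rewrite c0' mulr0; have [->|b0] := eqVneq b 0; first by rewrite expr0n.
have := h (- (a + 1) / (2 * b)); rewrite c0' mulr0 addr0.
have -> : a + 2 * (- (a + 1) / (2 * b)) * b = -1 by field; rewrite b0.
by rewrite ler0N1.
Qed.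

Lemma Cov_CS w f g : wt w -> egro f -> egro g -> Cov w f g ^+ 2 <= Var w f * Var w g.
Proof.
move=> ww ef eg; apply: quad_disc; [exact: Var_ge0|exact: Var_ge0|].
move=> t; rewrite -Var_lin//; apply: Var_ge0 => //.
by apply: egroD => //; exact: egroZ.
Qed.

Lemma lip_dot (v : 'rV[R]_n) : forall x y, dot x v - dot y v <= norm2 v * norm2 (x - y).
Proof. by move=> x y; rewrite -dotBl mulrC cauchy_schwarz. Qed.

Lemma measurable_dotl (v : 'rV[R]_n) : measurable_fun setT (fun x : 'rV[R]_n => dot x v).
Proof. by case: (lgro_dot v). Qed.

Lemma egro_dot (v : 'rV[R]_n) : egro (fun x : 'rV[R]_n => dot x v).
Proof. exact/lgro_egro/lgro_dot. Qed.

Lemma Var_dot w k v : wt w -> slc k w -> 0 < k -> Var w (fun x => dot x v) <= dot v v / k.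
Proof.
move=> ww kw k0; have := @poincare R n w k 0 (norm2 v) (fun x => dot x v) (fun=> norm2 v)
  ww kw k0 (lexx _) (lgro_dot v) (measurable_cst _).
rewrite (E_cst _ ww) sqr_norm2; apply.
  by move=> x; rewrite norm2_ge0 lexx.
by move=> x z; rewrite mul0r addr0; exact: lip_dot.
Qed.

Lemma Var_dot_tilt w k L F v : wt w -> slc k w -> 0 < k -> 0 <= L -> measurable_fun setT F ->
  (forall x y, F x - F y <= L * norm2 (x - y)) ->
  Var (tilt w F) (fun x => dot x v) <= 4 * expR ((L + 1) ^+ 2 / (2 * k)) * dot v v.
Proof.
move=> ww kw k0 L0 mF FL; have lF := lip_lgro mF FL.
have wF : wt (tilt w F) by exact: wt_tilt.
have [->|v0] := eqVneq v 0.
  have -> : Var (tilt w F) (fun x => dot x 0) = 0.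
    rewrite (_ : (fun x : 'rV[R]_n => dot x 0) = fun x => 0 * dot x 0); last by apply/funext => x; rewrite mul0r dot0r.
    by rewrite (VarZ _ wF (egro_dot 0)) expr0n mul0r.
  by rewrite dot0r mulr0.
have nv := norm2_gt0 v0.
pose t := (norm2 v)^-1 *: v.
have t1 : norm2 t = 1 by rewrite norm2Z gtr0_norm ?invr_gt0// mulVf// gt_eqF.
have -> : (fun x => dot x v) = (fun x => norm2 v * dot x t).
  by apply/funext => x; rewrite /t dotZr mulrA divff ?mul1r// gt_eqF.
rewrite (VarZ _ wF (egro_dot t)) sqr_norm2 mulrC ler_wpM2r ?dot_ge0//.
have := @var_tilt_lip R n w k L 1 F (fun x => dot x t) ww kw k0 L0 ler01 mF (measurable_dotl t) FL.
have lt1 x y : dot x t - dot y t <= 1 * norm2 (x - y) by rewrite -t1 lip_dot.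
have lt2 x y : dot y t - dot x t <= 1 * norm2 (x - y) by rewrite norm2B lt1.
move=> /(_ lt1 lt2) h.
rewrite (le_trans (Var_le (E w (fun x => dot x t)) wF (egro_dot t)))//.
have e2 : egro (fun x => (dot x t - E w (fun x => dot x t)) ^+ 2).
  by apply/egroX/egroB; [exact: egro_dot|exact: egro_cst].
have -> : E (tilt w F) (fun x => (dot x t - E w (fun x => dot x t)) ^+ 2) =
   2 * E (tilt w F) (fun x => (dot x t - E w (fun x => dot x t)) ^+ 2 / 2).
  have ee : egro (fun x => (dot x t - E w (fun x => dot x t)) ^+ 2 / 2) by apply: egroM => //; exact: egro_cst.
  by rewrite -(EZ _ wF ee); apply: eq_E => x; field.
have -> : 4 * expR ((L + 1) ^+ 2 / (2 * k)) = 2 * (2 * expR ((L + 1) ^+ 2 / (2 * k))) by ring.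
by rewrite ler_wpM2l.
Qed.

End variance.

Section concave1.
Context (R : realType).

Lemma concave_deriv2 (f f1 f2 : R -> R) (m : R) (s : R) : 0 < s < 1 ->
  (forall t, is_derive t (1 : R) f (f1 t)) -> (forall t, is_derive t (1 : R) f1 (f2 t)) ->
  (forall t, 0 <= t <= 1 -> f2 t <= - m) ->
  (1 - s) * f 0 + s * f 1 + m * (s * (1 - s)) / 2 <= f s.
Proof.
move=> /andP[s0 s1] d1 d2 hm.
pose g t := f t + m / 2 * (t * t).
have dg t : is_derive t (1 : R) g (f1 t + m * t).
  have D := is_deriveD (d1 t) (is_deriveZ (m / 2) (is_deriveM (is_derive_id t (1 : R)) (is_derive_id t (1 : R)))).
  by apply: (is_derive_eq D); rewrite /GRing.scale/=; field.
have dg1 t : is_derive t (1 : R) (fun t => f1 t + m * t) (f2 t + m).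
  have D := is_deriveD (d2 t) (is_deriveZ m (is_derive_id t (1 : R))).
  by apply: (is_derive_eq D); rewrite /GRing.scale/= mulr1.
have [a [/andP[a0 a1] ha]] := MVT_is_derive s0 (fun t _ => dg t).
have [b [/andP[b0 b1] hb]] := MVT_is_derive s1 (fun t _ => dg t).
have [c [/andP[c0 c1] hc]] := MVT_is_derive (lt_trans a1 b0) (fun t _ => dg1 t).
have h : f1 b + m * b <= f1 a + m * a.
  rewrite -subr_le0 hc mulr_le0_ge0//; last by rewrite subr_ge0 ltW// (lt_trans a1).
  have : 0 <= c <= 1 by rewrite !ltW// ?(lt_trans c1 b1)// (lt_trans a0).
  by move=> /hm; lra.
have {}ha : g s - g 0 = (f1 a + m * a) * s by rewrite ha subr0.
suff : (1 - s) * g 0 + s * g 1 <= g s.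
  by rewrite /g !mul0r !mulr0 mulr1 addr0; move: (f 0) (f 1) (f s); clear; move=> *; lra.
move: h ha hb; move: (f1 b + m * b) (f1 a + m * a) (g s) (g 0) (g 1) => p q x y z.
move: s0 s1; clear => s0 s1 pq xy zx.
have -> : y = x - q * s by rewrite -xy opprB addrC subrK.
have -> : z = x + p * (1 - s) by rewrite -zx addrC subrK.
rewrite -subr_ge0 (_ : _ - _ = s * (1 - s) * (q - p)); last by ring.
by rewrite !mulr_ge0 ?subr_ge0// ltW.
Qed.

End concave1.

(** * Gaussian smoothing *)

Section smoothing.
Context (R : realType) (n : nat).
Local Notation lamn := (@lam R n).
Implicit Types (f g h w u F G : 'rV[R]_n -> R) (k eta : R) (x y v : 'rV[R]_n).

(** The Gaussian density of variance [eta] per coordinate, unnormalised: its mass [gmass] cancels in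
    every expectation [E]. *)
Definition gk eta x : R := expR (- (2 * eta)^-1 * dot x x).

Lemma gk_gt0 eta x : 0 < gk eta x. Proof. exact: expR_gt0. Qed.

Lemma gk_le1 eta x : 0 < eta -> gk eta x <= 1.
Proof.
move=> e0; rewrite -expR0 ler_expR mulNr oppr_le0 mulr_ge0 ?dot_ge0// invr_ge0.
by rewrite mulr_ge0// ltW.
Qed.

Lemma measurable_gk eta d (T : measurableType d) (p : T -> 'rV[R]_n) :
  measurable_fun setT p -> measurable_fun setT (fun t => gk eta (p t)).
Proof.
by move=> mp; rewrite /gk; apply: (measurableT_comp (f := @expR R)) => //; apply: measurable_funM => //; exact: measurable_dot.
Qed.


Lemma egro_gk eta y : 0 < eta -> egro (fun x => gk eta (y - x)).
Proof.
move=> e0; apply: (@egro_bounded _ _ _ 1).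
  by apply: measurable_gk; exact: measurable_rVB.
by move=> x; rewrite gtr0_norm ?gk_gt0// gk_le1.
Qed.

Lemma wt_gk eta : 0 < eta -> wt (gk eta).
Proof.
move=> e0; split; last exact: gk_gt0.
split; first exact: measurable_gk.
exists 1, (2 * eta)^-1; split; first by rewrite invr_gt0 mulr_gt0.
by move=> x; rewrite gtr0_norm ?gk_gt0// mul1r.
Qed.

Definition wk eta w y : 'rV[R]_n -> R := fun x => gk eta (y - x) * w x.

(** Up to the factor [gmass], the density of $x + \sqrt\eta Z$ for $x$ distributed according to
    [w]. *)
Definition sm eta w y : R := \int[lamn]_x wk eta w y x.

Lemma gdom_wk eta w y : 0 < eta -> gdom w -> gdom (wk eta w y).
Proof. by move=> e0 gw; apply: egro_gdom => //; exact: egro_gk. Qed.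

Lemma wt_wk eta w y : 0 < eta -> wt w -> wt (wk eta w y).
Proof.
move=> e0 [gw w0]; split; first exact: gdom_wk.
by move=> x; rewrite mulr_gt0 ?gk_gt0.
Qed.

Lemma wk_tilt eta w F y : wk eta (tilt w F) y = tilt (wk eta w y) F.
Proof. by apply/funext => x; rewrite /wk /tilt mulrCA. Qed.

Lemma slc_tilt_dot k w v (a : R) : wt w -> slc k w -> slc k (tilt w (fun x => a * dot x v)).
Proof.
move=> ww kw s x y s01; have := kw s x y s01.
have lnt z : ln (tilt w (fun x => a * dot x v) z) = a * dot z v + ln (w z).
  by rewrite /tilt lnM ?posrE ?expR_gt0 ?expRK//; case: ww.
by rewrite !lnt (dotDl ((1 - s) *: x)) !(dotZl _ _ v); lra.
Qed.

Lemma slc_wk k eta w y : 0 < eta -> wt w -> slc k w -> slc (k + eta^-1) (wk eta w y).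
Proof.
move=> e0 ww kw s x z s01; have := kw s x z s01.
have lnt z' : ln (wk eta w y z') = - (2 * eta)^-1 * dot (y - z') (y - z') + ln (w z').
  by rewrite /wk lnM ?posrE ?expR_gt0 ?expRK//; case: ww.
rewrite !lnt => h.
have id : (1 - s) * dot (y - x) (y - x) + s * dot (y - z) (y - z) =
   dot (y - ((1 - s) *: x + s *: z)) (y - ((1 - s) *: x + s *: z)) + s * (1 - s) * dot (x - z) (x - z).
  rewrite !dotBl !dotBr !dotDl !dotDr !dotZl !dotZr (dotC x y) (dotC z y) (dotC z x); ring.
have {}id : dot (y - ((1 - s) *: x + s *: z)) (y - ((1 - s) *: x + s *: z)) =
  (1 - s) * dot (y - x) (y - x) + s * dot (y - z) (y - z) - s * (1 - s) * dot (x - z) (x - z).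
  by rewrite id addrK.
rewrite id invfM; move: h; clear.
generalize (dot (y - x) (y - x)) (dot (y - z) (y - z)) (dot (x - z) (x - z)) => a b c.
generalize (ln (w x)) (ln (w z)) (ln (w ((1 - s) *: x + s *: z))) => wx wz ws h.
lra.
Qed.

Lemma J_scale w (c : R) f : J (fun x => c * w x) f = J w (fun x => c * f x).
Proof. by rewrite !J_Rint; apply: eq_Rint => x; ring. Qed.

Lemma E_scale w (c : R) f : c != 0 -> wt w -> egro f -> E (fun x => c * w x) f = E w f.
Proof.
move=> c0 ww ef; have j0 := J1_gt0 ww; have [gw _] := ww.
rewrite !EJ !J_scale !JZ//; last exact: egro_cst.
by field; rewrite c0 gt_eqF.
Qed.

(** Moving the observation [y] tilts the posterior by a linear function. Derivatives in [y] of
    posterior means are therefore covariances, with no regularity asked of [w]. *)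
Lemma wk_shift eta w y v : 0 < eta ->
  wk eta w (y + v) = fun x => expR (- (eta^-1 * dot y v) - (2 * eta)^-1 * dot v v) *
    tilt (wk eta w y) (fun x => eta^-1 * dot x v) x.
Proof.
move=> e0; apply/funext => x; rewrite /wk /tilt /gk !mulrA -!expRD; congr (expR _ * _).
rewrite !dotBl !dotBr !dotDl !dotDr (dotC v y) (dotC v x) (dotC x y) invfM.
by field; rewrite gt_eqF.
Qed.

Lemma E_wk_shift eta w y v f : 0 < eta -> wt w -> egro f ->
  E (wk eta w (y + v)) f = E (tilt (wk eta w y) (fun x => eta^-1 * dot x v)) f.
Proof.
move=> e0 ww ef; rewrite wk_shift// E_scale ?gt_eqF ?expR_gt0//.
by apply: wt_tilt; [exact: wt_wk|apply: lgroZ; exact: lgro_dot].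
Qed.

Lemma sm_J eta w y : sm eta w y = J (wk eta w y) (fun=> 1).
Proof. exact: Rint_J1. Qed.

Lemma sm_gt0 eta w y : 0 < eta -> wt w -> 0 < sm eta w y.
Proof. by move=> e0 ww; rewrite sm_J; apply/J1_gt0/wt_wk. Qed.

Lemma ln_sm_shift eta w y v : 0 < eta -> wt w ->
  ln (sm eta w (y + v)) = - (eta^-1 * dot y v) - (2 * eta)^-1 * dot v v + ln (sm eta w y) +
    lnE (wk eta w y) (fun x => eta^-1 * dot x v).
Proof.
move=> e0 ww; have wy := wt_wk y e0 ww.
have ld : lgro (fun x => eta^-1 * dot x v) by apply: lgroZ; exact: lgro_dot.
have wt' := wt_tilt wy ld.
rewrite !sm_J wk_shift// J_scale JZ ?lnM ?posrE ?expR_gt0 ?J1_gt0//; last 2 first.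
- by case: wt'.
- exact: egro_cst.
rewrite expRK -!addrA; congr (_ + (_ + _)).
rewrite lnE_J// addrC subrK; congr (ln _).
by rewrite !J_Rint; apply: eq_Rint => x; rewrite /tilt mul1r.
Qed.

Lemma Rint_shift f v : gdom f -> (forall x, 0 <= f x) ->
  \int[lamn]_x f (x + v) = \int[lamn]_x f x.
Proof.
move=> [mf _] f0; rewrite /Rintegral; congr fine.
apply: (@ge0_integral_lam_shift R n v (EFin \o f)); first exact/measurable_EFinP.
by move=> x; rewrite lee_fin.
Qed.

Definition gmass eta := \int[lamn]_x gk eta x.

Lemma gmass_gt0 eta : 0 < eta -> 0 < gmass eta.
Proof. by move=> e0; rewrite /gmass Rint_J1; apply/J1_gt0/wt_gk. Qed.

Lemma Rint_gk eta y : 0 < eta -> \int[lamn]_x gk eta (x - y) = gmass eta.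
Proof.
by move=> e0; apply: Rint_shift; [case: (wt_gk e0)|move=> x; exact/ltW/gk_gt0].
Qed.

Lemma gdom_gk_shift eta x : 0 < eta -> gdom (fun z => gk eta (z - x)).
Proof.
move=> e0; split; first by apply: measurable_gk; exact: measurable_rVB.
have i0 : 0 < (2 * eta)^-1 by rewrite invr_gt0 mulr_gt0.
exists (expR ((2 * eta)^-1 * dot x x)), ((2 * eta)^-1 / 2); split; first by rewrite divr_gt0.
move=> z; rewrite gtr0_norm ?gk_gt0// /gk -expRD ler_expR.
have := dot_ge0 (z - x - x); rewrite !dotBl !dotBr (dotC x z).
by move: i0; generalize (dot z z) (dot z x) (dot x x) (2 * eta)^-1; clear => a b c i; nra.
Qed.

Lemma gk_conv eta D x y : 0 < eta -> 0 < D ->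
  \int[lamn]_z (gk eta (z - x) * gk D (y - z)) =
  gmass (eta * D / (eta + D)) * gk (eta + D) (y - x).
Proof.
move=> e0 D0; have eD : 0 < eta + D by rewrite addr_gt0.
have s0 : 0 < eta * D / (eta + D) by rewrite divr_gt0// mulr_gt0.
pose z0 := (eta + D)^-1 *: (D *: x + eta *: y).
transitivity (\int[lamn]_z (gk (eta + D) (y - x) * gk (eta * D / (eta + D)) (z - z0))).
  apply: eq_Rint => z; rewrite /gk -!expRD; congr expR.
  rewrite /z0 !dotBl !dotBr !dotZl !dotZr !dotDl !dotDr !dotZl !dotZr.
  rewrite (dotC x z) (dotC y z) (dotC y x).
  by field; rewrite !gt_eqF.
rewrite (@RintegralZl _ _ _ lamn setT (fun z => gk (eta * D / (eta + D)) (z - z0)))//; last exact/gdom_integrable/gdom_gk_shift.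
by rewrite (Rint_gk z0 s0) [RHS]mulrC.
Qed.

Lemma addr_norm_ge0 (a : R) : 0 <= a + `|a|.
Proof. by rewrite addrC -[X in _ + X]opprK subr_ge0 -normrN ler_norm. Qed.

Lemma gdom_norm f : gdom f -> gdom (fun x => `|f x|).
Proof.
move=> [mf [A [c [c0 fA]]]].
by split; [exact: measurableT_comp|exists A, c; split => // x; rewrite normr_id].
Qed.

Lemma sm_gdom eta w : 0 < eta -> gdom w -> gdom (sm eta w).
Proof.
move=> e0 gw; have [mw [A [c [c0 wA]]]] := gw.
have A0 : 0 <= A.
  by have := le_trans (normr_ge0 _) (wA 0); rewrite pmulr_lge0 ?expR_gt0.
have mwk g : measurable_fun setT g ->
    measurable_fun setT (fun p : 'rV[R]_n * 'rV[R]_n => wk eta g p.1 p.2).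
  move=> mg; apply: measurable_funM; last by apply: measurableT_comp.
  by apply: measurable_gk; exact: measurable_rVB.
have pos g : gdom g -> (forall x, 0 <= g x) -> measurable_fun setT (sm eta g).
  move=> [mg _] g0.
  rewrite (_ : sm eta g = fine \o (fun y => \int[lamn]_x (wk eta g y x)%:E)%E)//.
  apply: measurableT_comp => //.
  apply: (@measurable_fun_fubini_tonelli_F _ _ _ _ _ lamn (EFin \o (fun p => wk eta g p.1 p.2))).
    by apply/measurable_EFinP; exact: mwk.
  by move=> p; rewrite lee_fin mulr_ge0// ltW// gk_gt0.
have gn : gdom (fun x => `|w x|) by exact: gdom_norm.
split.
  (* A difference of nonnegative functions, for each of which Tonelli gives measurability. The same
     splitting serves in [sm_swap]. *)
  have -> : sm eta w = fun y => sm eta (fun x => w x + `|w x|) y - sm eta (fun x => `|w x|) y.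
    apply/funext => y; rewrite /sm -RintegralB//; try (by apply/gdom_integrable/gdom_wk => //; exact: gdomD).
    by apply: eq_Rint => x; rewrite /wk; ring.
  apply: measurable_funB; apply: pos => //; first exact: gdomD.
  by move=> x; exact: addr_norm_ge0.
pose m := Num.min (c / 2) (2 * eta)^-1.
have m0 : 0 < m by rewrite lt_min divr_gt0//= invr_gt0 mulr_gt0.
have gg : gdom (fun x => expR (- (c / 2) * dot x x)).
  split.
    by apply: measurableT_comp => //; apply: measurable_funM => //; exact: measurable_dot.
  exists 1, (c / 2); split; first by rewrite divr_gt0.
  by move=> x; rewrite ger0_norm ?expR_ge0// mul1r.
exists (A * \int[lamn]_x expR (- (c / 2) * dot x x)), (m / 2); split; first by rewrite divr_gt0.
move=> y; rewrite mulrAC -RintegralZl//; last exact: gdom_integrable.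
rewrite (le_trans (le_normr_Rintegral _ _))//; first exact/gdom_integrable/gdom_wk.
apply: ler_Rint.
- exact/gdom_integrable/gdom_norm/gdom_wk.
- exact/gdom_integrable/gdomZ.
move=> x; rewrite /wk normrM gtr0_norm ?gk_gt0// mulrC -mulrA.
apply: (@le_trans _ _ (A * expR (- c * dot x x) * gk eta (y - x))).
  by rewrite ler_wpM2r// ltW// gk_gt0.
rewrite -mulrA ler_wpM2l// /gk -!expRD ler_expR.
have m1 : m <= c / 2 by rewrite ge_min lexx.
have m2 : m <= (2 * eta)^-1 by rewrite ge_min lexx orbT.
have h : dot y y <= 2 * (dot x x + dot (y - x) (y - x)).
  have := dot_ge0 (y - x - x); rewrite !dotBl !dotBr (dotC x y).
  rewrite -subr_ge0 => h; lra.
have := dot_ge0 x; have := dot_ge0 (y - x).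
move: h m1 m2 m0; clear.
generalize (dot y y) (dot x x) (dot (y - x) (y - x)) (2 * eta)^-1 => a b d e; nra.
Qed.

Lemma wt_sm eta w : 0 < eta -> wt w -> wt (sm eta w).
Proof. by move=> e0 ww; split; [apply: sm_gdom => //; case: ww|move=> y; exact: sm_gt0]. Qed.

Lemma sm_swap eta f g : 0 < eta -> gdom f -> measurable_fun setT g -> (forall x, 0 <= g x <= 1) ->
  \int[lamn]_y (g y * sm eta f y) =
  \int[lamn]_x (f x * \int[lamn]_y (g y * gk eta (y - x))).
Proof.
move=> e0 gf mg g01.
have eg : egro g.
  by apply: (@egro_bounded _ _ _ 1) => // x; have /andP[h1 h2] := g01 x; rewrite ger0_norm.
pose K x := \int[lamn]_y (g y * gk eta (y - x)).
have gkx x : gdom (fun y => g y * gk eta (y - x)).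
  by apply: egro_gdom => //; exact: gdom_gk_shift.
have K0 x : 0 <= K x by apply: Rintegral_ge0 => y _; rewrite mulr_ge0 ?(ltW (gk_gt0 _ _))//; case/andP: (g01 y).
have mK : measurable_fun setT K.
  rewrite (_ : K = fine \o (fun x => \int[lamn]_y (g y * gk eta (y - x))%:E)%E)//.
  apply: measurableT_comp => //.
  apply: (@measurable_fun_fubini_tonelli_F _ _ _ _ _ lamn (EFin \o (fun p : 'rV[R]_n * 'rV[R]_n => g p.2 * gk eta (p.2 - p.1)))).
    apply/measurable_EFinP; apply: measurable_funM; first by apply: measurableT_comp.
    by apply: measurable_gk; exact: measurable_rVB.
  by move=> p; rewrite lee_fin mulr_ge0 ?(ltW (gk_gt0 _ _))//; case/andP: (g01 p.2).
have eK : egro K.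
  apply: (@egro_bounded _ _ _ (gmass eta)) => // x; rewrite ger0_norm// -(Rint_gk x e0).
  apply: ler_Rint; [exact: gdom_integrable|exact/gdom_integrable/gdom_gk_shift|].
  by move=> y; rewrite ler_piMl ?(ltW (gk_gt0 _ _))//; case/andP: (g01 y).
have pos h : gdom h -> (forall x, 0 <= h x) ->
  \int[lamn]_y (g y * sm eta h y) = \int[lamn]_x (h x * K x).
  move=> gh h0; apply: EFin_inj; rewrite !EFin_Rint; last 2 first.
  - apply: gdom_integrable; rewrite (_ : (fun _ => _) = fun x => K x * h x); last by apply/funext => x; rewrite mulrC.
    exact: egro_gdom.
  - by apply: gdom_integrable; apply: egro_gdom => //; exact: sm_gdom.
  pose H (p : 'rV[R]_n * 'rV[R]_n) := (g p.1 * (gk eta (p.1 - p.2) * h p.2))%:E.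
  transitivity (\int[lamn]_y \int[lamn]_x H (y, x))%E.
    apply: eq_integral => y _; rewrite EFinM /sm EFin_Rint; last exact/gdom_integrable/gdom_wk.
    rewrite -[LHS]ge0_integralZl//.
    - by apply/measurable_EFinP; case: (gdom_wk y e0 gh).
    - by move=> x _; rewrite lee_fin mulr_ge0 ?(ltW (gk_gt0 _ _)).
    - by rewrite lee_fin; case/andP: (g01 y).
  rewrite (fubini_tonelli H); last 2 first.
  - apply/measurable_EFinP; apply: measurable_funM; first by apply: measurableT_comp.
    apply: measurable_funM; last by apply: measurableT_comp; case: gh.
    by apply: measurable_gk; exact: measurable_rVB.
  - move=> p; rewrite lee_fin; case/andP: (g01 p.1) => p0 _.
    by rewrite !mulr_ge0 ?(ltW (gk_gt0 _ _)).
  apply: eq_integral => x _; rewrite EFinM /K EFin_Rint; last exact/gdom_integrable.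
  rewrite -[RHS]ge0_integralZl//.
  - by apply: eq_integral => y _; rewrite /H/= -EFinM; congr EFin; ring.
  - by apply/measurable_EFinP; case: (gkx x).
  - by move=> y _; rewrite lee_fin mulr_ge0 ?(ltW (gk_gt0 _ _))//; case/andP: (g01 y).
  - by rewrite lee_fin.
have gn : gdom (fun x => `|f x|) by exact: gdom_norm.
have gfn : gdom (fun x => f x + `|f x|) by exact: gdomD.
have fn0 x : 0 <= f x + `|f x| by exact: addr_norm_ge0.
have -> : \int[lamn]_y (g y * sm eta f y) =
   \int[lamn]_y (g y * sm eta (fun x => f x + `|f x|) y) - \int[lamn]_y (g y * sm eta (fun x => `|f x|) y).
  rewrite -RintegralB//; try (by apply: gdom_integrable; apply: egro_gdom => //; exact: sm_gdom).
  apply: eq_Rint => y; rewrite -mulrBr; congr (_ * _).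
  rewrite /sm -RintegralB//; try (by apply/gdom_integrable/gdom_wk => //; exact: gdomD).
  by apply: eq_Rint => x; rewrite /wk; ring.
rewrite !pos// -RintegralB//; last 2 first.
- rewrite (_ : (EFin \o _) = EFin \o fun x => K x * (f x + `|f x|)); last by apply/funext => x; rewrite /= mulrC.
  by apply: gdom_integrable; exact: egro_gdom.
- rewrite (_ : (EFin \o _) = EFin \o fun x => K x * `|f x|); last by apply/funext => x; rewrite /= mulrC.
  by apply: gdom_integrable; exact: egro_gdom.
by apply: eq_Rint => x; rewrite -/(K x); ring.
Qed.

Lemma Rint_sm eta f : 0 < eta -> gdom f ->
  \int[lamn]_y sm eta f y = gmass eta * \int[lamn]_x f x.
Proof.
move=> e0 gf; have := @sm_swap eta f (fun=> 1) e0 gf (measurable_cst _).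
have -> : \int[lamn]_y (1 * sm eta f y) = \int[lamn]_y sm eta f y by apply: eq_Rint => y; rewrite mul1r.
move=> -> => [|x]; last by rewrite ler01 lexx.
rewrite -RintegralZl//; last exact: gdom_integrable.
apply: eq_Rint => x; rewrite mulrC; congr (_ * _).
by rewrite -(Rint_gk x e0); apply: eq_Rint => y; rewrite mul1r.
Qed.

Lemma sm_sm eta D f y : 0 < eta -> 0 < D -> gdom f ->
  sm D (sm eta f) y = gmass (eta * D / (eta + D)) * sm (eta + D) f y.
Proof.
move=> e0 D0 gf; have eD : 0 < eta + D by rewrite addr_gt0.
rewrite /sm -/(sm eta f) /wk (@sm_swap eta f (fun z => gk D (y - z)) e0 gf); last 2 first.
- by apply: measurable_gk; exact: measurable_rVB.
- by move=> z; rewrite (ltW (gk_gt0 _ _)) gk_le1.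
rewrite -RintegralZl//; last exact/gdom_integrable/gdom_wk.
apply: eq_Rint => x.
have -> : \int[lamn]_z (gk D (y - z) * gk eta (z - x)) = gmass (eta * D / (eta + D)) * gk (eta + D) (y - x).
  by apply: etrans (gk_conv x y e0 D0); apply: eq_Rint => z; exact: mulrC.
by rewrite [LHS]mulrC -[LHS]mulrA.
Qed.

(** Prekopa-Leindler applied to the integrands at three observation points. The constant is the
    minimum over [X] of $k|X|^2 + |Y-X|^2/\eta$ at $|Y| = 1$, attained at $X = Y/(1+k\eta)$; the
    gain enters as the constant factor [expR (- c)] on the third integrand. *)
Lemma slc_sm k eta w : 0 < eta -> 0 < k -> wt w -> slc k w -> slc (k / (1 + k * eta)) (sm eta w).
Proof.
move=> e0 k0 ww kw s y0 y1 s01; have [gw w0] := ww.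
have ke : 0 < 1 + k * eta by rewrite addr_gt0// mulr_gt0.
set ys := (1 - s) *: y0 + s *: y1; set K := k / (1 + k * eta).
set c := K * (s * (1 - s)) / 2 * dot (y0 - y1) (y0 - y1).
have wy y := wt_wk y e0 ww.
have lnt y x : ln (wk eta w y x) = - (2 * eta)^-1 * dot (y - x) (y - x) + ln (w x).
  by rewrite /wk lnM ?posrE ?expR_gt0 ?expRK//; exact: w0.
have wh : wt (fun x => expR c * wk eta w ys x).
  by apply: (@wt_tilt _ _ (wk eta w ys) (fun=> c)); [exact: wy|exact: lgro_cst].
have wc : wt (fun x => expR (- c) * wk eta w ys x).
  by apply: (@wt_tilt _ _ (wk eta w ys) (fun=> - c)); [exact: wy|exact: lgro_cst].
have := @prekopa_leindler R n s (wk eta w y0) (wk eta w y1) (fun x => expR (- c) * wk eta w ys x) s01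
  (wt_gdom (wy y0)) (wt_gdom (wy y1)) (wt_gdom wc) (wt_gt0 (wy y0)) (wt_gt0 (wy y1)) (wt_gt0 wc).
rewrite -/(sm eta w y0) -/(sm eta w y1).
have -> : \int[lamn]_x (expR (- c) * wk eta w ys x) = expR (- c) * sm eta w ys.
  by rewrite RintegralZl//; exact/gdom_integrable/wt_gdom.
rewrite lnM ?posrE ?expR_gt0 ?sm_gt0// expRK => h.
rewrite -(lerD2l (- c)) addrC addrK; apply: h => x z.
rewrite lnM ?posrE ?expR_gt0//; last exact: (wt_gt0 (wy ys)).
rewrite expRK !lnt; set xs := (1 - s) *: x + s *: z.
have hk := kw s x z s01; rewrite -/xs in hk.
have id : dot (ys - xs) (ys - xs) = (1 - s) * dot (y0 - x) (y0 - x) + s * dot (y1 - z) (y1 - z)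
    - s * (1 - s) * dot ((y0 - y1) - (x - z)) ((y0 - y1) - (x - z)).
  have -> : ys - xs = (1 - s) *: (y0 - x) + s *: (y1 - z) by apply/matrixP => i j; rewrite !mxE; ring.
  have -> : (y0 - y1) - (x - z) = (y0 - x) - (y1 - z) by apply/matrixP => i j; rewrite !mxE; ring.
  move: (y0 - x) (y1 - z) => a b.
  by rewrite !dotDl !dotDr !dotNl !dotNr !dotZl !dotZr (dotC b a); ring.
have sq : K * dot (y0 - y1) (y0 - y1) <= k * dot (x - z) (x - z) +
    eta^-1 * dot ((y0 - y1) - (x - z)) ((y0 - y1) - (x - z)).
  move: (y0 - y1) (x - z) => Y X.
  have := dot_ge0 (X - (1 + k * eta)^-1 *: Y).
  have ek : 0 < k + eta^-1 by rewrite addr_gt0// invr_gt0.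
  rewrite -(pmulr_rge0 _ ek) -(subr_ge0 (K * _)).
  rewrite !dotBl !dotBr !dotZl !dotZr (dotC X Y) /K.
  congr (0 <= _); field; by rewrite !gt_eqF.
have s1s : 0 <= s * (1 - s) / 2.
  by case/andP: s01 => s0 s1; rewrite !mulr_ge0 ?invr_ge0 ?subr_ge0// ltW.
have := ler_wpM2l s1s sq; rewrite id /c invfM; move: hk; clear.
generalize (dot (y0 - x) (y0 - x)) (dot (y1 - z) (y1 - z)) (dot (x - z) (x - z)) => a b d.
generalize (dot (y0 - y1) (y0 - y1)) (dot (y0 - y1 - (x - z)) (y0 - y1 - (x - z))) => e f.
generalize (ln (w x)) (ln (w z)) (ln (w xs)) K => wx wz ws L h1 h2.
lra.
Qed.

End smoothing.

Global Opaque sm gmass.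

(** * Posterior means and the gradient of the noisy log-density *)

Section posterior.
Context (R : realType) (n : nat).
Implicit Types (f g h w F : 'rV[R]_n -> R) (k eta L : R) (x y v : 'rV[R]_n).


Lemma egro_coord (i : 'I_n) : egro (fun x : 'rV[R]_n => x ord0 i).
Proof.
rewrite (_ : (fun _ => _) = (fun x => dot x (delta_mx ord0 i))); first exact: egro_dot.
by apply/funext => x; rewrite dot_delta.
Qed.

Definition mean w : 'rV[R]_n := \row_i E w (fun x => x ord0 i).

Lemma dot_mean w v : wt w -> dot (mean w) v = E w (fun x => dot x v).
Proof.
move=> ww; rewrite /dot (E_sum (F := fun i x => x ord0 i * v ord0 i) _ ww); last first.
  by move=> i; apply: egroM; [exact: egro_coord|exact: egro_cst].
apply: eq_bigr => i _; rewrite mxE mulrC -(EZ _ ww (egro_coord i)).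
by apply: eq_E => x; rewrite mulrC.
Qed.

Lemma line1 x y : y + 1 *: (x - y) = x.
Proof. by rewrite scale1r addrC subrK. Qed.

Lemma line0 y v : y + 0 *: v = y.
Proof. by rewrite scale0r addr0. Qed.

Lemma scale_dotZ eta v (t : R) :
  (fun x => eta^-1 * dot x (t *: v)) = (fun x => t * (eta^-1 * dot x v)).
Proof. by apply/funext => x; rewrite dotZr mulrCA. Qed.

Lemma lgro_scale_dot eta v : lgro (fun x => eta^-1 * dot x v).
Proof. by apply: lgroZ; exact: lgro_dot. Qed.

Lemma E_wk_line eta w f y v (t : R) : 0 < eta -> wt w -> egro f ->
  E (wk eta w (y + t *: v)) f = E (tilt (wk eta w y) (fun x => t * (eta^-1 * dot x v))) f.
Proof. by move=> e0 ww ef; rewrite (E_wk_shift y (t *: v) e0 ww ef) scale_dotZ. Qed.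

Lemma ln_sm_line eta w y v (t : R) : 0 < eta -> wt w ->
  ln (sm eta w (y + t *: v)) = ln (sm eta w y) + lnE (wk eta w y) (fun x => t * (eta^-1 * dot x v))
   - t * (eta^-1 * dot y v) - t * t * ((2 * eta)^-1 * dot v v).
Proof.
move=> e0 ww; apply: (etrans (ln_sm_shift y (t *: v) e0 ww)); rewrite scale_dotZ !dotZr dotZl.
by move: (lnE _ _) (ln _) (dot y v) (dot v v) => a b c d; ring.
Qed.

Lemma E_wk_derive eta w f y v (s : R) : 0 < eta -> wt w -> egro f ->
  is_derive s (1 : R) (fun s => E (wk eta w (y + s *: v)) f)
    (Cov (wk eta w (y + s *: v)) f (fun x => eta^-1 * dot x v)).
Proof.
move=> e0 ww ef; have ld := lgro_scale_dot eta v.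
have eh := lgro_egro ld.
have -> : (fun s => E (wk eta w (y + s *: v)) f) =
    (fun s => E (tilt (wk eta w y) (fun x => s * (eta^-1 * dot x v))) f).
  by apply/funext => t; exact: (E_wk_line y v t e0 ww ef).
have D := E_tilt_derive s (wt_wk y e0 ww) ef ld; apply: (is_derive_eq D).
by rewrite /Cov (E_wk_line y v s e0 ww (egroM ef eh)) (E_wk_line y v s e0 ww ef) (E_wk_line y v s e0 ww eh).
Qed.

(* [wk eta w y] is, up to normalisation, the law of [x ~ w] given [x + sqrt(eta) Z = y];
   [up] is the log-density of the noisy version of [e^F w] relative to that of [w], and
   [gup] its gradient. *)
Definition up eta w F y := lnE (wk eta w y) F.

Lemma up_sm eta w F y : 0 < eta -> wt w -> lgro F ->
  up eta w F y = ln (sm eta (tilt w F) y) - ln (sm eta w y).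
Proof.
move=> e0 ww lF; rewrite /up (lnE_J (wt_wk y e0 ww) lF) !sm_J; congr (ln _ - _).
by rewrite !J_Rint; apply: eq_Rint => x; rewrite wk_tilt /tilt mul1r.
Qed.

Definition gup eta w F y : 'rV[R]_n :=
  eta^-1 *: (mean (wk eta (tilt w F) y) - mean (wk eta w y)).

Lemma dot_gup eta w F y v : 0 < eta -> wt w -> lgro F ->
  dot (gup eta w F y) v =
  eta^-1 * (E (wk eta (tilt w F) y) (fun x => dot x v) - E (wk eta w y) (fun x => dot x v)).
Proof.
move=> e0 ww lF; rewrite /gup dotZl dotBl !dot_mean//; [exact: wt_wk|].
by apply: wt_wk => //; exact: wt_tilt.
Qed.

Lemma up_derive eta w F y v (s : R) : 0 < eta -> wt w -> lgro F ->
  is_derive s (1 : R) (fun s => up eta w F (y + s *: v)) (dot (gup eta w F (y + s *: v)) v).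
Proof.
move=> e0 ww lF; have wF : wt (tilt w F) by exact: wt_tilt.
have ld : lgro (fun x => eta^-1 * dot x v) by apply: lgroZ; exact: lgro_dot.
have eh := lgro_egro ld.
have -> : (fun s => up eta w F (y + s *: v)) = (fun s =>
   (up eta w F y + lnE (wk eta (tilt w F) y) (fun x => s * (eta^-1 * dot x v)))
    - lnE (wk eta w y) (fun x => s * (eta^-1 * dot x v))).
  apply/funext => t; rewrite (up_sm (y + t *: v) e0 ww lF) (up_sm y e0 ww lF).
  apply: (etrans (congr2 (fun a b => a - b) (ln_sm_line y v t e0 wF) (ln_sm_line y v t e0 ww))).
  move: (lnE _ _) (lnE _ _) (ln _) (ln _) => a b c d; ring.
have D := is_deriveB (is_deriveD (is_derive_cst (up eta w F y) s (1 : R))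
  (lnE_derive s (wt_wk y e0 wF) ld)) (lnE_derive s (wt_wk y e0 ww) ld).
apply: (is_derive_eq D); rewrite add0r (dot_gup (y + s *: v) v e0 ww lF) mulrBr.
have ed := egro_dot v.
rewrite -(EZ eta^-1 (wt_wk (y + s *: v) e0 wF) ed) -(EZ eta^-1 (wt_wk (y + s *: v) e0 ww) ed).
by rewrite (E_wk_line y v s e0 wF eh) (E_wk_line y v s e0 ww eh).
Qed.

Lemma gup_derive eta w F y v (s : R) : 0 < eta -> wt w -> lgro F ->
  is_derive s (1 : R) (fun s => dot (gup eta w F (y + s *: v)) v)
    (eta^-1 ^+ 2 * (Var (wk eta (tilt w F) (y + s *: v)) (fun x => dot x v)
             - Var (wk eta w (y + s *: v)) (fun x => dot x v))).
Proof.
move=> e0 ww lF; have wF : wt (tilt w F) by exact: wt_tilt.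
have ed := egro_dot v.
have -> : (fun s => dot (gup eta w F (y + s *: v)) v) =
   (fun s => eta^-1 * (E (wk eta (tilt w F) (y + s *: v)) (fun x => dot x v) -
     E (wk eta w (y + s *: v)) (fun x => dot x v))).
  by apply/funext => t; rewrite dot_gup.
have D := is_deriveZ eta^-1 (is_deriveB (E_wk_derive y v s e0 wF ed) (E_wk_derive y v s e0 ww ed)).
apply: (is_derive_eq D); rewrite /GRing.scale/= /Var.
have wy := wt_wk (y + s *: v) e0 ww; have wFy := wt_wk (y + s *: v) e0 wF.
by rewrite (CovC _ (fun x => dot x v)) (CovC (wk eta w _) (fun x => dot x v)) !CovZl//; ring.
Qed.

Lemma MVT_taylor2 (f f1 f2 : R -> R) (C : R) :
  (forall t, is_derive t (1 : R) f (f1 t)) -> (forall t, is_derive t (1 : R) f1 (f2 t)) ->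
  0 <= C -> (forall t, f2 t <= C) -> f 1 - f 0 <= f1 0 + C.
Proof.
move=> d1 d2 C0 hC.
have [a [/andP[a0 a1] ->]] := MVT_is_derive ltr01 (fun t _ => d1 t).
have [b [_]] := MVT_is_derive a0 (fun t _ => d2 t).
rewrite !subr0 mulr1 => h; have : f2 b * a <= C; last by lra.
have [fb|fb] := leP (f2 b) 0; first by rewrite (le_trans _ C0)// mulr_le0_ge0// ltW.
by rewrite (le_trans _ (hC b))// ler_piMr ?ltW.
Qed.

Section lipschitz_tilt.
Variables (k L eta : R) (w F : 'rV[R]_n -> R).
Hypotheses (ww : wt w) (kw : slc k w) (k0 : 0 < k) (e0 : 0 < eta) (L0 : 0 < L).
Hypotheses (mF : measurable_fun setT F) (FL : forall x y, F x - F y <= L * norm2 (x - y)).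

Let lF : lgro F := lip_lgro mF FL.
Let wF : wt (tilt w F) := wt_tilt ww lF.
Let ei0 : 0 < eta^-1. Proof. by rewrite invr_gt0. Qed.
Let k'0 : 0 < k + eta^-1. Proof. exact: addr_gt0. Qed.
Let kw' y : slc (k + eta^-1) (wk eta w y) := slc_wk y e0 ww kw.
Let ke0 : 0 < 1 + k * eta. Proof. by rewrite addr_gt0// mulr_gt0. Qed.
Let keE : eta^-1 / (k + eta^-1) = (1 + k * eta)^-1.
Proof. by field; rewrite !gt_eqF//= addrC. Qed.

(** The posterior of [w] has concavity constant $k + 1/\eta$, so by [shift_lip] tilting by [F] moves
    its mean by at most $L/(k + 1/\eta)$; dividing by $\eta$ gives the bound. *)
Lemma gup_bound y : norm2 (gup eta w F y) <= L / (1 + k * eta).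
Proof.
have [g0|g0] := eqVneq (gup eta w F y) 0.
  by rewrite g0 norm20 divr_ge0 ?ltW.
have ng := norm2_gt0 g0; set g := gup _ _ _ _ in g0 ng *.
have h : norm2 g ^+ 2 <= norm2 g * (L / (1 + k * eta)).
  rewrite sqr_norm2 {1}/g dot_gup// wk_tilt.
  have := shift_lip (wt_wk y e0 ww) (kw' y) k'0 L0 ng mF (measurable_dotl g) FL (lip_dot g).
  move=> /(ler_wpM2l (ltW ei0)) h; rewrite (le_trans h)//.
  by rewrite -keE le_eqVlt; apply/orP; left; apply/eqP; ring.
by move: h; rewrite expr2 ler_pM2l.
Qed.

Lemma up_lip x y : up eta w F x - up eta w F y <= L / (1 + k * eta) * norm2 (x - y).
Proof.
have [c [_]] := MVT_is_derive ltr01 (fun s _ => up_derive y (x - y) s e0 ww lF).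
rewrite line1 line0 subr0 mulr1 => ->.
rewrite (le_trans (cauchy_schwarz _ _))// ler_wpM2r ?norm2_ge0//; exact: gup_bound.
Qed.

(** The constant of [Var_dot_tilt]. It does not involve [eta]: the posterior is more concave than
    [w], so the bound at constant [k] holds at every noise level. *)
Definition tiltvar : R := 4 * expR ((L + 1) ^+ 2 / (2 * k)).

Lemma tiltvar_gt0 : 0 < tiltvar.
Proof. by rewrite mulr_gt0// expR_gt0. Qed.

Lemma Var_posterior y v : Var (wk eta (tilt w F) y) (fun x => dot x v) <= tiltvar * dot v v.
Proof.
rewrite wk_tilt; have := @Var_dot_tilt R n (wk eta w y) (k + eta^-1) L F v (wt_wk y e0 ww) (kw' y)
  k'0 (ltW L0) mF FL.
move=> h; rewrite (le_trans h)// ler_wpM2r ?dot_ge0// ler_wpM2l// ler_expR.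
rewrite ler_wpM2l ?sqr_ge0// lef_pV2 ?posrE ?mulr_gt0// ler_wpM2l// lerDl ltW//.
Qed.

(** The second derivative of [up] is $\eta^{-2}$ times a difference of two posterior variances. Only
    an upper bound is wanted, so the negative one is dropped. This is the increment condition of
    [local_lsi], with slope the norm of [gup]. *)
Lemma up_taylor x y :
  up eta w F x - up eta w F y <= dot (gup eta w F y) (x - y) +
    eta^-1 ^+ 2 * tiltvar * dot (x - y) (x - y).
Proof.
have := @MVT_taylor2 _ _ _ (eta^-1 ^+ 2 * tiltvar * dot (x - y) (x - y))
  (fun s => up_derive y (x - y) s e0 ww lF) (fun s => gup_derive y (x - y) s e0 ww lF).
rewrite line1 line0; apply.
  by rewrite !mulr_ge0 ?sqr_ge0 ?dot_ge0// ltW// tiltvar_gt0.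
move=> t; rewrite -mulrA ler_wpM2l ?sqr_ge0//.
have := Var_posterior (y + t *: (x - y)) (x - y).
have := Var_ge0 (wt_wk (y + t *: (x - y)) e0 ww) (egro_dot (x - y)).
by move=> h1 h2; rewrite (le_trans _ h2)// gerBl.
Qed.

Lemma measurable_up : measurable_fun setT (up eta w F).
Proof.
have -> : up eta w F = fun y => ln (sm eta (tilt w F) y) - ln (sm eta w y).
  by apply/funext => y; rewrite up_sm.
apply: measurable_funB; apply: measurableT_comp => //; apply: gdom_measurable; apply: sm_gdom => //.
  exact: wt_gdom wF.
exact: wt_gdom ww.
Qed.

Lemma E_wk_sm (v f : 'rV[R]_n -> R) y : wt v -> E (wk eta v y) f = sm eta (fun x => f x * v x) y / sm eta v y.
Proof.
move=> wv; rewrite EJ -sm_J J_Rint; congr (_ / _).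
by apply: eq_Rint => x; rewrite /wk mulrCA.
Qed.

Lemma measurable_E_wk (v f : 'rV[R]_n -> R) : wt v -> egro f -> measurable_fun setT (fun y => E (wk eta v y) f).
Proof.
move=> wv ef; have -> : (fun y => E (wk eta v y) f) = fun y => sm eta (fun x => f x * v x) y * (sm eta v y)^-1.
  by apply/funext => y; exact: E_wk_sm.
apply: measurable_funM.
  apply: gdom_measurable; apply: (sm_gdom e0); apply: (egro_gdom ef); exact: wt_gdom wv.
have mv : measurable_fun setT (sm eta v) by apply: gdom_measurable; apply: (sm_gdom e0); exact: wt_gdom wv.
have -> : (fun y => (sm eta v y)^-1) = fun y => expR (- ln (sm eta v y)).
  by apply/funext => y; rewrite expRN (lnK (sm_gt0 y e0 wv)).
apply: (measurableT_comp (f := @expR R)) => //; apply: measurableT_comp => //.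
by apply: (measurableT_comp (f := @ln R)) => //; exact: measurable_ln.
Qed.

Lemma measurable_gup (i : 'I_n) : measurable_fun setT (fun y => gup eta w F y ord0 i).
Proof.
have -> : (fun y => gup eta w F y ord0 i) = fun y =>
    eta^-1 * (E (wk eta (tilt w F) y) (fun x => x ord0 i) - E (wk eta w y) (fun x => x ord0 i)).
  by apply/funext => y; rewrite !mxE.
by apply: measurable_funM => //; apply: measurable_funB; apply: measurable_E_wk => //; exact: egro_coord.
Qed.

Lemma measurable_gup_rV : measurable_fun setT (gup eta w F).
Proof. by apply: measurable_fun_rV => i; exact: measurable_gup. Qed.

(** The derivative is $\eta^{-1}$ times a posterior covariance of two linear forms, which
    Cauchy-Schwarz and Poincare bound by the product of their norms over $k + 1/\eta$. *)
Lemma mean_lip v x y : E (wk eta w x) (fun z => dot z v) - E (wk eta w y) (fun z => dot z v) <=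
  norm2 v / (1 + k * eta) * norm2 (x - y).
Proof.
have ed := egro_dot v.
have [c [_]] := MVT_is_derive ltr01 (fun s _ => E_wk_derive y (x - y) s e0 ww ed).
rewrite line1 line0 subr0 mulr1 => ->.
set z := y + c *: _; have wz := wt_wk z e0 ww.
rewrite CovC (CovZl _ wz (egro_dot _) ed).
have C : Cov (wk eta w z) (fun t => dot t (x - y)) (fun t => dot t v) <=
    norm2 (x - y) * norm2 v / (k + eta^-1).
  have b0 : 0 <= norm2 (x - y) * norm2 v / (k + eta^-1).
    by rewrite divr_ge0 ?mulr_ge0 ?norm2_ge0// ltW.
  rewrite (le_trans (ler_norm _))// -(@ler_pXn2r _ 2)// ?nnegrE// real_normK ?num_real//.
  rewrite (le_trans (Cov_CS wz (egro_dot _) ed))//.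
  have h1 := Var_dot (x - y) wz (kw' z) k'0; have h2 := Var_dot v wz (kw' z) k'0.
  have -> : (norm2 (x - y) * norm2 v / (k + eta^-1)) ^+ 2 =
     (dot (x - y) (x - y) / (k + eta^-1)) * (dot v v / (k + eta^-1)).
    by rewrite -!sqr_norm2 mulrACA -invfM -exprMn -expr2 expr_div_n.
  by apply: (ler_pM (Var_ge0 wz (egro_dot _)) (Var_ge0 wz ed) h1 h2).
rewrite (le_trans (ler_wpM2l (ltW ei0) C))// -keE.
by rewrite le_eqVlt; apply/orP; left; apply/eqP; ring.
Qed.

(** Along a line in the unit direction the second derivative of the logarithm is $\eta^{-2}$ times a
    posterior variance, minus $\eta^{-1}$. For $\eta$ larger than [tiltvar] the smoothing thus
    creates a strong log-concavity that [e^F w] did not have. *)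
Lemma slc_sm_tilt : slc (eta^-1 - eta^-1 ^+ 2 * tiltvar) (sm eta (tilt w F)).
Proof.
move=> s y0 y1 s01; pose v := y1 - y0.
have ld : lgro (fun x => eta^-1 * dot x v) by apply: lgroZ; exact: lgro_dot.
have eh := lgro_egro ld; have ed := egro_dot v.
have w0 := wt_wk y0 e0 wF.
pose q t := ln (sm eta (tilt w F) (y0 + t *: v)).
pose c1 := - (eta^-1 * dot y0 v); pose c2 := eta^-1 * dot v v.
have qE : q = fun t => (ln (sm eta (tilt w F) y0) + lnE (wk eta (tilt w F) y0) (fun x => t * (eta^-1 * dot x v)))
   + (c1 *: id t - (c2 / 2) *: (t * t)).
  apply/funext => t; apply: (etrans (ln_sm_line y0 v t e0 wF)); rewrite /GRing.scale/= /c1 /c2.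
  move: (lnE _ _) (ln _) (dot _ _) (dot _ _) => a b c d; field; by rewrite gt_eqF.
pose q1 t := E (wk eta (tilt w F) (y0 + t *: v)) (fun x => eta^-1 * dot x v) + (c1 - c2 * t).
have d1 t : is_derive t (1 : R) q (q1 t).
  rewrite qE.
  have D := is_deriveD (is_deriveD (is_derive_cst (ln (sm eta (tilt w F) y0)) t (1 : R)) (lnE_derive t w0 ld))
    (is_deriveB (is_deriveZ c1 (is_derive_id t (1 : R))) (is_deriveZ (c2 / 2) (is_deriveM (is_derive_id t (1 : R)) (is_derive_id t (1 : R))))).
  apply: (is_derive_eq D); rewrite /q1 (E_wk_line y0 v t e0 wF eh) /GRing.scale/= add0r.
  by move: (E _ _) => a; field.
have d2 t : is_derive t (1 : R) q1 (Cov (wk eta (tilt w F) (y0 + t *: v)) (fun x => eta^-1 * dot x v) (fun x => eta^-1 * dot x v) + (0 - c2)).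
  have D := is_deriveD (E_wk_derive y0 v t e0 wF eh)
    (is_deriveB (is_derive_cst c1 t (1 : R)) (is_deriveZ c2 (is_derive_id t (1 : R)))).
  by apply: (is_derive_eq D); rewrite /GRing.scale/= mulr1.
have := concave_deriv2 (m := (eta^-1 - eta^-1 ^+ 2 * tiltvar) * dot v v) s01 d1 d2.
have -> : q 0 = ln (sm eta (tilt w F) y0) by rewrite /q line0.
have -> : q 1 = ln (sm eta (tilt w F) y1) by rewrite /q line1.
have -> : q s = ln (sm eta (tilt w F) ((1 - s) *: y0 + s *: y1)).
  by rewrite /q; congr (ln (sm _ _ _)); apply/matrixP => i j; rewrite !mxE; ring.
have -> : dot (y0 - y1) (y0 - y1) = dot v v by rewrite /v -opprB dotNl dotNr opprK.
move=> h; rewrite mulrAC [X in _ + X <= _]mulrAC -[X in _ + X <= _]mulrA [X in _ + X]mulrC.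
rewrite [X in _ + X <= _](_ : _ = (eta^-1 - eta^-1 ^+ 2 * tiltvar) * dot v v * (s * (1 - s)) / 2); last by ring.
apply: h => t _; rewrite -/(Var _ (fun x => eta^-1 * dot x v)).
have wt' := wt_wk (y0 + t *: v) e0 wF.
rewrite (VarZ _ wt' ed) /c2.
have := Var_posterior (y0 + t *: v) v.
have i2 : 0 <= eta^-1 ^+ 2 by exact: sqr_ge0.
move=> /(ler_wpM2l i2); lra.
Qed.

End lipschitz_tilt.

End posterior.

(** * The tower property between noise levels *)

Section tower.
Context (R : realType) (n : nat).
Local Notation lamn := (@lam R n).
Implicit Types (f g h w F : 'rV[R]_n -> R) (k eta D L : R) (x y v : 'rV[R]_n).

Lemma tilt_up eta w F : 0 < eta -> wt w -> lgro F ->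
  tilt (sm eta w) (up eta w F) = sm eta (tilt w F).
Proof.
move=> e0 ww lF; apply/funext => y.
transitivity (expR (up eta w F y) * sm eta w y) => //.
have p1 := sm_gt0 y e0 ww; have p2 := sm_gt0 y e0 (wt_tilt ww lF).
rewrite (up_sm y e0 ww lF) expRD expRN (lnK p1) (lnK p2) -mulrA mulVf ?mulr1//.
by rewrite gt_eqF.
Qed.

Lemma tower_sm eta w f : 0 < eta -> wt w -> egro f ->
  E (sm eta w) (fun y => E (wk eta w y) f) = E w f.
Proof.
move=> e0 ww ef; have [gw w0] := ww; have gf := egro_gdom ef gw.
have g0 : gmass n eta != 0 by rewrite gt_eqF ?gmass_gt0.
have j0 := J1_gt0 ww; rewrite -Rint_J1 in j0.
rewrite !EJ -!Rint_J1 !J_Rint (Rint_sm e0 gw).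
have -> : \int[lamn]_y (E (wk eta w y) f * sm eta w y) = gmass n eta * \int[lamn]_x (f x * w x).
  rewrite -(Rint_sm e0 gf); apply: eq_Rint => y; rewrite (E_wk_sm eta f y ww) mulfVK//.
  by rewrite gt_eqF ?sm_gt0.
by field; rewrite g0 gt_eqF.
Qed.

(** Noise of variance [eta + D] is noise [eta] followed by noise [D]; conditioning on the final
    observation may first average over the intermediate point [z]. *)
Lemma tower_wk eta D w f y : 0 < eta -> 0 < D -> wt w -> egro f ->
  E (wk D (sm eta w) y) (fun z => E (wk eta w z) f) = E (wk (eta + D) w y) f.
Proof.
move=> e0 D0 ww ef; have [gw w0] := ww; have gf := egro_gdom ef gw.
have eD : 0 < eta + D by exact: addr_gt0.
have c0 : gmass n (eta * D / (eta + D)) != 0.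
  by rewrite gt_eqF ?gmass_gt0// divr_gt0// mulr_gt0.
have s0 := sm_gt0 y eD ww.
rewrite (E_wk_sm D _ y (wt_sm e0 ww)) (E_wk_sm (eta + D) f y ww) (sm_sm y e0 D0 gw).
have -> : (fun x => E (wk eta w x) f * sm eta w x) = sm eta (fun x => f x * w x).
  apply/funext => z; rewrite (E_wk_sm eta f z ww) mulfVK//.
  by rewrite gt_eqF ?sm_gt0.
rewrite (sm_sm y e0 D0 gf); field; by rewrite c0 gt_eqF.
Qed.

Lemma lnE_up eta w F : 0 < eta -> wt w -> lgro F -> lgro (up eta w F) ->
  lnE (sm eta w) (up eta w F) = lnE w F.
Proof.
move=> e0 ww lF lu; have wF := wt_tilt ww lF; have [gw _] := ww; have [gwF _] := wF.
rewrite (lnE_J (wt_sm e0 ww) lu) (lnE_J ww lF) -!Rint_J1 -!Rint_tilt (tilt_up e0 ww lF).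
rewrite (Rint_sm e0 gw) (Rint_sm e0 gwF).
have j0 := J1_gt0 ww; have j1 := J1_gt0 wF; have g0 := gmass_gt0 n e0.
rewrite !lnM ?posrE// !Rint_J1//; ring.
Qed.

End tower.

(** * Entropy and gradient at one noise level *)

Section scale.
Context (R : realType) (n : nat).
Local Notation lamn := (@lam R n).
Variables (w F : 'rV[R]_n -> R) (L : R).
Hypotheses (ww : wt w) (kw : slc 1 w) (L0 : 0 < L).
Hypotheses (mF : measurable_fun setT F) (FL : forall x y, F x - F y <= L * norm2 (x - y)).

Let lF : lgro F := lip_lgro mF FL.
Let wF : wt (tilt w F) := wt_tilt ww lF.

Section one_scale.
Variables (eta : R).
Hypothesis e0 : 0 < eta.
Let ei0 : 0 < eta^-1. Proof. by rewrite invr_gt0. Qed.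
Let N0 : 0 < 1 + eta. Proof. exact: addr_gt0. Qed.
Let k'0 : 0 < 1 + eta^-1. Proof. exact: addr_gt0. Qed.

Lemma up_lip1 x y : up eta w F x - up eta w F y <= L / (1 + eta) * norm2 (x - y).
Proof. by have := up_lip ww kw ltr01 e0 L0 mF FL x y; rewrite mul1r. Qed.

Lemma lgro_up : lgro (up eta w F).
Proof. exact: lip_lgro (measurable_up ww e0 mF FL) up_lip1. Qed.

Lemma gup_bound1 y : 0 <= norm2 (gup eta w F y) <= L / (1 + eta).
Proof. by rewrite norm2_ge0; have := gup_bound ww kw ltr01 e0 L0 mF FL y; rewrite mul1r. Qed.

Lemma slc_sm1 : slc (1 + eta)^-1 (sm eta w).
Proof. by have := slc_sm e0 ltr01 ww kw; rewrite !mul1r. Qed.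

Lemma KL_posterior_bound y : 0 <= KL (wk eta w y) F <= L ^+ 2 / (2 * (1 + eta^-1)).
Proof.
have wy := wt_wk y e0 ww; rewrite (lgro_KL_ge0 wy lF)/=.
exact: (lip_KL wy (slc_wk y e0 ww kw) k'0 (ltW L0) mF FL).
Qed.

Lemma KL_posteriorE y : KL (wk eta w y) F = E (wk eta (tilt w F) y) F - up eta w F y.
Proof. by rewrite /KL wk_tilt. Qed.

Lemma egro_KL_posterior : egro (fun y => KL (wk eta w y) F).
Proof.
apply: (@egro_bounded _ _ _ (L ^+ 2 / (2 * (1 + eta^-1)))).
  have -> : (fun y => KL (wk eta w y) F) = fun y => E (wk eta (tilt w F) y) F - up eta w F y.
    by apply/funext => y; exact: KL_posteriorE.
  apply: measurable_funB; last exact: lgro_measurable lgro_up.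
  exact: (measurable_E_wk e0 wF (lgro_egro lF)).
by move=> y; have /andP[h1 h2] := KL_posterior_bound y; rewrite ger0_norm.
Qed.

(** The joint law of signal and observation has the entropy of the signal, because the noise is the
    same under both measures; it splits into the entropy of the observation and the mean posterior
    entropy. *)
Lemma KL_chain : KL w F = KL (sm eta w) (up eta w F) +
  E (sm eta (tilt w F)) (fun y => KL (wk eta w y) F).
Proof.
have wZ := wt_sm e0 wF; have eu := lgro_egro lgro_up.
rewrite /KL (tilt_up e0 ww lF) (lnE_up e0 ww lF lgro_up) -(tower_sm e0 wF (lgro_egro lF)).
have -> : E (sm eta (tilt w F)) (fun y => E (wk eta (tilt w F) y) F) =
   E (sm eta (tilt w F)) (fun y => up eta w F y + KL (wk eta w y) F).
  by apply: eq_E => y; rewrite KL_posteriorE addrC subrK.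
by rewrite (ED wZ eu egro_KL_posterior) addrAC.
Qed.

(** The posteriors take at most $L^2/(2(1+1/\eta))$, and what is left of $L^2/2$ is exactly the
    largest entropy that [lip_KL] allows at level [eta]. The defect [e] is thus inherited without
    loss. *)
Lemma KL_sm_ge e : L ^+ 2 / 2 - e <= KL w F ->
  L ^+ 2 / (2 * (1 + eta)) - e <= KL (sm eta w) (up eta w F).
Proof.
rewrite KL_chain => h.
have h2 := @E_le_cst _ _ _ _ _ (wt_sm e0 wF) egro_KL_posterior (fun y => proj2 (andP (KL_posterior_bound y))).
have id : L ^+ 2 / (2 * (1 + eta)) = L ^+ 2 / 2 - L ^+ 2 / (2 * (1 + eta^-1)).
  by field; rewrite !gt_eqF//= addrC.
by rewrite id; move: h h2; lra.
Qed.

Lemma measurable_norm_gup : measurable_fun setT (fun y => norm2 (gup eta w F y)).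
Proof. by apply: measurable_norm2; exact: (measurable_gup_rV ww e0 mF FL). Qed.

Lemma egro_sqr_gup : egro (fun y => norm2 (gup eta w F y) ^+ 2).
Proof.
apply: egroX; apply: (@egro_bounded _ _ _ (L / (1 + eta))); first exact: measurable_norm_gup.
by move=> y; have /andP[h1 h2] := gup_bound1 y; rewrite ger0_norm.
Qed.

Lemma E_sqr_gup_ge e : L ^+ 2 / 2 - e <= KL w F ->
  (L / (1 + eta)) ^+ 2 - 2 * e / (1 + eta) <=
  E (sm eta (tilt w F)) (fun y => norm2 (gup eta w F y) ^+ 2).
Proof.
move=> /KL_sm_ge h.
have C0 : 0 <= eta^-1 ^+ 2 * tiltvar 1 L by rewrite mulr_ge0 ?sqr_ge0// ltW// tiltvar_gt0.
have i0 : 0 < (1 + eta)^-1 by rewrite invr_gt0.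
have lsi := @local_lsi _ _ _ _ _ _ _ _ (wt_sm e0 ww) slc_sm1 i0 C0 lgro_up measurable_norm_gup gup_bound1.
have {lsi} := lsi (fun x y => le_trans (up_taylor ww kw ltr01 e0 L0 mF FL x y) (lerD (cauchy_schwarz _ _) (lexx _))).
rewrite (tilt_up e0 ww lF) => h2; have := le_trans h h2.
rewrite ler_pdivlMr ?mulr_gt0// => h3; apply: le_trans h3.
by rewrite le_eqVlt; apply/orP; left; apply/eqP; field; rewrite gt_eqF.
Qed.

(** From the second moment to the first, by $M^2 - g^2 \ge M(M - g)$ for $0 \le g \le M =
    L/(1+\eta)$. *)
Lemma E_gup_defect e : L ^+ 2 / 2 - e <= KL w F ->
  E (sm eta (tilt w F)) (fun y => L / (1 + eta) - norm2 (gup eta w F y)) <= 2 * e / L.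
Proof.
move=> /E_sqr_gup_ge h; have wZ := wt_sm e0 wF.
have M0 : 0 < L / (1 + eta) by rewrite divr_gt0.
have eg : egro (fun y => norm2 (gup eta w F y)).
  apply: (@egro_bounded _ _ _ (L / (1 + eta))); first exact: measurable_norm_gup.
  by move=> y; have /andP[h1 h2] := gup_bound1 y; rewrite ger0_norm.
rewrite -(ler_pM2l M0); apply: (@le_trans _ _ (2 * e / (1 + eta))); last first.
  by rewrite le_eqVlt; apply/orP; left; apply/eqP; field; rewrite !gt_eqF.
rewrite -(EZ _ wZ (egroB (egro_cst _ _) eg)).
apply: (@le_trans _ _ (E (sm eta (tilt w F)) (fun y => (L / (1 + eta)) ^+ 2 - norm2 (gup eta w F y) ^+ 2))).
  apply: (E_le wZ); [exact: (egroZ _ (egroB (egro_cst _ _) eg))|exact: (egroB (egro_cst _ _) egro_sqr_gup)|].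
  move=> y; have /andP[] := gup_bound1 y; move: M0.
  generalize (norm2 (gup eta w F y)) (L / (1 + eta)) => a b; nra.
rewrite (EB wZ (egro_cst _ _) egro_sqr_gup) (E_cst _ wZ); move: h; lra.
Qed.

End one_scale.
End scale.

(** * Variance split by an intermediate observation *)

Section posterior_poincare.
Context (R : realType) (n : nat).
Implicit Types (x y z : 'rV[R]_n).
Variables (v f : 'rV[R]_n -> R) (D A : R).
Hypotheses (wv : wt v) (lcv : slc 0 v) (D0 : 0 < D).
Hypotheses (mf : measurable_fun setT f) (fA : forall x, `|f x| <= A).

Let ef : egro f := egro_bounded mf fA.
Let A0 : 0 <= A. Proof. exact: le_trans (normr_ge0 _) (fA 0). Qed.
Let wy y : wt (wk D v y) := wt_wk y D0 wv.
Let Di0 : 0 < D^-1. Proof. by rewrite invr_gt0. Qed.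
Let lcy y : slc D^-1 (wk D v y).
Proof. by have := slc_wk y D0 wv lcv; rewrite add0r. Qed.

Lemma E_wk_bound y : `|E (wk D v y) f| <= A.
Proof.
apply: le_trans (E_norm (wy y) ef) _; apply: (E_le_cst (wy y)) => //.
exact: egro_norm.
Qed.

Lemma Var_wk_bound y : 0 <= Var (wk D v y) f <= A ^+ 2.
Proof.
rewrite (Var_ge0 (wy y) ef)/= /Var /Cov.
apply: (@le_trans _ _ (E (wk D v y) (fun x => f x * f x))); first by rewrite gerBl -expr2 sqr_ge0.
apply: (E_le_cst (wy y)); first exact: egroM.
by move=> x; rewrite -expr2 -real_normK ?num_real// lerXn2r ?nnegrE.
Qed.

Lemma Var_wk_dot y x : Var (wk D v y) (fun z => D^-1 * dot z x) <= D^-1 * dot x x.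
Proof.
rewrite (VarZ _ (wy y) (egro_dot x)).
have := Var_dot x (wy y) (lcy y) Di0; rewrite invrK => h.
apply: le_trans (ler_wpM2l (sqr_ge0 _) h) _.
by rewrite le_eqVlt; apply/orP; left; apply/eqP; field; rewrite gt_eqF.
Qed.

(** The left side is the derivative of the posterior mean of [f] in the direction [x], so this
    bounds the slope of that mean by the posterior variance of [f]. *)
Lemma Cov_wk_le y x : Cov (wk D v y) f (fun z => D^-1 * dot z x) <=
  Num.sqrt (D^-1 * Var (wk D v y) f) * norm2 x.
Proof.
have eh : egro (fun z => D^-1 * dot z x) by exact/egroZ/egro_dot.
have /andP[v0 _] := Var_wk_bound y.
have b0 : 0 <= Num.sqrt (D^-1 * Var (wk D v y) f) * norm2 x.
  by rewrite mulr_ge0 ?sqrtr_ge0 ?norm2_ge0.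
rewrite (le_trans (ler_norm _))// -(@ler_pXn2r _ 2)// ?nnegrE// real_normK ?num_real//.
rewrite (le_trans (Cov_CS (wy y) ef eh))// exprMn sqr_sqrtr; last first.
  by rewrite mulr_ge0// ltW.
rewrite sqr_norm2 mulrAC [X in _ <= X]mulrC.
by apply: ler_wpM2l => //; exact: Var_wk_dot.
Qed.

Lemma Cov_wk_derive y x (s : R) : let h := fun z => D^-1 * dot z x in
  is_derive s (1 : R) (fun s => Cov (wk D v (y + s *: x)) f h)
   (Cov (wk D v (y + s *: x)) (fun z => f z * h z) h -
     (E (wk D v (y + s *: x)) f * Var (wk D v (y + s *: x)) h +
      E (wk D v (y + s *: x)) h * Cov (wk D v (y + s *: x)) f h)).
Proof.
move=> h; have eh : egro h by exact/egroZ/egro_dot.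
have Dv := is_deriveB (E_wk_derive y x s D0 wv (egroM ef eh))
  (is_deriveM (E_wk_derive y x s D0 wv ef) (E_wk_derive y x s D0 wv eh)).
by apply: (is_derive_eq Dv).
Qed.

(** The second derivative of the posterior mean is a third cumulant, equal to the mean of $(f -
    Ef)(h - m)^2$; for $|f| \le A$ it is at most $2A$ times the variance of [h]. *)
Lemma cumulant3_le y x : let h := fun z => D^-1 * dot z x in
  Cov (wk D v y) (fun z => f z * h z) h -
     (E (wk D v y) f * Var (wk D v y) h + E (wk D v y) h * Cov (wk D v y) f h) <=
  2 * A * (D^-1 * dot x x).
Proof.
cbv zeta; set h := (fun z : 'rV[R]_n => D^-1 * dot z x); have eh : egro h by exact/egroZ/egro_dot.
have wyy := wy y; set m := E (wk D v y) h.
have efh := egroM ef eh; have efhh := egroM efh eh.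
have ed : egro (fun z => (h z - m) ^+ 2) by exact/egroX/(egroB eh)/egro_cst.
have Vh : Var (wk D v y) h = E (wk D v y) (fun z => (h z - m) ^+ 2).
  rewrite /Var (Cov_E wyy eh eh); apply: eq_E => z; by rewrite expr2.
have -> : Cov (wk D v y) (fun z => f z * h z) h = E (wk D v y) (fun z => f z * (h z - m) ^+ 2)
   + m * Cov (wk D v y) f h.
  have -> : E (wk D v y) (fun z => f z * (h z - m) ^+ 2) =
     E (wk D v y) (fun z => f z * h z * h z - (2 * m) * (f z * h z) + m ^+ 2 * f z).
    by apply: eq_E => z; ring.
  rewrite (ED wyy (egroB efhh (egroZ (2 * m) efh)) (egroZ (m ^+ 2) ef)) (EB wyy efhh (egroZ (2 * m) efh)).
  rewrite (EZ _ wyy efh) (EZ _ wyy ef) /Cov -/m; ring.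
have B : E (wk D v y) (fun z => f z * (h z - m) ^+ 2) <= A * Var (wk D v y) h.
  rewrite Vh -(EZ _ wyy ed); apply: (E_le wyy (egroM ef ed) (egroZ _ ed)) => z.
  by rewrite ler_wpM2r ?sqr_ge0// (le_trans (ler_norm _)).
have V0 := Var_ge0 wyy eh; have V1 := Var_wk_dot y x; rewrite -/h in V1.
have := E_wk_bound y; rewrite ler_norml => /andP[f1 _]; move: B V0 V1 f1 A0.
generalize (Var (wk D v y) h) (E (wk D v y) f) (D^-1 * dot x x) => a b c.
generalize (E (wk D v y) (fun z => f z * (h z - m) ^+ 2)) (Cov (wk D v y) f h) => p q; nra.
Qed.

Lemma E_wk_taylor x z : E (wk D v x) f - E (wk D v z) f <=
  Num.sqrt (D^-1 * Var (wk D v z) f) * norm2 (x - z) + 2 * A * D^-1 * dot (x - z) (x - z).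
Proof.
have := @MVT_taylor2 _ _ _ _ (2 * A * (D^-1 * dot (x - z) (x - z)))
  (fun s => E_wk_derive z (x - z) s D0 wv ef) (fun s => Cov_wk_derive z (x - z) s).
rewrite line1 line0 => h; apply: le_trans (h _ _) _.
- by rewrite !mulr_ge0 ?dot_ge0// ltW.
- move=> t; exact: cumulant3_le.
- by rewrite -[2 * A * D^-1 * _]mulrA lerD2r Cov_wk_le.
Qed.

Lemma egro_E_wk : egro (fun y => E (wk D v y) f).
Proof. exact: egro_bounded (measurable_E_wk D0 wv ef) E_wk_bound. Qed.

Lemma egro_Var_wk : egro (fun y => Var (wk D v y) f).
Proof.
apply: (@egro_bounded _ _ _ (A ^+ 2)).
  apply: measurable_funB; first exact: (measurable_E_wk D0 wv (egroM ef ef)).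
  by apply: measurable_funM; exact: (measurable_E_wk D0 wv ef).
by move=> y; have /andP[h1 h2] := Var_wk_bound y; rewrite ger0_norm.
Qed.

Lemma Var_posterior_mean m : 0 < m -> slc m (sm D v) ->
  Var (sm D v) (fun y => E (wk D v y) f) <=
  E (sm D v) (fun y => Var (wk D v y) f) / (m * D).
Proof.
move=> m0 lcm; have wZ := wt_sm D0 wv.
have C0 : 0 <= 2 * A * D^-1 by rewrite !mulr_ge0// ltW.
have lP : lgro (fun y => E (wk D v y) f).
  split; first exact: egro_measurable egro_E_wk.
  exists A => y; rewrite (le_trans (E_wk_bound y))// ler_peMr// lerDl norm2_ge0 //.
have mG : measurable_fun setT (fun y => Num.sqrt (D^-1 * Var (wk D v y) f)).
  by apply: measurable_sqrtr; apply: measurable_funM => //; exact: egro_measurable egro_Var_wk.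
have GB y : 0 <= Num.sqrt (D^-1 * Var (wk D v y) f) <= Num.sqrt (D^-1 * A ^+ 2).
  rewrite sqrtr_ge0/=; apply: ler_wsqrtr; apply: ler_wpM2l; first exact: ltW.
  by case/andP: (Var_wk_bound y).
have := poincare wZ lcm m0 C0 lP mG GB E_wk_taylor => h.
apply: le_trans h _.
have -> : E (sm D v) (fun y => Num.sqrt (D^-1 * Var (wk D v y) f) ^+ 2) =
   D^-1 * E (sm D v) (fun y => Var (wk D v y) f).
  rewrite -(EZ _ wZ egro_Var_wk); apply: eq_E => y; rewrite sqr_sqrtr// mulr_ge0// ?(ltW Di0)//.
  by case/andP: (Var_wk_bound y).
by rewrite le_eqVlt; apply/orP; left; apply/eqP; field; rewrite !gt_eqF.
Qed.

(** Total variance is mean posterior variance plus variance of the posterior mean. Poincare for the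
    noisy weight bounds the second by a multiple of the first, so a function that is nearly constant
    under most posteriors is nearly constant. *)
Lemma Var_two_scale m : 0 < m -> slc m (sm D v) ->
  Var v f <= (1 + (m * D)^-1) * E (sm D v) (fun y => Var (wk D v y) f).
Proof.
move=> m0 lcm; have wZ := wt_sm D0 wv; have := Var_posterior_mean m0 lcm.
have eE := egro_E_wk; have eff := egroM ef ef.
have eE2 : egro (fun y => E (wk D v y) (fun x => f x * f x)).
  apply: (@egro_bounded _ _ _ (A ^+ 2)); first exact: (measurable_E_wk D0 wv eff).
  move=> y; rewrite ger0_norm; last by apply: (E_ge0 (wy y) eff) => x; rewrite -expr2 sqr_ge0.
  apply: (E_le_cst (wy y) eff) => x; by rewrite -expr2 -real_normK ?num_real// lerXn2r ?nnegrE.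
rewrite {1}/Var /Cov (tower_sm D0 wv ef) mulrDl mul1r => h.
rewrite {1}/Var /Cov -(tower_sm D0 wv eff).
have -> : E (sm D v) (fun y => Var (wk D v y) f) = E (sm D v) (fun y => E (wk D v y) (fun x => f x * f x))
    - E (sm D v) (fun y => E (wk D v y) f * E (wk D v y) f).
  by rewrite -(EB wZ eE2 (egroM eE eE)).
move: h; have -> : E (sm D v) (fun y => Var (wk D v y) f) = E (sm D v) (fun y => E (wk D v y) (fun x => f x * f x))
    - E (sm D v) (fun y => E (wk D v y) f * E (wk D v y) f).
  by rewrite -(EB wZ eE2 (egroM eE eE)).
rewrite [(m * D)^-1 * _]mulrC.
set a := E (sm D v) _; set b := E (sm D v) _; set c := E v f * _; set q := _ / _.
by move: a b c q => a b c q h; lra.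
Qed.

End posterior_poincare.

(** * A near-optimal direction *)

Section vector_mean.
Context (R : realType) (n : nat).
Implicit Types (g : 'rV[R]_n -> 'rV[R]_n) (q : 'rV[R]_n -> R).

Definition vmean q g : 'rV[R]_n := \row_i E q (fun z => g z ord0 i).

Lemma dot_vmean q g v : wt q -> (forall i, egro (fun z => g z ord0 i)) ->
  dot (vmean q g) v = E q (fun z => dot (g z) v).
Proof.
move=> wq eg; rewrite /dot (E_sum (F := fun i z => g z ord0 i * v ord0 i) _ wq); last first.
  by move=> i; apply: egroM; [exact: eg|exact: egro_cst].
apply: eq_bigr => i _; rewrite mxE mulrC -(EZ _ wq (eg i)).
by apply: eq_E => z; rewrite mulrC.
Qed.

Lemma egro_dot_vec g v : (forall i, egro (fun z => g z ord0 i)) -> egro (fun z => dot (g z) v).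
Proof.
move=> eg; apply: (@egro_sum _ _ _ _ (fun i z => g z ord0 i * v ord0 i)) => i.
by apply: egroM; [exact: eg|exact: egro_cst].
Qed.

Lemma sum_Var q g : wt q -> (forall i, egro (fun z => g z ord0 i)) ->
  \sum_(i < n) Var q (fun z => g z ord0 i) =
  E q (fun z => norm2 (g z) ^+ 2) - norm2 (vmean q g) ^+ 2.
Proof.
move=> wq eg; rewrite sqr_norm2 /Var /Cov sumrB.
have -> : E q (fun z => norm2 (g z) ^+ 2) = E q (fun z => \sum_(i < n) (g z ord0 i * g z ord0 i)).
  by apply: eq_E => z; rewrite sqr_norm2.
rewrite (E_sum (F := fun i z => g z ord0 i * g z ord0 i) _ wq); last by move=> i; exact: egroM.
by congr (_ - _); apply: eq_bigr => i _; rewrite !mxE.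
Qed.

Lemma slc_le (k k' : R) q : k <= k' -> slc k' q -> slc k q.
Proof.
move=> kk h s x y s01; apply: le_trans (h s x y s01).
rewrite lerD2l ler_wpM2r ?dot_ge0// !mulrA ler_wpM2r ?invr_ge0// ler_wpM2r//.
  by rewrite subr_ge0; case/andP: s01 => _ /ltW.
by rewrite ler_wpM2r//; case/andP: s01 => /ltW.
Qed.

End vector_mean.

(** * The noisy gradient at levels [s] and [s + D] *)

Section two_scales.
Context (R : realType) (n : nat).
Local Notation lamn := (@lam R n).
Variables (w F : 'rV[R]_n -> R) (L s D : R).
Hypotheses (ww : wt w) (kw : slc 1 w) (L0 : 0 < L).
Hypotheses (mF : measurable_fun setT F) (FL : forall x y, F x - F y <= L * norm2 (x - y)).
Hypotheses (s0 : 0 < s) (D0 : 0 < D) (sT : 2 * tiltvar 1 L <= s).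

Let lF : lgro F := lip_lgro mF FL.
Let wF : wt (tilt w F) := wt_tilt ww lF.
Let Zs := sm s (tilt w F).
Let wZ : wt Zs := wt_sm s0 wF.
Let ws : wt (sm s w) := wt_sm s0 ww.
Let sD : 0 < s + D. Proof. exact: addr_gt0. Qed.
Let N0 : 0 < 1 + s. Proof. exact: addr_gt0. Qed.
Let ND0 : 0 < 1 + (s + D). Proof. exact: addr_gt0. Qed.

(** The hypothesis [sT] makes [tiltvar] cost at most half of the constant in [slc_sm_tilt]. *)
Lemma slc_Zs : slc (2 * s)^-1 Zs.
Proof.
apply: slc_le (slc_sm_tilt ww kw ltr01 s0 L0 mF FL).
rewrite -subr_ge0; have -> : s^-1 - s^-1 ^+ 2 * tiltvar 1 L - (2 * s)^-1 =
  (s - 2 * tiltvar 1 L) * ((2 * s ^+ 2)^-1) by field; rewrite gt_eqF.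
by rewrite mulr_ge0 ?subr_ge0// invr_ge0 mulr_ge0// sqr_ge0.
Qed.

Lemma slc0_Zs : slc 0 Zs.
Proof. by apply: slc_le slc_Zs; rewrite invr_ge0 mulr_ge0// ltW. Qed.

Lemma slc_sm_Zs : slc (2 * s + D)^-1 (sm D Zs).
Proof.
have k0 : 0 < (2 * s)^-1 by rewrite invr_gt0 mulr_gt0.
apply: slc_le (slc_sm D0 k0 wZ slc_Zs).
rewrite le_eqVlt; apply/orP; left; apply/eqP; field.
have h1 : 0 < 2 * s + D by rewrite addr_gt0// mulr_gt0.
by rewrite !gt_eqF.
Qed.

Lemma gup_coord_bound i z : `|gup s w F z ord0 i| <= L / (1 + s).
Proof.
apply: le_trans (coord_le_norm2 _ _) _.
by have /andP[_] := gup_bound1 ww kw L0 mF FL s0 z.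
Qed.

Lemma measurable_gup_coord i : measurable_fun setT (fun z => gup s w F z ord0 i).
Proof. exact: (measurable_gup ww s0 mF FL). Qed.

Lemma egro_gup i : egro (fun z => gup s w F z ord0 i).
Proof. exact: egro_bounded (measurable_gup_coord i) (gup_coord_bound i). Qed.

Lemma egro_mean_wk v : egro (fun z => E (wk s w z) (fun x => dot x v)).
Proof.
apply/lgro_egro/(lip_lgro (measurable_E_wk s0 ww (egro_dot v))) => x y.
exact: (mean_lip ww kw ltr01 s0 v x y).
Qed.

(** The tower property collapses the tilted half of [gup] to level [s + D]. It does not apply to the
    other half, where means under [w] are averaged with the tilted weight [Zs]; [mean_wk_shift] pays
    for the mismatch. *)
Lemma mean_gup_tower y v : dot (vmean (wk D Zs y) (gup s w F)) v =
  s^-1 * (E (wk (s + D) (tilt w F) y) (fun x => dot x v) -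
          E (wk D Zs y) (fun z => E (wk s w z) (fun x => dot x v))).
Proof.
have wy : wt (wk D Zs y) := wt_wk y D0 wZ; have ed := egro_dot v.
have eF : egro (fun z => E (wk s (tilt w F) z) (fun x => dot x v)).
  have -> : (fun z => E (wk s (tilt w F) z) (fun x => dot x v)) =
    fun z => s * dot (gup s w F z) v + E (wk s w z) (fun x => dot x v).
    by apply/funext => z; rewrite (dot_gup z v s0 ww lF) mulVKf ?gt_eqF// subrK.
  by apply: egroD (egro_mean_wk v); apply/egroZ/egro_dot_vec/egro_gup.
rewrite (dot_vmean v wy egro_gup) -(tower_wk y s0 D0 wF ed) -(EB wy eF (egro_mean_wk v)).
rewrite -(EZ _ wy (egroB eF (egro_mean_wk v))).
by apply: eq_E => z; rewrite (dot_gup z v s0 ww lF).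
Qed.

(** Replacing [Zs] by the smoothing of [w] removes a tilt by [up], of Lipschitz constant $L/(1+s)$.
    The averaged function has constant $|v|/(1+s)$ by [mean_lip] and the weight has concavity
    $1/(1+s) + 1/D$, so [shift_lip] gives the bound. *)
Lemma mean_wk_shift y v : v != 0 ->
  E (wk D Zs y) (fun z => E (wk s w z) (fun x => dot x v)) -
  E (wk (s + D) w y) (fun x => dot x v) <= norm2 v * (L * D / ((1 + s) * (1 + (s + D)))).
Proof.
move=> v0; have nv := norm2_gt0 v0.
have Di0 : 0 < D^-1 by rewrite invr_gt0.
have Ni0 : 0 < (1 + s)^-1 by rewrite invr_gt0.
have k0 : 0 < (1 + s)^-1 + D^-1 by exact: addr_gt0.
have l0 : 0 < norm2 v / (1 + s) by rewrite divr_gt0.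
have l1 : 0 < L / (1 + s) by rewrite divr_gt0.
have lip x z : E (wk s w x) (fun x => dot x v) - E (wk s w z) (fun x => dot x v) <=
    norm2 v / (1 + s) * norm2 (x - z).
  by have := mean_lip ww kw ltr01 s0 v x z; rewrite mul1r.
have := shift_lip (wt_wk y D0 ws) (slc_wk y D0 ws (slc_sm1 ww kw s0)) k0 l1 l0
  (measurable_up ww s0 mF FL) (measurable_E_wk s0 ww (egro_dot v))
  (up_lip1 ww kw L0 mF FL s0) lip.
rewrite -wk_tilt (tilt_up s0 ww lF) (tower_wk y s0 D0 ww (egro_dot v)) => h.
apply: le_trans h _.
rewrite le_eqVlt; apply/orP; left; apply/eqP; field.
have h1 : 0 < D + (1 + s) by exact: addr_gt0.
by rewrite !gt_eqF.
Qed.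

(* [|gup|] is at most [L/(1+eta)] at each noise level [eta], and the average of the gradient
   at level [s] nearly recovers the one at level [s + D]; so near-saturation of the latter
   bound forces the former gradient to be nearly constant under the posterior. *)
Lemma gup_mean_defect y : L / (1 + s) - norm2 (vmean (wk D Zs y) (gup s w F)) <=
  (s + D) / s * (L / (1 + (s + D)) - norm2 (gup (s + D) w F y)).
Proof.
set gb := vmean _ _; set g := gup (s + D) w F y.
(* The two sharp bounds fit together: with the gradient at level [s + D] of maximal length, the
   estimate below returns exactly the maximal length at level [s]. *)
have id : L / (1 + s) = (s + D) / s * (L / (1 + (s + D))) - s^-1 * (L * D / ((1 + s) * (1 + (s + D)))).
  by field; rewrite !gt_eqF.
suff h : (s + D) / s * norm2 g - s^-1 * (L * D / ((1 + s) * (1 + (s + D)))) <= norm2 gb.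
  rewrite id mulrBr; move: h; set a := _ / s * norm2 g; set b := s^-1 * _; set c := norm2 gb.
  set q := (s + D) / s * _; lra.
have [g0|g0] := eqVneq g 0.
  rewrite g0 norm20 mulr0 add0r (le_trans _ (norm2_ge0 _))// oppr_le0.
  by rewrite mulr_ge0 ?invr_ge0 ?divr_ge0 ?mulr_ge0// ltW.
have ng := norm2_gt0 g0; rewrite -(ler_pM2l ng).
have si : 0 < s^-1 by rewrite invr_gt0.
have h1 := cauchy_schwarz gb g; rewrite [X in _ <= X]mulrC in h1; apply: le_trans h1.
rewrite /gb mean_gup_tower.
have h2 := mean_wk_shift y g0.
have h3 := dot_gup y g sD ww lF; rewrite -/g -sqr_norm2 in h3.
have {}h3 : E (wk (s + D) (tilt w F) y) (fun x => dot x g) =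
  (s + D) * norm2 g ^+ 2 + E (wk (s + D) w y) (fun x => dot x g).
  by rewrite h3 mulVKf ?gt_eqF// subrK.
rewrite h3 -(subr_ge0 (norm2 g * _)); move: h2; clear h3.
set a := E (wk D Zs y) _; set b := E (wk (s + D) w y) _.
set c := L * D / _; set q := norm2 g => h2.
have -> : s^-1 * ((s + D) * q ^+ 2 + b - a) - q * ((s + D) / s * q - s^-1 * c) = s^-1 * (q * c - (a - b)).
  by field; rewrite gt_eqF.
by rewrite mulr_ge0 ?(ltW si)// subr_ge0.
Qed.

(** A vector field of length at most $a$ whose mean has length $b$ has total variance at most $a^2 -
    b^2 \le 2a(a-b)$. *)
Lemma sum_Var_posterior y : \sum_(i < n) Var (wk D Zs y) (fun z => gup s w F z ord0 i) <=
  2 * (L / (1 + s)) * ((s + D) / s * (L / (1 + (s + D)) - norm2 (gup (s + D) w F y))).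
Proof.
have wy : wt (wk D Zs y) := wt_wk y D0 wZ.
rewrite (sum_Var wy egro_gup); have := gup_mean_defect y.
have l1 : 0 < L / (1 + s) by rewrite divr_gt0.
have : E (wk D Zs y) (fun z => norm2 (gup s w F z) ^+ 2) <= (L / (1 + s)) ^+ 2.
  apply: (E_le_cst wy (egro_sqr_gup ww kw L0 mF FL s0)) => z.
  by have /andP[h1 h2] := gup_bound1 ww kw L0 mF FL s0 z; rewrite lerXn2r ?nnegrE// ltW.
move: l1; set a := L / (1 + s); set b := norm2 (vmean _ _); set c := E _ _; set d := (s + D) / s * _.
move: a b c d => a b c d a0 h1 h2.
have a20 : 0 <= 2 * a by rewrite mulr_ge0// ltW.
have := ler_wpM2l a20 h2; have := sqr_ge0 (a - b); lra.
Qed.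

Lemma E_sm_Zs f : egro f -> E (sm D Zs) f = E (sm (s + D) (tilt w F)) f.
Proof.
move=> ef; have [gF _] := wF.
have c0 : gmass n (s * D / (s + D)) != 0.
  by rewrite gt_eqF ?gmass_gt0// divr_gt0// mulr_gt0.
have -> : sm D Zs = fun y => gmass n (s * D / (s + D)) * sm (s + D) (tilt w F) y.
  by apply/funext => y; exact: (sm_sm y s0 D0 gF).
exact: (E_scale c0 (wt_sm sD wF) ef).
Qed.

(** [Var_two_scale] coordinate by coordinate. Summation comes before any estimate of the posterior
    variances, so that the bound does not depend on the dimension. *)
Lemma sum_Var_gup e : L ^+ 2 / 2 - e <= KL w F ->
  \sum_(i < n) Var Zs (fun z => gup s w F z ord0 i) <=
  (1 + (2 * s + D) / D) * (2 / (1 + s) * ((s + D) / s) * (2 * e)).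
Proof.
move=> h; have wS : wt (sm D Zs) := wt_sm D0 wZ.
have m0 : 0 < (2 * s + D)^-1 by rewrite invr_gt0 addr_gt0// mulr_gt0.
have eV i := egro_Var_wk wZ D0 (measurable_gup_coord i) (gup_coord_bound i).
have l1 : 0 < 1 + (2 * s + D) / D by rewrite addr_gt0// divr_gt0// addr_gt0// mulr_gt0.
apply: (@le_trans _ _ (\sum_(i < n) (1 + (2 * s + D) / D) *
   E (sm D Zs) (fun y => Var (wk D Zs y) (fun z => gup s w F z ord0 i)))).
  apply: ler_sum => i _.
  have := Var_two_scale wZ slc0_Zs D0 (measurable_gup_coord i) (gup_coord_bound i) m0 slc_sm_Zs.
  by rewrite invfM invrK.
rewrite -mulr_sumr (ler_pM2l l1) -(E_sum _ wS eV).
have eD : egro (fun y => L / (1 + (s + D)) - norm2 (gup (s + D) w F y)).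
  apply: egroB; first exact: egro_cst.
  apply: (@egro_bounded _ _ _ (L / (1 + (s + D)))); first exact: (measurable_norm_gup ww mF FL sD).
  by move=> y; have /andP[h1 h2] := gup_bound1 ww kw L0 mF FL sD y; rewrite ger0_norm.
set c := 2 * (L / (1 + s)) * ((s + D) / s).
have c0 : 0 <= c by rewrite !mulr_ge0 ?invr_ge0// ltW.
apply: (@le_trans _ _ (c * (2 * e / L))); last first.
  rewrite le_eqVlt; apply/orP; left; apply/eqP; rewrite /c; field; by rewrite !gt_eqF.
apply: (@le_trans _ _ (E (sm D Zs) (fun y => c * (L / (1 + (s + D)) - norm2 (gup (s + D) w F y))))).
  apply: (E_le wS); first exact: egro_sum.
    exact: egroZ.
  by move=> y; have := sum_Var_posterior y; rewrite mulrA.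
rewrite (EZ _ wS eD); apply: (ler_wpM2l c0); rewrite (E_sm_Zs eD).
exact: (E_gup_defect ww kw L0 mF FL sD).
Qed.

End two_scales.

Section second_difference.
Context (R : realType).

(** The mean value theorem for $f(t + 1/2) - f(t)$, then for its derivative. It turns information at
    0, 1/2 and 1 into a point where the second derivative is small. *)
Lemma second_difference (f f1 f2 : R -> R) :
  (forall t, is_derive t (1 : R) f (f1 t)) -> (forall t, is_derive t (1 : R) f1 (f2 t)) ->
  exists c, 0 < c < 1 /\ f 1 - 2 * f 2^-1 + f 0 = f2 c / 4.
Proof.
move=> d1 d2; have h0 : (0 : R) < 2^-1 by rewrite invr_gt0.
have dS (g dg : R -> R) t : (forall t, is_derive t (1 : R) g (dg t)) ->
    is_derive t (1 : R) (fun t => g (t + 2^-1)) (dg (t + 2^-1)).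
  move=> dg1.
  have Di : is_derive t (1 : R) (fun t : R => t + 2^-1) 1.
    by have D := is_deriveD (is_derive_id t (1 : R)) (is_derive_cst (2^-1 : R) t (1 : R)); apply: (is_derive_eq D); rewrite addr0.
  have D := @is_derive1_comp R g (fun t => t + 2^-1) t (dg (t + 2^-1)) 1 (dg1 (t + 2^-1)) Di.
  by move: D; rewrite mulr1.
have [a [/andP[a0 a1] ha]] := MVT_is_derive h0 (fun t _ => is_deriveB (dS f f1 t d1) (d1 t)).
have ah : a < a + 2^-1 by rewrite ltrDl.
have [c [/andP[c0 c1] hc]] := MVT_is_derive ah (fun t _ => d2 t).
exists c; split; first by apply/andP; split; move: c0 c1 a0 a1 {ha hc}; lra.
have e1 : 2^-1 + 2^-1 = 1 :> R by lra.
move: ha; rewrite !fctE e1 add0r subr0 hc => ha.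
have -> : f 1 - 2 * f 2^-1 + f 0 = f 1 - f 2^-1 - (f 2^-1 - f 0) by ring.
by rewrite ha; field.
Qed.

End second_difference.

Section exponential_moments.
Context (R : realType) (n : nat).
Local Notation lamn := (@lam R n).
Implicit Types (w : 'rV[R]_n -> R) (v : 'rV[R]_n).

(** Cumulant functions of independent variables add, and the noise contributes its Gaussian one.
    This transfers estimates from the noisy weight back to [w]. *)
Lemma lnE_sm_dot (s a : R) w v : 0 < s -> wt w ->
  lnE (sm s w) (fun y => a * dot y v) = lnE w (fun x => a * dot x v) + s * a ^+ 2 / 2 * dot v v.
Proof.
move=> s0 ww; have [gw _] := ww; have ws := wt_sm s0 ww.
have ld : lgro (fun x : 'rV[R]_n => a * dot x v) by apply: lgroZ; exact: lgro_dot.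
have wt' := wt_tilt ww ld; have [gt' _] := wt'.
rewrite (lnE_J ws ld) (lnE_J ww ld) -!Rint_J1 -!Rint_tilt (Rint_sm s0 gw).
have pw y : tilt (sm s w) (fun y => a * dot y v) y =
  expR (s * a ^+ 2 / 2 * dot v v) * sm s (tilt w (fun x => a * dot x v)) (y + (- (s * a)) *: v).
  rewrite {1}/tilt !sm_J !J_Rint.
  rewrite -(RintegralZl _ measurableT (J_int (wt_gdom (wt_wk _ s0 ww)) (egro_cst _ _))).
  rewrite -(RintegralZl _ measurableT (J_int (wt_gdom (wt_wk _ s0 wt')) (egro_cst _ _))).
  apply: eq_Rint => x; rewrite /wk /tilt /gk !mul1r !mulrA -!expRD; congr (expR _ * _).
  rewrite !dotBl !dotBr !dotDl !dotDr !dotZl !dotZr (dotC v y) (dotC v x) (dotC x y).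
  by field; rewrite gt_eqF.
have -> : \int[lamn]_x tilt (sm s w) (fun y => a * dot y v) x =
  expR (s * a ^+ 2 / 2 * dot v v) * (gmass n s * \int[lamn]_x tilt w (fun x => a * dot x v) x).
  have gs := sm_gdom s0 gt'.
  rewrite -(Rint_sm s0 gt') -(Rint_shift (- (s * a) *: v) gs); last first.
    by move=> x; rewrite ltW// sm_gt0.
  rewrite -(RintegralZl _ measurableT); last first.
    apply: gdom_integrable; split.
      by apply: measurableT_comp; [exact: gdom_measurable gs|exact: measurable_rVD].
    have [_ [A [c [c0 h]]]] := gs.
    move: (- (s * a) *: v) => q.
    exists (A * expR (c * dot q q)), (c / 2); split; first by rewrite divr_gt0.
    move=> x; apply: le_trans (h _) _; rewrite -mulrA -expRD.
    have A0 : 0 <= A by have := le_trans (normr_ge0 _) (h 0); rewrite pmulr_lge0 ?expR_gt0.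
    rewrite ler_wpM2l// ler_expR !dotDl !dotDr (dotC q x).
    have := dot_ge0 (x + 2 *: q); rewrite !dotDl !dotDr !dotZl !dotZr (dotC q x).
    move: c0; generalize (dot x x) (dot x q) (dot q q) => p1 p2 p3 c0 hh; nra.
  by apply: eq_Rint => y; exact: pw.
have j0 := J1_gt0 ww; have j1 := J1_gt0 wt'; have g0 := gmass_gt0 n s0.
rewrite -Rint_J1 in j0; rewrite -Rint_J1 in j1.
rewrite lnM ?posrE ?expR_gt0 ?mulr_gt0// expRK !lnM ?posrE//.
set p := ln _; set q := ln _; set r := ln _; ring.
Qed.

End exponential_moments.

(** * From the mean gradient to a tilt of nearly maximal variance *)

Section direction.
Context (R : realType) (n : nat).
Variables (w F : 'rV[R]_n -> R) (L s e : R).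
Hypotheses (ww : wt w) (kw : slc 1 w) (L0 : 0 < L).
Hypotheses (mF : measurable_fun setT F) (FL : forall x y, F x - F y <= L * norm2 (x - y)).
Hypotheses (s0 : 0 < s) (sT : 2 * tiltvar 1 L <= s) (KLF : L ^+ 2 / 2 - e <= KL w F).

Let lF : lgro F := lip_lgro mF FL.
Let wF : wt (tilt w F) := wt_tilt ww lF.
Let Zs := sm s (tilt w F).
Let wZ : wt Zs := wt_sm s0 wF.
Let ws : wt (sm s w) := wt_sm s0 ww.
Let N0 : 0 < 1 + s. Proof. exact: addr_gt0. Qed.
Let eg i : egro (fun z => gup s w F z ord0 i) := egro_gup ww kw L0 mF FL s0 i.
Let b : 'rV[R]_n := vmean Zs (gup s w F).

Let E_sqr_le : E Zs (fun y => norm2 (gup s w F y) ^+ 2) <= (L / (1 + s)) ^+ 2.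
Proof.
apply: (E_le_cst wZ (egro_sqr_gup ww kw L0 mF FL s0)) => z.
have /andP[h1 h2] := gup_bound1 ww kw L0 mF FL s0 z; rewrite lerXn2r ?nnegrE//.
by rewrite divr_ge0// ltW.
Qed.

Lemma bary_le : norm2 b <= L / (1 + s).
Proof.
have l1 : 0 <= L / (1 + s) by rewrite divr_ge0// ltW.
rewrite -(@ler_pXn2r _ 2)// ?nnegrE ?norm2_ge0//; apply: le_trans E_sqr_le.
rewrite -subr_ge0 -(sum_Var wZ eg); apply: sumr_ge0 => i _; exact: Var_ge0.
Qed.

Lemma bary_ge : (L / (1 + s)) ^+ 2 - 34 * e / (1 + s) <= norm2 b ^+ 2.
Proof.
(* The second noise increment is taken equal to [s]; this gives the constant 32, and 34 adds the 2
   of [E_sqr_gup_ge]. *)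
have h1 := sum_Var_gup ww kw L0 mF FL s0 s0 sT KLF; rewrite (sum_Var wZ eg) in h1.
have h2 := E_sqr_gup_ge ww kw L0 mF FL s0 KLF.
have id : (1 + (2 * s + s) / s) * (2 / (1 + s) * ((s + s) / s) * (2 * e)) = 32 * e / (1 + s).
  by field; rewrite !gt_eqF.
rewrite id in h1; rewrite -/Zs in h2; rewrite -/b in h1.
have -> : 34 * e / (1 + s) = 32 * e / (1 + s) + 2 * e / (1 + s) by field; rewrite gt_eqF.
move: h1 h2; set p := 32 * e / _; set q := 2 * e / _; set r := _ ^+ 2; set t := E _ _; set z := norm2 b ^+ 2.
lra.
Qed.

Let l y := dot y b.
(** Gaussian minus actual cumulant function in the direction [b]. The mean of [x . b] is not
    subtracted, since only second differences of [k] are used. *)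
Let k t := t ^+ 2 / 2 * dot b b - lnE w (fun x => t * dot x b).

Let u := up s w F.
Let lu : lgro u := lgro_up ww kw L0 mF FL s0.
Let eu : egro u := lgro_egro lu.
Let lh : lgro (fun x => 2^-1 * dot x b). Proof. exact/lgroZ/lgro_dot. Qed.
Let lb : lgro (fun x => dot x b) := lgro_dot b.
Let tu : tilt (sm s w) u = Zs. Proof. exact: tilt_up s0 ww lF. Qed.

(** The logarithmic Sobolev inequality on the way from half the linear tilt to the full tilt [u].
    Its slope is $|g - b/2|$ with $g$ the noisy gradient, and since $g$ has mean [b], the mean
    square is $E|g|^2 - 3|b|^2/4$. *)
Let half_lower : KL (sm s w) u - 2^-1 * E Zs (fun y => dot y b) +
  lnE (sm s w) (fun x => 2^-1 * dot x b) <=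
  (1 + s) / 2 * (E Zs (fun y => norm2 (gup s w F y) ^+ 2) - 3 / 4 * dot b b).
Proof.
have wh := wt_tilt ws lh; have lq := lgroB lu lh.
have Ni0 : 0 < (1 + s)^-1 by rewrite invr_gt0.
have slh := slc_tilt_dot b 2^-1 ws (slc_sm1 ww kw s0).
have C0 : 0 <= s^-1 ^+ 2 * tiltvar 1 L by rewrite mulr_ge0 ?sqr_ge0// ltW// tiltvar_gt0.
pose G z := norm2 (gup s w F z - 2^-1 *: b).
have mG : measurable_fun setT G.
  apply: measurable_norm2; apply: measurable_rVB; last exact: measurable_cst.
  exact: (measurable_gup_rV ww s0 mF FL).
have GB z : 0 <= G z <= L / (1 + s) + norm2 (2^-1 *: b).
  rewrite norm2_ge0/= /G (le_trans (norm2D _ _))// norm2N lerD2r.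
  by case/andP: (gup_bound1 ww kw L0 mF FL s0 z).
have tay x z : (u x - 2^-1 * dot x b) - (u z - 2^-1 * dot z b) <=
   G z * norm2 (x - z) + s^-1 ^+ 2 * tiltvar 1 L * dot (x - z) (x - z).
  have h := up_taylor ww kw ltr01 s0 L0 mF FL x z.
  have h2 := cauchy_schwarz (gup s w F z - 2^-1 *: b) (x - z).
  rewrite -/(G z) (dotBl _ (2^-1 *: b)) (dotZl 2^-1 b) (dotBr x z b) (dotC b x) (dotC b z) in h2; move: h h2; rewrite -/u.
  set p := norm2 _; set q := dot (gup _ _ _ _) _; set r := _ * tiltvar _ _ * _; set c := G z * _.
  move: (u x) (u z) (dot x b) (dot z b) p q r c => ux uz xb zb p q r c; lra.
have := local_lsi wh slh Ni0 C0 lq mG GB tay.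
have tt : tilt (tilt (sm s w) (fun x => 2^-1 * dot x b)) (fun x => u x - 2^-1 * dot x b) = Zs.
  rewrite tiltD -tu; congr (tilt _ _); apply/funext => x; by rewrite addrC subrK.
have EG : E Zs (fun x => G x ^+ 2) = E Zs (fun y => norm2 (gup s w F y) ^+ 2) - 3 / 4 * dot b b.
  have -> : E Zs (fun x => G x ^+ 2) = E Zs (fun x => norm2 (gup s w F x) ^+ 2 - dot (gup s w F x) b + 4^-1 * dot b b).
    apply: eq_E => x; rewrite /G !sqr_norm2; move: b (gup s w F x) => b' g.
    by rewrite !dotBl !dotBr !dotZl !dotZr (dotC b' g); field.
  have e1 := egro_sqr_gup ww kw L0 mF FL s0; have e2 := egro_dot_vec b eg.
  rewrite (ED wZ (egroB e1 e2) (egro_cst _ _)) (EB wZ e1 e2) (E_cst _ wZ) -(dot_vmean b wZ eg) -/b.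
  by field.
rewrite /KL tt EG (EB wZ eu (lgro_egro lh)) (EZ _ wZ (egro_dot b)).
have lnq := lnED ws lh lq.
have uE : (fun x => 2^-1 * dot x b + (u x - 2^-1 * dot x b)) = u by apply/funext => x; rewrite addrC subrK.
rewrite uE in lnq; rewrite tu lnq => h.
apply: le_trans (_ : _ <= _) (le_trans h _).
  set p := lnE _ _; set q := lnE _ _; set r := E _ _; set t := E _ _; move: p q r t {h lnq} => p q r t; lra.
rewrite le_eqVlt; apply/orP; left; apply/eqP; field; by rewrite gt_eqF.
Qed.

(** Twice [half_lower] bounds the cumulant at 1/2 from above, Donsker-Varadhan for [x . b] the one
    at 1 from below; their sum no longer contains the mean of [x . b] under [Zs]. What remains is
    compared through the nearly extreme values of the entropy and of $|b|^2$. *)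
Lemma kappa_le : k 1 - 2 * k 2^-1 <= 19 * e.
Proof.
have Ni0 : 0 < (1 + s)^-1 by rewrite invr_gt0.
have l1 : 0 <= L / (1 + s) by rewrite divr_ge0// ltW.
have DV := donsker_varadhan ws lu lb; rewrite tu in DV.
have K1 := KL_sm_ge ww kw L0 mF FL s0 KLF; rewrite -/u in K1.
have K2 := lip_KL ws (slc_sm1 ww kw s0) Ni0 l1 (measurable_up ww s0 mF FL) (up_lip1 ww kw L0 mF FL s0).
rewrite -/u in K2.
have h2 := half_lower; rewrite (lnE_sm_dot _ b s0 ww) in h2.
have m1 := lnE_sm_dot 1 b s0 ww.
have d1 : (fun y => 1 * dot y b) = (fun y => dot y b) by apply/funext => y; rewrite mul1r.
rewrite d1 in m1; rewrite m1 in DV.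
have bg := bary_ge; rewrite sqr_norm2 in bg.
rewrite /k d1; set l' := (L / (1 + s)) ^+ 2 in bg.
have id1 : (L / (1 + s)) ^+ 2 / (2 * (1 + s)^-1) = (1 + s) / 2 * l' by rewrite /l'; field; rewrite gt_eqF.
have id2 : L ^+ 2 / (2 * (1 + s)) = (1 + s) / 2 * l' by rewrite /l'; field; rewrite gt_eqF.
rewrite id1 in K2; rewrite id2 in K1.
have E2 := E_sqr_le; rewrite -/l' in E2.
have p0 : 0 <= (1 + s) / 2 by rewrite divr_ge0// ltW.
have h3 := ler_wpM2l p0 E2; have h4 := ler_wpM2l p0 bg.
have id3 : (1 + s) / 2 * (l' - 34 * e / (1 + s)) = (1 + s) / 2 * l' - 17 * e by field; rewrite gt_eqF.
rewrite id3 in h4; rewrite mulrBr in h2; move: h2 h3 h4 K1 K2 DV.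
set KK := KL _ _; set B := E Zs (fun y => dot y b); set q := E Zs _.
set a1 := lnE _ _; set a2 := lnE _ _; set bb := dot b b.
move: KK B q a1 a2 bb l' {bg id1 id2 id3 E2 p0} => KK B q a1 a2 bb l'; lra.
Qed.

(** The left side is the second derivative of [k] at [c]. As [k 0 = 0], the second difference of [k]
    is bounded by [kappa_le], and $76 = 4 \cdot 19$. *)
Lemma direction_var : exists c, 0 < c < 1 /\
  dot b b - Var (tilt w (fun x => c * dot x b)) (fun x => dot x b) <= 76 * e.
Proof.
pose k1 t := t * dot b b - E (tilt w (fun x => t * dot x b)) (fun x => dot x b).
pose k2 t := dot b b - Var (tilt w (fun x => t * dot x b)) (fun x => dot x b).
have d1 t : is_derive t (1 : R) k (k1 t).
  have D := is_deriveB (is_deriveZ (dot b b / 2) (is_deriveM (is_derive_id t (1 : R)) (is_derive_id t (1 : R))))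
     (lnE_derive t ww lb).
  have -> : k = (dot b b / 2) *: (id * id)%R \- (fun t => lnE w (fun x => t * dot x b)).
    by apply/funext => z; rewrite /k !fctE /GRing.scale/=; congr (_ - _); ring.
  by apply: (is_derive_eq D); rewrite /k1 /GRing.scale/=; field.
have d2 t : is_derive t (1 : R) k1 (k2 t).
  have D := is_deriveB (is_deriveZ (dot b b) (is_derive_id t (1 : R))) (E_tilt_derive t ww (egro_dot b) lb).
  have -> : k1 = (dot b b) *: id \- (fun t => E (tilt w (fun x => t * dot x b)) (fun x => dot x b)).
    by apply/funext => z; rewrite /k1 !fctE /GRing.scale/= mulrC.
  by apply: (is_derive_eq D); rewrite /k2 /GRing.scale/= mulr1.
have [c [c01 hc]] := second_difference d1 d2.
exists c; split => //; rewrite -/(k2 c).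
have k0 : k 0 = 0.
  rewrite /k; have -> : (fun x : 'rV[R]_n => 0 * dot x b) = (fun=> 0) by apply/funext => x; rewrite mul0r.
  by rewrite (lnE_cst _ ww); ring.
by move: hc kappa_le; rewrite k0; move: (k 1) (k 2^-1) (k2 c) => p q r; lra.
Qed.

End direction.

Section near_gaussian_direction.
Context (R : realType).

Lemma tiltvar_le (k L L' : R) : 0 < k -> 0 <= L -> L <= L' -> tiltvar k L <= tiltvar k L'.
Proof.
move=> /ltW k1 L0 LL; have L'0 := le_trans L0 LL.
rewrite /tiltvar ler_wpM2l// ler_expR ler_wpM2r//; first by rewrite invr_ge0 mulr_ge0.
by rewrite lerXn2r ?nnegrE ?addr_ge0 ?lerD2r.
Qed.

(** In Herbst's argument [lnE w F - E w F] accumulates [KL w (l F) / l ^ 2], which never exceeds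
    $L^2/2$; a total defect [d] thus leaves a point of [[1/2, 1]] with defect at most [2 d]. Staying
    above 1/2 keeps the rescaled Lipschitz constant comparable to [L]. *)
Lemma KL_rescale n (w F : 'rV[R]_n -> R) (L d : R) : wt w -> slc 1 w -> 0 < L ->
  measurable_fun setT F -> (forall x y, F x - F y <= L * norm2 (x - y)) ->
  L ^+ 2 / 2 - d <= lnE w F - E w F -> 0 <= d ->
  exists a, 2^-1 < a < 1 /\ (a * L) ^+ 2 / 2 - 2 * d <= KL w (fun x => a * F x).
Proof.
move=> ww kw L0 mF FL hd d0; have lF := lip_lgro mF FL.
have h0 : (0 : R) < 2^-1 by rewrite invr_gt0.
have h1 : (2^-1 : R) < 1 by lra.
have D (t : R) : 2^-1 <= t <= 1 -> is_derive t (1 : R) (fun l => lnE w (fun x => l * F x) * l^-1)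
    (KL w (fun x => t * F x) / t ^+ 2).
  by move=> /andP[t1 _]; apply: herbst_derive => //; exact: lt_le_trans t1.
have [a [/andP[a0 a1] ha]] := MVT_is_derive h1 D.
exists a; rewrite a0 a1; split => //.
have half : lnE w (fun x => 2^-1 * F x) <= 2^-1 * E w F + (2^-1 * L) ^+ 2 / 2.
  have mF2 : measurable_fun setT (fun x => 2^-1 * F x) by exact: measurable_funM.
  have := laplace_lip ww kw ltr01 (mulr_ge0 (ltW h0) (ltW L0)) mF2 (lipZ (ltW h0) FL).
  by rewrite (EZ _ ww (lgro_egro lF)) mulr1.
have one : lnE w (fun x => 1 * F x) = lnE w F by congr lnE; apply/funext => x; rewrite mul1r.
rewrite invr1 mulr1 invrK one in ha.
have K : L ^+ 2 / 2 - 2 * d <= KL w (fun x => a * F x) / a ^+ 2.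
  move: ha half hd; set q := _ / _ ^+ 2; set A := lnE w F; set B := lnE w _; set C := E w F.
  by clear; move: q A B C => q A B C; lra.
have a00 : 0 < a := lt_trans h0 a0.
have a2 : 0 < a ^+ 2 by exact: exprn_gt0.
move: K; rewrite (ler_pdivlMr _ _ a2) => K; apply: le_trans K.
have a21 : a ^+ 2 <= 1 by move: a00 a1; clear; move: a => a; nra.
rewrite exprMn; have := ler_piMr d0 a21; clear; move: (a ^+ 2) (L ^+ 2) => A B; lra.
Qed.

Lemma near_gaussian_direction (L0 : R) : 0 < L0 ->
  exists C d0 : R, [/\ 0 < C, 0 < d0 &
    forall n (w F : 'rV[R]_n -> R) d, wt w -> slc 1 w ->
      measurable_fun setT F -> (forall x y, F x - F y <= L0 * norm2 (x - y)) ->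
      0 <= d -> d <= d0 -> L0 ^+ 2 / 2 - d <= lnE w F - E w F ->
      exists sigma t, [/\ norm2 sigma = 1, 0 <= t <= L0 &
        1 - Var (tilt w (fun x => t * dot x sigma)) (fun x => dot x sigma) <= C * d]].
Proof.
(* A noise level that serves for every rescaling [a F] with [a < 1], as [tiltvar] increases with the
   Lipschitz constant. *)
move=> L00; pose s := 2 * tiltvar 1 L0; have s0 : 0 < s by rewrite mulr_gt0// tiltvar_gt0.
have N0 : 0 < 1 + s by exact: addr_gt0.
have L2 : 0 < L0 ^+ 2 by exact: exprn_gt0.
have N2 : 0 < (1 + s) ^+ 2 by exact: exprn_gt0.
(* With defect [2 d], the threshold [d0] makes the loss in [bary_ge] at most half of
   $L_0^2/(4(1+s)^2)$, so that [b3] holds; here $544 = 8 \cdot 68$. Dividing [direction_var] by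
   $|b|^2$ then gives $1216 = 76 \cdot 2 \cdot 8$. *)
have [C CE] : exists C, C = 1216 * (1 + s) ^+ 2 / L0 ^+ 2 by eexists.
have [d0 d0E] : exists d0, d0 = L0 ^+ 2 / (544 * (1 + s)) by eexists.
have C0 : 0 < C by rewrite CE; apply: divr_gt0 L2; apply: mulr_gt0 N2; exact: ltr0Sn.
have d00 : 0 < d0 by rewrite d0E; apply: divr_gt0 L2 _; apply: mulr_gt0 N0; exact: ltr0Sn.
exists C, d0; split=> //.
move=> n w F d ww kw mF FL dge dle hd.
have [a [/andP[a0 a1] KLa]] := KL_rescale ww kw L00 mF FL hd dge.
have a00 : 0 < a by rewrite (lt_trans _ a0)// invr_gt0.
have La : 0 < a * L0 by exact: mulr_gt0.
have aL : a * L0 <= L0 by rewrite ler_piMl// ltW.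
have maF : measurable_fun setT (fun x => a * F x) by exact: measurable_funM.
have aFL := lipZ (ltW a00) FL.
have sT : 2 * tiltvar 1 (a * L0) <= s by rewrite /s ler_wpM2l// tiltvar_le// ltW.
pose b := vmean (sm s (tilt w (fun x => a * F x))) (gup s w (fun x => a * F x)).
have b1 := bary_le ww kw La maF aFL s0; rewrite -/b in b1.
have b2 := bary_ge ww kw La maF aFL s0 sT KLa; rewrite -/b in b2.
have [c [/andP[c0 c1] hc]] := direction_var ww kw La maF aFL s0 sT KLa; rewrite -/b in hc.
have b3 : L0 ^+ 2 / (8 * (1 + s) ^+ 2) <= norm2 b ^+ 2.
  apply: le_trans b2.
  have h1 : L0 ^+ 2 / (4 * (1 + s) ^+ 2) <= (a * L0 / (1 + s)) ^+ 2.
    rewrite expr_div_n exprMn invfM mulrA ler_wpM2r ?invr_ge0 ?sqr_ge0//.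
    rewrite mulrC ler_wpM2r ?sqr_ge0//; have := a0; move: (a) => q; nra.
  have h2 : 34 * (2 * d) / (1 + s) <= L0 ^+ 2 / (8 * (1 + s) ^+ 2).
    have -> : L0 ^+ 2 / (8 * (1 + s) ^+ 2) = 68 * d0 / (1 + s).
      by rewrite d0E; field; rewrite gt_eqF.
    apply: ler_wpM2r; [by rewrite invr_ge0 ltW|]; move: (dle); clear; lra.
  have h3 : L0 ^+ 2 / (4 * (1 + s) ^+ 2) = 2 * (L0 ^+ 2 / (8 * (1 + s) ^+ 2)).
    by field; rewrite gt_eqF.
  rewrite h3 in h1; move: h1 h2; set p := _ / (8 * _); set q := _ ^+ 2; set r := 34 * _ / _.
  by move: p q r => p q r h1 h2; lra.
have nb : 0 < norm2 b.
  rewrite lt_neqAle norm2_ge0 andbT eq_sym; apply/eqP => nb0.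
  move: b3; rewrite nb0 expr0n/= leNgt divr_gt0 ?mulr_gt0 ?exprn_gt0//.
have bE : b = norm2 b *: ((norm2 b)^-1 *: b) by rewrite scalerA mulfV ?scale1r// gt_eqF.
exists ((norm2 b)^-1 *: b), (c * norm2 b); split.
- by rewrite norm2Z ger0_norm ?invr_ge0 ?norm2_ge0// mulVf// gt_eqF.
- have cb0 : 0 <= c * norm2 b by apply: mulr_ge0 (norm2_ge0 _); exact: ltW.
  rewrite cb0/=; apply: le_trans aL.
  apply: (@le_trans _ _ (norm2 b)); first by apply: ler_piMl (norm2_ge0 _) _; exact: ltW.
  apply: le_trans b1 _; rewrite ler_pdivrMr// ler_peMr ?(ltW La)//.
  by rewrite lerDl ltW.
set sig := _ *: b.
have db x : dot x b = norm2 b * dot x sig by rewrite -dotZr -bE.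
have -> : (fun x => c * norm2 b * dot x sig) = (fun x => c * dot x b).
  by apply/funext => x; rewrite db mulrA.
have lb : lgro (fun x : 'rV[R]_n => c * dot x b) by apply: lgroZ; exact: lgro_dot.
have hv : (fun x : 'rV[R]_n => dot x b) = (fun x => norm2 b * dot x sig).
  by apply/funext => x; exact: db.
move: hc; rewrite hv (VarZ _ (wt_tilt ww lb) (egro_dot sig)) -sqr_norm2.
set V := Var _ _; rewrite -[X in X - _]mulr1 -mulrBr => hc.
have nb2 : 0 < norm2 b ^+ 2 by rewrite exprn_gt0.
rewrite -(ler_pM2l nb2); apply: le_trans hc _.
have -> : 76 * (2 * d) = (L0 ^+ 2 / (8 * (1 + s) ^+ 2)) * (C * d).
  by rewrite CE; field; rewrite !gt_eqF.
by apply: ler_wpM2r b3; rewrite mulr_ge0// ltW.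
Qed.

End near_gaussian_direction.

(** * Stein's equation on the line *)

Section half_line_integral.
Context (R : realType).
Local Notation leb := (@lebesgue_measure R).
Implicit Types (f p q : R -> R) (t r : R).

Record eg1 p : Prop := Eg1 {
  eg1_measurable : measurable_fun [set: measurableTypeR R] p;
  eg1_bound : exists A, 0 <= A /\ forall r, `|p r| <= A * expR (A * `|r|) }.

Lemma eg1_cst (a : R) : eg1 (fun=> a).
Proof.
split; first exact: measurable_cst.
by exists `|a|; split => // r; rewrite ler_peMr// -expR0 ler_expR mulr_ge0.
Qed.

Lemma eg1_lip (L : R) p : (forall r s, `|p r - p s| <= L * `|r - s|) ->
  measurable_fun [set: measurableTypeR R] p -> eg1 p.
Proof.
move=> pl mp; split => //; exists (Num.max (`|p 0|) L + 1).
have A0 : 0 <= Num.max (`|p 0|) L by rewrite le_max normr_ge0.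
split; first exact: addr_ge0.
move=> r; have := pl r 0; rewrite subr0 => h.
have h1 : `|p r| <= `|p 0| + L * `|r|.
  by rewrite -[p r](subrK (p 0)) (le_trans (ler_normD _ _))// addrC lerD2l.
apply: (le_trans h1); set M := Num.max _ _ in A0 *.
have hM1 : `|p 0| <= M by rewrite le_max lexx.
have hM2 : L <= M by rewrite le_max lexx orbT.
apply: (@le_trans _ _ ((M + 1) * (1 + `|r|))).
  have := normr_ge0 r; move: `|r| `|p 0| hM1 hM2 A0 => a b; nra.
rewrite ler_wpM2l ?addr_ge0//; apply: le_trans (expR_ge1Dx _) _.
by rewrite ler_expR ler_peMl// lerDr.
Qed.

Lemma eg1_id : eg1 id.
Proof. by apply: (@eg1_lip 1) => // r s; rewrite mul1r. Qed.

Lemma eg1D p q : eg1 p -> eg1 q -> eg1 (fun r => p r + q r).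
Proof.
move=> [mp [A [A0 hA]]] [mq [B [B0 hB]]]; split; first exact: measurable_funD.
exists (A + B); split; first exact: addr_ge0.
move=> r; rewrite (le_trans (ler_normD _ _))// mulrDl lerD//.
  by rewrite (le_trans (hA r))// ler_wpM2l// ler_expR ler_wpM2r// lerDl.
by rewrite (le_trans (hB r))// ler_wpM2l// ler_expR ler_wpM2r// lerDr.
Qed.

Lemma eg1M p q : eg1 p -> eg1 q -> eg1 (fun r => p r * q r).
Proof.
move=> [mp [A [A0 hA]]] [mq [B [B0 hB]]]; split; first exact: measurable_funM.
exists (A * B + (A + B)); have AB0 := addr_ge0 A0 B0; have AB := mulr_ge0 A0 B0.
split; first exact: addr_ge0.
move=> r; rewrite normrM; apply: le_trans (ler_pM _ _ (hA r) (hB r)) _ => //.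
rewrite mulrACA -expRD ler_pM ?expR_ge0// ?lerDl//.
by rewrite ler_expR -mulrDl ler_wpM2r// lerDr.
Qed.

Lemma eg1N p : eg1 p -> eg1 (fun r => - p r).
Proof.
move=> ep; rewrite (_ : (fun r => _) = fun r => -1 * p r); last by apply/funext => r; rewrite mulN1r.
exact: eg1M (eg1_cst _) ep.
Qed.

Lemma eg1_norm p : eg1 p -> eg1 (fun r => `|p r|).
Proof.
move=> [mp [A [A0 hA]]]; split; first exact: measurableT_comp.
by exists A; split => // r; rewrite normr_id.
Qed.

Definition g1 r : R := expR (- (r ^+ 2 / 2)).

Lemma g1_gt0 r : 0 < g1 r. Proof. exact: expR_gt0. Qed.

Lemma eg1_gdom1 p : eg1 p -> gdom1 (fun r => p r * g1 r).
Proof.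
move=> [mp [A [A0 hA]]]; split.
  apply: measurable_funM => //; apply: measurableT_comp => //; apply: measurableT_comp => //.
  by apply: measurable_funM => //; exact: measurable_funX.
exists (A * expR (A ^+ 2)), 4^-1; split; first by rewrite invr_gt0.
move=> r; rewrite normrM (gtr0_norm (g1_gt0 r)).
apply: le_trans (ler_wpM2r (ltW (g1_gt0 r)) (hA r)) _.
rewrite -!mulrA ler_wpM2l// /g1 -!expRD ler_expR -[r ^+ 2]real_normK ?num_real//.
have := sqr_ge0 (A - `|r| / 2); move: `|r| => a h; lra.
Qed.

Lemma eg1_integrable p : eg1 p -> leb.-integrable setT (EFin \o (fun r => p r * g1 r)).
Proof. by move=> ep; apply/gdom1_integrable/eg1_gdom1. Qed.

Definition Il p t := \int[leb]_(r in `]-oo, t]) (p r * g1 r).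

Let mI t : measurable (`]-oo, t]%classic : set (measurableTypeR R)). Proof. exact: measurable_itv. Qed.

Let intI p t : eg1 p -> leb.-integrable `]-oo, t] (EFin \o (fun r => p r * g1 r)).
Proof. by move=> ep; apply: integrableS (eg1_integrable ep) => //; exact: mI. Qed.

Lemma IlD p q t : eg1 p -> eg1 q -> Il (fun r => p r + q r) t = Il p t + Il q t.
Proof.
move=> ep eq; rewrite /Il -(RintegralD (mI t) (intI t ep) (intI t eq)).
by apply: eq_Rintegral => r _; rewrite mulrDl.
Qed.

Lemma IlZ (a : R) p t : eg1 p -> Il (fun r => a * p r) t = a * Il p t.
Proof.
move=> ep; rewrite /Il -(RintegralZl _ (mI t) (intI t ep)).
by apply: eq_Rintegral => r _; rewrite mulrA.
Qed.

Lemma eq_Il p q t : p =1 q -> Il p t = Il q t.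
Proof. by move=> pq; apply: eq_Rintegral => r _; rewrite pq. Qed.

Lemma Il_ge0 p t : eg1 p -> (forall r, r <= t -> 0 <= p r) -> 0 <= Il p t.
Proof.
move=> ep p0; apply: Rintegral_ge0 => r /=; rewrite in_itv/= => rt.
by rewrite mulr_ge0 ?p0// ltW// g1_gt0.
Qed.

Lemma Il_le p q t : eg1 p -> eg1 q -> (forall r, r <= t -> p r <= q r) -> Il p t <= Il q t.
Proof.
move=> ep eq pq; rewrite -subr_ge0 -mulN1r -(IlZ _ _ ep) -IlD//; last exact: eg1M (eg1_cst _) ep.
apply: Il_ge0 => [|r rt]; first exact: eg1D eq (eg1M (eg1_cst _) ep).
by rewrite mulN1r subr_ge0 pq.
Qed.

Lemma Il_norm p q t : eg1 p -> eg1 q -> (forall r, r <= t -> `|p r| <= q r) -> `|Il p t| <= Il q t.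
Proof.
move=> ep eq pq; rewrite ler_norml; apply/andP; split.
  rewrite -mulN1r -(IlZ _ _ eq); apply: Il_le => //; first exact: eg1M (eg1_cst _) eq.
  by move=> r rt; rewrite mulN1r; have := pq r rt; rewrite ler_norml => /andP[].
by apply: Il_le => // r rt; rewrite (le_trans (ler_norm _))// pq.
Qed.

Lemma Il_le_total p t : eg1 p -> (forall r, 0 <= p r) -> Il p t <= \int[leb]_r (p r * g1 r).
Proof.
move=> ep p0; rewrite /Il -lee_fin (EFin_Rint (eg1_integrable ep)).
have -> : ((\int[leb]_(r in `]-oo, t]) (p r * g1 r))%:E = \int[leb]_(r in `]-oo, t]) (p r * g1 r)%:E)%E.
  by rewrite fineK//; exact: integrable_fin_num (intI t ep).
apply: ge0_subset_integral => //.
- by apply/measurable_EFinP; exact: gdom1_measurable (eg1_gdom1 ep).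
- by move=> r _; rewrite lee_fin mulr_ge0// ltW// g1_gt0.
Qed.

Lemma Il_decay p : eg1 p -> exists A, 0 <= A /\ forall t, t < 0 -> `|t| * `|Il p t| <= A.
Proof.
move=> ep; exists (\int[leb]_r ((`|r| * `|p r|) * g1 r)).
have ea : eg1 (fun r => `|r| * `|p r|) by apply: eg1M; apply: eg1_norm => //; exact: eg1_id.
split; first by apply: Rintegral_ge0 => r _; rewrite !mulr_ge0// ltW// g1_gt0.
move=> t t0; apply: le_trans (Il_le_total t ea _); last by move=> r; rewrite mulr_ge0.
apply: (@le_trans _ _ (`|t| * Il (fun r => `|p r|) t)).
  by rewrite ler_wpM2l//; apply: Il_norm => //; exact: eg1_norm.
rewrite -(IlZ _ _ (eg1_norm ep)); apply: Il_le => //; first exact: eg1M (eg1_cst _) (eg1_norm ep).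
move=> r rt; rewrite ler_wpM2r// (ltr0_norm t0) ltr0_norm ?lerN2//.
exact: le_lt_trans t0.
Qed.

Lemma continuous_g1 : continuous (g1 : R -> R).
Proof.
move=> r; apply: continuous_comp; last exact: continuous_expR.
apply: cvgN; apply: cvgM; last exact: cvg_cst.
exact: exprn_continuous.
Qed.

Lemma Il_derive p t : eg1 p -> continuous (p : R -> R) -> is_derive t (1 : R) (Il p) (p t * g1 t).
Proof.
move=> ep cp; have lt1 : t < t + 1 by rewrite ltrDl.
have := @continuous_FTC1 R (fun r => p r * g1 r) -oo%O t (t + 1) lt1 (intI _ ep).
move=> /(_ (ltNyr _)) []; first by apply: cvgM; [exact: cp|exact: continuous_g1].
move=> d1 d2; apply: DeriveDef; first exact: d1.
by rewrite -derive1E.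
Qed.

(** [Il p] is the primitive of [p * g1] vanishing at minus infinity; boundedness of $|t||q(t)|$ is a
    convenient sufficient form of that decay. Closed forms of [Il] are obtained by differentiation
    instead of integration by parts. *)
Lemma Il_unique p q t : eg1 p -> continuous (p : R -> R) ->
  (forall t, is_derive t (1 : R) q (p t * g1 t)) ->
  (exists A, 0 <= A /\ forall t, t < 0 -> `|t| * `|q t| <= A) -> Il p t = q t.
Proof.
move=> ep cp dq [A [A0 hA]]; have [B [B0 hB]] := Il_decay ep.
have D r : is_derive r (1 : R) (fun r => Il p r - q r) 0.
  by have D := is_deriveB (Il_derive r ep cp) (dq r); apply: (is_derive_eq D); rewrite subrr.
have cst r : r < t -> Il p r - q r = Il p t - q t.
  move=> rt; have [c [_ h]] := MVT_is_derive rt (fun x _ => D x).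
  by apply/eqP; rewrite eq_sym -subr_eq0 h mul0r.
apply/eqP; rewrite -subr_eq0; apply/negP => /negP; rewrite -normr_gt0 => d0.
set d := `|_| in d0.
pose r := - ((A + B) / d + `|t| + 1).
have AB : 0 <= (A + B) / d by rewrite divr_ge0 ?addr_ge0// ltW.
have tt := ler_norm (- t); rewrite normrN in tt; have t1 := normr_ge0 t.
have r0 : r < 0 by rewrite /r; lra.
have rt : r < t by rewrite /r; lra.
have h1 : `|r| * d <= `|r| * `|Il p r| + `|r| * `|q r|.
  by rewrite -mulrDr ler_wpM2l// /d -(cst r rt) ler_normB.
have h2 := le_trans h1 (lerD (hB r r0) (hA r r0)).
have rE : `|r| = (A + B) / d + `|t| + 1 by rewrite (ltr0_norm r0) /r opprK.
move: h2; rewrite rE [B + A]addrC [(_ + 1) * d]mulrDl [(_ + `|t|) * d]mulrDl mulfVK ?gt_eqF// mul1r.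
have := mulr_ge0 t1 (ltW d0); lra.
Qed.


Lemma continuous_lip (L : R) p : (forall r s, `|p r - p s| <= L * `|r - s|) -> continuous (p : R -> R).
Proof.
move=> pl r; apply/cvgrPdist_le => e e0; near=> s.
have A1 : 0 < `|L| + 1 by rewrite ltr_pwDr.
apply: (@le_trans _ _ ((`|L| + 1) * `|r - s|)).
  apply: (le_trans (pl r s)); rewrite ler_wpM2r// (le_trans (ler_norm _))// lerDl//.
rewrite mulrC -ler_pdivlMr//; near: s.
apply/nbhs_ballP; exists (e / (`|L| + 1)) => /=; first by rewrite divr_gt0.
by move=> x /= /ltW.
Unshelve. all: by end_near. Qed.

Let ec := eg1_cst.
Let eid : eg1 (fun r => r). Proof. exact: eg1_id. Qed.
Let eN : eg1 (fun r => - r). Proof. exact: eg1N. Qed.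

Lemma is_derive_g1 t : is_derive t (1 : R) g1 (- t * g1 t).
Proof.
have D0 : is_derive t (1 : R) (fun t : R => - (t ^+ 2 / 2)) (- t).
  have D := is_deriveZ (- 2^-1 : R) (is_deriveM (is_derive_id t (1 : R)) (is_derive_id t (1 : R))).
  have -> : (fun t : R => - (t ^+ 2 / 2)) = (- 2^-1 : R) *: (id * id)%R.
    by apply/funext => z; rewrite !fctE /GRing.scale/=; field.
  by apply: (is_derive_eq D); rewrite /GRing.scale/=; field.
have D := @is_derive1_comp R (@expR R) (fun t => - (t ^+ 2 / 2)) t _ _ (is_derive_expR _) D0.
by apply: (is_derive_eq D); rewrite mulrC.
Qed.

Lemma g1_decay : exists A, 0 <= A /\ forall t : R, t ^+ 2 * g1 t <= A.
Proof.
exists 2; split => // t; rewrite /g1 expRN ler_pdivrMr ?expR_gt0//.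
have := expR_ge1Dx (t ^+ 2 / 2); lra.
Qed.

Lemma Il_opp t : Il (fun r => - r) t = g1 t.
Proof.
apply: (Il_unique t eN) => [|r|].
- by move=> r; apply: cvgN; exact: cvg_id.
- exact: is_derive_g1.
have [A [A0 hA]] := g1_decay; exists (A + 1); split; first exact: addr_ge0.
move=> s _; rewrite (gtr0_norm (g1_gt0 s)).
have := hA s; have h1 : g1 s <= 1 by rewrite /g1 -expR0 ler_expR oppr_le0 mulr_ge0 ?sqr_ge0.
have := g1_gt0 s; rewrite -[s ^+ 2]real_normK ?num_real//; move: (g1 s) h1 `|s| => a a1 b a0 h.
have [b1|b1] := leP b 1.
  have : b * a <= a by rewrite ler_piMl// ltW.
  lra.
have : b * a <= b ^+ 2 * a.
  by apply: (ler_wpM2r (ltW a0)); rewrite expr2 ler_peMl ?(ltW b1)// ltW// (lt_trans _ b1).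
lra.
Qed.

Definition Phi1 t := Il (fun=> 1) t.

Lemma Phi1_ge0 t : 0 <= Phi1 t. Proof. exact: Il_ge0. Qed.

Lemma Il_sqr t : Il (fun r => r ^+ 2) t = Phi1 t - t * g1 t.
Proof.
have e2 : eg1 (fun r => r ^+ 2) by exact: (eg1M eid eid).
apply: (@Il_unique _ (fun t => Phi1 t - t * g1 t) t e2) => [r|r|].
- exact: exprn_continuous.
- have D := is_deriveB (Il_derive r (ec 1) (@cst_continuous _ _ (1 : R))) (is_deriveM (is_derive_id r (1 : R)) (is_derive_g1 r)).
  by apply: (is_derive_eq D); rewrite /GRing.scale/=; ring.
have [A [A0 hA]] := g1_decay; have [B [B0 hB]] := Il_decay (ec 1).
exists (B + A); split; first exact: addr_ge0.
move=> s s0; apply: (@le_trans _ _ (`|s| * `|Phi1 s| + s ^+ 2 * g1 s)); last by rewrite lerD// hB.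
rewrite -[s ^+ 2]real_normK ?num_real// expr2 -mulrA -mulrDr ler_wpM2l//.
by rewrite (le_trans (ler_normB _ _))// normrM (gtr0_norm (g1_gt0 s)).
Qed.

(** The right side integrates the nonnegative function $t - r$ up to [t]; [mills1] does the same
    with $(t-r)^2$. Together they bound the Gaussian tail from both sides. *)
Lemma mills0 t : 0 <= t * Phi1 t + g1 t.
Proof.
have : 0 <= Il (fun r => t * 1 + - r) t.
  apply: Il_ge0 => [|r rt]; first exact: eg1D (eg1M (ec t) (ec 1)) eN.
  by rewrite mulr1 subr_ge0.
by rewrite (IlD t (eg1M (ec t) (ec 1)) eN) (IlZ t t (ec 1)) Il_opp.
Qed.

Lemma mills1 t : 0 <= (t ^+ 2 + 1) * Phi1 t + t * g1 t.
Proof.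
have e2 : eg1 (fun r => r ^+ 2) by exact: (eg1M eid eid).
have e3 := eg1M (ec (t ^+ 2)) (ec 1); have e4 := eg1M (ec (2 * t)) eN.
have : 0 <= Il (fun r => t ^+ 2 * 1 + (2 * t) * (- r) + r ^+ 2) t.
  apply: Il_ge0 => [|r rt]; first exact: eg1D (eg1D e3 e4) e2.
  by have := sqr_ge0 (t - r); rewrite sqrrB; lra.
rewrite (IlD t (eg1D e3 e4) e2) (IlD t e3 e4) (IlZ _ t (ec 1)) (IlZ _ t eN) Il_opp Il_sqr /Phi1.
by move=> h; apply: le_trans h _; rewrite le_eqVlt; apply/orP; left; apply/eqP; ring.
Qed.

Definition gmass1 := \int[leb]_r (1 * g1 r).

Lemma gmass1_gt0 : 0 < gmass1.
Proof.
apply: Rint_gt0; first exact: (eg1_integrable (ec 1)).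
  by move=> r; rewrite mul1r g1_gt0.
exact: lebT_neq0.
Qed.

(** Bounds [Phi1 / g1] on the negative half-line: by 1 up to -1, from [mills0], and by the total
    mass over the smallest value $e^{-1/2}$ of [g1] on $[-1, 0]$. *)
Definition mills_cst := 1 + gmass1 * expR (2^-1).

Lemma mills_cst_ge1 : 1 <= mills_cst.
Proof. by rewrite lerDl mulr_ge0 ?expR_ge0// ltW// gmass1_gt0. Qed.

Lemma Phi1_le t : t <= 0 -> Phi1 t <= mills_cst * g1 t.
Proof.
move=> t0; have [t1|t1] := leP t (-1).
  apply: (@le_trans _ _ (g1 t)); last by rewrite ler_peMl ?mills_cst_ge1// ltW// g1_gt0.
  by have := mills0 t; have := Phi1_ge0 t; move: (Phi1 t) (g1 t) => a b; nra.
apply: (@le_trans _ _ gmass1); first exact: Il_le_total.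
apply: (@le_trans _ _ (gmass1 * expR (2^-1) * g1 t)).
  rewrite -mulrA; apply: ler_peMr; first exact/ltW/gmass1_gt0.
  rewrite /g1 -expRD -[X in X <= _]expR0 ler_expR.
  have : t ^+ 2 <= 1 by move: t0 t1; move: t => t; nra.
  lra.
by rewrite ler_wpM2r ?lerDr// ltW// g1_gt0.
Qed.

Lemma leb_opp (D : set (measurableTypeR R)) (f : R -> R) : measurable D ->
  measurable_fun [set: measurableTypeR R] f ->
  leb.-integrable ((-%R : R -> measurableTypeR R) @^-1` D) (EFin \o (fun r => f (- r))) ->
  \int[leb]_(r in D) f r = \int[leb]_(r in (-%R : R -> measurableTypeR R) @^-1` D) f (- r).
Proof.
move=> mD mf fi; rewrite /Rintegral; congr fine.
have mN : measurable_fun [set: measurableTypeR R] (-%R : R -> measurableTypeR R) by exact: oppr_measurable.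
rewrite -[RHS](@integral_pushforward _ _ _ _ _ _ mN leb D (EFin \o f))//.
  by apply: eq_measure_integral => A mA _; exact/esym/lebesgue_measureN.
exact/measurable_EFinP.
Qed.

Lemma g1N r : g1 (- r) = g1 r. Proof. by rewrite /g1 sqrrN. Qed.

Lemma eg1_opp p : eg1 p -> eg1 (fun r => p (- r)).
Proof.
move=> [mp [A [A0 hA]]]; split; last by exists A; split => // r; have := hA (- r); rewrite normrN.
by apply: measurableT_comp => //; exact: oppr_measurable.
Qed.

Lemma Rint_opp p : eg1 p -> \int[leb]_r (p (- r) * g1 r) = \int[leb]_r (p r * g1 r).
Proof.
move=> ep; rewrite [RHS](@leb_opp setT (fun r => p r * g1 r))//=.
- by rewrite preimage_setT; apply: eq_Rint => r; rewrite g1N.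
- exact: gdom1_measurable (eg1_gdom1 ep).
- rewrite preimage_setT (_ : (EFin \o _) = EFin \o (fun r => p (- r) * g1 r)).
    exact/eg1_integrable/eg1_opp.
  by apply/funext => r /=; rewrite g1N.
Qed.

(** Reduces positive [t], where dividing [Il] by [g1] would be disastrous, to negative [t]: for a
    centred integrand the total integral vanishes. *)
Lemma Il_reflect p t : eg1 p -> Il p t = \int[leb]_r (p r * g1 r) - Il (fun r => p (- r)) (- t).
Proof.
move=> ep; have ei := eg1_integrable ep.
have e2 : leb.-integrable [set` Interval (BInfty R true) (BInfty R false)] (EFin \o (fun r => p r * g1 r)).
  by rewrite set_itvNyy.
have := @Rintegral_itvB _ _ (BInfty R true) (BInfty R false) t e2 isT isT.
rewrite set_itvNyy -/(Il p t) => /eqP; rewrite subr_eq => /eqP ->.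
suff -> : \int[leb]_(r in [set` Interval (BRight t) (BInfty R false)]) (p r * g1 r) = Il (fun r => p (- r)) (- t).
  by rewrite addrAC subrr add0r.
rewrite Rintegral_itv_obnd_cbnd; last exact: integrableS ei.
have pe : (-%R : R -> measurableTypeR R) @^-1` [set` Interval (BLeft t) (BInfty R false)] = `]-oo, - t]%classic.
  by rewrite opp_preimage_itvbndy.
rewrite (@leb_opp _ (fun r => p r * g1 r))//.
- by rewrite pe; apply: eq_Rintegral => r _; rewrite g1N.
- exact: gdom1_measurable (eg1_gdom1 ep).
- rewrite pe; have := intI (- t) (eg1_opp ep).
  by apply: eq_integrable => // r _ /=; rewrite g1N.
Qed.

Definition mean1 p := \int[leb]_r (p r * g1 r) / gmass1.

Let gm0 : 0 < gmass1 := gmass1_gt0.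

Lemma mean1_lin p (a b : R) : eg1 p -> mean1 (fun r => a + b * p r) = a + b * mean1 p.
Proof.
move=> ep; rewrite /mean1.
have -> : \int[leb]_r ((a + b * p r) * g1 r) = a * gmass1 + b * \int[leb]_r (p r * g1 r).
  rewrite /gmass1 -(RintegralZl _ measurableT (eg1_integrable (ec 1))).
  rewrite -(RintegralZl _ measurableT (eg1_integrable ep)).
  have e1 := eg1_integrable (eg1M (ec a) (ec 1)); have e2 := eg1_integrable (eg1M (ec b) ep).
  have := RintegralD measurableT e1 e2.
  have -> : \int[leb]_r (a * 1 * g1 r) = \int[leb]_r (a * (1 * g1 r)) by apply: eq_Rint => r; rewrite mulrA.
  have -> : \int[leb]_r (b * p r * g1 r) = \int[leb]_r (b * (p r * g1 r)) by apply: eq_Rint => r; rewrite mulrA.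
  by move=> <-; apply: eq_Rint => r; rewrite mulr1 mulrDl.
by field; rewrite gt_eqF.
Qed.

Lemma mean1_le p q : eg1 p -> eg1 q -> (forall r, p r <= q r) -> mean1 p <= mean1 q.
Proof.
move=> ep eq pq; rewrite ler_wpM2r ?invr_ge0 ?(ltW gm0)//.
by apply: ler_Rint => [||r]; [exact: eg1_integrable|exact: eg1_integrable|rewrite ler_wpM2r// ltW// g1_gt0].
Qed.

Lemma mean1_dist p q (a : R) : eg1 p -> eg1 q -> (forall r, `|p r - q r| <= a) ->
  `|mean1 p - mean1 q| <= a.
Proof.
move=> ep eq pq; rewrite ler_distl.
have h1 : mean1 p <= mean1 (fun r => a + 1 * q r).
  apply: mean1_le => [//||r]; first exact: eg1D (ec a) (eg1M (ec 1) eq).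
  by have := pq r; rewrite mul1r ler_norml; lra.
have h2 : mean1 (fun r => - a + 1 * q r) <= mean1 p.
  apply: mean1_le => [||r]//; first exact: eg1D (ec (- a)) (eg1M (ec 1) eq).
  by have := pq r; rewrite mul1r ler_norml; lra.
by move: h1 h2; rewrite !mean1_lin// !mul1r => h1 h2; apply/andP; split; lra.
Qed.

Definition absmean := mean1 (fun r => `|r|).

Lemma absmean_ge0 : 0 <= absmean.
Proof. by rewrite mulr_ge0 ?invr_ge0 ?(ltW gm0)//; apply: Rintegral_ge0 => r _; rewrite mulr_ge0 ?(ltW (g1_gt0 _)). Qed.

Section stein_solution.
Variable psi : R -> R.
Hypothesis psil : forall r s, `|psi r - psi s| <= `|r - s|.

Lemma lip1_continuous : continuous (psi : R -> R).
Proof. by apply: (@continuous_lip 1) => r s; rewrite mul1r. Qed.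

Lemma lip1_eg1 : eg1 psi.
Proof.
apply: (@eg1_lip 1) => [r s|]; first by rewrite mul1r.
by apply: continuous_measurable_fun; exact: lip1_continuous.
Qed.
Let ep := lip1_eg1.

Definition cent r := psi r - mean1 psi.

Lemma eg1_cent : eg1 cent.
Proof. exact: eg1D ep (ec _). Qed.

Lemma Rint_cent : \int[leb]_r (cent r * g1 r) = 0.
Proof.
have := mean1_lin (- mean1 psi) 1 ep; rewrite mul1r addNr /mean1.
move=> /eqP; rewrite mulf_eq0 invr_eq0 (gt_eqF gm0) orbF => /eqP h.
by rewrite -[RHS]h; apply: eq_Rint => r; rewrite /cent mul1r addrC.
Qed.

Lemma cent_bound r : `|cent r| <= `|r| + absmean.
Proof.
have ea : eg1 (fun r : R => `|r|) by exact: eg1_norm eid.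
have h z : `|psi r - psi z| <= `|r| + 1 * `|z|.
  by rewrite mul1r (le_trans (psil r z))// ler_normB.
have h1 : mean1 psi <= mean1 (fun z => (psi r + `|r|) + 1 * `|z|).
  apply: mean1_le => // [|z]; first exact: eg1D (ec _) (eg1M (ec 1) ea).
  by have := h z; rewrite ler_norml; lra.
have h2 : mean1 (fun z => (psi r - `|r|) + (-1) * `|z|) <= mean1 psi.
  apply: mean1_le => // [|z]; first exact: eg1D (ec _) (eg1M (ec (-1)) ea).
  by have := h z; rewrite ler_norml; lra.
move: h1 h2; rewrite !mean1_lin// -/absmean /cent ler_norml => h1 h2; apply/andP; split; lra.
Qed.

(** The bounded solution of Stein's equation $f' - t f = \psi - \int \psi\, d\gamma$. *)
Definition st t := Il cent t / g1 t.

Lemma st_derive t : is_derive t (1 : R) st (t * st t + cent t).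
Proof.
have cc : continuous (cent : R -> R).
  by move=> r; apply: cvgB; [exact: lip1_continuous|exact: cvg_cst].
have gi : is_derive t (1 : R) (fun t : R => expR (t ^+ 2 / 2)) (t * expR (t ^+ 2 / 2)).
  have D0 : is_derive t (1 : R) (fun t : R => t ^+ 2 / 2) t.
    have D := is_deriveZ (2^-1 : R) (is_deriveM (is_derive_id t (1 : R)) (is_derive_id t (1 : R))).
    have -> : (fun t : R => t ^+ 2 / 2) = (2^-1 : R) *: (id * id)%R.
      by apply/funext => z; rewrite !fctE /GRing.scale/=; field.
    by apply: (is_derive_eq D); rewrite /GRing.scale/=; field.
  have D := @is_derive1_comp R (@expR R) (fun t => t ^+ 2 / 2) t _ _ (is_derive_expR _) D0.
  by apply: (is_derive_eq D); rewrite mulrC.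
have D := is_deriveM (Il_derive t eg1_cent cc) gi.
have -> : st = (Il cent * (fun t : R => expR (t ^+ 2 / 2)))%R.
  by apply/funext => z; rewrite /st /g1 expRN invrK.
apply: (is_derive_eq D); rewrite /GRing.scale/= fctE.
have -> : expR (t ^+ 2 / 2) = (g1 t)^-1 by rewrite /g1 expRN invrK.
by field; rewrite gt_eqF ?g1_gt0.
Qed.

Definition stein_cst := 2 + absmean * mills_cst.

Lemma absmean_le : absmean <= absmean * mills_cst.
Proof. by rewrite ler_peMr ?absmean_ge0 ?mills_cst_ge1. Qed.

Lemma st_bound_neg t : t <= 0 -> `|st t| <= stein_cst.
Proof.
move=> t0; rewrite normrM normfV (gtr0_norm (g1_gt0 t)) ler_pdivrMr ?g1_gt0//.
have eD : eg1 (fun=> absmean * 1) := ec _.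
apply: (@le_trans _ _ (Il (fun r => - r + absmean * 1) t)).
  apply: Il_norm; [exact: eg1_cent|exact: eg1D|] => r rt.
  by rewrite mulr1 -(ler0_norm (le_trans rt t0)) cent_bound.
rewrite (IlD t eN eD) (IlZ _ t (ec 1)) Il_opp -/(Phi1 t).
have := ler_wpM2l absmean_ge0 (Phi1_le t0); have := g1_gt0 t; rewrite /stein_cst mulrA.
move: (g1 t) (Phi1 t) (absmean * mills_cst) => a b c; lra.
Qed.

(** The two terms may be large separately. Since $g_1(t)$ is the integral of $-r$, their sum is one
    integral, of $t(\bar\psi(r) - \bar\psi(t)) + \bar\psi(t)(t - r)$ with $\bar\psi$ the centred
    function, and the Lipschitz bound makes this at most $(m - 2t)(t - r)$, where $m$ is [absmean].
    The Mills bounds finish. *)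
Lemma st_deriv_bound_neg t : t <= 0 -> `|t * st t + cent t| <= stein_cst.
Proof.
move=> t0; have g0 := g1_gt0 t.
have eq : eg1 (fun r => t * cent r + cent t * (- r)).
  exact: eg1D (eg1M (ec t) eg1_cent) (eg1M (ec _) eN).
have id : t * st t + cent t = Il (fun r => t * cent r + cent t * (- r)) t / g1 t.
  rewrite (IlD t (eg1M (ec t) eg1_cent) (eg1M (ec _) eN)) (IlZ _ t eg1_cent) (IlZ _ t eN) Il_opp /st.
  by field; rewrite gt_eqF.
rewrite id normrM normfV (gtr0_norm g0) ler_pdivrMr//.
pose a := absmean - 2 * t.
have a0 : 0 <= a by rewrite /a; have := absmean_ge0; lra.
have eb : eg1 (fun r => a * (t * 1 + - r)).
  exact: eg1M (ec a) (eg1D (eg1M (ec t) (ec 1)) eN).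
apply: (@le_trans _ _ (Il (fun r => a * (t * 1 + - r)) t)).
  apply: Il_norm => // r rt; rewrite mulr1.
  have -> : t * cent r + cent t * - r = t * (cent r - cent t) + cent t * (t - r) by ring.
  have d : `|cent r - cent t| <= t - r.
    by rewrite /cent opprB addrA subrK (le_trans (psil r t))// ler0_norm ?opprB// subr_le0.
  rewrite (le_trans (ler_normD _ _))// !normrM (ler0_norm t0).
  have tr : 0 <= t - r by rewrite subr_ge0.
  rewrite (ger0_norm tr); have := cent_bound t; rewrite (ler0_norm t0) => h.
  have := ler_wpM2l (_ : 0 <= - t) d; rewrite oppr_ge0 => /(_ t0) h1.
  have h2 := ler_wpM2r tr h; rewrite /a; move: h1 h2.
  move: `|_ - _| `|cent t| absmean => u v w; nra.
rewrite (IlZ _ t (eg1D (eg1M (ec t) (ec 1)) eN)) (IlD t (eg1M (ec t) (ec 1)) eN) (IlZ _ t (ec 1)) Il_opp -/(Phi1 t).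
have h1 := mills1 t; have h0 := mills0 t; have p0 := Phi1_ge0 t.
have b1 : t * Phi1 t + g1 t <= g1 t by rewrite gerDr; exact: mulr_le0_ge0.
have b2 : - t * (t * Phi1 t + g1 t) <= g1 t.
  have t1 : 0 < t ^+ 2 + 1 by rewrite ltr_pwDr ?sqr_ge0.
  rewrite -(ler_pM2l t1).
  have h2 : (t ^+ 2 + 1) * (- t * (t * Phi1 t + g1 t)) <= - t * g1 t.
    rewrite -subr_ge0; have := mulr_ge0 (sqr_ge0 t) h1.
    by congr (0 <= _); ring.
  apply: (le_trans h2); rewrite ler_pM2r//; have := sqr_ge0 (t + 1); lra.
have := ler_wpM2l absmean_ge0 b1; have := ler_wpM2r (ltW g0) absmean_le; rewrite /a /stein_cst.
move: b2; move: (t * Phi1 t + g1 t) (g1 t) (absmean * mills_cst) absmean => x y z u; lra.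
Qed.

Lemma st_neg_diff t q (a : R) : t <= 0 -> eg1 q -> (forall r, `|cent r - q r| <= a) ->
  `|st t - Il q t / g1 t| <= a * mills_cst.
Proof.
move=> t0 eq h; have g0 := g1_gt0 t.
rewrite /st -mulrBl normrM normfV (gtr0_norm g0) ler_pdivrMr// -mulrA.
have -> : Il cent t - Il q t = Il (fun r => cent r + -1 * q r) t.
  by rewrite (IlD t eg1_cent (eg1M (ec (-1)) eq)) (IlZ _ t eq) mulN1r.
apply: (@le_trans _ _ (Il (fun=> a * 1) t)).
  apply: Il_norm => [||r _]; [exact: eg1D eg1_cent (eg1M (ec _) eq)|exact: ec|].
  by rewrite mulN1r mulr1.
rewrite (IlZ _ t (ec 1)) ler_wpM2l ?Phi1_le// (le_trans _ (h 0))//.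
Qed.

End stein_solution.

Lemma MVT_abs (f df : R -> R) (a b C : R) : (forall t, is_derive t (1 : R) f (df t)) ->
  (forall t, `|t - a| <= `|b - a| -> `|df t| <= C) -> `|f b - f a| <= C * `|b - a|.
Proof.
move=> d hC; have [ab|ba|->] := ltgtP a b; last by rewrite !subrr normr0 mulr0.
  have [c [/andP[ac cb] ->]] := MVT_is_derive ab (fun t _ => d t).
  by rewrite normrM ler_wpM2r// hC// !gtr0_norm ?subr_gt0// lerD2r ltW.
have [c [/andP[bc ca] h]] := MVT_is_derive ba (fun t _ => d t).
rewrite distrC h normrM [`|b - a|]distrC ler_wpM2r// hC// distrC [`|b - a|]distrC.
by rewrite !gtr0_norm ?subr_gt0// lerD2l lerN2 ltW.
Qed.

Section stein_bounds.
Variable psi : R -> R.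
Hypothesis psil : forall r s, `|psi r - psi s| <= `|r - s|.
Let psin r := psi (- r).
Let psinl r s : `|psin r - psin s| <= `|r - s|.
Proof. by rewrite (le_trans (psil _ _))// opprK -[X in `|X|]opprK opprD opprK normrN. Qed.

Lemma cent_opp r : cent psin r = cent psi (- r).
Proof. by rewrite /cent /mean1 (Rint_opp (lip1_eg1 psil)). Qed.

Lemma st_opp t : st psi t = - st psin (- t).
Proof.
rewrite /st (Il_reflect t (eg1_cent psil)) (Rint_cent psil) sub0r g1N mulNr.
have -> // : Il (fun r => cent psi (- r)) (- t) = Il (cent psin) (- t).
by apply: eq_Il => r; rewrite cent_opp.
Qed.

Lemma st_bound t : `|st psi t| <= stein_cst.
Proof.
have [t0|t0] := leP t 0; first exact: st_bound_neg.
by rewrite st_opp normrN; apply: st_bound_neg => //; rewrite oppr_le0 ltW.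
Qed.

Lemma st_deriv_bound t : `|t * st psi t + cent psi t| <= stein_cst.
Proof.
have [t0|t0] := leP t 0; first exact: st_deriv_bound_neg.
have := @st_deriv_bound_neg psin psinl (- t); rewrite oppr_le0 => /(_ (ltW t0)).
by rewrite cent_opp opprK st_opp !mulrN mulNr.
Qed.

Lemma st_lip t s : `|st psi t - st psi s| <= stein_cst * `|t - s|.
Proof. by apply: (MVT_abs (fun x => st_derive psil x)) => x _; exact: st_deriv_bound. Qed.

(** The derivative $t f + \bar\psi$ is only locally Lipschitz, with a constant growing linearly
    because of the factor $t$. The factor [1 + |s|] is later absorbed by the cutoff. *)
Lemma st_taylor t s : `|st psi t - st psi s - (t - s) * (s * st psi s + cent psi s)| <=
  (stein_cst + 1) * (1 + `|s|) * (t - s) ^+ 2.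
Proof.
pose F x := st psi x - x * (s * st psi s + cent psi s).
have -> : st psi t - st psi s - (t - s) * (s * st psi s + cent psi s) = F t - F s by rewrite /F; ring.
rewrite -real_normK ?num_real// expr2 mulrA.
pose dF x := x * st psi x + cent psi x - (s * st psi s + cent psi s).
apply: (@MVT_abs F dF) => [x|x hx].
  have D := is_deriveB (st_derive psil x) (is_deriveZ (s * st psi s + cent psi s) (is_derive_id x (1 : R))).
  have -> : F = st psi \- (s * st psi s + cent psi s) *: id.
    by apply/funext => y; rewrite /F !fctE /GRing.scale/= [in LHS]mulrC.
  by apply: (is_derive_eq D); rewrite /dF /GRing.scale/= mulr1.
have -> : dF x = s * (st psi x - st psi s) + (x - s) * st psi x + (psi x - psi s).
  by rewrite /dF /cent; ring.
have h1 := st_lip x s; have h2 := st_bound x; have h3 := psil x s.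
have A0 : 0 <= stein_cst := le_trans (normr_ge0 _) h2.
apply: (@le_trans _ _ (`|s| * (stein_cst * `|x - s|) + `|x - s| * stein_cst + `|x - s|)).
  apply: le_trans (ler_normD _ _) _; apply: lerD h3; apply: le_trans (ler_normD _ _) _.
  rewrite (normrM s) (normrM (x - s)); exact: lerD (ler_wpM2l (normr_ge0 _) h1) (ler_wpM2l (normr_ge0 _) h2).
apply: (@le_trans _ _ ((stein_cst + 1) * (1 + `|s|) * `|x - s|)).
  have := normr_ge0 s; have := normr_ge0 (x - s); move: `|s| `|x - s| stein_cst A0 => a b c; nra.
by apply: ler_wpM2l hx; rewrite mulr_ge0// addr_ge0.
Qed.

End stein_bounds.

(** Stability of the solution under a uniform change of the datum. Applied to neighbouring parallel
    lines, it gives the Lipschitz bound transversal to [sigma]; the factor 2 accounts for the change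
    of the Gaussian mean. *)
Lemma st_diff psi1 psi2 (a t : R) :
  (forall r s, `|psi1 r - psi1 s| <= `|r - s|) -> (forall r s, `|psi2 r - psi2 s| <= `|r - s|) ->
  (forall r, `|psi1 r - psi2 r| <= a) -> `|st psi1 t - st psi2 t| <= 2 * a * mills_cst.
Proof.
move=> l1 l2 h.
have cd p1 p2 : (forall r s, `|p1 r - p1 s| <= `|r - s|) -> (forall r s, `|p2 r - p2 s| <= `|r - s|) ->
    (forall r, `|p1 r - p2 r| <= a) -> forall r, `|cent p1 r - cent p2 r| <= 2 * a.
  move=> k1 k2 hh r; have hm := mean1_dist (lip1_eg1 k1) (lip1_eg1 k2) hh.
  have -> : cent p1 r - cent p2 r = (p1 r - p2 r) - (mean1 p1 - mean1 p2) by rewrite /cent; ring.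
  by rewrite (le_trans (ler_normB _ _))// mulr_natl mulr2n lerD.
have [t0|t0] := leP t 0; first exact: (st_neg_diff l1 t0 (eg1_cent l2) (cd _ _ l1 l2 h)).
rewrite (st_opp l1) (st_opp l2) -opprD normrN.
have ln p : (forall r s, `|p r - p s| <= `|r - s|) -> forall r s, `|p (- r) - p (- s)| <= `|r - s|.
  by move=> pl r s; rewrite (le_trans (pl _ _))// opprK -[X in `|X|]opprK opprD opprK normrN.
apply: (st_neg_diff (ln _ l1) _ (eg1_cent (ln _ l2))); first by rewrite oppr_le0 ltW.
by apply: cd; [exact: ln|exact: ln|move=> r; exact: h].
Qed.

End half_line_integral.

(** * An approximate Stein identity *)

Section cutoff.
Context (R : realType).
Variables (tau eps : R).
Hypotheses (t0 : 0 <= tau) (e0 : 0 < eps).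
Implicit Types (t s a : R).

(** The pure exponential is unbounded, and so would be the slopes and the quadratic error in
    Poincare. With [eps > 0] all of them are bounded; the final estimate does not depend on [eps],
    which then tends to 0. *)
Definition theta t : R := expR (- (tau * t) - eps * t ^+ 2).
Definition theta' t : R := - (tau + 2 * eps * t) * theta t.
Definition theta'' t : R := ((tau + 2 * eps * t) ^+ 2 - 2 * eps) * theta t.

Lemma theta_gt0 t : 0 < theta t. Proof. exact: expR_gt0. Qed.

Lemma theta_derive t : is_derive t (1 : R) theta (theta' t).
Proof.
have D0 : is_derive t (1 : R) (fun t : R => - (tau * t) - eps * t ^+ 2) (- (tau + 2 * eps * t)).
  have D := is_deriveB (is_deriveZ (- tau) (is_derive_id t (1 : R)))
    (is_deriveZ eps (is_deriveM (is_derive_id t (1 : R)) (is_derive_id t (1 : R)))).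
  have -> : (fun t : R => - (tau * t) - eps * t ^+ 2) = ((- tau) *: id \- eps *: (id * id)%R).
    by apply/funext => z; rewrite !fctE /GRing.scale/= mulNr expr2.
  by apply: (is_derive_eq D); rewrite /GRing.scale/=; ring.
have D := @is_derive1_comp R (@expR R) (fun t => - (tau * t) - eps * t ^+ 2) t _ _ (is_derive_expR _) D0.
by apply: (is_derive_eq D); rewrite mulrC.
Qed.

Lemma theta'_derive t : is_derive t (1 : R) theta' (theta'' t).
Proof.
have D1 : is_derive t (1 : R) (fun t : R => - (tau + 2 * eps * t)) (- (2 * eps)).
  have D := is_deriveB (is_derive_cst (- tau) t (1 : R)) (is_deriveZ (2 * eps) (is_derive_id t (1 : R))).
  have -> : (fun t : R => - (tau + 2 * eps * t)) = (cst (- tau) \- (2 * eps) *: id).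
    by apply/funext => z; rewrite !fctE /GRing.scale/= opprD.
  by apply: (is_derive_eq D); rewrite /GRing.scale/=; ring.
have D := is_deriveM D1 (theta_derive t).
by apply: (is_derive_eq D); rewrite /GRing.scale/= /theta'' /theta'; ring.
Qed.

Lemma theta_decay : exists M, 0 <= M /\ forall t, (1 + t ^+ 2) * theta t <= M.
Proof.
exists ((1 + 2 / eps) * expR (tau ^+ 2 / (2 * eps))).
have c0 : 0 <= 1 + 2 / eps by rewrite addr_ge0// divr_ge0// ltW.
split; first by rewrite mulr_ge0 ?expR_ge0.
move=> t; have h1 : 1 + t ^+ 2 <= (1 + 2 / eps) * expR (eps / 2 * t ^+ 2).
  have := expR_ge1Dx (eps / 2 * t ^+ 2) => h.
  apply: le_trans (ler_wpM2l c0 h); have := sqr_ge0 t => q0.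
  have i0 : 0 < eps^-1 by rewrite invr_gt0.
  have -> : (1 + 2 / eps) * (1 + eps / 2 * t ^+ 2) = 1 + t ^+ 2 + 2 / eps + eps / 2 * t ^+ 2.
    by field; rewrite gt_eqF.
  have p1 : 0 <= 2 / eps by rewrite divr_ge0// ltW.
  have p2 : 0 <= eps / 2 * t ^+ 2 by rewrite mulr_ge0// divr_ge0// ltW.
  by rewrite -addrA lerDl addr_ge0.
apply: le_trans (ler_wpM2r (ltW (theta_gt0 t)) h1) _.
rewrite -[X in X <= _]mulrA ler_wpM2l// /theta -expRD ler_expR -subr_ge0.
have -> : tau ^+ 2 / (2 * eps) - (eps / 2 * t ^+ 2 + (- (tau * t) - eps * t ^+ 2)) =
  (eps * t + tau) ^+ 2 / (2 * eps) by field; rewrite gt_eqF.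
by rewrite divr_ge0 ?sqr_ge0// mulr_ge0// ltW.
Qed.

Lemma theta_bounds : exists M, 0 <= M /\ forall t,
  [/\ (1 + `|t|) * theta t <= M, `|theta' t| <= M & `|theta'' t| <= M].
Proof.
have [M [M0 hM]] := theta_decay.
pose c := 2 + tau + 2 * eps + (2 * tau ^+ 2 + 8 * eps ^+ 2 + 2 * eps).
have ee := ltW e0; have s1 := sqr_ge0 tau; have s2 := sqr_ge0 eps.
have c1 : 0 <= tau + 2 * eps by rewrite addr_ge0 ?mulr_ge0.
have c2 : 0 <= 2 * tau ^+ 2 + 8 * eps ^+ 2 + 2 * eps by rewrite !addr_ge0 ?mulr_ge0.
have c0 : 0 <= c by rewrite /c; lra.
exists (c * M); split; first exact: mulr_ge0.
have P t p b : b <= c -> p <= b * (1 + t ^+ 2) -> p * theta t <= c * M.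
  move=> bc h; apply: le_trans (ler_wpM2r (ltW (theta_gt0 t)) h) _.
  apply: le_trans (ler_wpM2l c0 (hM t)); rewrite mulrA ler_wpM2r ?(ltW (theta_gt0 _))//.
  by rewrite ler_wpM2r// addr_ge0 ?sqr_ge0.
have tt t : `|t| <= 1 + t ^+ 2.
  by rewrite -(real_normK (num_real t)); have := sqr_ge0 (`|t| - 1); have := sqr_ge0 `|t|; lra.
move=> t; have q0 := sqr_ge0 t; have ht := tt t; split.
- apply: (P t _ 2); first by rewrite /c; lra.
  by move: ht q0; move: (t ^+ 2) `|t| => u v; lra.
- rewrite normrM (gtr0_norm (theta_gt0 t)) normrN; apply: (P t _ (tau + 2 * eps)); first by rewrite /c; lra.
  rewrite (le_trans (ler_normD _ _))// (ger0_norm t0) normrM ger0_norm ?mulr_ge0//.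
  have := ler_wpM2l (mulr_ge0 (ler0n R 2) ee) ht; have := mulr_ge0 t0 q0; lra.
- rewrite normrM (gtr0_norm (theta_gt0 t)); apply: (P t _ (2 * tau ^+ 2 + 8 * eps ^+ 2 + 2 * eps)).
    by rewrite /c; lra.
  rewrite (le_trans (ler_normB _ _))// ger0_norm ?sqr_ge0// ger0_norm ?mulr_ge0//.
  have := sqr_ge0 (tau - 2 * eps * t).
  have := mulr_ge0 s1 q0; have := mulr_ge0 ee q0; lra.
Qed.

Lemma theta_taylor : exists M, 0 <= M /\ forall s a,
  [/\ (1 + `|s|) * theta s <= M, `|theta' s| <= M, `|theta (s + a) - theta s| <= M * `|a| &
   `|theta (s + a) - theta s - a * theta' s| <= M * a ^+ 2].
Proof.
have [M [M0 hM]] := theta_bounds; exists M; split => // s a; have [h1 h2 _] := hM s.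
have sa : s + a - s = a by rewrite addrAC subrr add0r.
split => //.
  rewrite -{2}sa; apply: (MVT_abs theta_derive) => t _; by have [] := hM t.
pose F x := theta x - x * theta' s.
have -> : theta (s + a) - theta s - a * theta' s = F (s + a) - F s by rewrite /F; ring.
rewrite -(real_normK (num_real a)) expr2 mulrA.
have := @MVT_abs R F (fun x => theta' x - theta' s) s (s + a) (M * `|a|); rewrite sa; apply => [x|x hx].
  have D := is_deriveB (theta_derive x) (is_deriveZ (theta' s) (is_derive_id x (1 : R))).
  have -> : F = theta \- (theta' s) *: id.
    by apply/funext => y; rewrite /F !fctE /GRing.scale/= [in LHS]mulrC.
  by apply: (is_derive_eq D); rewrite /GRing.scale/= mulr1.
apply: (@le_trans _ _ (M * `|x - s|)); last exact: ler_wpM2l.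
by apply: (MVT_abs theta'_derive) => t _; have [] := hM t.
Qed.

End cutoff.

(* Poincare for [h + xi g] under [mu], with [g = K e^(-tau h)], is a quadratic inequality in
   [xi] whose constant term is [1 - Var mu h <= delta], hence bounds its linear term. The
   factor [theta] is [e^(-tau h)] with a Gaussian cutoff. *)
Section stein_inequality.
Context (R : realType) (n : nat).
Implicit Types (x z : 'rV[R]_n).
Variables (w K K' : 'rV[R]_n -> R) (sigma : 'rV[R]_n) (tau A B Lam delta : R).
Hypotheses (ww : wt w) (kw : slc 1 w) (s1 : norm2 sigma = 1) (t0 : 0 <= tau).
Let h x := dot x sigma.
Let mu := tilt w (fun x => tau * dot x sigma).
Hypotheses (mK : measurable_fun setT K) (mK' : measurable_fun setT K').
Hypotheses (KA : forall x, `|K x| <= A) (K'A : forall x, `|K' x| <= A).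
Hypotheses (B0 : 0 <= B) (Lam0 : 0 <= Lam).
Hypothesis KL : forall x a, `|K (x + a *: sigma) - K x| <= A * `|a|.
Hypothesis KT : forall x a, `|K (x + a *: sigma) - K x - a * K' x| <= B * (1 + `|h x|) * a ^+ 2.
Hypothesis Kp : forall x z, dot x sigma = dot z sigma -> `|K x - K z| <= Lam * norm2 (x - z).
Hypothesis Vd : 1 - Var mu h <= delta.

Let lh : lgro (fun x : 'rV[R]_n => dot x sigma) := lgro_dot sigma.
Let lth : lgro (fun x : 'rV[R]_n => tau * dot x sigma). Proof. exact: lgroZ. Qed.
Let wm : wt mu := wt_tilt ww lth.
Let lcm : slc 1 mu := slc_tilt_dot sigma tau ww kw.
Let eh : egro h := lgro_egro lh.
Let eK : egro K := egro_bounded mK KA.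
Let eK' : egro K' := egro_bounded mK' K'A.
Let A0 : 0 <= A. Proof. exact: le_trans (normr_ge0 _) (KA 0). Qed.
Let ss : dot sigma sigma = 1. Proof. by rewrite -sqr_norm2 s1 expr1n. Qed.

Section with_cutoff.
Variable eps : R.
Hypothesis e0 : 0 < eps.
Let th x := theta tau eps (h x).
Let th' x := theta' tau eps (h x).
Let g x := K x * th x.
Let g' x := K' x * th x + K x * th' x.

Let mh : measurable_fun setT h. Proof. exact: measurable_dotl. Qed.

Let mth : measurable_fun setT th.
Proof.
apply: (measurableT_comp (f := @expR R)) => //; apply: measurable_funB.
  by apply: measurableT_comp => //; exact: measurable_funM.
by apply: measurable_funM => //; exact: measurable_funX.
Qed.

Let mth' : measurable_fun setT th'.
Proof.
apply: measurable_funM; last exact: mth.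
apply: measurableT_comp => //; apply: measurable_funD => //; exact: measurable_funM.
Qed.

Lemma stein_cutoff :
  (E mu (fun x => g' x - (h x - E mu h) * g x)) ^+ 2 <=
  delta * E mu (fun x => g' x ^+ 2 + Lam ^+ 2 * th x ^+ 2).
Proof.
have [M [M0 hM]] := theta_taylor t0 e0.
have thM x : 0 <= th x <= M.
  rewrite (ltW (theta_gt0 _ _ _))/=; have [h1 _ _ _] := hM (h x) 0; apply: le_trans h1.
  by rewrite ler_peMl ?(ltW (theta_gt0 _ _ _))// lerDl.
have th'M x : `|th' x| <= M by have [] := hM (h x) 0.
have eth : egro th by apply: (@egro_bounded _ _ _ M mth) => x; have /andP[h1 h2] := thM x; rewrite ger0_norm.
have eth' : egro th' by exact: egro_bounded mth' th'M.
have eg : egro g by exact: egroM.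
have eg' : egro g' by apply: egroD; exact: egroM.
have g'M x : `|g' x| <= 2 * A * M.
  have -> : 2 * A * M = A * M + A * M by ring.
  apply: le_trans (ler_normD _ _) _; rewrite (normrM (K' x)) (normrM (K x)).
  have /andP[h1 h2] := thM x; rewrite (ger0_norm h1).
  by apply: lerD; apply: ler_pM.
have gM x : `|g x| <= A * M.
  by rewrite normrM; have /andP[h1 h2] := thM x; rewrite (ger0_norm h1) ler_pM.
(* The increment is split at the point [x'] on the line through [z], level with [x]: a length [a]
   along [sigma], where [g] has slope [g'], and a length [p] across, where its slope is at most
   [Lam * th]. Every other product is of second order. *)
have tay x z : exists p, [/\ 0 <= p, (h x - h z) ^+ 2 + p ^+ 2 = dot (x - z) (x - z) &
    `|g x - g z - (h x - h z) * g' z| <= Lam * th z * p + (B + 2 * A + Lam) * M * dot (x - z) (x - z)].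
  set a := h x - h z; pose x' := z + a *: sigma.
  have hx' : dot x sigma = dot x' sigma by rewrite /x' dotDl dotZl ss mulr1 /a addrC subrK.
  exists (norm2 (x - x')); have pyt : a ^+ 2 + norm2 (x - x') ^+ 2 = dot (x - z) (x - z).
    rewrite sqr_norm2 /x' opprD addrA; move: (x - z) (dotBl x z sigma) => d hd.
    rewrite dotBl !dotBr !dotZl !dotZr ss (dotC sigma d) hd -/(h x) -/(h z) -/a; ring.
  split; [exact: norm2_ge0|exact: pyt|].
  have [h1 h2 h3 h4] := hM (h z) a.
  have hxa : h x = h z + a by rewrite /a addrC subrK.
  have k1 := Kp hx'; have k2 := KL z a; have k3 := KT z a.
  rewrite -/x' in k2 k3.
  have -> : g x - g z - a * g' z = (K x - K x') * (theta tau eps (h z + a) - th z) + (K x - K x') * th z +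
     ((K x' - K z - a * K' z) * th z + K z * (theta tau eps (h z + a) - th z - a * th' z) +
      (K x' - K z) * (theta tau eps (h z + a) - th z)).
    by rewrite /g /g' {1}/th hxa; ring.
  have a2 : `|a| ^+ 2 = a ^+ 2 by exact: real_normK (num_real a).
  have q0 : 0 <= a ^+ 2 by exact: sqr_ge0.
  have p0 := norm2_ge0 (x - x'); set p := norm2 (x - x') in k1 pyt p0 *.
  have /andP[tz0 tzM] := thM z.
  have e1 : `|(K x - K x') * (theta tau eps (h z + a) - th z)| <= Lam * M * (p * `|a|).
    rewrite normrM; apply: le_trans (ler_pM (normr_ge0 _) (normr_ge0 _) k1 h3) _.
    by rewrite mulrACA.
  have e2 : `|(K x - K x') * th z| <= Lam * p * th z.
    by rewrite normrM (ger0_norm tz0) ler_wpM2r.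
  have e3 : `|(K x' - K z - a * K' z) * th z| <= B * M * a ^+ 2.
    rewrite normrM (ger0_norm tz0); apply: le_trans (ler_wpM2r tz0 k3) _.
    have -> : B * (1 + `|h z|) * a ^+ 2 * th z = B * ((1 + `|h z|) * th z) * a ^+ 2 by ring.
    by rewrite ler_wpM2r// ler_wpM2l.
  have e4 : `|K z * (theta tau eps (h z + a) - th z - a * th' z)| <= A * M * a ^+ 2.
    by rewrite normrM -mulrA; apply: ler_pM.
  have e5 : `|(K x' - K z) * (theta tau eps (h z + a) - th z)| <= A * M * a ^+ 2.
    rewrite normrM; apply: le_trans (ler_pM (normr_ge0 _) (normr_ge0 _) k2 h3) _.
    by rewrite mulrACA -expr2 a2.
  apply: le_trans (ler_normD _ _) _; apply: le_trans (lerD (ler_normD _ _) (ler_normD _ _)) _.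
  apply: le_trans (lerD (lerD e1 e2) (lerD (le_trans (ler_normD _ _) (lerD e3 e4)) e5)) _.
  have pa : p * `|a| <= dot (x - z) (x - z) by rewrite -pyt -a2; have := sqr_ge0 (p - `|a|); have := sqr_ge0 p; have := sqr_ge0 `|a|; lra.
  have ad : a ^+ 2 <= dot (x - z) (x - z) by rewrite -pyt lerDl sqr_ge0.
  have := ler_wpM2l (mulr_ge0 Lam0 M0) pa; have := ler_wpM2l (mulr_ge0 B0 M0) ad; have := ler_wpM2l (mulr_ge0 A0 M0) ad.
  have -> : (B + 2 * A + Lam) * M * dot (x - z) (x - z) =
    B * M * dot (x - z) (x - z) + 2 * (A * M * dot (x - z) (x - z)) + Lam * M * dot (x - z) (x - z) by ring.
  rewrite [Lam * th z * p]mulrAC; move: (Lam * p * th z) (p * `|a|) (a ^+ 2) (dot _ _) => u1 u2 u3 u4.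
  lra.
pose Y := E mu (fun x => g' x ^+ 2 + Lam ^+ 2 * th x ^+ 2).
have eg2 : egro (fun x => g' x ^+ 2) by exact: egroX.
have et2 : egro (fun x => Lam ^+ 2 * th x ^+ 2) by exact/egroZ/egroX.
have eY := egroD eg2 et2.
have Y0 : 0 <= Y by apply: (E_ge0 wm eY) => x; apply: addr_ge0; [exact: sqr_ge0|apply: mulr_ge0; exact: sqr_ge0].
have V1 : 0 <= delta.
  apply: le_trans Vd; rewrite subr_ge0.
  by have := Var_dot sigma wm lcm ltr01; rewrite ss divr1.
have -> : E mu (fun x => g' x - (h x - E mu h) * g x) = E mu g' - Cov mu h g.
  have ehg : egro (fun x => h x * g x) by exact: egroM.
  have -> : E mu (fun x => g' x - (h x - E mu h) * g x) = E mu (fun x => g' x - h x * g x + E mu h * g x).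
    by apply: eq_E => x; ring.
  by rewrite (ED wm (egroB eg' ehg) (egroZ _ eg)) (EB wm eg' ehg) (EZ _ wm eg) /Cov; ring.
apply: quad_disc => // xi.
(* The length of the gradient bound of [h + xi g], with its components along and across [sigma].
   Keeping them orthogonal is what leaves only $E g'$ in the linear term in [xi]. *)
pose G x := Num.sqrt ((1 + xi * g' x) ^+ 2 + (xi * Lam * th x) ^+ 2).
have mG : measurable_fun setT G.
  apply: measurable_sqrtr; apply: measurable_funD; apply: measurable_funX.
    by apply: measurable_funD => //; apply: measurable_funM => //; exact: egro_measurable eg'.
  by apply: measurable_funM => //.
pose Gm := Num.sqrt ((1 + `|xi| * (2 * A * M)) ^+ 2 + (`|xi| * Lam * M) ^+ 2).
have GB x : 0 <= G x <= Gm.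
  rewrite sqrtr_ge0/=; apply: ler_wsqrtr; apply: lerD.
    rewrite -[X in X <= _]real_normK ?num_real// lerXn2r ?nnegrE ?addr_ge0 ?mulr_ge0//.
    by rewrite (le_trans (ler_normD _ _))// normr1 lerD2l normrM ler_wpM2l.
  rewrite -[X in X <= _]real_normK ?num_real// lerXn2r ?nnegrE ?mulr_ge0//.
  by have /andP[h1 h2] := thM x; rewrite !normrM (ger0_norm Lam0) (ger0_norm h1) ler_wpM2l ?mulr_ge0.
have C0 : 0 <= `|xi| * ((B + 2 * A + Lam) * M) by rewrite !mulr_ge0 ?addr_ge0 ?mulr_ge0.
have lf : lgro (fun x => h x + xi * g x).
  apply: lgroD => //; apply: lgroZ; split; first exact: egro_measurable eg.
  by exists (A * M) => x; rewrite (le_trans (gM x))// ler_peMr ?mulr_ge0// lerDl norm2_ge0.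
have T x z : (h x + xi * g x) - (h z + xi * g z) <=
    G z * norm2 (x - z) + `|xi| * ((B + 2 * A + Lam) * M) * dot (x - z) (x - z).
  have [p [p0 pyt hp]] := tay x z; set a := h x - h z in pyt hp.
  have -> : (h x + xi * g x) - (h z + xi * g z) = a * (1 + xi * g' z) + xi * (g x - g z - a * g' z).
    by rewrite /a; ring.
  have h1 : xi * (g x - g z - a * g' z) <= `|xi| * (Lam * th z * p) + `|xi| * ((B + 2 * A + Lam) * M * dot (x - z) (x - z)).
    by rewrite -mulrDr (le_trans (ler_norm _))// normrM ler_wpM2l.
  apply: le_trans (lerD (lexx _) h1) _; rewrite addrA -[X in _ <= _ + X]mulrA lerD2r.
  rewrite (le_trans (ler_norm _))// -(@ler_pXn2r _ 2)// ?nnegrE ?mulr_ge0 ?sqrtr_ge0 ?norm2_ge0//.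
  rewrite exprMn sqr_sqrtr ?addr_ge0 ?sqr_ge0// sqr_norm2 -pyt real_normK ?num_real//.
  rewrite -subr_ge0; set b := 1 + xi * g' z.
  have -> : (xi * Lam * th z) ^+ 2 = (`|xi| * (Lam * th z)) ^+ 2.
    by rewrite -mulrA !exprMn real_normK ?num_real.
  rewrite [`|xi| * (Lam * th z * p)]mulrA; set q := `|xi| * (Lam * th z).
  have -> : (b ^+ 2 + q ^+ 2) * (a ^+ 2 + p ^+ 2) - (a * b + q * p) ^+ 2 = (b * p - q * a) ^+ 2 by ring.
  exact: sqr_ge0.
have := poincare wm lcm ltr01 C0 lf mG GB T; rewrite divr1 (Var_lin xi wm eh eg).
have -> : E mu (fun x => G x ^+ 2) = 1 + 2 * xi * E mu g' + xi ^+ 2 * Y.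
  have -> : E mu (fun x => G x ^+ 2) = E mu (fun x => 1 + (2 * xi) * g' x + xi ^+ 2 * (g' x ^+ 2 + Lam ^+ 2 * th x ^+ 2)).
    by apply: eq_E => x; rewrite sqr_sqrtr ?addr_ge0 ?sqr_ge0//; ring.
  rewrite (ED wm (egroD (egro_cst n 1) (egroZ (2 * xi) eg')) (egroZ (xi ^+ 2) eY)) (ED wm (egro_cst n 1) (egroZ (2 * xi) eg')).
  by rewrite (E_cst _ wm) (EZ _ wm eg') (EZ _ wm eY).
have vg := mulr_ge0 (sqr_ge0 xi) (Var_ge0 wm eg).
rewrite (mulrBr (2 * xi) (E mu g')); move: Vd vg.
move: (Var mu h) (xi ^+ 2 * Var mu g) (xi ^+ 2 * Y) (2 * xi * E mu g') (2 * xi * Cov mu h g) => u1 u2 u3 u4 u5.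
lra.
Qed.

End with_cutoff.

(** For $g = K e^{-\tau h}$ one has $g' - (h - E_\mu h) g = (K' - (h - c) K) e^{-\tau h}$:
    differentiating the exponential shifts the centre by [tau]. *)
Let c := E mu h - tau.
Let U x := K' x - (h x - c) * K x.
Let ex x := expR (- (tau * h x)).

Let eU : egro U.
Proof. by apply: egroB => //; apply: egroM => //; apply: egroB => //; exact: egro_cst. Qed.

Let eex : egro ex.
Proof.
apply: egro_expR; rewrite (_ : (fun x => _) = (fun x => - tau * h x)); first exact: lgroZ.
by apply/funext => x; rewrite mulNr.
Qed.

Let ea : egro (fun x => `|h x|). Proof. exact: egro_norm. Qed.

(** The limit of [stein_cutoff] as [eps] goes to 0, made quantitative: both sides change by at most
    a constant times [eps]. The slope satisfies $|g'| \le A(1+\tau)e^{-\tau h}$ in the limit. *)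
Lemma stein_tilted : E mu (fun x => U x * ex x) ^+ 2 <=
  delta * ((A ^+ 2 * (1 + tau) ^+ 2 + Lam ^+ 2) * E mu (fun x => ex x ^+ 2)).
Proof.
have d0 : 0 <= delta.
  apply: le_trans Vd; rewrite subr_ge0.
  by have := Var_dot sigma wm lcm ltr01; rewrite ss divr1.
have e2h : egro (fun x => h x ^+ 2) by exact: egroX.
have eaU : egro (fun x => `|U x|) by exact: egro_norm.
have ec1 : egro (fun x => ex x * (h x ^+ 2 * `|U x| + (2 * A) * `|h x|)).
  by apply: egroM => //; apply: egroD; [exact: egroM|exact: egroZ].
pose C1 := E mu (fun x => ex x * (h x ^+ 2 * `|U x| + (2 * A) * `|h x|)).
have e2x : egro (fun x => ex x ^+ 2) by exact: egroX.
have ec2 : egro (fun x => ex x ^+ 2 * ((4 * A ^+ 2 * (1 + tau)) * `|h x| + (4 * A ^+ 2) * h x ^+ 2)).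
  by apply: egroM => //; apply: egroD; exact: egroZ.
pose C2 := E mu (fun x => ex x ^+ 2 * ((4 * A ^+ 2 * (1 + tau)) * `|h x| + (4 * A ^+ 2) * h x ^+ 2)).
have A2 : 0 <= A ^+ 2 by exact: sqr_ge0.
have t1 : 0 <= 1 + tau by exact: addr_ge0.
have C10 : 0 <= C1.
  apply: (E_ge0 wm ec1) => x; apply: mulr_ge0; first exact: expR_ge0.
  by apply: addr_ge0; apply: mulr_ge0 => //; [exact: sqr_ge0|exact: mulr_ge0].
set X0 := E mu _; set Y0 := _ * E mu _.
apply: (@le_eps R _ _ (delta * C2 + C1 * (2 * `|X0| + C1)) 1) => // eps /andP[e0 e1].
have := stein_cutoff e0; set Xe := E mu _; set Ye := E mu _ => hX.
have thE x : theta tau eps (h x) = ex x * expR (- (eps * h x ^+ 2)).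
  by rewrite /theta expRD.
have d1 x : `|expR (- (eps * h x ^+ 2)) - 1| <= eps * h x ^+ 2.
  have y0 : 0 <= eps * h x ^+ 2 by rewrite mulr_ge0 ?(ltW e0)//; exact: sqr_ge0.
  rewrite distrC ger0_norm; last by rewrite subr_ge0 -expR0 ler_expR oppr_le0.
  by have := expR_ge1Dx (- (eps * h x ^+ 2)); lra.
have th1 x : 0 <= expR (- (eps * h x ^+ 2)) <= 1.
  rewrite expR_ge0/= -expR0 ler_expR oppr_le0 mulr_ge0 ?(ltW e0)//; exact: sqr_ge0.
have [M [M0 hM]] := theta_taylor t0 e0.
have mh : measurable_fun setT h by exact: measurable_dotl.
have mth : measurable_fun setT (fun x => theta tau eps (h x)).
  apply: (measurableT_comp (f := @expR R)) => //; apply: measurable_funB.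
    by apply: measurableT_comp => //; exact: measurable_funM.
  by apply: measurable_funM => //; exact: measurable_funX.
have mth' : measurable_fun setT (fun x => theta' tau eps (h x)).
  apply: measurable_funM; last exact: mth.
  apply: measurableT_comp => //; apply: measurable_funD => //; exact: measurable_funM.
have eth : egro (fun x => theta tau eps (h x)).
  apply: (@egro_bounded _ _ _ M mth) => x; rewrite gtr0_norm ?theta_gt0//.
  have [h1 _ _ _] := hM (h x) 0; apply: le_trans h1.
  by rewrite ler_peMl ?(ltW (theta_gt0 _ _ _))// lerDl.
have eth' : egro (fun x => theta' tau eps (h x)).
  by apply: (@egro_bounded _ _ _ M mth') => x; have [] := hM (h x) 0.
have eg : egro (fun x => K x * theta tau eps (h x)) by exact: egroM.
have eg' : egro (fun x => K' x * theta tau eps (h x) + K x * theta' tau eps (h x)).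
  by apply: egroD; exact: egroM.
have eXe : egro (fun x => (K' x * theta tau eps (h x) + K x * theta' tau eps (h x)) -
    (h x - E mu h) * (K x * theta tau eps (h x))).
  by apply: egroB => //; apply: egroM => //; apply: egroB => //; exact: egro_cst.
have eUx : egro (fun x => U x * ex x) by exact: egroM.
have hd : `|X0 - Xe| <= eps * C1.
  rewrite /X0 /Xe -(EB wm eUx eXe) /C1 -(EZ _ wm ec1).
  apply: le_trans (E_norm wm (egroB eUx eXe)) _; apply: (E_le wm (egro_norm (egroB eUx eXe)) (egroZ _ ec1)) => x.
  have -> : U x * ex x - ((K' x * theta tau eps (h x) + K x * theta' tau eps (h x)) -
      (h x - E mu h) * (K x * theta tau eps (h x))) =
     ex x * (- ((expR (- (eps * h x ^+ 2)) - 1) * U x) + (2 * eps * h x * K x) * expR (- (eps * h x ^+ 2))).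
    by rewrite /theta' !thE /U /c; ring.
  rewrite (normrM (ex x)) (gtr0_norm (expR_gt0 (- (tau * h x)))) [X in _ <= X]mulrCA; apply: ler_wpM2l; first exact: expR_ge0.
  apply: le_trans (ler_normD _ _) _; rewrite normrN (mulrDr eps); apply: lerD.
    by rewrite normrM mulrA ler_wpM2r.
  have /andP[p0 p1] := th1 x; rewrite normrM (ger0_norm p0).
  apply: le_trans (ler_wpM2l (normr_ge0 _) p1) _; rewrite mulr1 !normrM (gtr0_norm e0) ger0_norm//.
  have := ler_wpM2l (mulr_ge0 (mulr_ge0 (ler0n R 2) (ltW e0)) (normr_ge0 (h x))) (KA x) => q.
  by apply: (le_trans q); rewrite le_eqVlt; apply/orP; left; apply/eqP; ring.
have hY : Ye <= Y0 + eps * C2.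
  rewrite /Y0 /C2 -(EZ _ wm e2x) -(EZ eps wm ec2) -(ED wm (egroZ _ e2x) (egroZ _ ec2)).
  apply: (E_le wm) => [||x].
  - by apply: egroD; [exact: egroX|apply: egroZ; exact: egroX].
  - by apply: egroD; exact: egroZ.
  have /andP[p0 p1] := th1 x; set q := expR (- (eps * h x ^+ 2)) in p0 p1.
  have -> : (K' x * theta tau eps (h x) + K x * theta' tau eps (h x)) ^+ 2 + Lam ^+ 2 * theta tau eps (h x) ^+ 2 =
    ex x ^+ 2 * ((q ^+ 2) * ((K' x - (tau + 2 * eps * h x) * K x) ^+ 2 + Lam ^+ 2)).
    by rewrite /theta' !thE -/q; ring.
  have -> : (A ^+ 2 * (1 + tau) ^+ 2 + Lam ^+ 2) * ex x ^+ 2 +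
     eps * (ex x ^+ 2 * ((4 * A ^+ 2 * (1 + tau)) * `|h x| + (4 * A ^+ 2) * h x ^+ 2)) =
    ex x ^+ 2 * ((A ^+ 2 * (1 + tau) ^+ 2 + Lam ^+ 2) + eps * ((4 * A ^+ 2 * (1 + tau)) * `|h x| + (4 * A ^+ 2) * h x ^+ 2)) by ring.
  apply: ler_wpM2l; first exact: sqr_ge0.
  have q2 : q ^+ 2 <= 1 by rewrite expr_le1.
  set z := (K' x - _) ^+ 2 + _.
  have z0 : 0 <= z by apply: addr_ge0; exact: sqr_ge0.
  apply: le_trans (ler_wpM2r z0 q2) _; rewrite mul1r /z addrAC lerD2r.
  have kb : `|K' x - (tau + 2 * eps * h x) * K x| <= A * (1 + tau) + 2 * eps * A * `|h x|.
    rewrite (le_trans (ler_normB _ _))// (le_trans (lerD (K'A x) (lexx _)))// normrM.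
    have tb : `|tau + 2 * eps * h x| <= tau + 2 * eps * `|h x|.
      by rewrite (le_trans (ler_normD _ _))// (ger0_norm t0) !normrM (gtr0_norm e0) ger0_norm.
    apply: le_trans (lerD (lexx _) (ler_pM (normr_ge0 _) (normr_ge0 _) tb (KA x))) _.
    by rewrite le_eqVlt; apply/orP; left; apply/eqP; ring.
  rewrite -[X in X <= _]real_normK ?num_real//.
  have kb0 : 0 <= A * (1 + tau) + 2 * eps * A * `|h x| := le_trans (normr_ge0 _) kb.
  apply: (@le_trans _ _ ((A * (1 + tau) + 2 * eps * A * `|h x|) ^+ 2)); first by rewrite lerXn2r ?nnegrE.
  have h2 : `|h x| ^+ 2 = h x ^+ 2 by exact: real_normK (num_real _).
  rewrite -h2.
  have ee : eps ^+ 2 <= eps by rewrite expr2 ler_piMl// ltW.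
  have := ler_wpM2r (mulr_ge0 A2 (sqr_ge0 `|h x|)) ee.
  move: `|h x| => u; rewrite -subr_ge0 -(subr_ge0 (_ ^+ 2)) => k.
  have -> : A ^+ 2 * (1 + tau) ^+ 2 + eps * (4 * A ^+ 2 * (1 + tau) * u + 4 * A ^+ 2 * u ^+ 2) -
    (A * (1 + tau) + 2 * eps * A * u) ^+ 2 = 4 * (eps * (A ^+ 2 * u ^+ 2) - eps ^+ 2 * (A ^+ 2 * u ^+ 2)) by ring.
  exact: mulr_ge0.
have hX2 : Xe ^+ 2 <= delta * Y0 + eps * (delta * C2).
  by apply: (le_trans hX); apply: le_trans (ler_wpM2l d0 hY) _; rewrite mulrDr [delta * (eps * _)]mulrCA.
rewrite -[X0 ^+ 2]real_normK ?num_real//; rewrite -[Xe ^+ 2]real_normK ?num_real// in hX2.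
have hx : `|X0| - `|Xe| <= eps * C1 := le_trans (lerB_dist _ _) hd.
have hx' : `|Xe| - `|X0| <= eps * C1.
  by apply: le_trans (lerB_dist _ _) _; rewrite distrC.
have n0 := normr_ge0 X0; have n1 := normr_ge0 Xe.
have ec : eps * C1 <= C1 by rewrite ler_piMl// ltW.
have ec0 : 0 <= eps * C1 by rewrite mulr_ge0// ltW.
have k : `|X0| ^+ 2 - `|Xe| ^+ 2 <= eps * C1 * (2 * `|X0| + C1).
  have -> : `|X0| ^+ 2 - `|Xe| ^+ 2 = (`|X0| - `|Xe|) * (`|X0| + `|Xe|) by ring.
  have s0 : 0 <= `|X0| + `|Xe| by exact: addr_ge0.
  apply: le_trans (ler_wpM2r s0 hx) _; apply: ler_wpM2l => //.
  move: hx' ec; move: `|X0| `|Xe| (eps * C1) => u v w'; lra.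
have -> : delta * Y0 + eps * (delta * C2 + C1 * (2 * `|X0| + C1)) =
  delta * Y0 + eps * (delta * C2) + eps * C1 * (2 * `|X0| + C1) by ring.
move: k hX2; move: (`|X0| ^+ 2) (`|Xe| ^+ 2) (delta * Y0 + _) (eps * C1 * _) => u v y z; lra.
Qed.

(** The tilt cancels [ex] and leaves the product of the Laplace transforms of [h] at [tau] and at
    [- tau]. Herbst's bound for both, where the means of [h] cancel, makes that product at most
    $e^{\tau^2}$. *)
Lemma stein_inequality : E w U ^+ 2 <=
  delta * (A ^+ 2 * (1 + tau) ^+ 2 + Lam ^+ 2) * expR (tau ^+ 2).
Proof.
have := stein_tilted; rewrite (E_tilt _ ww lth) (E_tilt (fun x => ex x ^+ 2) ww lth).
have exK x : ex x * expR (tau * dot x sigma) = 1 by rewrite /ex -expRD addNr expR0.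
have -> : E w (fun x => U x * ex x * expR (tau * dot x sigma)) = E w U.
  by apply: eq_E => x; rewrite -mulrA exK mulr1.
have -> : E w (fun x => ex x ^+ 2 * expR (tau * dot x sigma)) = E w ex.
  by apply: eq_E => x; rewrite expr2 -mulrA exK mulr1.
have eth : egro (fun x => expR (tau * dot x sigma)) by exact: egro_expR.
have Z0 : 0 < E w (fun x => expR (tau * dot x sigma)) by apply: (E_gt0 ww eth) => x; exact: expR_gt0.
have ZZ : E w (fun x => expR (tau * dot x sigma)) * E w ex <= expR (tau ^+ 2).
  have lN : lgro (fun x : 'rV[R]_n => tau * dot x (- sigma)) by apply: lgroZ; exact: lgro_dot.
  have -> : E w ex = expR (lnE w (fun x => tau * dot x (- sigma))).
    by rewrite (lnEK ww lN); apply: eq_E => x; rewrite /ex dotNr mulrN.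
  rewrite -(lnEK ww lth) -expRD ler_expR.
  have lip v : norm2 v = 1 -> forall x y, tau * dot x v - tau * dot y v <= tau * norm2 (x - y).
    by move=> v1 x y; have := lipZ t0 (lip_dot v) x y; rewrite v1 mulr1.
  have mm v : measurable_fun setT (fun x : 'rV[R]_n => tau * dot x v).
    by apply: measurable_funM => //; exact: measurable_dotl.
  have := laplace_lip ww kw ltr01 t0 (mm _) (lip _ s1).
  have := laplace_lip ww kw ltr01 t0 (mm _) (lip (- sigma) (etrans (norm2N sigma) s1)).
  have -> : E w (fun x => tau * dot x (- sigma)) = - E w (fun x => tau * dot x sigma).
    have et : egro (fun x : 'rV[R]_n => tau * dot x sigma) by exact: lgro_egro.
    rewrite -[RHS]mulN1r -(EZ _ ww et); apply: eq_E => x; by rewrite dotNr mulN1r mulrN.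
  move: (lnE _ _) (lnE _ _) (E _ _) => u v y; lra.
have V0 : 0 <= delta * (A ^+ 2 * (1 + tau) ^+ 2 + Lam ^+ 2).
  apply: mulr_ge0; last by apply: addr_ge0; [apply: mulr_ge0; exact: sqr_ge0|exact: sqr_ge0].
  apply: le_trans Vd; rewrite subr_ge0.
  by have := Var_dot sigma wm lcm ltr01; rewrite ss divr1.
move: Z0 ZZ; set Z := E w (fun x => expR _); set W := E w ex => Z0 ZZ hh.
apply: le_trans (ler_wpM2l V0 ZZ).
have Z2 : 0 < Z ^+ 2 by exact: exprn_gt0.
rewrite expr_div_n ler_pdivrMr// in hh; apply: (le_trans hh).
by rewrite le_eqVlt; apply/orP; left; apply/eqP; field; rewrite gt_eqF.
Qed.


End stein_inequality.

Section parametric_integral.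
Context d (T : measurableType d) (R : realType).
Local Notation leb := (@lebesgue_measure R).

(** Tonelli for the positive and negative parts, so that integrability of the sections need not be
    checked. *)
Lemma measurable_Rint_param (F : T * measurableTypeR R -> R) : measurable_fun setT F ->
  measurable_fun setT (fun x => \int[leb]_r F (x, r)).
Proof.
move=> mF.
have pos (f : T * measurableTypeR R -> R) : measurable_fun setT f ->
    measurable_fun setT (fun x => \int[leb]_r (Order.max (f (x, r)) 0)%:E)%E.
  move=> mf; apply: (@measurable_fun_fubini_tonelli_F _ _ _ _ _ leb (fun p => (Order.max (f p) 0)%:E)).
    by apply/measurable_EFinP; exact: measurable_maxr.
  by move=> p; rewrite lee_fin le_max lexx orbT.
rewrite (_ : (fun x => _) = fine \o (fun x => \int[leb]_r (Order.max (F (x, r)) 0)%:E -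
    \int[leb]_r (Order.max (- F (x, r)) 0)%:E)%E).
  apply: measurableT_comp => //; apply: emeasurable_funB; first exact: (pos F).
  by apply: (pos (fun p => - F p)); exact: measurableT_comp.
apply/funext => x; rewrite /Rintegral [in LHS]integralE /=; congr (fine (_ - _)%E).
  by apply: eq_integral => r _; rewrite funepos.unlock EFin_max.
by apply: eq_integral => r _; rewrite funeneg.unlock EFin_max EFinN.
Qed.

End parametric_integral.

(** * Stein's equation on the lines parallel to [sigma] *)

Section product_test.
Context (R : realType) (n : nat).
Local Notation leb := (@lebesgue_measure R).
Implicit Types (x z : 'rV[R]_n) (c r : R).
Variables (sigma : 'rV[R]_n) (phi : 'rV[R]_n -> R).
Hypotheses (s1 : norm2 sigma = 1) (mphi : measurable_fun setT phi).
Hypothesis phil : forall x z, phi x - phi z <= norm2 (x - z).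

Let ss : dot sigma sigma = 1. Proof. by rewrite -sqr_norm2 s1 expr1n. Qed.

Lemma lip1_abs x z : `|phi x - phi z| <= norm2 (x - z).
Proof. by rewrite ler_norml phil andbT lerNl opprB norm2B. Qed.

(** [phi] on the line through [x], with the origin placed at height [c], so that a standard Gaussian
    in [r] is the Gaussian of barycenter [c]. The point [x] itself sits at [r = dot x sigma - c]. *)
Definition fiber c x r : R := phi (proj_perp sigma x + (c + r) *: sigma).

Lemma fiber_lip c x r r' : `|fiber c x r - fiber c x r'| <= `|r - r'|.
Proof.
apply: le_trans (lip1_abs _ _) _.
have -> : proj_perp sigma x + (c + r) *: sigma - (proj_perp sigma x + (c + r') *: sigma) = (r - r') *: sigma.
  by apply/matrixP => i j; rewrite !mxE; ring.
by rewrite norm2Z s1 mulr1.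
Qed.

Lemma proj_perp_dist x z : norm2 (proj_perp sigma x - proj_perp sigma z) <= norm2 (x - z).
Proof.
rewrite -(@ler_pXn2r _ 2)// ?nnegrE ?norm2_ge0// !sqr_norm2.
have -> : proj_perp sigma x - proj_perp sigma z = (x - z) - dot (x - z) sigma *: sigma.
  by rewrite /proj_perp dotBl; apply/matrixP => i j; rewrite !mxE; ring.
move: (x - z) => y; rewrite (dotBl y) !dotBr !dotZl !dotZr ss (dotC sigma y).
have := sqr_ge0 (dot y sigma); rewrite expr2; lra.
Qed.

Lemma fiber_dist c x z r : `|fiber c x r - fiber c z r| <= norm2 (proj_perp sigma x - proj_perp sigma z).
Proof.
apply: le_trans (lip1_abs _ _) _.
by rewrite opprD addrACA subrr addr0.
Qed.

Lemma measurable_fiber d (T : measurableType d) c (X : T -> 'rV[R]_n) (Y : T -> R) :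
  measurable_fun setT X -> measurable_fun setT Y ->
  measurable_fun setT (fun t => fiber c (X t) (Y t)).
Proof.
move=> mX mY; apply: measurableT_comp => //; apply: measurable_rVD.
  apply: measurable_rVB => //; apply: measurable_rVZ => //; exact: measurable_dot.
by apply: measurable_rVZ => //; exact: measurable_funD.
Qed.

Let mg1 d (T : measurableType d) (Y : T -> R) : measurable_fun setT Y ->
  measurable_fun setT (fun t => g1 (Y t)).
Proof.
move=> mY; apply: (measurableT_comp (f := @expR R)) => //; apply: measurableT_comp => //.
by apply: measurable_funM => //; exact: measurable_funX.
Qed.

Lemma measurable_mean1_fiber c : measurable_fun setT (fun x => mean1 (fiber c x)).
Proof.
apply: measurable_funM => //.
apply: (@measurable_Rint_param _ _ R (fun p => fiber c p.1 p.2 * g1 p.2)).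
by apply: measurable_funM; [exact: measurable_fiber|exact: mg1].
Qed.

Definition stein_fun c x := st (fiber c x) (dot x sigma - c).
(** The derivative of [stein_fun] along [sigma], as prescribed by Stein's equation. *)
Definition stein_fun' c x := (dot x sigma - c) * stein_fun c x + (phi x - mean1 (fiber c x)).

Lemma measurable_stein_fun c : measurable_fun setT (stein_fun c).
Proof.
have mh : measurable_fun setT (fun x : 'rV[R]_n => dot x sigma - c).
  by apply: measurable_funB => //; exact: measurable_dotl.
(* The moving endpoint becomes an indicator in the integrand, to which measurability of parametric
   integrals applies. *)
rewrite (_ : stein_fun c = fun x => (\int[leb]_r ((cent (fiber c x) r * g1 r) * ((r : R) <= dot x sigma - c)%R%:R)) *
   expR ((dot x sigma - c) ^+ 2 / 2)).
  apply: measurable_funM; last first.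
    apply: (measurableT_comp (f := @expR R)) => //; apply: measurable_funM => //; exact: measurable_funX.
  apply: (@measurable_Rint_param _ _ R (fun p => (cent (fiber c p.1) p.2 * g1 p.2) * ((p.2 : R) <= dot p.1 sigma - c)%R%:R)).
  apply: measurable_funM; first apply: measurable_funM; last 2 first.
  - exact: mg1.
  - have mb : measurable_fun setT (fun p : 'rV[R]_n * measurableTypeR R => p.2 <= dot p.1 sigma - c).
      apply: measurable_fun_ler => //; apply: measurable_funB => //.
      by apply: measurable_dot.
    rewrite (_ : (fun p => _) = (fun p : 'rV[R]_n * measurableTypeR R => if (p.2 <= dot p.1 sigma - c) then 1 else 0)).
      by apply: measurable_fun_ifT.
    by apply/funext => p; case: ifP.
  apply: measurable_funB; first exact: measurable_fiber.
  by apply: (measurableT_comp (measurable_mean1_fiber c)).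
apply/funext => x; rewrite /stein_fun /st /g1 -expRN opprK; congr (_ * _).
rewrite /Il Rintegral_mkcond; apply: eq_Rint => r; rewrite patchE.
case: (boolP (r <= _)) => hr; first by rewrite mem_set ?mulr1//= in_itv.
by rewrite memNset ?mulr0//= in_itv/=; exact/negP.
Qed.

Lemma centE c x : cent (fiber c x) (dot x sigma - c) = phi x - mean1 (fiber c x).
Proof.
rewrite /cent /fiber; congr (phi _ - _).
by rewrite (addrC c) subrK /proj_perp subrK.
Qed.

Lemma fiber_shift c x a : fiber c (x + a *: sigma) = fiber c x.
Proof.
apply/funext => r; rewrite /fiber; congr (phi (_ + _)).
by rewrite /proj_perp dotDl dotZl ss; apply/matrixP => i j; rewrite !mxE; ring.
Qed.

Lemma lgro_mean1_fiber c : lgro (fun x => mean1 (fiber c x)).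
Proof.
apply: (@lip_lgro _ _ _ 1) (measurable_mean1_fiber c) _ => x z; rewrite mul1r.
apply: le_trans (ler_norm _) _; apply: le_trans (proj_perp_dist x z).
by apply: (mean1_dist (lip1_eg1 (fiber_lip c x)) (lip1_eg1 (fiber_lip c z))) => r; exact: fiber_dist.
Qed.

(** The constant of [stein_inequality], with [stein_cst] bounding the solution and its derivative
    along the lines and [2 * mills_cst] its slope across them. *)
Definition product_cst (tau : R) : R :=
  ((@stein_cst R) ^+ 2 * (1 + tau) ^+ 2 + (2 * @mills_cst R) ^+ 2) * expR (tau ^+ 2).

(** For these two functions, $K' - (h - c)K$ is [phi] minus its Gaussian average on the line, by
    Stein's equation. The Gaussian is centred at the [c] imposed by the tilt, not yet at the
    barycenter of [w]. *)
Lemma stein_product w (tau delta : R) : wt w -> slc 1 w -> 0 <= tau ->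
  1 - Var (tilt w (fun x => tau * dot x sigma)) (fun x => dot x sigma) <= delta ->
  let c := E (tilt w (fun x => tau * dot x sigma)) (fun x => dot x sigma) - tau in
  (E w phi - E w (fun x => mean1 (fiber c x))) ^+ 2 <= delta * product_cst tau.
Proof.
move=> ww kw t0 hd; set c := _ - tau; cbv zeta; set A := @stein_cst R.
have A0 : 0 <= A := le_trans (normr_ge0 _) (st_bound (fiber_lip 0 0) 0).
have KA x : `|stein_fun c x| <= A by exact: st_bound (fiber_lip c x) _.
have K'A x : `|stein_fun' c x| <= A.
  by rewrite /stein_fun' -centE; exact: st_deriv_bound (fiber_lip c x) _.
have hs x a : dot (x + a *: sigma) sigma - c = (dot x sigma - c) + a by rewrite dotDl dotZl ss mulr1 addrAC.
have KL x a : `|stein_fun c (x + a *: sigma) - stein_fun c x| <= A * `|a|.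
  rewrite /stein_fun fiber_shift hs; have := st_lip (fiber_lip c x) (dot x sigma - c + a) (dot x sigma - c).
  by have -> : dot x sigma - c + a - (dot x sigma - c) = a by ring.
have B0 : 0 <= (A + 1) * (1 + `|c|) by rewrite mulr_ge0// addr_ge0.
have KT x a : `|stein_fun c (x + a *: sigma) - stein_fun c x - a * stein_fun' c x| <=
    (A + 1) * (1 + `|c|) * (1 + `|dot x sigma|) * a ^+ 2.
  rewrite /stein_fun' -centE /stein_fun fiber_shift hs.
  have := st_taylor (fiber_lip c x) (dot x sigma - c + a) (dot x sigma - c).
  have -> : dot x sigma - c + a - (dot x sigma - c) = a by ring.
  move=> h; apply: le_trans h _.
  apply: ler_wpM2r; first exact: sqr_ge0.
  rewrite -[X in _ <= X]mulrA; apply: ler_wpM2l; first exact: addr_ge0.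
  have h := ler_normB (dot x sigma) c; have := mulr_ge0 (normr_ge0 c) (normr_ge0 (dot x sigma)).
  rewrite mulrDl !mulrDr !mul1r mulr1; move: h; move: `|_ - c| `|c| `|dot x sigma| (`|c| * _) => u v y z; lra.
have M0 : 0 <= 2 * @mills_cst R by rewrite mulr_ge0// (le_trans _ (mills_cst_ge1 R)).
have Kp x z : dot x sigma = dot z sigma -> `|stein_fun c x - stein_fun c z| <= 2 * @mills_cst R * norm2 (x - z).
  move=> h; rewrite /stein_fun h.
  have := st_diff (dot z sigma - c) (fiber_lip c x) (fiber_lip c z) (fun r => fiber_dist c x z r).
  move=> k; apply: le_trans k _; rewrite mulrAC; apply: ler_wpM2l => //; exact: proj_perp_dist.
have lphi : lgro phi by apply: (@lip_lgro _ _ _ 1) => // x z; rewrite mul1r.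
have mK' : measurable_fun setT (stein_fun' c).
  apply: measurable_funD.
    apply: measurable_funM; last exact: measurable_stein_fun.
    by apply: measurable_funB => //; exact: measurable_dotl.
  by apply: measurable_funB => //; exact: measurable_mean1_fiber.
have := stein_inequality ww kw s1 t0 (measurable_stein_fun c) mK' KA K'A B0 M0 KL KT Kp hd.
have -> : E w (fun x => stein_fun' c x - (dot x sigma - (E (tilt w (fun x => tau * dot x sigma)) (fun x => dot x sigma) - tau)) * stein_fun c x) =
   E w phi - E w (fun x => mean1 (fiber c x)).
  rewrite -(EB ww (lgro_egro lphi) (lgro_egro (lgro_mean1_fiber c))); apply: eq_E => x.
  by rewrite /stein_fun' -/c addrAC subrr add0r.
by rewrite -mulrA.
Qed.

End product_test.

Section product_close.
Context (R : realType) (n : nat).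
Variables (w : 'rV[R]_n -> R) (sigma : 'rV[R]_n) (tau delta : R).
Hypotheses (ww : wt w) (kw : slc 1 w) (s1 : norm2 sigma = 1) (t0 : 0 <= tau).
Hypothesis hd : 1 - Var (tilt w (fun x => tau * dot x sigma)) (fun x => dot x sigma) <= delta.

Let c := E (tilt w (fun x => tau * dot x sigma)) (fun x => dot x sigma) - tau.

Let mean1_id : mean1 (fun r : R => r) = 0.
Proof.
have e1 := @eg1_id R; have := Rint_opp e1; rewrite /=.
have -> : \int[@lebesgue_measure R]_r (- r * g1 r) = - \int[@lebesgue_measure R]_r (r * g1 r).
  rewrite -mulN1r -(RintegralZl _ measurableT (eg1_integrable e1)).
  by apply: eq_Rint => r; rewrite mulN1r mulNr.
rewrite /mean1; set I := Rintegral _ _ _ => h; have -> : I = 0 by lra.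
by rewrite mul0r.
Qed.

(** The comparison tested with [x . sigma] itself, whose Gaussian average on every line is [c]. *)
Lemma barycenter_close : (E w (fun x => dot x sigma) - c) ^+ 2 <= delta * product_cst tau.
Proof.
have lip x z : dot x sigma - dot z sigma <= norm2 (x - z).
  by have := lip_dot sigma x z; rewrite s1 mul1r.
have := stein_product s1 (measurable_dotl sigma) lip ww kw t0 hd; cbv zeta; rewrite -/c.
have ss : dot sigma sigma = 1 by rewrite -sqr_norm2 s1 expr1n.
suff -> : E w (fun x => mean1 (fiber sigma (fun x => dot x sigma) c x)) = c by [].
rewrite -[RHS](E_cst c ww); apply: eq_E => x.
have -> : fiber sigma (fun x => dot x sigma) c x = fun r => c + 1 * r.
  apply/funext => r; rewrite /fiber /proj_perp dotDl dotBl !dotZl ss; ring.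
by rewrite (mean1_lin c 1 (@eg1_id R)) mean1_id mulr0 addr0.
Qed.

(** Moving the Gaussian from [c] to the barycenter changes averages of 1-Lipschitz functions by at
    most the distance of the centres, which obeys the same bound; hence the factor 2. *)
Lemma product_close (phi : 'rV[R]_n -> R) : measurable_fun setT phi ->
  (forall x z, phi x - phi z <= norm2 (x - z)) ->
  `|E w phi - E w (fun x => mean1 (fiber sigma phi (E w (fun x => dot x sigma)) x))| <=
  2 * Num.sqrt (delta * product_cst tau).
Proof.
move=> mphi phil; set b := E w (fun x => dot x sigma).
have q (a y : R) : a ^+ 2 <= y -> `|a| <= Num.sqrt y.
  by move=> h; rewrite -sqrtr_sqr ler_wsqrtr.
have h1 := q _ _ (stein_product s1 mphi phil ww kw t0 hd); have h2 := q _ _ barycenter_close.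
rewrite -/c in h1; rewrite -/b in h2.
have h3 : `|E w (fun x => mean1 (fiber sigma phi c x)) - E w (fun x => mean1 (fiber sigma phi b x))| <= `|b - c|.
  have eb := lgro_egro (lgro_mean1_fiber s1 mphi phil b); have ec := lgro_egro (lgro_mean1_fiber s1 mphi phil c).
  rewrite -(EB ww ec eb); apply: le_trans (E_norm ww (egroB ec eb)) _.
  apply: (E_le_cst ww (egro_norm (egroB ec eb))) => x.
  apply: (mean1_dist (lip1_eg1 (fiber_lip s1 phil c x)) (lip1_eg1 (fiber_lip s1 phil b x))) => r.
  apply: le_trans (lip1_abs phil _ _) _.
  have -> : proj_perp sigma x + (c + r) *: sigma - (proj_perp sigma x + (b + r) *: sigma) = (c - b) *: sigma.
    by apply/matrixP => i j; rewrite !mxE; ring.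
  by rewrite norm2Z s1 mulr1 distrC.
rewrite -[X in `|X - _|](subrK (E w (fun x => mean1 (fiber sigma phi c x)))) -addrA.
apply: le_trans (ler_normD _ _) _; rewrite mulr_natl mulr2n.
exact: (lerD h1 (le_trans h3 h2)).
Qed.

End product_close.

(** * Kantorovich duality *)

Section sublinear.
Context (R : realType) (V : lmodType R).
Implicit Types (p q : V -> R) (u v : V) (t : R).

Record sublin p : Prop := Sublin {
  sublinD : forall u v, p (u + v) <= p u + p v;
  sublinZ : forall t u, 0 <= t -> p (t *: u) = t * p u }.

Lemma sublin0 p : sublin p -> p 0 = 0.
Proof. by move=> sp; rewrite -(scale0r 0) (sublinZ sp)// mul0r. Qed.

Lemma sublinN p u : sublin p -> 0 <= p u + p (- u).
Proof. by move=> sp; rewrite -(sublin0 sp) -(subrr u) (sublinD sp). Qed.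

(** The elementary Hahn-Banach step: a smaller sublinear functional that takes opposite values at
    [v] and [- v], hence is linear on that line. Later steps keep this property, so no maximality
    argument is needed. *)
Definition along p v u : R := inf [set p (u + t *: v) - t * p v | t in [set t | 0 <= t]].

Section along.
Variables (p : V -> R) (v : V).
Hypothesis sp : sublin p.

Let S u := [set p (u + t *: v) - t * p v | t in [set t | 0 <= t]].

Let lbS u : lbound (S u) (- p (- u)).
Proof.
move=> _ [t /= t0 <-]; rewrite -(sublinZ sp)// lerNl opprB lerBlDr addrC -lerBlDr.
have := sublinD sp (u + t *: v) (- u); rewrite addrAC subrr add0r; lra.
Qed.

Let has_infS u : has_inf (S u).
Proof.
split; last by exists (- p (- u)); exact: lbS.
by exists (p (u + 0 *: v) - 0 * p v), 0 => /=.
Qed.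

Let along_le t u : 0 <= t -> along p v u <= p (u + t *: v) - t * p v.
Proof. by move=> t0; apply: ge_inf; [case: (has_infS u)|exists t]. Qed.

Let along_ge u (a : R) : (forall t, 0 <= t -> a <= p (u + t *: v) - t * p v) -> a <= along p v u.
Proof.
by move=> h; apply: lb_le_inf; [case: (has_infS u)|move=> _ [t /= t0 <-]; exact: h].
Qed.

Lemma along_le_self u : along p v u <= p u.
Proof. by have := @along_le 0 u (lexx _); rewrite scale0r addr0 mul0r subr0. Qed.

Lemma sublin_along : sublin (along p v).
Proof.
split=> [u1 u2|t u t0].
  apply/ler_addgt0Pr => e e0.
  have e2 : 0 < e / 2 by rewrite divr_gt0.
  have [_ [t1 /= t10 <-] h1] := inf_adherent e2 (has_infS u1).
  have [_ [t2 /= t20 <-] h2] := inf_adherent e2 (has_infS u2).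
  have h := @along_le (t1 + t2) (u1 + u2) (addr_ge0 t10 t20).
  have := sublinD sp (u1 + t1 *: v) (u2 + t2 *: v).
  rewrite addrACA -scalerDl; move: h h1 h2; rewrite -/(along p v u1) -/(along p v u2); lra.
have [->|tn0] := eqVneq t 0.
  rewrite mul0r scale0r; apply/eqP; rewrite eq_le; apply/andP; split.
    by have := along_le_self 0; rewrite (sublin0 sp).
  by apply: along_ge => s s0; rewrite add0r (sublinZ sp)// subrr.
have tp : 0 < t by rewrite lt_neqAle eq_sym tn0.
apply/eqP; rewrite eq_le; apply/andP; split.
  rewrite mulrC -ler_pdivrMr//; apply: along_ge => s s0; rewrite ler_pdivrMr//.
  have := @along_le (t * s) (t *: u) (mulr_ge0 t0 s0).
  by rewrite -scalerA -scalerDr (sublinZ sp)// => h; rewrite mulrBl mulrC [s * _ * _]mulrAC [s * t]mulrC.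
apply: along_ge => s s0.
have := @along_le (t^-1 * s) u (mulr_ge0 (ltW (_ : 0 < t^-1)) s0); rewrite invr_gt0 => /(_ tp) h.
have := ler_wpM2l t0 h; rewrite mulrBr -(sublinZ sp _ t0) scalerDr scalerA mulrA mulfV// mul1r.
by rewrite mulrA mulrA mulfV// mul1r.
Qed.

Lemma along_odd : along p v (- v) = - p v.
Proof.
apply/eqP; rewrite eq_le; apply/andP; split.
  by have := @along_le 1 (- v) ler01; rewrite scale1r addNr (sublin0 sp) mul1r add0r.
by have := sublinN v sublin_along; have := along_le_self v; lra.
Qed.

End along.

Definition odd_at p v := p (- v) = - p v.

Lemma odd_le p q v : sublin q -> (forall u, q u <= p u) -> odd_at p v -> q v = p v /\ odd_at q v.
Proof.
rewrite /odd_at => sq qp ov; have h1 := qp v; have h2 := qp (- v); have := sublinN v sq.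
by rewrite ov in h2; split; lra.
Qed.

Lemma hahn_banach_seq p (s : seq V) : sublin p ->
  exists q, [/\ sublin q, forall u, q u <= p u & {in s, forall v, odd_at q v}].
Proof.
move=> sp; elim: s => [|v s [q [sq qp qo]]]; first by exists p.
have sa := sublin_along v sq.
exists (along q v); split=> // [u|u]; first by rewrite (le_trans (along_le_self _ sq _)).
have al := along_le_self v sq.
rewrite inE => /orP[/eqP->|us]; last by have [] := odd_le sa al (qo u us).
rewrite /odd_at (along_odd v sq); apply/eqP; rewrite eqr_opp eq_le; apply/andP; split => //.
by have := sublinN v sa; rewrite (along_odd v sq); lra.
Qed.

Lemma odd_atD q u v : sublin q -> odd_at q u -> odd_at q v -> q (u + v) = q u + q v /\ odd_at q (u + v).
Proof.
rewrite /odd_at => sq ou ov; have h1 := sublinD sq u v; have := sublinD sq (- u) (- v).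
by rewrite -opprD ou ov => h2; have := sublinN (u + v) sq; split; lra.
Qed.

Lemma odd_atZ q t u : sublin q -> odd_at q u -> q (t *: u) = t * q u /\ odd_at q (t *: u).
Proof.
rewrite /odd_at => sq ou.
have pos r : 0 <= r -> q (r *: u) = r * q u /\ q (- (r *: u)) = - q (r *: u).
  by move=> r0; rewrite -scalerN !(sublinZ sq)// ou mulrN.
have [t0|t0] := leP 0 t; first exact: pos.
have nt : 0 <= - t by rewrite oppr_ge0 ltW.
have [h1 h2] := pos _ nt; rewrite scaleNr in h1 h2.
by rewrite opprK in h2; rewrite h2 h1 mulNr opprK.
Qed.

Lemma odd_at_sum q (I : finType) (F : I -> V) (a : I -> R) : sublin q -> (forall i, odd_at q (F i)) ->
  q (\sum_i a i *: F i) = \sum_i a i * q (F i).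
Proof.
move=> sq oF.
suff : q (\sum_i a i *: F i) = \sum_i a i * q (F i) /\ odd_at q (\sum_i a i *: F i) by case.
apply: (big_ind2 (fun x y => q x = y /\ odd_at q x)).
- by rewrite /odd_at oppr0 (sublin0 sq) oppr0.
- by move=> x1 x2 y1 y2 [<- o1] [<- o2]; exact: odd_atD.
- by move=> i _; exact: odd_atZ.
Qed.

End sublinear.

(** * Duality for finitely supported measures *)

Section finite_kantorovich.
Context (R : realType) (I : finType).
Variables (p q : I -> R) (c : I -> I -> R) (B : R).
Hypotheses (p0 : forall i, 0 <= p i) (q0 : forall i, 0 <= q i).
Hypotheses (p1 : \sum_i p i = 1) (q1 : \sum_i q i = 1).
Hypothesis dual : forall a b : I -> R, (forall i j, a i + b j <= c i j) ->
  \sum_i a i * p i + \sum_j b j * q j <= B.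

Let V : lmodType R := {ffun I * I -> R^o}.
Implicit Types (z : V).

Let val (a b : I -> R) := \sum_i a i * p i + \sum_j b j * q j.
Let feas z := [set r | exists a b, (forall i j, z (i, j) <= a i + b j) /\ r = val a b].
(** The least price of a pair of potentials dominating [z]. Linear functionals below [U] are
    integrals against transport plans. *)
Let U z := inf (feas z).

Let valE a b : val a b = \sum_i \sum_j p i * q j * (a i + b j).
Proof.
transitivity (\sum_i \sum_j (a i * p i * q j) + \sum_j \sum_i (b j * q j * p i)).
  congr (_ + _); apply: eq_bigr => i _; rewrite -mulr_sumr ?q1 ?p1 mulr1//.
rewrite [X in _ + X]exchange_big -big_split; apply: eq_bigr => i _ /=.
by rewrite -big_split; apply: eq_bigr => j _ /=; ring.
Qed.

Let lbU z : lbound (feas z) (\sum_i \sum_j p i * q j * z (i, j)).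
Proof.
move=> _ [a [b [h ->]]]; rewrite valE; apply: ler_sum => i _; apply: ler_sum => j _.
by rewrite ler_wpM2l// mulr_ge0.
Qed.

Let has_infU z : has_inf (feas z).
Proof.
split; last by eexists; exact: lbU.
eexists; exists (fun=> \sum_k `|z k|), (fun=> 0); split; last by [].
move=> i j; rewrite addr0 (le_trans (ler_norm _))// (bigD1 (i, j))//= lerDl.
by apply: sumr_ge0.
Qed.

Let U_le z a b : (forall i j, z (i, j) <= a i + b j) -> U z <= val a b.
Proof. by move=> h; apply: ge_inf; [case: (has_infU z)|exists a, b]. Qed.

Let U_ge z (r : R) : (forall a b, (forall i j, z (i, j) <= a i + b j) -> r <= val a b) -> r <= U z.
Proof.
by move=> h; apply: lb_le_inf; [case: (has_infU z)|move=> _ [a [b [k ->]]]; exact: h].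
Qed.

Let valZ (t : R) a b : val (fun i => t * a i) (fun j => t * b j) = t * val a b.
Proof. by rewrite /val mulrDr !mulr_sumr; congr (_ + _); apply: eq_bigr => i _; rewrite mulrA. Qed.

Let sublinU : sublin U.
Proof.
split=> [z1 z2|t z t0].
  apply/ler_addgt0Pr => e e0; have e2 : 0 < e / 2 by rewrite divr_gt0.
  have [_ [a1 [b1 [f1 ->]]] h1] := inf_adherent e2 (has_infU z1).
  have [_ [a2 [b2 [f2 ->]]] h2] := inf_adherent e2 (has_infU z2).
  have : U (z1 + z2) <= val (fun i => a1 i + a2 i) (fun i => b1 i + b2 i).
    by apply: U_le => i j; rewrite ffunE addrACA lerD.
  have -> : val (fun i => a1 i + a2 i) (fun i => b1 i + b2 i) = val a1 b1 + val a2 b2.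
    by rewrite /val addrACA; congr (_ + _); rewrite -big_split; apply: eq_bigr => i _; rewrite mulrDl.
  move: h1 h2; rewrite -/(U z1) -/(U z2); lra.
have [->|tn0] := eqVneq t 0.
  rewrite mul0r scale0r; apply/eqP; rewrite eq_le; apply/andP; split.
    have := @U_le 0 (fun=> 0) (fun=> 0); rewrite /val !big1 ?addr0; [|by move=> *; rewrite mul0r..].
    by apply => i j; rewrite ffunE.
  apply: U_ge => a b h; rewrite valE; apply: sumr_ge0 => i _; apply: sumr_ge0 => j _.
  by rewrite !mulr_ge0//; have := h i j; rewrite ffunE.
have tp : 0 < t by rewrite lt_neqAle eq_sym tn0.
apply/eqP; rewrite eq_le; apply/andP; split.
  rewrite mulrC -ler_pdivrMr//; apply: U_ge => a b h; rewrite ler_pdivrMr// mulrC -valZ.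
  by apply: U_le => i j; rewrite ffunE /GRing.scale/= -mulrDr ler_wpM2l.
apply: U_ge => a b h; rewrite -[val a b]mul1r -(mulfV tn0) -mulrA ler_wpM2l// -valZ.
apply: U_le => i j; rewrite -mulrDr mulrC ler_pdivlMr// mulrC.
by have := h i j; rewrite ffunE.
Qed.

Let cost : V := [ffun ij => c ij.1 ij.2].
Let dl (ij : I * I) : V := [ffun kl => (kl == ij)%:R].

Let vE z : z = \sum_ij z ij *: dl ij.
Proof.
apply/ffunP => kl; rewrite sum_ffunE (bigD1 kl)//= !ffunE eqxx /GRing.scale/= mulr1.
by rewrite big1 ?addr0// => ij ne; rewrite !ffunE eq_sym (negbTE ne) /GRing.scale/= mulr0.
Qed.

(** The plan consists of the values on the coordinate vectors of a functional [l] below [U]. Test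
    vectors with cheap dominating potentials yield the constraints: [- dl] gives positivity, and
    plus and minus the indicator of a row or a column give the marginals. *)
Lemma finite_kantorovich : exists pi : I -> I -> R,
  [/\ forall i j, 0 <= pi i j, forall i, \sum_j pi i j = p i, forall j, \sum_i pi i j = q j &
    \sum_i \sum_j pi i j * c i j <= B].
Proof.
(* Starting from [along (- cost) U] forces [l cost <= - U (- cost)], which the dual hypothesis
   bounds by [B]; this makes the plan cheap. *)
have [l [sl lU lo]] := hahn_banach_seq ((- cost) :: [seq dl ij | ij <- enum {: I * I}]) (sublin_along (- cost) sublinU).
have lUU z : l z <= U z by apply: le_trans (lU z) _; exact: (along_le_self (- cost) sublinU z).
have od ij : odd_at l (dl ij) by apply: lo; rewrite inE map_f ?orbT// mem_enum.
pose pi i j := l (dl (i, j)).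
have lE z : l z = \sum_i \sum_j z (i, j) * pi i j.
  by rewrite {1}(vE z) (odd_at_sum _ sl od) pair_bigA; apply: eq_bigr => -[i j] _.
have lN z : l (- z) = - l z.
  by rewrite !lE -sumrN; apply: eq_bigr => i _; rewrite -sumrN; apply: eq_bigr => j _; rewrite ffunE mulNr.
have eqb (i k : I) (r : I -> R) : \sum_j (j == i)%:R * r j = r i.
  by rewrite (bigD1 i)//= eqxx mul1r big1 ?addr0// => j /negbTE ->; rewrite mul0r.
have z0 (r : I -> R) : \sum_j (0 : R) * r j = 0 by rewrite big1// => j _; rewrite mul0r.
have row i : l [ffun kl => (kl.1 == i)%:R] = \sum_j pi i j.
  rewrite lE (bigD1 i)//= [X in _ + X]big1 ?addr0.
    by apply: eq_bigr => j _; rewrite ffunE/= eqxx mul1r.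
  by move=> k /negbTE ne; rewrite big1// => j _; rewrite ffunE/= ne mul0r.
have col j : l [ffun kl => (kl.2 == j)%:R] = \sum_i pi i j.
  rewrite lE; apply: eq_bigr => i _; rewrite (bigD1 j)//= ffunE/= eqxx mul1r big1 ?addr0//.
  by move=> k /negbTE ne; rewrite ffunE/= ne mul0r.
exists pi; split.
- move=> i j; rewrite -oppr_le0 -lN; apply: le_trans (lUU _) _.
  have := @U_le (- dl (i, j)) (fun=> 0) (fun=> 0); rewrite /val !z0 addr0; apply => k m.
  by rewrite !ffunE oppr_le0.
- move=> i; rewrite -row; apply/eqP; rewrite eq_le; apply/andP; split.
    apply: le_trans (lUU _) _; have := @U_le [ffun kl => (kl.1 == i)%:R] (fun k => (k == i)%:R) (fun=> 0).
    by rewrite /val z0 eqb// addr0; apply => k m; rewrite ffunE/= addr0.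
  rewrite -lerN2 -lN; apply: le_trans (lUU _) _.
  have := @U_le (- [ffun kl => (kl.1 == i)%:R]) (fun k => - (k == i)%:R) (fun=> 0).
  rewrite /val z0 addr0 (eq_bigr (fun k => - ((k == i)%:R * p k))); last by move=> k _; rewrite mulNr.
  by rewrite sumrN eqb//; apply => k m; rewrite !ffunE/= addr0.
- move=> j; rewrite -col; apply/eqP; rewrite eq_le; apply/andP; split.
    apply: le_trans (lUU _) _; have := @U_le [ffun kl => (kl.2 == j)%:R] (fun=> 0) (fun k => (k == j)%:R).
    by rewrite /val z0 eqb// add0r; apply => k m; rewrite ffunE/= add0r.
  rewrite -lerN2 -lN; apply: le_trans (lUU _) _.
  have := @U_le (- [ffun kl => (kl.2 == j)%:R]) (fun=> 0) (fun k => - (k == j)%:R).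
  rewrite /val z0 add0r (eq_bigr (fun k => - ((k == j)%:R * q k))); last by move=> k _; rewrite mulNr.
  by rewrite sumrN eqb//; apply => k m; rewrite !ffunE/= add0r.
have -> : \sum_i \sum_j pi i j * c i j = l cost.
  by rewrite lE; apply: eq_bigr => i _; apply: eq_bigr => j _; rewrite ffunE mulrC.
have h1 : - U (- cost) <= B.
  rewrite lerNl; apply: U_ge => a b h.
  have := @dual (fun i => - a i) (fun j => - b j).
  have -> : \sum_i - a i * p i + \sum_j - b j * q j = - val a b.
    by rewrite /val opprD -!sumrN; congr (_ + _); apply: eq_bigr => i _; rewrite mulNr.
  by rewrite lerNl; apply => i j; have := h i j; rewrite !ffunE/=; lra.
have := lU cost; have := along_odd (- cost) sublinU; rewrite opprK => ->; lra.
Qed.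

End finite_kantorovich.

(** * Discretisation on a bounded grid *)

Section discretization.
Context (R : realType).

(** Mesh [1/N] on [[-N, N]]. Outside, values are clipped: on the right by the minimum, on the left
    because [truncn] is 0 on negative numbers. *)
Definition grid_code N (t : R) : nat := minn (2 * N ^ 2) (Num.truncn (N%:R * (t + N%:R))).
Definition grid_rep N (j : nat) : R := j%:R / N%:R - N%:R.

(** Inside the range the error is at most the mesh. Outside, it is at most $2|t|$, and $|t| > N$
    turns this into $2t^2/N$, which a second moment controls. *)
Lemma grid_err N (t : R) : (0 < N)%N ->
  `|t - grid_rep N (grid_code N t)| <= N%:R^-1 * (1 + 2 * t ^+ 2).
Proof.
move=> N0; have n0 : 0 < N%:R :> R by rewrite ltr0n.
rewrite /grid_rep; set c := grid_code N t.
have -> : t - (c%:R / N%:R - N%:R) = N%:R^-1 * (N%:R * (t + N%:R) - c%:R) by field; rewrite gt_eqF.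
rewrite normrM gtr0_norm ?invr_gt0// ler_wpM2l ?invr_ge0 ?(ltW n0)//.
have KE : (2 * N ^ 2)%N%:R = N%:R * (2 * N%:R) :> R by rewrite natrM natrX; ring.
set y := N%:R * (t + N%:R).
have q0 := sqr_ge0 t.
have [tN|tN] := leP `|t| N%:R.
  have yb : 0 <= y <= (2 * N ^ 2)%N%:R.
    move: tN; rewrite ler_norml => /andP[t1 t2]; rewrite KE /y mulr_ge0 ?(ltW n0)//=; last by lra.
    by rewrite ler_pM2l//; lra.
  have /andP[y0 y1] := yb.
  have -> : c = Num.truncn y.
    rewrite /c /grid_code -/y; apply/minn_idPr; rewrite -(@ler_nat R) (le_trans _ y1)// truncn_le//.
  have /andP[h1 h2] := truncn_itv y0.
  by rewrite ger0_norm ?subr_ge0//; move: h2; rewrite -natr1; lra.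
have c0 : 0 <= c%:R :> R by exact: ler0n.
have cK : c%:R <= N%:R * (2 * N%:R) :> R by rewrite -KE ler_nat geq_minl.
have h : `|y - c%:R| <= 2 * (N%:R * `|t|).
  have h1 : `|y - (N%:R : R) ^+ 2| = N%:R * `|t|.
    have -> : y - N%:R ^+ 2 = N%:R * t by rewrite /y; ring.
    by rewrite normrM (gtr0_norm n0).
  have h2 : `|(N%:R : R) ^+ 2 - c%:R| <= (N%:R : R) ^+ 2 by rewrite ler_norml; apply/andP; split; rewrite expr2; lra.
  have -> : y - c%:R = (y - N%:R ^+ 2) + (N%:R ^+ 2 - c%:R) by ring.
  apply: le_trans (ler_normD _ _) _; rewrite h1 (mulr_natl _ 2) mulr2n lerD2l (le_trans h2)//.
  by rewrite expr2 ler_pM2l// ltW.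
have h3 : N%:R * `|t| <= t ^+ 2.
  by rewrite -(real_normK (num_real t)) expr2 ler_wpM2r// ltW.
lra.
Qed.

Variable n : nat.

Definition grid N : finType := {ffun 'I_n -> 'I_(2 * N ^ 2).+1}.

Definition to_grid N (x : 'rV[R]_n) : grid N := [ffun k => inord (grid_code N (x ord0 k))].

Definition grid_pt N (i : grid N) : 'rV[R]_n := \row_k grid_rep N (i k).

Lemma to_grid_err N x : (0 < N)%N ->
  norm2 (x - grid_pt (to_grid N x)) <= N%:R^-1 * (n%:R + 2 * dot x x).
Proof.
move=> N0; apply: le_trans (norm2_le_sum _) _.
have -> : N%:R^-1 * (n%:R + 2 * dot x x) = \sum_(i < n) N%:R^-1 * (1 + 2 * x ord0 i ^+ 2).
  rewrite -mulr_sumr big_split/= sumr_const card_ord -mulr_sumr; congr (_ * (_ + _ * _)).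
apply: ler_sum => i _; rewrite !mxE ffunE inordK; first exact: grid_err.
by rewrite ltnS geq_minl.
Qed.

Lemma measurable_to_grid N (i : grid N) : measurable [set x : 'rV[R]_n | to_grid N x = i].
Proof.
have mge (k : 'I_n) (j : nat) : measurable_fun setT (fun x : 'rV[R]_n => (j <= grid_code N (x ord0 k))%N).
  case: j => [|j].
    by rewrite (_ : (fun x => _) = fun=> true)//; apply/funext => x; rewrite leq0n.
  have [jK|jK] := leqP j.+1 (2 * N ^ 2).
    rewrite (_ : (fun x => _) = fun x : 'rV[R]_n => j.+1%:R <= N%:R * (x ord0 k + N%:R)).
      apply: measurable_fun_ler => //; apply: measurable_funM => //; apply: measurable_funD => //.
      exact: measurable_coord_rV.
    by apply/funext => x; rewrite /grid_code leq_min jK/= truncn_gt_nat.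
  rewrite (_ : (fun x => _) = fun=> false)//; apply/funext => x.
  by rewrite /grid_code leq_min leqNgt jK.
have meq (k : 'I_n) (j : nat) : measurable_fun setT (fun x : 'rV[R]_n => grid_code N (x ord0 k) == j).
  rewrite (_ : (fun x => _) = fun x : 'rV[R]_n => (j <= grid_code N (x ord0 k))%N && ~~ (j.+1 <= grid_code N (x ord0 k))%N).
    by apply: measurable_and; [exact: mge|apply: measurable_neg; exact: mge].
  by apply/funext => x; rewrite -leqNgt eqn_leq andbC.
have -> : [set x : 'rV[R]_n | to_grid N x = i] = \bigcap_(k in [set: 'I_n]) [set x | grid_code N (x ord0 k) == i k]; last first.
  apply: fin_bigcap_measurable => // k _.
  by have := meq k (i k) measurableT [set true] I; rewrite setTI.
apply/seteqP; split => x /=.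
  by move=> <- k _ /=; rewrite ffunE inordK// ltnS geq_minl.
by move=> h; apply/ffunP => k; apply/val_inj; rewrite ffunE/= inordK ?ltnS ?geq_minl//; exact/eqP/h.
Qed.

End discretization.

Section simple_integral.
Context d (X : measurableType d) (R : realType) (m : {measure set X -> \bar R}) (I : finType) (S : X -> I).
Hypothesis mS : forall i, measurable [set x | S x = i].

Lemma integral_simple (h : I -> R) : (forall i, 0 <= h i) ->
  (\int[m]_x (h (S x))%:E = \sum_i (h i)%:E * m [set x | S x = i])%E.
Proof.
move=> h0.
have -> : (\int[m]_x (h (S x))%:E = \int[m]_x (\sum_i (h i)%:E * (\1_[set x | S x = i] x)%:E))%E.
  apply: eq_integral => x _; rewrite (bigD1 (S x))//= indicE mem_set// mule1 big1 ?adde0//.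
  by move=> i ne; rewrite indicE memNset ?mule0// => /= e; rewrite e eqxx in ne.
rewrite ge0_integral_sum//.
- apply: eq_bigr => i _; rewrite ge0_integralZl_EFin//; last exact/measurable_EFinP.
  by rewrite integral_indic ?setIT.
- by move=> i; apply: measurable_funeM; exact/measurable_EFinP.
- by move=> i x _; rewrite mule_ge0// lee_fin.
Qed.

End simple_integral.

Section partition.
Context d (X : measurableType d) (R : realType) (m : {measure set X -> \bar R}) (I : finType) (S : X -> I).
Hypothesis mS : forall i, measurable [set x | S x = i].

Lemma measure_partition A : measurable A -> (m A = \sum_i m (A `&` [set x | S x = i]))%E.
Proof.
move=> mA; have := @integral_simple _ _ _ (mrestr m mA) I S mS (fun=> 1) (fun=> ler01).
rewrite integral_cst//= mul1e /mrestr setTI => ->.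
by apply: eq_bigr => i _; rewrite mul1e setIC.
Qed.

End partition.

(** * A coupling from a plan between cells *)

Section plan_coupling.
Context (R : realType) d (X : measurableType d).
Variables (P Q : probability X R) (I : finType) (S : X -> I) (pi : I -> I -> R) (x0 : X).
Hypothesis mS : forall i, measurable [set x | S x = i].

Let D i := [set x | S x = i].
Let p i := fine (P (D i)).
Let q i := fine (Q (D i)).

Hypotheses (pi0 : forall i j, 0 <= pi i j).
Hypotheses (pip : forall i, \sum_j pi i j = p i) (piq : forall j, \sum_i pi i j = q j).

(** Density on the cell [D i x D j] of the coupling with respect to $P \otimes Q$: the mass [pi i j]
    is spread as a product of conditional laws. Where [p i] or [q j] is 0 the quotient is 0 by
    convention, which is harmless since [pi i j] is 0 there too. *)
Let r i j := pi i j / (p i * q j).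

Let p0 i : 0 <= p i. Proof. by rewrite fine_ge0. Qed.
Let q0 i : 0 <= q i. Proof. by rewrite fine_ge0. Qed.
Let PE i : (P (D i) = (p i)%:E)%E. Proof. by rewrite fineK// fin_num_measure//; exact: mS. Qed.
Let QE i : (Q (D i) = (q i)%:E)%E. Proof. by rewrite fineK// fin_num_measure//; exact: mS. Qed.

Let r0 i j : 0 <= r i j.
Proof. by rewrite divr_ge0// mulr_ge0. Qed.

Let mD2 (ij : I * I) : measurable (D ij.1 `*` D ij.2).
Proof. by apply: measurableX; exact: mS. Qed.

Let nthI (k : nat) : I * I := nth (S x0, S x0) (enum {: I * I}) k.

Let m_ (k : nat) : {measure set (X * X)%type -> \bar R} :=
  mscale (NngNum (r0 (nthI k).1 (nthI k).2)) (mrestr (P \x Q)%E (mD2 (nthI k))).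

Definition plan_measure : set (X * X)%type -> \bar R := msum m_ (size (enum {: I * I})).

HB.instance Definition _ := Measure.copy plan_measure (msum m_ (size (enum {: I * I}))).

Let plan_rect A B : measurable A -> measurable B ->
  (plan_measure (A `*` B) = \sum_i \sum_j (r i j)%:E * (P (A `&` D i) * Q (B `&` D j)))%E.
Proof.
move=> mA mB; rewrite pair_bigA/=.
transitivity (\sum_(k < size (enum {: I * I})) m_ k (A `*` B))%E => //.
rewrite -(big_mkord xpredT (fun k => m_ k (A `*` B))).
transitivity (\sum_(ij <- enum {: I * I}) (r ij.1 ij.2)%:E * (P (A `&` D ij.1) * Q (B `&` D ij.2)))%E; last by rewrite big_enum.
rewrite (big_nth (S x0, S x0)); apply: eq_bigr => k _.
rewrite /m_ /= /mscale /= /mrestr -/(nthI k) -setXI; congr (_ * _)%E.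
by rewrite [LHS]product_measure1E//; apply: measurableI => //; exact: mS.
Qed.

Let row_sum i : p i != 0 -> \sum_j r i j * q j = 1.
Proof.
move=> pn; have -> : \sum_j r i j * q j = \sum_j pi i j / p i.
  apply: eq_bigr => j _; rewrite /r; have [qj|qj] := eqVneq (q j) 0; last by field; rewrite pn qj.
  have := piq j; rewrite qj => /eqP; rewrite psumr_eq0// => /allP /(_ i); rewrite mem_index_enum => /(_ isT)/= /eqP ->.
  by rewrite !mul0r.
by rewrite -mulr_suml pip mulfV.
Qed.

Let col_sum j : q j != 0 -> \sum_i r i j * p i = 1.
Proof.
move=> qn; have -> : \sum_i r i j * p i = \sum_i pi i j / q j.
  apply: eq_bigr => i _; rewrite /r; have [pj|pj] := eqVneq (p i) 0; last by field; rewrite pj qn.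
  have := pip i; rewrite pj => /eqP; rewrite psumr_eq0// => /allP /(_ j); rewrite mem_index_enum => /(_ isT)/= /eqP ->.
  by rewrite !mul0r.
by rewrite -mulr_suml piq mulfV.
Qed.

Lemma plan_measure_fst A : measurable A -> plan_measure (A `*` setT) = P A.
Proof.
move=> mA; rewrite plan_rect// (measure_partition P mS mA); apply: eq_bigr => i _.
have -> : (\sum_j (r i j)%:E * (P (A `&` D i) * Q (setT `&` D j)) = P (A `&` D i) * (\sum_j r i j * q j)%:E)%E.
  rewrite -sumEFin ge0_sume_distrr; last by move=> j _; rewrite lee_fin mulr_ge0.
  by apply: eq_bigr => j _; rewrite setTI QE EFinM muleCA.
have [pz|pz] := eqVneq (p i) 0; last by rewrite row_sum// mule1.
have z : P (A `&` D i) = 0%E; last by rewrite [RHS]z z mul0e.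
apply/eqP; rewrite eq_le measure_ge0 andbT.
have := PE i; rewrite pz => e; rewrite -[X in (_ <= X)%E]e; apply: le_measure; rewrite ?inE; last exact: subIsetr.
  by apply: measurableI => //; exact: mS.
exact: mS.
Qed.

Lemma plan_measure_snd A : measurable A -> plan_measure (setT `*` A) = Q A.
Proof.
move=> mA; rewrite plan_rect// exchange_big (measure_partition Q mS mA); apply: eq_bigr => j _ /=.
have -> : (\sum_i (r i j)%:E * (P (setT `&` D i) * Q (A `&` D j)) = Q (A `&` D j) * (\sum_i r i j * p i)%:E)%E.
  rewrite -sumEFin ge0_sume_distrr; last by move=> i _; rewrite lee_fin mulr_ge0.
  by apply: eq_bigr => i _; rewrite setTI PE EFinM muleA muleC.
have [pz|pz] := eqVneq (q j) 0; last by rewrite col_sum// mule1.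
have z : Q (A `&` D j) = 0%E; last by rewrite [RHS]z z mul0e.
apply/eqP; rewrite eq_le measure_ge0 andbT.
have := QE j; rewrite pz => e; rewrite -[X in (_ <= X)%E]e; apply: le_measure; rewrite ?inE; last exact: subIsetr.
  by apply: measurableI => //; exact: mS.
exact: mS.
Qed.

Let plan_measureT : plan_measure setT = 1%E.
Proof. by rewrite -setXTT plan_measure_fst// probability_setT. Qed.

HB.instance Definition _ := Measure_isProbability.Build _ _ R plan_measure plan_measureT.

Definition plan_probability : probability (X * X)%type R := plan_measure.

Lemma plan_measure_cell i j : plan_measure (D i `*` D j) = (pi i j)%:E.
Proof.
rewrite plan_rect; [|exact: mS|exact: mS].
rewrite (bigD1 i)//= (bigD1 j)//= [X in (_ + X + _)%E]big1; last first.
  move=> k kj; have -> : D j `&` D k = set0; last by rewrite measure0 !mule0.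
  by apply/seteqP; split => // x [/= e1 e2]; rewrite -e2 e1 eqxx in kj.
rewrite [X in (_ + X)%E]big1; last first.
  move=> k ki; rewrite big1// => l _; have -> : D i `&` D k = set0; last by rewrite measure0 mul0e mule0.
  by apply/seteqP; split => // x [/= e1 e2]; rewrite -e2 e1 eqxx in ki.
rewrite !setIid !adde0 PE QE -!EFinM; congr EFin.
rewrite /r; have [pq|pq] := eqVneq (p i * q j) 0; last by rewrite divfK.
rewrite pq mulr0; move/eqP: pq; rewrite mulf_eq0 => /orP[/eqP z|/eqP z].
  have := pip i; rewrite z => /eqP; rewrite psumr_eq0// => /allP /(_ j); rewrite mem_index_enum => /(_ isT)/= /eqP ->//.
have := piq j; rewrite z => /eqP; rewrite psumr_eq0// => /allP /(_ i); rewrite mem_index_enum => /(_ isT)/= /eqP ->//.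
Qed.

End plan_coupling.

Section signed_simple_integral.
Context d (X : measurableType d) (R : realType) (m : probability X R) (I : finType) (S : X -> I).
Hypothesis mS : forall i, measurable [set x | S x = i].

Lemma measurable_simple (h : I -> R) : measurable_fun setT (fun x => h (S x)).
Proof.
rewrite (_ : (fun x => _) = fun x => \sum_i h i * \1_[set x | S x = i] x).
  by apply: measurable_sum => i; exact: measurable_funM.
apply/funext => x; rewrite (bigD1 (S x))//= indicE mem_set// mulr1 big1 ?addr0// => i ne.
by rewrite indicE memNset ?mulr0// => /= e; rewrite e eqxx in ne.
Qed.

Lemma integrable_bounded (h : X -> R) (A : R) : measurable_fun setT h -> (forall x, `|h x| <= A) ->
  m.-integrable setT (EFin \o h).
Proof.
by move=> mh hA; apply: integrable_le hA => //; exact: finite_measure_integrable_cst.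
Qed.

Lemma Rint_cst (a : R) : \int[m]_x a = a.
Proof. by rewrite Rintegral_cst//= probability_setT mulr1. Qed.

Lemma Rint_simple (h : I -> R) : \int[m]_x h (S x) = \sum_i h i * fine (m [set x | S x = i]).
Proof.
pose c := \sum_i `|h i|.
have hc i : `|h i| <= c by rewrite /c (bigD1 i)//= lerDl sumr_ge0.
have hc0 i : 0 <= h i + c by have := hc i; rewrite ler_norml => /andP[]; lra.
have ih : m.-integrable setT (EFin \o (fun x => h (S x))) by exact: (integrable_bounded (measurable_simple h) (fun x => hc (S x))).
have ic : m.-integrable setT (EFin \o (fun=> c : R)) by exact: finite_measure_integrable_cst.
have h1 : \int[m]_x (h (S x) + c) = \int[m]_x h (S x) + c by rewrite (RintegralD measurableT ih ic) Rint_cst.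
have fE i : (m [set x | S x = i] = (fine (m [set x | S x = i]))%:E)%E.
  by rewrite fineK// fin_num_measure//; exact: mS.
have h2 : \int[m]_x (h (S x) + c) = \sum_i (h i + c) * fine (m [set x | S x = i]).
  rewrite /Rintegral (integral_simple m mS hc0) -[RHS]/(fine (\sum_i (h i + c) * fine (m [set x | S x = i]))%:E).
  by congr fine; rewrite -sumEFin; apply: eq_bigr => i _; rewrite EFinM -fE.
have h3 : \sum_i fine (m [set x | S x = i]) = 1.
  apply: EFin_inj; rewrite -sumEFin -(@probability_setT _ _ _ m) (measure_partition m mS measurableT).
  by apply: eq_bigr => i _; rewrite -fE setTI.
have h4 : \sum_i (h i + c) * fine (m [set x | S x = i]) = \sum_i h i * fine (m [set x | S x = i]) + c.
  rewrite -[X in _ + X]mulr1 -h3 mulr_sumr -big_split; apply: eq_bigr => i _ /=; exact: mulrDl.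
by move: h1; rewrite h2 h4 => /addIr.
Qed.

End signed_simple_integral.

(** * From potentials on the grid to Lipschitz test functions *)

Section duality.
Context (R : realType) (n : nat).
Implicit Types (x y z : 'rV[R]_n) (phi : 'rV[R]_n -> R).

(** The transform of the potential [b] by the distance cost, extended from the grid points to the
    whole space as a 1-Lipschitz function. The index [i0] supplies a default value that is one of
    the terms. *)
Definition dist_min (I : finType) (i0 : I) (pt : I -> 'rV[R]_n) (b : I -> R) x : R :=
  \big[Num.min/norm2 (x - pt i0) - b i0]_i (norm2 (x - pt i) - b i).

Lemma dist_min_le (I : finType) (i0 : I) pt b x i : @dist_min I i0 pt b x <= norm2 (x - pt i) - b i.
Proof. exact: bigmin_le. Qed.

Lemma dist_min_ge (I : finType) (i0 : I) pt b x (a : R) : (forall i, a <= norm2 (x - pt i) - b i) ->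
  a <= @dist_min I i0 pt b x.
Proof. by move=> h; apply: le_bigmin => // i _. Qed.

Lemma dist_min_lip (I : finType) (i0 : I) pt b x y :
  @dist_min I i0 pt b x - @dist_min I i0 pt b y <= norm2 (x - y).
Proof.
rewrite lerBlDr -lerBlDl; apply: dist_min_ge => i; rewrite lerBlDl.
apply: le_trans (dist_min_le i0 pt b x i) _; rewrite addrA lerD2r; exact: norm2_tri.
Qed.

Lemma measurable_dist_min (I : finType) (i0 : I) pt b : measurable_fun setT (@dist_min I i0 pt b).
Proof.
have mt i : measurable_fun setT (fun x => norm2 (x - pt i) - b i).
  by apply: measurable_funB => //; apply: measurable_norm2; exact: measurable_rVB.
rewrite /dist_min; elim: (index_enum I) => [|i s IH].
  by rewrite (_ : (fun x => _) = (fun x => norm2 (x - pt i0) - b i0))//; apply/funext => x; rewrite big_nil.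
rewrite (_ : (fun x => _) = (fun x => Num.min (norm2 (x - pt i) - b i)
   (\big[Num.min/norm2 (x - pt i0) - b i0]_(i <- s) (norm2 (x - pt i) - b i)))); first exact: measurable_minr.
by apply/funext => x; rewrite big_cons.
Qed.

Section moment.
Variables (P : probability 'rV[R]_n R) (M : R).
Hypothesis PM : (\int[P]_x (dot x x)%:E <= M%:E)%E.

Let mdot : measurable_fun setT (fun x : 'rV[R]_n => dot x x). Proof. exact: measurable_dot. Qed.

Lemma integrable_dot : P.-integrable setT (EFin \o (fun x => dot x x)).
Proof.
apply/integrableP; split; first exact/measurable_EFinP.
apply: le_lt_trans (ltry M); apply: le_trans PM.
by rewrite le_eqVlt; apply/orP; left; apply/eqP; apply: eq_integral => x _ /=; rewrite ger0_norm ?dot_ge0.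
Qed.

Lemma integrable_sub_dot (f : 'rV[R]_n -> R) (a b : R) : measurable_fun setT f ->
  (forall x, `|f x| <= a + b * dot x x) -> P.-integrable setT (EFin \o f).
Proof.
move=> mf fa; apply: (integrable_le mf _ fa).
apply: (@integrableD _ _ _ P setT measurableT (EFin \o (fun=> a)) (EFin \o (fun x => b * dot x x))).
  exact: finite_measure_integrable_cst.
exact: integrable_Zl integrable_dot.
Qed.

Lemma integrable_lip1 phi : measurable_fun setT phi -> (forall x y, phi x - phi y <= norm2 (x - y)) ->
  P.-integrable setT (EFin \o phi).
Proof.
move=> mp lp; apply: (@integrable_sub_dot _ (`|phi 0| + 1) 1) => // x.
have h := lip1_abs lp x 0; rewrite subr0 in h.
have h2 : norm2 x <= 1 + dot x x by rewrite -sqr_norm2; have := sqr_ge0 (norm2 x - 1); have := norm2_ge0 x; lra.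
rewrite -[phi x](subrK (phi 0)) (le_trans (ler_normD _ _))//; lra.
Qed.

Variable N : nat.
Hypothesis N0 : (0 < N)%N.
Let T := @to_grid R n N.
Let err x := norm2 (x - grid_pt R (T x)).

Lemma measurable_grid_err : measurable_fun setT err.
Proof.
apply: measurable_norm2; apply: measurable_rVB => //; apply: measurable_fun_rV => k.
exact: (measurable_simple (@measurable_to_grid R n N) (fun i => grid_pt R i ord0 k)).
Qed.

Lemma integral_grid_err : (\int[P]_x (err x)%:E <= (N%:R^-1 * (n%:R + 2 * M))%:E)%E.
Proof.
have i0 : 0 <= N%:R^-1 :> R by rewrite invr_ge0.
apply: (@le_trans _ _ (\int[P]_x ((N%:R^-1)%:E * (n%:R%:E + 2%:E * (dot x x)%:E)))%E).
  apply: ge0_le_integral => //.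
  - by move=> x _; rewrite lee_fin norm2_ge0.
  - by apply/measurable_EFinP; exact: measurable_grid_err.
  - apply: measurable_funeM; apply: emeasurable_funD => //; apply: measurable_funeM.
    exact/measurable_EFinP.
  - by move=> x _; have := to_grid_err x N0; rewrite -lee_fin; exact.
have mm : measurable_fun setT (fun x : 'rV[R]_n => (2%:E * (dot x x)%:E)%E).
  by apply: measurable_funeM; exact/measurable_EFinP.
rewrite ge0_integralZl_EFin//; last 2 first.
- by move=> x _; rewrite -EFinM -EFinD lee_fin addr_ge0 ?mulr_ge0 ?dot_ge0.
- exact: emeasurable_funD.
rewrite EFinM; apply: lee_wpmul2l; first by rewrite lee_fin.
rewrite ge0_integralD//; last by move=> x _; rewrite -EFinM lee_fin mulr_ge0 ?dot_ge0.
have -> : (\int[P]__ (n%:R)%:E = n%:R%:E)%E by rewrite integral_cst//= probability_setT mule1.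
have -> : (\int[P]_x (2%:E * (dot x x)%:E) = 2%:E * \int[P]_x (dot x x)%:E)%E.
  apply: ge0_integralZl_EFin => //; first by move=> x _; rewrite lee_fin dot_ge0.
  exact/measurable_EFinP.
have -> : ((n%:R + 2 * M)%:E = n%:R%:E + 2%:E * M%:E)%E by [].
by apply: leeD => //; apply: lee_wpmul2l => //; rewrite lee_fin.
Qed.

Lemma Rint_grid phi : measurable_fun setT phi -> (forall x y, phi x - phi y <= norm2 (x - y)) ->
  `|\int[P]_x phi (grid_pt R (T x)) - \int[P]_x phi x| <= N%:R^-1 * (n%:R + 2 * M).
Proof.
move=> mp lp.
have mg : measurable_fun setT (fun x => phi (grid_pt R (T x))).
  exact: (measurable_simple (@measurable_to_grid R n N) (fun i => phi (grid_pt R i))).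
have ig : P.-integrable setT (EFin \o (fun x => phi (grid_pt R (T x)))).
  have := @integrable_bounded _ _ _ P _ (\sum_i `|phi (@grid_pt R n N i)|) mg; apply => x.
  by rewrite (bigD1 (T x))//= lerDl sumr_ge0.
have ip := integrable_lip1 mp lp.
rewrite -(RintegralB measurableT ig ip).
have ib : P.-integrable setT (EFin \o (fun x => phi (grid_pt R (T x)) - phi x)).
  exact: (integrableB measurableT ig ip).
apply: le_trans (le_normr_Rintegral measurableT ib) _.
rewrite -lee_fin EFin_Rint; last exact: (integrable_norm ib).
apply: le_trans integral_grid_err; apply: ge0_le_integral => //.
- by apply/measurable_EFinP; apply: measurableT_comp => //; exact: measurable_funB.
- by apply/measurable_EFinP; exact: measurable_grid_err.
- by move=> x _; rewrite lee_fin distrC; exact: lip1_abs.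
Qed.

End moment.

(** The grid error costs [2 e] when grid potentials are tested on [P] and [Q], and [2 e] more when
    the plan between cells is turned into a coupling. The test functions may be taken nonnegative,
    which allows integration against the product by Tonelli alone. *)
Lemma W1_dual (P Q : probability 'rV[R]_n R) (B M : R) :
  (\int[P]_x (dot x x)%:E <= M%:E)%E -> (\int[Q]_x (dot x x)%:E <= M%:E)%E ->
  (forall phi, measurable_fun setT phi -> (forall x, 0 <= phi x) ->
     (forall x y, phi x - phi y <= norm2 (x - y)) -> \int[P]_x phi x - \int[Q]_x phi x <= B) ->
  (W1 P Q <= B%:E)%E.
Proof.
move=> PM QM dual.
(* [M] and [n] enter only through an error that vanishes as [N] grows, so finiteness of the second
   moments is all that matters. *)
suff H N : (0 < N)%N -> (W1 P Q <= (B + 4 * (N%:R^-1 * (n%:R + 2 * M)))%:E)%E.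
  apply/lee_addgt0Pr => e e0; set c := 4 * (n%:R + 2 * M).
  pose N := (Num.truncn (c / e)).+1.
  apply: le_trans (H N isT) _; rewrite -EFinD lee_fin lerD2l mulrCA -/c mulrC ler_pdivrMr ?ltr0n//.
  by rewrite mulrC -ler_pdivrMr// ltW// truncnS_gt.
move=> N0; set e := N%:R^-1 * _.
have mT := @measurable_to_grid R n N; set T := @to_grid R n N in mT.
pose pt := @grid_pt R n N.
pose p i := fine (P [set x | T x = i]); pose q i := fine (Q [set x | T x = i]).
have p0 i : 0 <= p i by rewrite fine_ge0.
have q0 i : 0 <= q i by rewrite fine_ge0.
have sum1 (m : probability 'rV[R]_n R) : \sum_i fine (m [set x | T x = i]) = 1.
  have := Rint_simple m mT (fun=> 1); rewrite Rint_cst => ->.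
  by apply: eq_bigr => i _; rewrite mul1r.
have fdual (a b : grid n N -> R) : (forall i j, a i + b j <= norm2 (pt i - pt j)) ->
    \sum_i a i * p i + \sum_j b j * q j <= B + 2 * e.
  (* Transferring the constant [c] from [b] to [a] makes the potential [g] nonnegative without
     changing the dual value. On the grid [g] dominates [a + c], and [- g] dominates [b - c]. *)
  move=> h; pose c := \sum_i `|b i|; pose g := dist_min (T 0) pt (fun i => b i - c).
  have bc i : b i <= c by rewrite (le_trans (ler_norm _))// /c (bigD1 i)//= lerDl sumr_ge0.
  have mg : measurable_fun setT g by exact: measurable_dist_min.
  have lg x y : g x - g y <= norm2 (x - y) by exact: dist_min_lip.
  have g0 x : 0 <= g x by apply: dist_min_ge => i; have := bc i; have := norm2_ge0 (x - pt i); lra.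
  have h1 : \sum_i (a i + c) * p i <= \sum_i g (pt i) * p i.
    apply: ler_sum => i _; rewrite ler_wpM2r//; apply: dist_min_ge => j.
    by have := h i j; lra.
  have h2 : \sum_j (b j - c) * q j <= - \sum_j g (pt j) * q j.
    rewrite -[X in _ <= X]sumrN; apply: ler_sum => j _; rewrite -mulNr ler_wpM2r//.
    by have := dist_min_le (T 0) pt (fun i => b i - c) (pt j) j; rewrite subrr norm20 sub0r lerNr.
  have h3 : \sum_i (a i + c) * p i = \sum_i a i * p i + c.
    rewrite -[X in _ + X]mulr1 -(sum1 P) mulr_sumr -big_split.
    by apply: eq_bigr => i _ /=; exact: mulrDl.
  have h4 : \sum_j (b j - c) * q j = \sum_j b j * q j - c.
    rewrite -[X in _ - X]mulr1 -(sum1 Q) mulr_sumr -sumrB.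
    by apply: eq_bigr => j _ /=; exact: mulrBl.
  have g1 := Rint_grid PM N0 mg lg; have g2 := Rint_grid QM N0 mg lg.
  have g3 := dual g mg g0 lg.
  rewrite -(Rint_simple P mT (fun i => g (pt i))) h3 in h1.
  rewrite -(Rint_simple Q mT (fun i => g (pt i))) h4 in h2.
  move: g1 g2 h1 h2 g3; rewrite -/e !ler_norml => /andP[_ g1] /andP[g2 _].
  rewrite /pt /T; move: g1 g2; set u1 := Rintegral _ _ _; set u2 := Rintegral _ _ _.
  set u3 := Rintegral _ _ _; set u4 := Rintegral _ _ _; set u5 := \sum_i a i * p i; set u6 := \sum_j b j * q j.
  lra.
have [pi [pi0 pip piq pic]] := finite_kantorovich p0 q0 (sum1 P) (sum1 Q) fdual.
pose pr := plan_probability (0 : 'rV[R]_n) mT pi0 pip piq.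
have plf A : measurable A -> pr (A `*` setT) = P A by move=> mA; exact: plan_measure_fst.
have pls A : measurable A -> pr (setT `*` A) = Q A by move=> mA; exact: plan_measure_snd.
have prc : coupling P Q pr by move=> A mA; split; [exact: plf|exact: pls].
apply: (@le_trans _ _ (\int[pr]_z (norm2 (z.1 - z.2))%:E)%E); first by apply: ereal_inf_lbound; exists pr.
pose err x := norm2 (x - pt (T x)).
have merr : measurable_fun setT err by exact: measurable_grid_err.
pose S2 (z : 'rV[R]_n * 'rV[R]_n) := (T z.1, T z.2).
have mS2 ij : measurable [set z | S2 z = ij].
  rewrite (_ : [set z | _] = [set x | T x = ij.1] `*` [set x | T x = ij.2]).
    by apply: measurableX; exact: mT.
  by apply/seteqP; split => -[x y] /=; rewrite /S2/=; case: ij => i j; [move=> [-> ->]|move=> [/= -> ->]].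
pose c2 ij := norm2 (pt ij.1 - pt ij.2).
have mc2 := measurable_simple mS2 c2.
have me1 : measurable_fun setT (fun z : 'rV[R]_n * 'rV[R]_n => (err z.1)%:E).
  by apply/measurable_EFinP; apply: measurableT_comp.
have me2 : measurable_fun setT (fun z : 'rV[R]_n * 'rV[R]_n => (err z.2)%:E).
  by apply/measurable_EFinP; apply: measurableT_comp.
have mc2e : measurable_fun setT (fun z : 'rV[R]_n * 'rV[R]_n => (c2 (S2 z))%:E) by exact/measurable_EFinP.
have mc3 := emeasurable_funD mc2e me2.
apply: (@le_trans _ _ (\int[pr]_z ((err z.1)%:E + ((c2 (S2 z))%:E + (err z.2)%:E)))%E).
  apply: ge0_le_integral => //.
  - by move=> z _; rewrite lee_fin norm2_ge0.
  - by apply/measurable_EFinP; apply: measurable_norm2; exact: measurable_rVB.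
  - exact: (emeasurable_funD me1 mc3).
  - move=> z _; rewrite -!EFinD lee_fin; apply: le_trans (norm2_tri _ (pt (T z.1)) _) _.
    by rewrite lerD2l; apply: le_trans (norm2_tri _ (pt (T z.2)) _) _; rewrite lerD2l norm2B.
have er1 (z : 'rV[R]_n * 'rV[R]_n) : setT z -> (0 <= (err z.1)%:E)%E by move=> _; rewrite lee_fin norm2_ge0.
have er2 (z : 'rV[R]_n * 'rV[R]_n) : setT z -> (0 <= (err z.2)%:E)%E by move=> _; rewrite lee_fin norm2_ge0.
have er3 (z : 'rV[R]_n * 'rV[R]_n) : setT z -> (0 <= (c2 (S2 z))%:E)%E by move=> _; rewrite lee_fin norm2_ge0.
rewrite (ge0_integralD pr measurableT er1 me1 (fun zz h => adde_ge0 (er3 zz h) (er2 zz h)) mc3).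
rewrite (ge0_integralD pr measurableT er3 mc2e er2 me2).
have marg1 : (\int[pr]_z (err z.1)%:E = \int[P]_x (err x)%:E)%E.
  have -> : (\int[P]_x (err x)%:E = \int[pushforward pr fst]_x (err x)%:E)%E.
    by apply: eq_measure_integral => A mA _; have := plf A mA; rewrite setXT => h; first [exact: h|exact: esym h].
  rewrite (@ge0_integral_pushforward _ _ _ _ R fst measurable_fst pr setT (EFin \o err))//.
    exact/measurable_EFinP.
  by move=> x _; rewrite lee_fin norm2_ge0.
have marg2 : (\int[pr]_z (err z.2)%:E = \int[Q]_x (err x)%:E)%E.
  have -> : (\int[Q]_x (err x)%:E = \int[pushforward pr snd]_x (err x)%:E)%E.
    by apply: eq_measure_integral => A mA _; have := pls A mA; rewrite setTX => h; first [exact: h|exact: esym h].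
  rewrite (@ge0_integral_pushforward _ _ _ _ R snd measurable_snd pr setT (EFin \o err))//.
    exact/measurable_EFinP.
  by move=> x _; rewrite lee_fin norm2_ge0.
have cc : (\int[pr]_z (c2 (S2 z))%:E <= (B + 2 * e)%:E)%E.
  rewrite (integral_simple pr mS2); last by move=> ij; exact: norm2_ge0.
  apply: le_trans (_ : _ <= (\sum_i \sum_j pi i j * norm2 (pt i - pt j))%:E)%E _; last by rewrite lee_fin.
  rewrite pair_bigA -sumEFin le_eqVlt; apply/orP; left; apply/eqP; apply: eq_bigr => -[i j] _ /=.
  rewrite EFinM muleC; congr (_ * _)%E.
  rewrite (_ : [set z | _] = [set x | T x = i] `*` [set x | T x = j]); first exact: plan_measure_cell.
  by apply/seteqP; split => -[x y] /=; rewrite /S2/=; [move=> [-> ->]|move=> [/= -> ->]].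
rewrite marg1 marg2.
have -> : (B + 4 * e)%:E = (e%:E + ((B + 2 * e)%:E + e%:E))%E by rewrite -!EFinD; congr EFin; ring.
apply: leeD; first exact: integral_grid_err.
by apply: leeD => //; exact: integral_grid_err.
Qed.

End duality.

(** * The Gibbs measure and the product measure *)

Section continuous_measurable.
Context (R : realType) (n : nat).
Implicit Types (f : 'rV[R]_n -> R) (x y v : 'rV[R]_n).

Let grid_seq x : ('rV[R]_n)^nat := fun N => grid_pt R (to_grid N.+1 x).

(** The sigma-algebra is generated by the coordinates, so open sets are not at hand; functions of
    the grid point take finitely many values on measurable cells, and their limits are
    measurable. *)
Lemma measurable_grid_limit f : (forall x, f (grid_pt R (to_grid N.+1 x)) @[N --> \oo] --> f x) ->
  measurable_fun setT f.
Proof.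
move=> h; apply: (@measurable_fun_cvg _ _ _ _ (fun N x => f (grid_seq x N))) => [N|x _].
  exact: (measurable_simple (@measurable_to_grid R n N.+1) (fun i => f (grid_pt R i))).
exact: h.
Qed.

Lemma grid_seq_cvg x : (fun N => norm2 (x - grid_seq x N)) @ \oo --> (0 : R).
Proof.
apply: (@squeeze_cvgr _ _ _ _ (fun=> 0) (fun N => N.+1%:R^-1 * (n%:R + 2 * dot x x))).
- by near=> N; rewrite norm2_ge0; exact: to_grid_err.
- exact: cvg_cst.
- rewrite -[X in _ --> X](mul0r (n%:R + 2 * dot x x)); apply: cvgM; last exact: cvg_cst.
  exact: cvg_harmonic.
Unshelve. all: by end_near. Qed.

Lemma norm_le_norm2 x : `|x| <= norm2 x.
Proof.
rewrite /Num.norm/= mx_normrE; apply: bigmax_le; first exact: norm2_ge0.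
by move=> [i j] _ /=; rewrite (ord1 i); exact: coord_le_norm2.
Qed.

Lemma continuous_measurable f : continuous f -> measurable_fun setT f.
Proof.
move=> cf; apply: measurable_grid_limit => x; apply: (@cvg_comp _ _ _ (grid_seq x) f _ _ _ _ (cf x)).
apply/cvgrPdist_le => e e0.
have /cvgrPdist_le /(_ e e0) h := grid_seq_cvg x; near=> N.
apply: le_trans (norm_le_norm2 _) _.
have : `|0 - norm2 (x - grid_seq x N)| <= e by near: N; exact: h.
by rewrite sub0r normrN ger0_norm ?norm2_ge0.
Unshelve. all: by end_near. Qed.

Lemma lip_measurable f (L : R) : (forall x y, f x - f y <= L * norm2 (x - y)) -> measurable_fun setT f.
Proof.
move=> fl; apply: measurable_grid_limit => x; apply/cvgrPdist_le => e e0.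
have L1 : 0 < `|L| + 1 by rewrite ltr_pwDr.
have eL : 0 < e / (`|L| + 1) by rewrite divr_gt0.
have /cvgrPdist_le /(_ _ eL) h := grid_seq_cvg x; near=> N.
have hN : `|0 - norm2 (x - grid_seq x N)| <= e / (`|L| + 1) by near: N; exact: h.
rewrite sub0r normrN ger0_norm ?norm2_ge0// ler_pdivlMr// mulrC in hN.
apply: le_trans hN; have LL y z : L * norm2 (y - z) <= (`|L| + 1) * norm2 (y - z).
  by rewrite ler_wpM2r ?norm2_ge0// (le_trans (ler_norm _))// lerDl.
rewrite ler_norml; apply/andP; split; last exact: le_trans (fl _ _) (LL _ _).
by rewrite lerNl opprB norm2B; exact: le_trans (fl _ _) (LL _ _).
Unshelve. all: by end_near. Qed.

End continuous_measurable.

Section density.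

Context d (T : measurableType d) (R : realType).
Variables (m m' : {measure set T -> \bar R}) (rho : T -> R).
Hypotheses (mrho : measurable_fun setT rho) (rho0 : forall x, 0 <= rho x).
Hypothesis mE : forall A, measurable A -> (m' A = \int[m]_(x in A) (rho x)%:E)%E.

Import HBNNSimple.

Let integral_density_nnsfun (g : {nnsfun T >-> R}) :
  (\int[m']_x (g x)%:E = \int[m]_x ((g x)%:E * (rho x)%:E))%E.
Proof.
pose s : seq R := finmap.enum_fset (fset_set (range g)); have gE := fimfunEord g; cbv zeta in gE; rewrite -/s in gE.
have s0 (i : 'I_(size s)) : 0 <= s`_i.
  have : s`_i \in s by rewrite mem_nth.
  move=> si; have : s`_i \in range g by rewrite -in_fset_set.
  by move=> /set_mem[x _ <-].
have mA (i : 'I_(size s)) : measurable (g @^-1` [set s`_i]) by exact: measurable_sfunP.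
have mI (i : 'I_(size s)) : measurable_fun setT (fun x : T => ((\1_(g @^-1` [set s`_i]) x : R)%:E)).
  exact/measurable_EFinP.
have mrE : measurable_fun setT (EFin \o rho) by exact/measurable_EFinP.
have -> : (\int[m']_x (g x)%:E = \int[m']_x (\sum_(i < size s) (s`_i)%:E * (\1_(g @^-1` [set s`_i]) x)%:E))%E.
  by apply: eq_integral => x _; rewrite gE -sumEFin; apply: eq_bigr => i _; rewrite EFinM.
have -> : (\int[m]_x ((g x)%:E * (rho x)%:E) =
    \int[m]_x (\sum_(i < size s) (s`_i)%:E * ((\1_(g @^-1` [set s`_i]) x)%:E * (rho x)%:E)))%E.
  apply: eq_integral => x _; rewrite gE -EFinM mulr_suml -sumEFin.
  by apply: eq_bigr => i _; rewrite -mulrA !EFinM.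
rewrite !ge0_integral_sum//; last 4 first.
- by move=> i; apply: measurable_funeM; exact: emeasurable_funM.
- by move=> i x _; rewrite !mule_ge0// lee_fin.
- by move=> i; exact: measurable_funeM.
- by move=> i x _; rewrite mule_ge0// lee_fin.
apply: eq_bigr => i _; rewrite !ge0_integralZl_EFin//; last 2 first.
- by move=> x _; rewrite mule_ge0// lee_fin.
- exact: emeasurable_funM.
rewrite integral_indic// setIT mE//; congr (_ * _)%E.
rewrite integral_mkcond; apply: eq_integral => x _; rewrite patchE indicE.
by case: ifPn => _; rewrite ?mul1e ?mul0e.
Qed.

(** The density is known only through the masses of sets; simple functions and monotone convergence
    extend this to integrals. *)
Lemma integral_density (f : T -> \bar R) : measurable_fun setT f -> (forall x, 0 <= f x)%E ->
  (\int[m']_x f x = \int[m]_x (f x * (rho x)%:E))%E.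
Proof.
move=> mf f0; pose g_ := nnsfun_approx measurableT mf.
have mrE : measurable_fun setT (EFin \o rho) by exact/measurable_EFinP.
have cg (x : T) : (g_ k x)%:E @[k --> \oo] --> f x by exact: cvg_nnsfun_approx.
have gE (x : T) : f x = limn (fun k => (g_ k x)%:E) by apply/esym/cvg_lim => //; exact: cg.
have gnd (x : T) : nondecreasing_seq (fun k => (g_ k x)%:E).
  by move=> a b ab; rewrite lee_fin; exact/lefP/nd_nnsfun_approx.
have mg k : measurable_fun setT (fun x => (g_ k x)%:E) by exact/measurable_EFinP.
have g0 k (x : T) : (0 <= (g_ k x)%:E)%E by rewrite lee_fin.
have r0E (x : T) : (0 <= (rho x)%:E)%E by rewrite lee_fin.
transitivity (limn (fun k => \int[m']_x (g_ k x)%:E)%E).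
  rewrite -monotone_convergence//.
  by apply: eq_integral => x _; exact: gE.
transitivity (limn (fun k => \int[m]_x ((g_ k x)%:E * (rho x)%:E))%E); last first.
  rewrite -monotone_convergence//.
  - apply: eq_integral => x _; apply/cvg_lim => //.
    by apply: cvgeMr => //; exact: cg.
  - by move=> k; apply: emeasurable_funM.
  - by move=> k x _; exact: mule_ge0.
  - by move=> x _ a b ab; apply: lee_wpmul2r => //; exact: gnd.
by congr (limn _); apply/funext => k; exact: integral_density_nnsfun.
Qed.

End density.

(** * The Gibbs weight of a strongly convex potential *)

Section strongly_convex.
Context (R : realType) (n : nat).
Variable V : 'rV[R]_n -> R.
Hypothesis V2 : twice_differentiable V.
Hypothesis hHess : forall x, loewner_le 1%:M (Hess V x).
Implicit Types (x y v : 'rV[R]_n).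

Lemma sum_delta v : v = \sum_(i < n) v ord0 i *: delta_mx ord0 i.
Proof. by rewrite {1}[v]row_sum_delta. Qed.

Lemma is_derive_line (W : normedModType R) (f : 'rV[R]_n -> W) x v (t : R) :
  differentiable f (x + t *: v) ->
  is_derive t (1 : R) (fun t => f (x + t *: v)) ('d f (x + t *: v) v).
Proof.
move=> df; have Dv : derivable f (x + t *: v) v by exact: diff_derivable.
have E1 : (fun h : R => h^-1 *: (((fun t => f (x + t *: v)) \o shift t) (h *: (1 : R)) - f (x + t *: v))) =
    (fun h : R => h^-1 *: ((f \o shift (x + t *: v)) (h *: v) - f (x + t *: v))).
  apply/funext => h /=; congr (_ *: (f _ - _)).
  by rewrite [h *: (1 : R)]mulr1 scalerDl addrCA.
apply: DeriveDef; first by rewrite /derivable E1.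
by rewrite -deriveE// /derive E1.
Qed.

Lemma diff_basis (f : 'rV[R]_n -> R) x v : differentiable f x ->
  'd f x v = \sum_(i < n) v ord0 i * 'D_(delta_mx ord0 i) f x.
Proof.
move=> df; rewrite {1}(sum_delta v) linear_sum; apply: eq_bigr => i _.
by rewrite linearZ/= deriveE.
Qed.

Let dV x : differentiable V x := V2.1 x.

Lemma differentiable_partial (j : 'I_n) x : differentiable (partial j V) x.
Proof.
rewrite (_ : partial j V = (fun N : 'rV[R]_n => N ord0 j : R) \o gradient V); last first.
  by apply/funext => y; rewrite /= mxE.
by apply: differentiable_comp; [exact: V2.2|exact: differentiable_coord].
Qed.

Let f1 x v t := \sum_(j < n) v ord0 j * partial j V (x + t *: v).
Let f2 x v t := \sum_(j < n) v ord0 j * 'd (partial j V) (x + t *: v) v.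

Let der1 x v (t : R) : is_derive t (1 : R) (fun t => V (x + t *: v)) (f1 x v t).
Proof. by have D := is_derive_line (dV (x + t *: v)); apply: (is_derive_eq D); rewrite diff_basis. Qed.

Let der2 x v (t : R) : is_derive t (1 : R) (f1 x v) (f2 x v t).
Proof.
have D (j : 'I_n) : is_derive t (1 : R) (fun t => v ord0 j * partial j V (x + t *: v)) (v ord0 j * 'd (partial j V) (x + t *: v) v).
  by have D := is_deriveZ (v ord0 j) (is_derive_line (differentiable_partial j (x + t *: v))); exact: D.
have -> : f1 x v = \sum_(j < n) (fun t => v ord0 j * partial j V (x + t *: v)).
  by apply/funext => s; rewrite /f1 fct_sumE.
by rewrite /f2; elim/big_ind2: _ => [|????|j _]; [exact: is_derive_cst|exact: is_deriveD|exact: D].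
Qed.

Let f2_ge x v t : dot v v <= f2 x v t.
Proof.
have := hHess (x + t *: v) v; set p := x + t *: v.
rewrite mulmxBr mulmxBl mulmx1 !mxE subr_ge0.
have -> : \sum_j v ord0 j * v^T j ord0 = dot v v by apply: eq_bigr => j _; rewrite mxE.
move=> h; apply: le_trans h _; rewrite le_eqVlt; apply/orP; left; apply/eqP.
apply: eq_bigr => j _; rewrite !mxE mulrC; congr (_ * _).
rewrite (diff_basis _ (differentiable_partial j p)); apply: eq_bigr => i _.
by rewrite mxE.
Qed.

Let w x := expR (- V x).

Lemma slc_Gibbs : slc 1 w.
Proof.
move=> s x y s01; rewrite /w !expRK mul1r.
have d1 (t : R) : is_derive t (1 : R) (fun t => - V (x + t *: (y - x))) (- f1 x (y - x) t).
  exact: is_deriveN (der1 x (y - x) t).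
have d2 (t : R) : is_derive t (1 : R) (fun t => - f1 x (y - x) t) (- f2 x (y - x) t).
  exact: is_deriveN (der2 x (y - x) t).
have := concave_deriv2 (m := dot (y - x) (y - x)) s01 d1 d2.
have -> : x + 0 *: (y - x) = x by rewrite scale0r addr0.
have -> : x + 1 *: (y - x) = y by rewrite scale1r addrC subrK.
have -> : x + s *: (y - x) = (1 - s) *: x + s *: y by apply/matrixP => i j; rewrite !mxE; ring.
have -> : dot (x - y) (x - y) = dot (y - x) (y - x) by rewrite -!sqr_norm2 norm2B.
have -> : s * (1 - s) / 2 * dot (y - x) (y - x) = dot (y - x) (y - x) * (s * (1 - s)) / 2 by ring.
by apply => t _; rewrite lerN2; exact: f2_ge.
Qed.

(** Quadratic growth of [V], which makes the weight Gaussian-dominated. *)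
Lemma Gibbs_lower x : V 0 + dot (gradient V 0) x + dot x x / 2 <= V x.
Proof.
pose F (t : R) := V (0 + t *: x) - (V 0 + t * f1 0 x 0 + t ^+ 2 / 2 * dot x x).
pose F' (t : R) := f1 0 x t - f1 0 x 0 - t * dot x x.
have D (t : R) : is_derive t (1 : R) F (F' t).
  have D := is_deriveB (der1 0 x t) (is_deriveD (is_deriveD (is_derive_cst (V 0) t (1 : R)) (is_deriveZ (f1 0 x 0) (is_derive_id t (1 : R))))
     (is_deriveZ (dot x x / 2) (is_deriveM (is_derive_id t (1 : R)) (is_derive_id t (1 : R))))).
  have -> : F = (fun t : R => V (0 + t *: x)) \- ((cst (V 0) \+ f1 0 x 0 *: id) \+ (dot x x / 2) *: (id * id)%R).
    by apply/funext => s; rewrite /F !fctE /GRing.scale/=; ring.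
  by apply: (is_derive_eq D); rewrite /F' /GRing.scale/= add0r; field.
have [c [/andP[c0 c1] hc]] := MVT_is_derive ltr01 (fun t _ => D t).
have [d [_ hd]] := MVT_is_derive c0 (fun t _ => der2 0 x t).
have F'0 : 0 <= F' c.
  by rewrite /F' hd subr0 mulrC -mulrBr mulr_ge0 ?(ltW c0)// subr_ge0; exact: f2_ge.
have g0 : f1 0 x 0 = dot (gradient V 0) x.
  by rewrite /f1 scale0r addr0; apply: eq_bigr => j _; rewrite mxE mulrC.
move: hc; rewrite /F scale0r scale1r !add0r g0 subr0 mulr1 mul1r !mul0r expr0n/= !mul0r expr1n !addr0 subrr subr0.
move=> hc; have := F'0; rewrite -hc; lra.
Qed.

Lemma wt_Gibbs : wt w.
Proof.
split; last by move=> x; exact: expR_gt0.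
split.
  apply: measurableT_comp => //; apply: measurableT_comp => //; apply: continuous_measurable => x.
  exact: differentiable_continuous.
(* Half of the quadratic term absorbs the linear one, by $|\nabla V(0) + x/2|^2 \ge 0$. *)
exists (expR (- V 0 + dot (gradient V 0) (gradient V 0))), 4^-1; split; first by rewrite invr_gt0.
move=> x; rewrite ger0_norm ?expR_ge0// /w -expRD ler_expR.
have := Gibbs_lower x; have := dot_ge0 (gradient V 0 + 2^-1 *: x).
rewrite !dotDl !dotDr !dotZl !dotZr (dotC x (gradient V 0)).
move: (V 0) (V x) (dot (gradient V 0) x) (dot x x) (dot (gradient V 0) (gradient V 0)) => a b p q r; lra.
Qed.

End strongly_convex.

Section standard_normal.
Context (R : realType).
Local Notation leb := (@lebesgue_measure R).
Implicit Types (p : R -> R) (r : R).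

Lemma mean1_ge0 p : (forall r, 0 <= p r) -> 0 <= mean1 p.
Proof.
move=> p0; rewrite mulr_ge0 ?invr_ge0 ?(ltW (gmass1_gt0 R))//.
by apply: Rintegral_ge0 => r _; rewrite mulr_ge0 ?(ltW (g1_gt0 _)).
Qed.

(** The normalising constants agree because both sides have total mass 1; the value of the Gaussian
    integral is not computed. *)
Lemma normal_pdf01 r : normal_pdf 0 1 r = g1 r / gmass1 R.
Proof.
have pE (t : R) : normal_pdf 0 1 t = normal_peak 1 * (1 * g1 t).
  by rewrite normal_pdfE ?oner_neq0// /normal_fun /g1 subr0 expr1n !mul1r mulNr.
have := @integral_normal_pdf R 0 1.
rewrite (_ : (fun x => _) = (fun t => (normal_peak 1)%:E * (1 * g1 t)%:E)%E); last first.
  by apply/funext => t; rewrite pE EFinM.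
have ig := eg1_integrable (@eg1_cst R 1).
rewrite integralZl// -(EFin_Rint ig) -EFinM -/(gmass1 R) => -[pg].
have g0 := gmass1_gt0 R.
rewrite pE mul1r; apply: (mulIf (lt0r_neq0 g0)); rewrite mulfVK ?lt0r_neq0//.
by rewrite mulrAC pg mul1r.
Qed.

Lemma integral_normal01 p : eg1 p -> (forall r, 0 <= p r) ->
  (\int[normal_prob (0 : R) 1]_r (p r)%:E)%E = (mean1 p)%:E.
Proof.
move=> ep p0; have mp := eg1_measurable ep.
rewrite (@integral_density _ _ R leb (normal_prob (0 : R) 1) (normal_pdf 0 1))//.
- have ip := eg1_integrable ep.
  rewrite (_ : (fun x => _) = (fun r => ((gmass1 R)^-1)%:E * (p r * g1 r)%:E)%E); last first.
    by apply/funext => r; rewrite normal_pdf01 -!EFinM; congr EFin; rewrite mulrA mulrC.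
  by rewrite integralZl// -(EFin_Rint ip) -EFinM mulrC.
- exact: measurable_normal_pdf.
- by move=> r; exact: normal_pdf_ge0.
- exact/measurable_EFinP.
Qed.

End standard_normal.

Section product_integral.
Context (R : realType) (n : nat).
Variables (mu : probability 'rV[R]_n R) (s : 'rV[R]_n).
Let b := barycenter_along mu s.
Let Q := direct_sum_product (gaussian_line b s) (marginal_perp mu s).

Lemma integral_direct_sum (f : 'rV[R]_n -> \bar R) : measurable_fun setT f -> (forall x, 0 <= f x)%E ->
  (\int[Q]_x f x = \int[mu]_x \int[normal_prob (0 : R) 1]_r f (line_map b s r + proj_perp s x)%R)%E.
Proof.
move=> mf f0.
have mfa : measurable_fun setT (f \o @add_rV R n) by apply: measurableT_comp => //; exact: measurable_add_rV.
apply: etrans (ge0_integral_pushforward (@measurable_add_rV R n) _ measurableT mf (fun x _ => f0 x)) _.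
rewrite preimage_setT (fubini_tonelli2 _ mfa)//; last by move=> x; exact: f0.
have mG := measurable_fun_fubini_tonelli_G (m1 := gaussian_line b s) (f \o @add_rV R n) mfa (fun x => f0 _).
apply: etrans (ge0_integral_pushforward (@measurable_proj_perp R n s) _ measurableT mG _) _.
  by move=> x _; apply: integral_ge0 => y _; exact: f0.
rewrite preimage_setT; apply: eq_integral => x _ /=; rewrite /fubini_G.
have mfx : measurable_fun setT (fun y : 'rV[R]_n => f (y + proj_perp s x)).
  exact: (measurableT_comp mfa (pair2_measurable (proj_perp s x))).
by apply: etrans (ge0_integral_pushforward (@measurable_line_map R n b s) _ measurableT mfx (fun y _ => f0 _)) _.
Qed.

Lemma direct_sum_setT : Q setT = 1%E.
Proof.
rewrite -[LHS]mul1e -integral_cst// integral_direct_sum//.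
rewrite (eq_integral (cst 1%E)) => [|x _]; last by rewrite integral_cst// mul1e; exact: probability_setT.
by rewrite integral_cst// mul1e; exact: probability_setT.
Qed.

End product_integral.

Section product_probability.
Context (R : realType) (n : nat).
Variables (mu : probability 'rV[R]_n R) (s : 'rV[R]_n).

(** Named so that its total mass 1 can be recorded as a probability structure, as [W1_dual]
    requires. *)
Definition product_measure : set 'rV[R]_n -> \bar R :=
  direct_sum_product (gaussian_line (barycenter_along mu s) s) (marginal_perp mu s).

HB.instance Definition _ := Measure.copy product_measure
  (direct_sum_product (gaussian_line (barycenter_along mu s) s) (marginal_perp mu s)).

HB.instance Definition _ := Measure_isProbability.Build _ _ R product_measure (direct_sum_setT mu s).

Definition product_probability : probability 'rV[R]_n R := product_measure.

End product_probability.

Transparent J E.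
Section Gibbs_measure.
Context (R : realType) (n : nat).
Variables (w : 'rV[R]_n -> R) (mu : probability 'rV[R]_n R).
Hypotheses (ww : wt w).
Hypothesis hmu : forall A : set 'rV[R]_n, measurable A -> mu A = (\int[lebesgue_rV R n]_(x in A) (w x)%:E)%E.
Implicit Types (f : 'rV[R]_n -> R).

Let integral_J f : egro f -> (forall x, 0 <= f x) -> (\int[mu]_x (f x)%:E)%E = (J w f)%:E.
Proof.
move=> ef f0; have mf := egro_measurable ef.
rewrite (@integral_density _ _ R (@lam R n) mu w)//.
- by rewrite /J EFin_Rint//; exact: (J_int (wt_gdom ww) ef).
- exact: gdom_measurable (wt_gdom ww).
- by move=> x; exact: ltW (wt_gt0 ww x).
- exact/measurable_EFinP.
Qed.

Let J1 : J w (fun=> 1) = 1.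
Proof.
apply: EFin_inj; rewrite -integral_J//; last exact: egro_cst.
by rewrite integral_cst// mul1e; exact: probability_setT.
Qed.

Lemma integral_E f : egro f -> (forall x, 0 <= f x) -> (\int[mu]_x (f x)%:E)%E = (E w f)%:E.
Proof. by move=> ef f0; rewrite integral_J// /E J1 divr1. Qed.

Lemma Rint_E f : egro f -> \int[mu]_x f x = E w f.
Proof.
move=> ef; have en := egro_norm ef.
have ep : egro (fun x => 2^-1 * (`|f x| + f x)) by apply: egroZ; exact: egroD.
have em : egro (fun x => 2^-1 * (`|f x| - f x)) by apply: egroZ; exact: egroB.
rewrite /Rintegral integralE.
have -> : (fun x => ((EFin \o f)^\+)%E x) = (fun x => (2^-1 * (`|f x| + f x))%:E).
  apply/funext => x; rewrite funeposE /= -EFin_max; congr EFin.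
  by case: (leP 0 (f x)) => h; [rewrite ger0_norm//|rewrite ltr0_norm//]; lra.
have -> : (fun x => ((EFin \o f)^\-)%E x) = (fun x => (2^-1 * (`|f x| - f x))%:E).
  apply/funext => x; rewrite funenegE /= -EFin_max; congr EFin.
  by case: (leP 0 (f x)) => h; [rewrite ger0_norm// max_r|rewrite ltr0_norm// max_l]; lra.
rewrite !integral_E//=; last 2 first.
- by move=> x; rewrite mulr_ge0 ?invr_ge0// subr_ge0 ler_norm.
- by move=> x; rewrite mulr_ge0 ?invr_ge0//; have := ler_norm (- f x); rewrite normrN; lra.
rewrite !EZ//; [|exact: egroB|exact: egroD].
by rewrite ED// EB//; lra.
Qed.

Variable sigma : 'rV[R]_n.
Hypothesis s1 : norm2 sigma = 1.
Let c := \int[mu]_x dot x sigma.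
Let Q := direct_sum_product (gaussian_line (barycenter_along mu sigma) sigma) (marginal_perp mu sigma).

Let cE : c = E w (fun x => dot x sigma).
Proof. exact: Rint_E (egro_dot sigma). Qed.

Let lineE x r : line_map (barycenter_along mu sigma) sigma r + proj_perp sigma x =
  proj_perp sigma x + (c + r) *: sigma.
Proof. by rewrite addrC /line_map /barycenter_along -scalerDl. Qed.

Lemma integral_product_lip (phi : 'rV[R]_n -> R) : measurable_fun setT phi -> (forall x, 0 <= phi x) ->
  (forall x y, phi x - phi y <= norm2 (x - y)) ->
  (\int[Q]_x (phi x)%:E)%E = (E w (fun x => mean1 (fiber sigma phi (E w (fun x => dot x sigma)) x)))%:E.
Proof.
move=> mphi p0 pl; rewrite integral_direct_sum//; last exact/measurable_EFinP.
have ef x : eg1 (fiber sigma phi c x) by apply: lip1_eg1 => r r'; exact: fiber_lip.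
transitivity (\int[mu]_x (mean1 (fiber sigma phi c x))%:E)%E.
  apply: eq_integral => x _; rewrite -integral_normal01//; last by move=> r; exact: p0.
  by apply: eq_integral => r _; rewrite lineE.
rewrite cE integral_E//; first by apply: lgro_egro; exact: lgro_mean1_fiber.
by move=> x; apply: mean1_ge0 => r; exact: p0.
Qed.

(** Under the product, the component of [x] along [sigma] is replaced by an independent [a], and the
    squared norm is at most $|x|^2 + a^2$. *)
Lemma integral_product_sqr : exists M : R,
  (\int[mu]_x (dot x x)%:E <= M%:E)%E /\ (\int[Q]_x (dot x x)%:E <= M%:E)%E.
Proof.
pose q r := (c + r) ^+ 2.
have eq : eg1 q.
  have e1 : eg1 (fun r => c + r) by apply: eg1D; [exact: eg1_cst|exact: eg1_id].
  exact: eg1M.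
pose K := mean1 q.
have K0 : 0 <= K.
  by apply: mean1_ge0 => r; exact: sqr_ge0.
have mdot : measurable_fun setT (fun x : 'rV[R]_n => dot x x) by exact: measurable_dot.
have ed : egro (fun x : 'rV[R]_n => dot x x).
  rewrite (_ : (fun x => _) = fun x => norm2 x ^+ 2); last by apply/funext => x; rewrite sqr_norm2.
  exact: egroX (lgro_egro (@lgro_norm2 R n)).
exists (E w (fun x => dot x x) + K); split.
  by rewrite integral_E//; [rewrite lee_fin lerDl|move=> x; exact: dot_ge0].
rewrite integral_direct_sum//; last 2 first.
- exact/measurable_EFinP.
- by move=> x; rewrite lee_fin dot_ge0.
have -> : (E w (fun x => dot x x) + K)%:E = (\int[mu]_x (dot x x + K)%:E)%E.
  rewrite integral_E//; first by rewrite ED ?E_cst//; exact: egro_cst.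
  - by apply: egroD => //; exact: egro_cst.
  - by move=> x; rewrite addr_ge0// dot_ge0.
pose D (z : 'rV[R]_n * measurableTypeR R) :=
  (dot (line_map (barycenter_along mu sigma) sigma z.2 + proj_perp sigma z.1)
       (line_map (barycenter_along mu sigma) sigma z.2 + proj_perp sigma z.1))%:E.
have mD : measurable_fun setT D.
  have ml := measurableT_comp (@measurable_line_map R n (barycenter_along mu sigma) sigma) measurable_snd.
  have mp := measurableT_comp (@measurable_proj_perp R n sigma) measurable_fst.
  by apply/measurable_EFinP; apply: measurable_dot; apply: measurable_rVD; [exact: ml|exact: mp|exact: ml|exact: mp].
have D0 z : (0 <= D z)%E by rewrite lee_fin dot_ge0.
apply: ge0_le_integral => //.
- by move=> x _; apply: integral_ge0 => r _; rewrite lee_fin dot_ge0.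
- exact: (measurable_fun_fubini_tonelli_F (m2 := normal_prob (0 : R) 1) D mD D0).
- by apply/measurable_EFinP; apply: measurable_funD.
move=> x _; have ss : dot sigma sigma = 1 by rewrite -sqr_norm2 s1 expr1n.
have -> : (dot x x + K)%:E = (\int[normal_prob (0 : R) 1]_r (dot x x + 1 * q r)%:E)%E.
  rewrite integral_normal01.
  - by rewrite mean1_lin// mul1r.
  - by apply: eg1D; [exact: eg1_cst|apply: eg1M => //; exact: eg1_cst].
  - by move=> r; rewrite mul1r addr_ge0 ?dot_ge0 ?sqr_ge0.
apply: ge0_le_integral => //.
- by move=> r _; rewrite lee_fin dot_ge0.
- exact: (measurableT_comp mD (pair1_measurable x)).
- apply/measurable_EFinP; apply: measurable_funD => //; apply: measurable_funM => //.
  exact: eg1_measurable eq.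
move=> r _; rewrite lee_fin mul1r lineE /proj_perp /q.
move: (c + r) => a; rewrite !dotE ss.
have := sqr_ge0 (dot x sigma); rewrite (dotC sigma x).
move: (dot x sigma) (dot x x) => u t; lra.
Qed.

Let Qp := product_probability mu sigma.

Lemma W1_product (B : R) : (forall phi : 'rV[R]_n -> R, measurable_fun setT phi -> (forall x, 0 <= phi x) ->
    (forall x y, phi x - phi y <= norm2 (x - y)) ->
    E w phi - E w (fun x => mean1 (fiber sigma phi (E w (fun x => dot x sigma)) x)) <= B) ->
  (W1 mu Q <= B%:E)%E.
Proof.
move=> h; have [M [h1 h2]] := integral_product_sqr.
apply: (@W1_dual R n mu Qp B M h1 h2) => phi mphi p0 pl.
rewrite Rint_E; first by rewrite {1}/Rintegral (integral_product_lip mphi p0 pl); exact: h.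
apply: lgro_egro; apply: (@lip_lgro _ _ _ 1) => // x y; rewrite mul1r; exact: pl.
Qed.

End Gibbs_measure.
Opaque J E.

(** * The crude bound and the choice of the constant *)

Section conclusion.
Context (R : realType) (n : nat).
Implicit Types (x y : 'rV[R]_n).

Lemma lip_constP (F : 'rV[R]_n -> R) (L : R) : (lip_const F <= L%:E)%E ->
  forall x y, F x - F y <= L * norm2 (x - y).
Proof.
move=> hF x y; have [->|xy] := eqVneq x y; first by rewrite !subrr norm20 mulr0.
have xy0 : 0 < norm2 (x - y) by rewrite norm2_gt0// subr_eq0.
apply: le_trans (ler_norm _) _; rewrite -ler_pdivrMr// -lee_fin; apply: le_trans hF.
by apply: ereal_sup_ubound; exists (x, y).
Qed.

(** Serves when [eps] is not small. On each line [phi] differs from its Gaussian average by at most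
    $|r| + m$ with $m$ the Gaussian mean of $|r|$; then $|r| \le (1 + r^2)/2$, and the variance of
    [x . sigma] is at most 1. *)
Lemma product_crude (w phi : 'rV[R]_n -> R) (sigma : 'rV[R]_n) : wt w -> slc 1 w -> norm2 sigma = 1 ->
  measurable_fun setT phi -> (forall x y, phi x - phi y <= norm2 (x - y)) ->
  `|E w phi - E w (fun x => mean1 (fiber sigma phi (E w (fun x => dot x sigma)) x))| <= 1 + absmean R.
Proof.
move=> ww kw s1 mphi pl; set c := E w (fun x => dot x sigma).
have eh := egro_dot sigma.
have ep : egro phi by apply: lgro_egro; apply: (@lip_lgro _ _ _ 1) => // x y; rewrite mul1r.
have em : egro (fun x => mean1 (fiber sigma phi c x)) by apply: lgro_egro; exact: lgro_mean1_fiber.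
have ec (a : R) : egro (fun _ : 'rV[R]_n => a) by exact: egro_cst.
have e2 : egro (fun x => (dot x sigma - c) * (dot x sigma - c)) by apply: egroM; exact: egroB.
have e3 : egro (fun x => 2^-1 * ((dot x sigma - c) * (dot x sigma - c))) by exact: egroZ.
rewrite -(EB ww ep em); apply: le_trans (E_norm ww (egroB ep em)) _.
apply: (@le_trans _ _ (E w (fun x => (2^-1 + absmean R) + 2^-1 * ((dot x sigma - c) * (dot x sigma - c))))).
  apply: (E_le ww (egro_norm (egroB ep em)) (egroD (ec _) e3)) => x.
  have fl r r' : `|fiber sigma phi c x r - fiber sigma phi c x r'| <= `|r - r'| by exact: fiber_lip.
  rewrite -(centE sigma phi); apply: le_trans (cent_bound fl _) _.
  move: (dot x sigma - c) (absmean R) => a b.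
  have := sqr_ge0 (`|a| - 1); rewrite sqrrB1 real_normK ?num_real// expr2 => h; lra.
rewrite (ED ww (ec _) e3) (E_cst _ ww) (EZ _ ww e2) -(Cov_E ww eh eh).
have := Var_dot sigma ww kw ltr01; rewrite /Var -sqr_norm2 s1 expr1n divr1.
move: (Cov _ _ _) (absmean R) => a b; lra.
Qed.

Lemma product_poly_ge0 (t : R) : 0 <= (@stein_cst R) ^+ 2 * (1 + t) ^+ 2 + (2 * @mills_cst R) ^+ 2.
Proof. by apply: addr_ge0; [apply: mulr_ge0|]; exact: sqr_ge0. Qed.

Lemma product_cst_ge0 (t : R) : 0 <= product_cst t.
Proof. by apply: mulr_ge0; [exact: product_poly_ge0|exact: expR_ge0]. Qed.

Lemma product_cst_le (s t : R) : 0 <= s -> s <= t -> product_cst s <= product_cst t.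
Proof.
move=> s0 st; have t0 := le_trans s0 st.
have sqst a b : 0 <= a -> a <= b -> a ^+ 2 <= b ^+ 2 :> R by move=> a0 ab; rewrite lerXn2r ?nnegrE// (le_trans a0).
rewrite /product_cst; apply: ler_pM; rewrite ?expR_ge0//.
- exact: product_poly_ge0.
- by rewrite lerD2r ler_wpM2l ?sqr_ge0// sqst ?addr_ge0// lerD2l.
- by rewrite ler_expR sqst.
Qed.

End conclusion.

Unset Implicit Arguments.

Theorem theorem1p7 (R : realType) (L : R) (hL : 0 < L) :
  exists C : R,
  forall (n : nat) (hn : (0 < n)%N) (V : 'rV[R]_n -> R)
    (mu : probability 'rV[R]_n R)
    (hVdiff : twice_differentiable V)
    (hmu : forall A : set 'rV[R]_n, measurable A ->
       mu A = (\int[lebesgue_rV R n]_(x in A) (expR (- V x))%:E)%E)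
    (hHess : forall x, loewner_le 1%:M (Hess V x))
    (F : 'rV[R]_n -> R) (hF : (lip_const F <= L%:E)%E)
    (eps : R) (heps : 0 <= eps)
    (hexp : ((expR (\int[mu]_x F x + L ^+ 2 / 2 * (1 - eps / 2)))%:E
             <= \int[mu]_x (expR (F x))%:E)%E),
  exists s : 'rV[R]_n,
    norm2 s = 1 /\
    (W1 mu (direct_sum_product (gaussian_line (barycenter_along mu s) s)
                               (marginal_perp mu s))
     <= (C * Num.sqrt eps)%:E)%E.
Proof.
have [C1 [d0 [C10 d00 hN]]] := near_gaussian_direction hL.
(* The bound of [product_close] for a variance defect $C_1 L^2 \epsilon/4$, with the unknown tilt
   replaced by its maximum [L]. *)
pose Ca : R := 2 * Num.sqrt (C1 * (L ^+ 2 / 4) * product_cst L).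
(* If the defect $L^2\epsilon/4$ exceeds [d0], then $\sqrt\epsilon$ times the second factor is at
   least 1, so the crude bound suffices. *)
pose Cb : R := (1 + absmean R) * (L / 2 / Num.sqrt d0).
have am0 : 0 <= 1 + absmean R by rewrite addr_ge0 ?absmean_ge0.
have Ca0 : 0 <= Ca by rewrite mulr_ge0 ?sqrtr_ge0.
have L20 : 0 <= L / 2 by rewrite divr_ge0 ?(ltW hL).
have Cb0 : 0 <= Cb by rewrite mulr_ge0 ?divr_ge0 ?sqrtr_ge0 ?(ltW hL).
exists (Ca + Cb) => n hn V mu hVdiff hmu hHess F hF eps heps hexp.
pose w x := expR (- V x); have ww : wt w := wt_Gibbs hVdiff hHess.
have kw : slc 1 w := slc_Gibbs hVdiff hHess.
have FL := lip_constP hF; have mF := lip_measurable FL; have lF := lip_lgro mF FL.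
have eF := lgro_egro lF.
(* The amount by which the hypothesis on [F] falls short of equality in Herbst's bound. *)
pose d := L ^+ 2 / 4 * eps.
have d0' : 0 <= d by rewrite mulr_ge0// mulr_ge0 ?sqr_ge0 ?invr_ge0.
have hd : L ^+ 2 / 2 - d <= lnE w F - E w F.
  move: hexp; rewrite (Rint_E ww hmu eF) (integral_E ww hmu (egro_expR lF)) => [|x]; last exact: expR_ge0.
  rewrite -(lnEK ww lF) lee_fin ler_expR /d => h; move: h; move: (E w F) (lnE w F) (L ^+ 2) => a b q h; nra.
have se := sqrtr_ge0 eps.
have [dd|dd] := leP d d0.
  have [s [t [s1 /andP[t0 tL] hV]]] := hN n w F d ww kw mF FL d0' dd hd.
  exists s; split=> //; apply: (@le_trans _ _ (Ca * Num.sqrt eps)%:E).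
    apply: (W1_product ww hmu s1) => phi mphi p0 pl.
    apply: le_trans (ler_norm _) _; apply: le_trans (product_close ww kw s1 t0 hV mphi pl) _.
    have C1L : 0 <= C1 * (L ^+ 2 / 4) * product_cst L.
      by apply: mulr_ge0; [rewrite mulr_ge0 ?(ltW C10) ?divr_ge0 ?sqr_ge0|exact: product_cst_ge0].
    rewrite -[leRHS]mulrA; apply: ler_wpM2l => //; rewrite -sqrtrM//; apply: ler_wsqrtr.
    have -> : C1 * (L ^+ 2 / 4) * product_cst L * eps = C1 * d * product_cst L by rewrite /d; ring.
    apply: ler_wpM2l; [exact: mulr_ge0 (ltW C10) d0'|exact: product_cst_le].
  by rewrite lee_fin ler_wpM2r// lerDl.
(* Any unit vector will do here; one exists because the dimension is positive. *)
have s1 : norm2 (delta_mx ord0 (Ordinal hn) : 'rV[R]_n) = 1.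
  by rewrite /norm2 dot_delta mxE !eqxx sqrtr1.
exists (delta_mx ord0 (Ordinal hn)); split=> //; apply: (@le_trans _ _ (1 + absmean R)%:E).
  apply: (W1_product ww hmu s1) => phi mphi p0 pl.
  exact: le_trans (ler_norm _) (product_crude ww kw s1 mphi pl).
rewrite lee_fin; apply: (@le_trans _ _ (Cb * Num.sqrt eps)); last by rewrite ler_wpM2r// lerDr.
rewrite -[leRHS]mulrA; apply: ler_peMr => //; rewrite mulrAC.
have sd0 : 0 < Num.sqrt d0 by rewrite sqrtr_gt0.
rewrite ler_pdivlMr// mul1r; have -> : L / 2 = Num.sqrt (L ^+ 2 / 4).
  have -> : L ^+ 2 / 4 = (L / 2) ^+ 2 by field.
  by rewrite sqrtr_sqr ger0_norm.
rewrite -sqrtrM; last by rewrite mulr_ge0 ?sqr_ge0 ?invr_ge0.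
by rewrite ler_wsqrtr// ltW.
Qed.
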